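(* Let $\widehat{\boldsymbol\omega}:\mathbb{R}^3\setminus\{0\}\to\mathbb{S}^4$ be a nonconstant $\mathbb{S}^1$-equivariant tangent map. 1) If the range of $\widehat{\boldsymbol\omega}$ is not contained in $\mathbb{R}\oplus\mathbb{C}\oplus\{0\}$, then $\widehat{\boldsymbol\omega}$ is unstable. 2) The map $\widehat{\boldsymbol\omega}$ is locally minimizing if and only if there exists $\alpha\in\mathbb{R}$ such that $\widehat{\boldsymbol\omega}(x)=\pm R_\alpha\cdot\boldsymbol\omega^{(1)}_{\rm eq}\left(\frac{x}{|x|}\right)$ (for one choice of sign), where $\boldsymbol\omega^{(1)}_{\rm eq}(x)=(x_3,x_1+ix_2,0)$ for $x\in\mathbb{S}^2$.
   Context: $\mathbb{S}^4$ is the unit sphere of $\mathbb{R}\oplus\mathbb{C}\oplus\mathbb{C}$ (Euclidean norm of the underlying real space). $\mathbb{S}^1$, identified with rotations $R_\alpha$ of angle $\alpha$ about the $x_3$-axis of $\mathbb{R}^3$, acts on $\mathbb{R}\oplus\mathbb{C}\oplus\mathbb{C}$ by $R_\alpha\cdot(t,\zeta_1,\zeta_2)=(t,e^{i\alpha}\zeta_1,e^{2i\alpha}\zeta_2)$. A map $u$ is $\mathbb{S}^1$-equivariant if $u(Rx)=R\cdot u(x)$ for all $R\in\mathbb{S}^1$ and (a.e.) $x$. An $\mathbb{S}^1$-equivariant tangent map is a map of the form $\widehat{\boldsymbol\omega}(x)=\boldsymbol\omega(x/|x|)$ with $\boldsymbol\omega:\mathbb{S}^2\to\mathbb{S}^4$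 an $\mathbb{S}^1$-equivariant (smooth) harmonic map. Let $\mathcal{E}_0(u,B_\rho)=\frac12\int_{B_\rho}|\nabla u|^2dx$. For an $\mathbb{S}^1$-equivariant $X\in C^\infty_c(\mathbb{R}^3;\mathbb{R}\oplus\mathbb{C}\oplus\mathbb{C})$ with support in $B_\rho$, the second variation is $\delta^2\mathcal{E}_0(\widehat{\boldsymbol\omega})[X]=\frac{d^2}{dt^2}\mathcal{E}_0\big(\frac{\widehat{\boldsymbol\omega}+tX}{|\widehat{\boldsymbol\omega}+tX|},B_\rho\big)\big|_{t=0}$. The tangent map is stable if $\delta^2\mathcal{E}_0(\widehat{\boldsymbol\omega})[X]\ge0$ for all such $X$, unstable otherwise. It is locally minimizing if for every $\rho>0$ and every $\mathbb{S}^1$-equivariant $w\in W^{1,2}(B_\rho;\mathbb{S}^4)$ with $\mathrm{spt}(\widehat{\boldsymbol\omega}-w)\subset B_\rho$ one has $\mathcal{E}_0(\widehat{\boldsymbol\omega},B_\rho)\le\mathcal{E}_0(w,B_\rho)$. *)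

(* Defs.v *)
From HB Require Import structures.
From mathcomp Require Import all_boot all_order all_algebra.
From mathcomp Require Import complex.
From mathcomp Require Import all_classical all_reals all_analysis.

Set Implicit Arguments.
Unset Strict Implicit.
Unset Printing Implicit Defensive.

Import Order.TTheory GRing.Theory Num.Theory.
Import numFieldNormedType.Exports.

Local Open Scope classical_set_scope.
Local Open Scope ring_scope.
Local Open Scope complex_scope.

(* The norm that MathComp puts on a product is the sup norm: on R3 it is used
   only for the topology and for directional derivatives. The Euclidean norms
   are [norm3] and [norm5]. *)
Notation R3 R := (R * R * R)%type (only parsing).
Notation RCC R := (R * R[i] * R[i])%type (only parsing).

Section EquivariantTangentMaps.
Variable R : realType.
Implicit Types (x p : R3 R) (y : RCC R) (u w X : R3 R -> RCC R).

Definition basis3 (j : 'I_3) : R3 R :=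
  ((val j == 0%N)%:R, (val j == 1%N)%:R, (val j == 2%N)%:R).

Definition norm3 x : R := Num.sqrt (x.1.1 ^+ 2 + x.1.2 ^+ 2 + x.2 ^+ 2).

Definition Ball3 (r : R) : set (R3 R) := [set x | norm3 x < r].

Definition Sphere2 : set (R3 R) := [set x | norm3 x = 1].

Definition leb3 : {measure set (measurableTypeR R * measurableTypeR R *
                                 measurableTypeR R)%type -> \bar R} :=
  ((@lebesgue_measure R \x @lebesgue_measure R) \x @lebesgue_measure R)%E.

Definition coord5 (i : 'I_5) y : R :=
  tnth [tuple y.1.1; complex.Re y.1.2; complex.Im y.1.2;
              complex.Re y.2; complex.Im y.2] i.

Definition norm5 y : R := Num.sqrt (\sum_(i < 5) coord5 i y ^+ 2).

Definition Sphere4 : set (RCC R) := [set y | norm5 y = 1].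

Definition scale5 (c : R) y : RCC R := (c * y.1.1, c%:C * y.1.2, c%:C * y.2).

Definition comp5 (i : 'I_5) u : R3 R -> R := fun x => coord5 i (u x).

Definition rot3 (a : R) x : R3 R :=
  (cos a * x.1.1 - sin a * x.1.2, sin a * x.1.1 + cos a * x.1.2, x.2).

Definition expi (a : R) : R[i] := cos a +i* sin a.

Definition rot5 (a : R) y : RCC R :=
  (y.1.1, expi a * y.1.2, expi (2 * a) * y.2).

Definition partial (j : 'I_3) (f : R3 R -> R) : R3 R -> R :=
  fun x => 'D_(basis3 j) f x.

Definition iter_partial (s : seq 'I_3) (f : R3 R -> R) : R3 R -> R :=
  foldr partial f s.

(* C^oo on an open set U: partial derivatives of all orders exist and are
   continuous on U. *)
Definition smooth_on (U : set (R3 R)) (f : R3 R -> R) : Prop :=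
  forall (s : seq 'I_3) x, U x ->
    {for x, continuous (iter_partial s f)} /\
    forall j : 'I_3, derivable (iter_partial s f) x (basis3 j).

Definition laplacian (f : R3 R -> R) : R3 R -> R :=
  fun x => \sum_(j < 3) partial j (partial j f) x.

Definition supp (V : zmodType) (f : R3 R -> V) : set (R3 R) :=
  closure [set x | f x != 0].

Definition test_fun (Omega : set (R3 R)) (phi : R3 R -> R) : Prop :=
  [/\ smooth_on setT phi, compact (supp phi) & supp phi `<=` Omega].

(* Maps defined on S^2 are represented by functions on R^3 of which only the
   values on S^2 are used; their 0-homogeneous extension f(x/|x|) is used only
   away from the origin. *)
Definition hom_ext (V : Type) (f : R3 R -> V) : R3 R -> V :=
  fun x => f ((norm3 x)^-1 *: x).

Definition smooth_on_S2 (f : R3 R -> R) : Prop :=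
  forall p, Sphere2 p -> exists (U : set (R3 R)) (F : R3 R -> R),
    [/\ open U, U p, smooth_on U F & forall x, U x -> Sphere2 x -> f x = F x].

(* On S^2, the tangential gradient and the Laplace-Beltrami operator of f are
   the Euclidean gradient and Laplacian of the 0-homogeneous extension of f. *)
Definition tgrad (j : 'I_3) (f : R3 R -> R) : R3 R -> R :=
  partial j (hom_ext f).

Definition laplace_beltrami (f : R3 R -> R) : R3 R -> R :=
  laplacian (hom_ext f).

Definition tgrad_sqr (o : R3 R -> RCC R) x : R :=
  \sum_(i < 5) \sum_(j < 3) tgrad j (comp5 i o) x ^+ 2.

(* Harmonic map equation into the unit sphere:
   Delta_T o + |grad_T o|^2 o = 0 on S^2. *)
Definition harmonic_S2_S4 (o : R3 R -> RCC R) : Prop :=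
  [/\ forall x, Sphere2 x -> Sphere4 (o x),
      forall i : 'I_5, smooth_on_S2 (comp5 i o) &
      forall (i : 'I_5) x, Sphere2 x ->
        laplace_beltrami (comp5 i o) x + tgrad_sqr o x * comp5 i o x = 0].

Definition equivariant_on (A : set (R3 R)) u : Prop :=
  forall (a : R) x, A x -> u (rot3 a x) = rot5 a (u x).

Definition ae_equivariant_on (A : set (R3 R)) u : Prop :=
  forall a : R, {ae leb3, forall x, A x -> u (rot3 a x) = rot5 a (u x)}.

(* A map defined on R^3 minus the origin: the value at the origin is
   irrelevant. *)
Definition equivariant_tangent_map u : Prop :=
  exists o : R3 R -> RCC R,
    [/\ harmonic_S2_S4 o, equivariant_on Sphere2 o &
        forall x, x != 0 -> u x = hom_ext o x].

Definition nonconstant u : Prop :=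
  ~ exists c : RCC R, forall x, x != 0 -> u x = c.

Definition locally_integrable3 (Omega : set (R3 R)) (f : R3 R -> R) : Prop :=
  measurable_fun Omega f /\
  forall K : set (R3 R), compact K -> K `<=` Omega ->
    leb3.-integrable K (EFin \o f).

Definition is_weak_partial (Omega : set (R3 R)) (j : 'I_3) (f g : R3 R -> R) :
    Prop :=
  [/\ locally_integrable3 Omega f, locally_integrable3 Omega g &
      forall phi, test_fun Omega phi ->
        \int[leb3]_(x in Omega) (f x * partial j phi x) =
        - \int[leb3]_(x in Omega) (g x * phi x)].

(* The weak partial derivative, unique up to null sets when it exists; the
   zero function otherwise. *)
Definition weak_partial (Omega : set (R3 R)) (j : 'I_3) (f : R3 R -> R) :
    R3 R -> R :=
  xget (fun=> 0) [set g | is_weak_partial Omega j f g].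

Definition square_integrable (Omega : set (R3 R)) (f : R3 R -> R) : Prop :=
  measurable_fun Omega f /\
  leb3.-integrable Omega (EFin \o (fun x => f x ^+ 2)).

Definition W12_S4 (Omega : set (R3 R)) w : Prop :=
  [/\ {ae leb3, forall x, Omega x -> Sphere4 (w x)},
      forall i : 'I_5, square_integrable Omega (comp5 i w) &
      forall (i : 'I_5) (j : 'I_3), exists2 g,
        is_weak_partial Omega j (comp5 i w) g & square_integrable Omega g].

(* E_0(u, B_r) *)
Definition energy u (r : R) : \bar R :=
  ((2^-1)%:E * \int[leb3]_(x in Ball3 r)
     (\sum_(i < 5) \sum_(j < 3)
        weak_partial (Ball3 r) j (comp5 i u) x ^+ 2)%:E)%E.

Definition normalize5 y : RCC R := scale5 (norm5 y)^-1 y.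

Definition second_variation u (r : R) X : R :=
  derive1n 2 (fun t : R =>
    fine (energy (fun x => normalize5 (u x + scale5 t (X x))) r)) 0.

Definition stable u : Prop :=
  forall (r : R) X, 0 < r ->
    (forall i : 'I_5, smooth_on setT (comp5 i X)) ->
    compact (supp X) -> supp X `<=` Ball3 r ->
    equivariant_on setT X ->
    0 <= second_variation u r X.

Definition unstable u : Prop := ~ stable u.

(* Support, taken in R^3, of the almost everywhere class of a function on
   Omega. Closing up in R^3 makes the inclusion [ess_supp (Ball3 r) f `<=`
   Ball3 r] say that f has compact support in the open ball. *)
Definition ess_supp (Omega : set (R3 R)) (f : R3 R -> RCC R) : set (R3 R) :=
  [set x | forall V, open V -> V x ->
     ~ {ae leb3, forall z, V z -> Omega z -> f z = 0}].

Definition locally_minimizing u : Prop :=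
  forall (r : R) w, 0 < r ->
    W12_S4 (Ball3 r) w -> ae_equivariant_on (Ball3 r) w ->
    ess_supp (Ball3 r) (fun x => u x - w x) `<=` Ball3 r ->
    (energy u r <= energy w r)%E.

Definition omega_eq1 x : RCC R := (x.2, x.1.1 +i* x.1.2, 0).

End EquivariantTangentMaps.

(* Main.v *)
(* Off the x_3-axis use the coordinate T with sh T = x_3 / rho, where rho is the
   distance to the axis. An equivariant 0-homogeneous harmonic map u is given by
   its profile f along a meridian, and the harmonic map equation becomes
   f_i'' = (k_i^2 - V) f_i with weights k = (0, 1, 1, 2, 2) and
   V = sum f_i'^2 + sum k_i^2 f_i^2. The Wronskian of f_1, f_2 vanishes, so some
   equivariant unit field N in the first factor C is orthogonal to u.

   Vary u along m N, where m is a cutoff times a component f_i of u in the second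
   factor C. Since f_i'' = (4 - V) f_i, integration by parts turns the second
   variation into the integral of f_i^2 (|grad chi|^2 - 3 chi^2 / rho^2), which by
   Hardy's inequality is negative when chi varies slowly in log |x|, unless
   f_i = 0. The same computation with finite variations applies to a minimizer.

   The model maps are calibrated: for equivariant v into the sphere,
   |grad v|^2 >= 2 s sqrt (1 - v_0^2) (d_3 v_0) / rho - grad (v_0^2) . x' / rho^2
   with x' = (x_1, x_2) and s = 1 or -1, the integral of the right-hand side only
   depends on the boundary values, and equality holds for the model of sign s.

   Conversely, if u has no component in the second factor, conservation of
   sum f_i'^2 - sum k_i^2 f_i^2 gives f_0' = 1 - f_0^2 up to sign, hence
   |grad u|^2 = 2 / (Y0 |x| + Z0 x_3)^2 with Y0^2 - Z0^2 = 1. Comparison with the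
   domain variations u (x - e eta (|x|) e_3) yields that the integral of
   eta' (|x|) |grad u|^2 x_3 / |x| is 0, which forces Z0 = 0. *)
Require Import Defs.
From HB Require Import structures.
From mathcomp Require Import all_boot all_order all_algebra.
From mathcomp Require Import complex.
From mathcomp Require Import all_classical all_reals all_analysis.
From mathcomp Require Import measurable_realfun.
From mathcomp Require Import ring lra zify.
Set Implicit Arguments.
Unset Strict Implicit.
Unset Printing Implicit Defensive.
Import Order.TTheory GRing.Theory Num.Theory.
Import numFieldNormedType.Exports.
Local Open Scope classical_set_scope.
Local Open Scope ring_scope.

(** The competitors of a minimizer carry the analytic weight: they are only of class W^{1,2}, and
    equivariant for each angle off a null set depending on that angle. The calibration needs, almost
    everywhere, tangency of the weak gradient to the sphere and the infinitesimal form of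
    equivariance, both obtained by testing, and a chain rule for functions of the coordinates,
    obtained by slicing along lines. The second obstacle is the axis, where the calibrating fields
    are singular. They are cut off at distance 1 / n; the error is of size 1 / rho^2, and
    equivariance pays for it, since (1 - v_0^2) / rho^2 <= |grad v|^2. In the second variation the
    corresponding error is harmless because the components of weight 2 vanish at the axis. The
    constant 3 there is 4 - 1, the difference of the squared weights of the second and of the first
    complex factor. Profiles with Z0 != 0 are conformal images of the model and still solve the
    harmonic map equation, so minimality has to be used a second time to exclude them. *)

Local Notation ix1 := (@Ordinal 5 1 isT).
Local Notation ix2 := (@Ordinal 5 2 isT).
Local Notation ix3 := (@Ordinal 5 3 isT).
Local Notation ix4 := (@Ordinal 5 4 isT).

(** * Integration *)

Section Integrable.
Context d (T : measurableType d) (R : realType) (mu : {measure set T -> \bar R}).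
Implicit Types (f g : T -> R) (D : set T).

Definition intg D f := mu.-integrable D (EFin \o f).

Lemma intg_le D f g : measurable D -> measurable_fun D f -> intg D g ->
  (forall x, D x -> `|f x| <= g x) -> intg D f.
Proof.
move=> mD mf ig fg; apply: (le_integrable mD _ _ ig).
  exact/measurable_EFinP.
by move=> x Dx /=; rewrite lee_fin (le_trans (fg x Dx))// ler_norm.
Qed.

Lemma intg_meas D f : intg D f -> measurable_fun D f.
Proof. by case/integrableP => /measurable_EFinP. Qed.

Lemma intgD D f g : measurable D -> intg D f -> intg D g -> intg D (fun x => f x + g x).
Proof. by move=> mD hf hg; have := integrableD mD hf hg; apply: eq_integrable. Qed.

Lemma intgB D f g : measurable D -> intg D f -> intg D g -> intg D (fun x => f x - g x).
Proof. by move=> mD hf hg; have := integrableB mD hf hg; apply: eq_integrable. Qed.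

Lemma intgN D f : measurable D -> intg D f -> intg D (fun x => - f x).
Proof. by move=> mD hf; have := integrableN hf; apply: eq_integrable. Qed.

Lemma intgZ D c f : measurable D -> intg D f -> intg D (fun x => c * f x).
Proof. by move=> mD hf; have := integrableZl mD c hf; apply: eq_integrable. Qed.

Lemma intg0 D : intg D (fun=> 0).
Proof. exact: integrable0. Qed.

Lemma intg_abs D f : measurable D -> intg D f -> intg D (fun x => `|f x|).
Proof. by move=> mD hf; have := integrable_abse hf; apply: eq_integrable. Qed.

Lemma intg_sum D (I : Type) (s : seq I) (F : I -> T -> R) : measurable D ->
  (forall i, intg D (F i)) -> intg D (fun x => \sum_(i <- s) F i x).
Proof.
move=> mD h; elim: s => [|i s IH].
  have : intg D (fun=> 0) by exact: intg0.
  by apply: eq_integrable => // x _ /=; rewrite big_nil.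
have := intgD mD (h i) IH.
by apply: eq_integrable => // x _ /=; rewrite big_cons.
Qed.

Lemma intg_sub D A f : measurable D -> measurable A -> A `<=` D -> intg D f -> intg A f.
Proof. by move=> mD mA AD; apply: integrableS. Qed.

Lemma eq_intg D f g : measurable D -> (forall x, D x -> f x = g x) -> intg D f -> intg D g.
Proof. by move=> mD h; apply: eq_integrable => // x /[!inE] Dx /=; rewrite h. Qed.

Lemma intgMl D C f g : measurable D -> measurable_fun D f ->
  (forall x, D x -> `|f x| <= C) -> intg D g -> intg D (fun x => f x * g x).
Proof.
move=> mD mf bf ig.
apply: (@intg_le _ _ (fun x => C * `|g x|)) => //.
- by apply: measurable_funM => //; exact: intg_meas ig.
- exact/intgZ/intg_abs.
- by move=> x Dx; rewrite normrM ler_wpM2r// bf.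
Qed.

Lemma Rint_dct D (f_ : nat -> T -> R) f g : measurable D ->
  (forall n, measurable_fun D (f_ n)) -> measurable_fun D f ->
  {ae mu, forall x, D x -> f_ ^~ x @ \oo --> f x} ->
  intg D g -> {ae mu, forall x, forall n, D x -> `|f_ n x| <= g x} ->
  (fun n => \int[mu]_(x in D) f_ n x) @ \oo --> \int[mu]_(x in D) f x.
Proof.
move=> mD mf_ mf cf ig fg.
have mf_' n : measurable_fun D (EFin \o f_ n) by exact/measurable_EFinP.
have mf' : measurable_fun D (EFin \o f) by exact/measurable_EFinP.
have cf' : {ae mu, forall x, D x -> (EFin \o f_ n) x @[n --> \oo] --> (EFin \o f) x}.
  by apply: filterS cf => x h Dx; apply: cvg_EFin; [exact: nearW|exact: h].
have fg' : {ae mu, forall x, forall n : nat, D x -> (`|(EFin \o f_ n) x| <= (EFin \o g) x)%E}.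
  by apply: filterS fg => x h n Dx; rewrite /= lee_fin h.
have [h1 _ h3] := dominated_convergence mD mf_' mf' cf' ig fg'.
have fin : (\int[mu]_(x in D) (EFin \o f) x)%E \is a fin_num by exact: integrable_fin_num.
rewrite /Rintegral; apply: fine_cvg; rewrite fineK//.
Qed.

Lemma Rint_ae_eq D f g : measurable D -> measurable_fun D f -> measurable_fun D g ->
  {ae mu, forall x, D x -> f x = g x} ->
  \int[mu]_(x in D) f x = \int[mu]_(x in D) g x.
Proof.
move=> mD mf mg h; rewrite /Rintegral; congr fine.
apply: ae_eq_integral => //; try exact/measurable_EFinP.
by apply: filterS h => x h Dx; rewrite h.
Qed.

Lemma intg_ae D f g : measurable D -> measurable_fun D g ->
  {ae mu, forall x, D x -> f x = g x} -> intg D f -> intg D g.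
Proof.
move=> mD mg h ig.
apply/integrableP; split; first exact/measurable_EFinP.
have mf := intg_meas ig.
rewrite (_ : (\int[mu]_(x in D) _)%E = (\int[mu]_(x in D) `|(EFin \o f) x|)%E).
  by case/integrableP: ig.
apply: ae_eq_integral => //.
- by apply: measurableT_comp => //; exact/measurable_EFinP.
- by apply: measurableT_comp => //; exact/measurable_EFinP.
- by apply: filterS h => x h Dx; rewrite /= h.
Qed.

Lemma intg_mkcond D f : measurable D -> intg D f <-> intg setT (f \_ D).
Proof.
move=> mD; rewrite /intg integrable_mkcond// /patch.
rewrite (_ : (fun _ => _) = EFin \o (fun x => if x \in D then f x else 0))//.
by apply/funext => x /=; case: ifP.
Qed.

Lemma Rint0_ae D f : measurable D -> intg D f -> (forall x, D x -> 0 <= f x) ->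
  \int[mu]_(x in D) f x = 0 -> {ae mu, forall x, D x -> f x = 0}.
Proof.
move=> mD ig f0 h.
have mf := intg_meas ig.
have h1 : (\int[mu]_(x in D) (EFin \o f) x)%E = 0%E.
  have fin : (\int[mu]_(x in D) (EFin \o f) x)%E \is a fin_num by exact: integrable_fin_num.
  by rewrite -(fineK fin); congr EFin.
have h2 : (\int[mu]_(x in D) `|(EFin \o f) x|)%E = 0%E.
  rewrite -h1; apply: eq_integral => x /[!inE] Dx /=.
  by rewrite ger0_norm ?f0.
have mf' : measurable_fun D (EFin \o f) by exact/measurable_EFinP.
have := (ae_eq_integral_abs mu mD mf').1 h2.
by apply: filterS => x hx Dx; have /= [] := hx Dx.
Qed.

Lemma ae_imp (P Q : T -> Prop) : (forall x, P x -> Q x) ->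
  {ae mu, forall x, P x} -> {ae mu, forall x, Q x}.
Proof. by move=> PQ; apply: filterS. Qed.

Lemma ae_and (P Q : T -> Prop) : {ae mu, forall x, P x} -> {ae mu, forall x, Q x} ->
  {ae mu, forall x, P x /\ Q x}.
Proof. by move=> h1 h2; apply: filterI. Qed.

End Integrable.

Section SigmaFiniteProduct.
Context d1 d2 (T1 : measurableType d1) (T2 : measurableType d2) (R : realType).
Variables (m1 : {sigma_finite_measure set T1 -> \bar R})
  (m2 : {sigma_finite_measure set T2 -> \bar R}).

Lemma prod_sigma_finite : sigma_finite setT (m1 \x m2)%E.
Proof.
have /sigma_finiteP[F [TF ndF Foo]] := sigma_finiteT m1.
have /sigma_finiteP[G [TG ndG Goo]] := sigma_finiteT m2.
exists (fun n => F n `*` G n).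
  rewrite -setXTT TF TG predeqE => -[x y]; split.
    move=> [/= [n _ Fnx] [k _ Gky]]; exists (maxn n k) => //; split.
    - by move: x Fnx; exact/subsetPset/ndF/leq_maxl.
    - by move: y Gky; exact/subsetPset/ndG/leq_maxr.
  by move=> [n _ []/= ? ?]; split; exists n.
move=> k; have [? ?] := Foo k; have [? ?] := Goo k.
split; first exact: measurableX.
by rewrite product_measure1E// lte_mul_pinfty// ge0_fin_numE.
Qed.

(* The instance of the library is shadowed by the one for subprobabilities. *)
Definition prodS : {sigma_finite_measure set (T1 * T2)%type -> \bar R} :=
  HB.pack (m1 \x m2)%E (Measure_isSigmaFinite.Build _ _ _ (m1 \x m2)%E prod_sigma_finite).
End SigmaFiniteProduct.

Section IteratedIntegral.
Context d1 d2 d3 (T1 : measurableType d1) (T2 : measurableType d2) (T3 : measurableType d3) (R : realType).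
Variables (m1 : {sigma_finite_measure set T1 -> \bar R}) (m2 : {sigma_finite_measure set T2 -> \bar R}) (m3 : {sigma_finite_measure set T3 -> \bar R}).
Lemma iter3 (g : T1 * T2 * T3 -> \bar R) : measurable_fun setT g -> (forall x, 0 <= g x)%E ->
  (\int[(m1 \x m2) \x m3]_x g x = \int[m1]_a \int[m2]_b \int[m3]_c g (a, b, c))%E.
Proof.
move=> mg g0.
have E := @fubini_tonelli1 _ _ _ _ R (prodS m1 m2) m3 g mg g0.
have E2 := @fubini_tonelli1 _ _ _ _ R m1 m2 (fubini_F m3 g) (measurable_fun_fubini_tonelli_F g mg g0) (fun x => integral_ge0 _ (fun y _ => g0 (x,y))).
rewrite -[RHS]/(\int[m1]_a fubini_F m2 (fubini_F m3 g) a)%E -E2 -[RHS]E.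
by [].
Qed.
End IteratedIntegral.

Section MeasurePreserving.
Context d (X : measurableType d) (R : realType).
Implicit Type m : {measure set X -> \bar R}.

(** Measure preservation is expressed by integrals of nonnegative functions, the form in which
    Tonelli's theorem produces it for swaps and shears. *)
Definition mpres m (T : X -> X) := measurable_fun setT T /\
  forall g : X -> \bar R, measurable_fun setT g -> (forall x, 0 <= g x)%E ->
    (\int[m]_x g (T x) = \int[m]_x g x)%E.

Lemma mpres_comp m T1 T2 : mpres m T1 -> mpres m T2 -> mpres m (T1 \o T2).
Proof.
move=> [m1 h1] [m2 h2]; split; first exact: measurableT_comp.
move=> g mg g0; rewrite -(h1 g)// -(h2 (g \o T1))//; first exact: measurableT_comp.
by move=> x; exact: g0.
Qed.

Lemma mpres_intg m T (f : X -> R) : mpres m T -> intg m setT f -> intg m setT (f \o T).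
Proof.
move=> [mT hT] /integrableP[mf fi]; apply/integrableP; split.
  exact: (measurableT_comp mf mT).
rewrite (hT (fun x => `|(EFin \o f) x|)%E)//.
exact: measurableT_comp.
Qed.

Lemma mpres_Rint m T (f : X -> R) : mpres m T ->
  measurable_fun setT f -> \int[m]_x f (T x) = \int[m]_x f x.
Proof.
move=> [mT hT] /measurable_EFinP mf; rewrite /Rintegral; congr fine.
rewrite [LHS]integralE [RHS]integralE; congr (_ - _)%E.
  rewrite -[RHS]hT//; last exact: measurable_funepos.
  by apply: eq_integral => x _; rewrite !funeposE.
rewrite -[RHS]hT//; last exact: measurable_funeneg.
by apply: eq_integral => x _; rewrite !funenegE.
Qed.

End MeasurePreserving.

Section SwapFibre.
Context d d' (X : measurableType d) (Y : measurableType d') (R : realType).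
Variables (m : {sigma_finite_measure set X -> \bar R}).
Variables (m' : {sigma_finite_measure set Y -> \bar R}).

Lemma meas_swap12 : measurable_fun setT (fun x : X * X * Y => (x.1.2, x.1.1, x.2)).
Proof.
apply: measurable_fun_pair => /=; last exact: measurable_snd.
apply: measurable_fun_pair => /=.
  exact: (measurableT_comp measurable_snd measurable_fst).
exact: (measurableT_comp measurable_fst measurable_fst).
Qed.

Lemma swap12_int (g : X * X * Y -> \bar R) : measurable_fun setT g -> (forall x, 0 <= g x)%E ->
  (\int[(m \x m) \x m']_x g (x.1.2, x.1.1, x.2) = \int[(m \x m) \x m']_x g x)%E.
Proof.
move=> mg g0.
have ms := measurableT_comp mg meas_swap12.
rewrite (iter3 m m m' mg g0) (iter3 m m m' ms (fun x => g0 _)) /=.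
exact/esym/(fubini_tonelli (fubini_F m' g) (measurable_fun_fubini_tonelli_F g mg g0)
  (fun x => integral_ge0 _ (fun y _ => g0 (x, y)))).
Qed.

Lemma meas_sec (g : Y * X * X -> \bar R) a : measurable_fun setT g ->
  measurable_fun setT (fun y : X * X => g (a, y.1, y.2)).
Proof.
move=> mg; apply: (measurableT_comp mg).
apply: measurable_fun_pair => //=.
exact: measurable_fun_pair.
Qed.

Lemma meas_swap23 : measurable_fun setT (fun x : Y * X * X => (x.1.1, x.2, x.1.2)).
Proof.
apply: measurable_fun_pair => /=; last exact: (measurableT_comp measurable_snd measurable_fst).
apply: measurable_fun_pair => /=; last exact: measurable_snd.
exact: (measurableT_comp measurable_fst measurable_fst).
Qed.

Lemma swap23_int (g : Y * X * X -> \bar R) : measurable_fun setT g -> (forall x, 0 <= g x)%E ->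
  (\int[(m' \x m) \x m]_x g (x.1.1, x.2, x.1.2) = \int[(m' \x m) \x m]_x g x)%E.
Proof.
move=> mg g0.
have ms := measurableT_comp mg meas_swap23.
rewrite (iter3 m' m m mg g0) (iter3 m' m m ms (fun x => g0 _)) /=.
apply: eq_integral => a _.
exact/esym/(fubini_tonelli _ (meas_sec a mg) (fun y => g0 _)).
Qed.

(** By Tonelli a map that only moves the second coordinate may be treated fibre by fibre. Shears,
    and through them rotations, are instances. *)
Lemma fibre_int (S : X * Y -> Y) (g : X * Y -> \bar R) :
  measurable_fun setT S ->
  (forall x (h : Y -> \bar R), measurable_fun setT h -> (forall y, 0 <= h y)%E ->
    (\int[m']_y h (S (x, y)) = \int[m']_y h y)%E) ->
  measurable_fun setT g -> (forall x, 0 <= g x)%E ->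
  (\int[m \x m']_x g (x.1, S x) = \int[m \x m']_x g x)%E.
Proof.
move=> mS hS mg g0.
have ms : measurable_fun setT (fun x => g (x.1, S x)).
  by apply: (measurableT_comp mg); exact: measurable_fun_pair.
rewrite (fubini_tonelli1 _ ms (fun x => g0 _)) (fubini_tonelli1 g mg g0).
apply: eq_integral => x _; rewrite /fubini_F/= (hS x (fun y => g (x, y)))//.
exact: measurableT_comp.
Qed.
End SwapFibre.

(** * Measurability and measure preserving maps on R^3 *)

Section R3basics.
Variable R : realType.
Local Notation mR := (measurableTypeR R).
Local Notation lam := (@lebesgue_measure R).
Notation leb3 := (leb3 R).
Local Notation T3 := (mR * mR * mR)%type.
Implicit Types (U : set (R3 R)).

(** Bridge between the product topology and the product sigma-algebra: an open set is the union of
    the countably many boxes with rational end points that it contains. *)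
Lemma open_measurable3 (U : set (R3 R)) : open U -> measurable (U : set T3).
Proof.
move=> oU.
pose box (q : rat * rat * rat * (rat * rat * rat)) : set (R3 R) :=
  (`]ratr q.1.1.1, ratr q.2.1.1[%classic `*` `]ratr q.1.1.2, ratr q.2.1.2[%classic)
   `*` `]ratr q.1.2, ratr q.2.2[%classic.
have -> : U = \bigcup_(q in [set q | box q `<=` U]) box q.
  apply/seteqP; split => [x Ux|x [q /= qU /qU//]].
  have /= [[A B] [/= [[A1 A2] [/= nA1 nA2] sA] nB] sAB] : nbhs x U by exact: open_nbhs_nbhs.
  have loc (a : R) (C : set R) : nbhs a C -> exists q : rat * rat,
      ratr q.1 < a < ratr q.2 /\ `]ratr q.1, ratr q.2[%classic `<=` C.
    move=> /nbhs_ballP [e /= e0 aC].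
    have [p /andP[p1 p2]] : exists p : rat, a - e < ratr p < a.
      have [p] := @rat_in_itvoo R (a - e) a (ltac:(lra)); rewrite in_itv/= => ?; by exists p.
    have [q /andP[q1 q2]] : exists p : rat, a < ratr p < a + e.
      have [q] := @rat_in_itvoo R a (a + e) (ltac:(lra)); rewrite in_itv/= => ?; by exists q.
    exists (p, q); split; first by rewrite /= p2 q1.
    move=> y /=; rewrite in_itv/= => /andP[y1 y2]; apply: aC.
    rewrite /ball/= ltr_norml; lra.
  have [q1 [h1 s1]] := loc _ _ nA1.
  have [q2 [h2 s2]] := loc _ _ nA2.
  have [q3 [h3 s3]] := loc _ _ nB.
  exists ((q1.1, q2.1, q3.1), (q1.2, q2.2, q3.2)) => /=.
    move=> y [[/= y1 y2] y3]; apply: sAB; split => /=.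
      by apply: sA; split; [exact: s1|exact: s2].
    exact: s3.
  by split => /=; [split => /=|]; rewrite in_itv.
rewrite bigcup_mkcond; apply: countable_bigcupT_measurable => // q.
case: ifP => // _.
apply: measurableX; last exact: measurable_itv.
by apply: measurableX; exact: measurable_itv.
Qed.

Lemma closed_measurable3 (U : set (R3 R)) : closed U -> measurable (U : set T3).
Proof.
move=> cU; rewrite -(setCK U); apply: measurableC; apply: open_measurable3.
exact: closed_openC.
Qed.

Lemma cont_measurable3 (U : set (R3 R)) (f : R3 R -> R) : open U ->
  (forall x, U x -> {for x, continuous f}) -> measurable_fun (U : set T3) f.
Proof.
move=> oU cf.
apply: (measurability _ (RGenOpens.measurableE R)) => _ [_ [a [b ->] <-]].
apply: open_measurable3; rewrite openE => x [Ux fx].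
apply: filterI; first exact: open_nbhs_nbhs.
apply: (cf x Ux); apply: open_nbhs_nbhs; split => //.
Qed.

Definition leb3S : {sigma_finite_measure set T3 -> \bar R} := prodS (prodS lam lam) lam.
Definition swap12 (x : R3 R) : R3 R := (x.1.2, x.1.1, x.2).
Definition swap23 (x : R3 R) : R3 R := (x.1.1, x.2, x.1.2).

Lemma swap12_mpres : mpres leb3 swap12.
Proof. by split; [exact: meas_swap12|exact: swap12_int]. Qed.

Lemma swap23_mpres : mpres leb3 swap23.
Proof. by split; [exact: meas_swap23|exact: swap23_int]. Qed.

Lemma meas_x1 : measurable_fun setT (fun x : T3 => x.1.1).
Proof. exact: (measurableT_comp measurable_fst measurable_fst). Qed.
Lemma meas_x2 : measurable_fun setT (fun x : T3 => x.1.2).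
Proof. exact: (measurableT_comp measurable_snd measurable_fst). Qed.
Lemma meas_x3 : measurable_fun setT (fun x : T3 => x.2).
Proof. exact: measurable_snd. Qed.

(** Lebesgue measure is determined by its values on half-open intervals, so the image measure under
    [phi] is [lam] itself. *)
Lemma lam_map (phi : mR -> mR) (h : mR -> \bar R) : measurable_fun setT phi ->
  (forall a b : R, lam (phi @^-1` `]a, b]%classic) = lam `]a, b]%classic) ->
  measurable_fun setT h -> (forall x, 0 <= h x)%E ->
  (\int[lam]_x h (phi x) = \int[lam]_x h x)%E.
Proof.
move=> mphi hphi mh h0.
rewrite -[LHS](@ge0_integral_pushforward _ _ mR mR R phi mphi lam setT)//.
apply: eq_measure_integral => A mA _; apply/esym.
have H (B : set R) : ocitv B -> lam B = pushforward lam phi B by move=> [[a b] /= _ <-]; rewrite /pushforward hphi.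
exact: (@lebesgue_measure_unique R (measure_function_pushforward__canonical__measure_function_Measure lam mphi) H A mA).
Qed.

Lemma lam_shift (c : R) (h : mR -> \bar R) : measurable_fun setT h -> (forall x, 0 <= h x)%E ->
  (\int[lam]_x h ((x : R) + c)%R = \int[lam]_x h x)%E.
Proof.
apply: (@lam_map (fun x : R => x + c)); first exact: measurable_funD.
move=> a b; rewrite (_ : _ @^-1` _ = `]a - c, b - c]%classic).
  by rewrite !lebesgue_measure_itv/= !lte_fin ltrD2r; case: ifP => // _; rewrite -!EFinD; congr EFin; lra.
by apply/seteqP; split => x /=; rewrite !in_itv/=; lra.
Qed.

Lemma lam_opp (h : mR -> \bar R) : measurable_fun setT h -> (forall x, 0 <= h x)%E ->
  (\int[lam]_x h (- (x : R))%R = \int[lam]_x h x)%E.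
Proof.
apply: (@lam_map (fun x : R => - x)); first exact: oppr_measurable.
move=> a b.
rewrite (_ : _ @^-1` _ = `[- b, - a[%classic).
  by rewrite !lebesgue_measure_itv/= !lte_fin ltrN2; case: ifP => // _; rewrite -!EFinD; congr EFin; lra.
by apply/seteqP; split => x /=; rewrite !in_itv/=; lra.
Qed.

(** For linear [c] this is a shear, a building block of rotations; for constant [c] it handles the
    displaced singularity in the domain variation. *)
Lemma vshift_mpres (c : R * R -> R) : measurable_fun setT (fun x : mR * mR => c x) ->
  mpres leb3 (fun x : R3 R => (x.1, x.2 + c x.1)).
Proof.
move=> mc.
have mS : measurable_fun setT ((fun x : R3 R => x.2 + c x.1) : T3 -> mR).
  by apply: measurable_funD meas_x3 _; exact: measurableT_comp.
split; first exact: measurable_fun_pair.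
move=> g mg g0.
apply: (@fibre_int _ _ _ _ R (prodS lam lam) lam (fun x : R3 R => x.2 + c x.1) g mS _ mg g0).
by move=> x h mh h0; exact: (lam_shift (c x) mh h0).
Qed.

Lemma vopp_mpres : mpres leb3 (fun x : R3 R => (x.1, - x.2)).
Proof.
have mS : measurable_fun setT ((fun x : R3 R => - x.2) : T3 -> mR).
  by apply: measurableT_comp meas_x3.
split; first exact: measurable_fun_pair.
move=> g mg g0.
apply: (@fibre_int _ _ _ _ R (prodS lam lam) lam (fun x : R3 R => - x.2) g mS _ mg g0).
by move=> x h mh h0; exact: (lam_opp mh h0).
Qed.

End R3basics.

(** * Smooth functions on R^3 *)

Section Lines.
Variable R : realType.
Local Notation lam := (@lebesgue_measure R).
Local Notation leb3 := (leb3 R).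

Lemma scalE (a b : R) : a *: b = a * b. Proof. by []. Qed.

Lemma is_derive_line (V : normedModType R) (f : V -> R) x v d :
  is_derive x v f d <-> is_derive (0 : R) 1 (fun h => f (x + h *: v)) d.
Proof.
set g := fun h : R => f (x + h *: v).
have E : (fun h : R => h^-1 *: ((f \o shift x) (h *: v) - f x)) =
   (fun h : R => h^-1 *: ((g \o shift 0) (h *: (1 : R)) - g 0)).
  apply/funext => h /=; rewrite /g addr0 scale0r addr0 (addrC x); congr (_ *: (f (_ *: _ + _) - _)).
  by rewrite /GRing.scale/= mulr1.
have Ed : derivable f x v = derivable g 0 1 by rewrite /derivable E.
have Ev : 'D_v f x = 'D_1 g 0 by rewrite /derive E.
split=> -[h1 h2]; apply: DeriveDef; first by rewrite -Ed.
- by rewrite -Ev.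
- by rewrite Ed.
- by rewrite Ev.
Qed.

Lemma near_is_derive (V : normedModType R) (f g : V -> R) x v d :
  (\forall y \near x, f y = g y) -> is_derive x v g d -> is_derive x v f d.
Proof.
move=> fg [h1 h2]; apply: DeriveDef; last by rewrite (near_eq_derive _ fg).
apply: near_eq_derivable h1 => //.
by apply: filterS fg => y ->.
Qed.

Lemma is_derive_shift1 (f : R -> R) (z d : R) :
  is_derive z 1 f d <-> is_derive (0 : R) 1 (fun h => f (z + h)) d.
Proof.
rewrite is_derive_line; have -> // : (fun h : R => f (z + h *: (1 : R))) = (fun h => f (z + h)).
by apply/funext => h; rewrite /GRing.scale/= mulr1.
Qed.

Lemma is_derive_comp1 (V : normedModType R) (f : V -> R) (g : R -> R) x v df dg :
  is_derive x v f df -> is_derive (f x) 1 g dg -> is_derive x v (g \o f) (dg * df).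
Proof.
move=> /is_derive_line hf hg; apply/is_derive_line.
have E : f x = f (x + 0 *: v) by rewrite scale0r addr0.
rewrite E in hg.
have := @is_derive1_comp R g (fun h => f (x + h *: v)) 0 dg df hg hf.
by [].
Qed.

Lemma int_compact_derive (F f : R -> R) (M : R) : 0 < M ->
  (forall z : R, is_derive z 1 F (f z)) -> continuous f ->
  (forall z, M <= `|z| -> F z = 0) -> (\int[lam]_z (f z)%:E = 0)%E.
Proof.
move=> M0 dF cf F0.
have f0 z : M < `|z| -> f z = 0.
  move=> Mz; have [_ <-] := dF z.
  have -> : 'D_1 F z = 'D_1 (cst 0 : R -> R) z.
    apply: near_eq_derive => //; near=> t; apply: F0.
    apply: ltW; near: t.
    have : open [set t : R | M < `|t|].
      have := @open_comp _ _ (fun t : R => `|t|) [set t : R | M < t] (fun x _ => @norm_continuous _ _ x) (@open_gt _ M).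
      by [].
    by move=> o; exact: open_nbhs_nbhs.
  exact: derive_cst.
pose D : set R := `[- (M + 1), M + 1]%classic.
transitivity (\int[lam]_(z in D) (f z)%:E)%E.
  rewrite [RHS]integral_mkcond; apply: eq_integral => z _.
  rewrite patchE; case: ifPn => //.
  rewrite notin_setE /D /= in_itv/= => h; congr EFin; apply: f0.
  rewrite ltNge; apply/negP => h'; apply: h.
  by move: h'; rewrite ler_norml; lra.
have cF : continuous F by move=> z; apply: differentiable_continuous; apply/derivable1_diffP; case: (dF z).
rewrite (@continuous_FTC2 _ f F)//.
- rewrite (F0 (M + 1)) ?(F0 (- (M + 1))) ?subee//; first by rewrite normrN gtr0_norm; lra.
  by rewrite gtr0_norm; lra.
- by lra.
- exact: continuous_subspaceT.
- split.
  + by move=> z _; case: (dF z).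
  + by apply: cvg_at_right_filter; exact: cF.
  + by apply: cvg_at_left_filter; exact: cF.
- by move=> z _; rewrite derive1E; case: (dF z).
Unshelve. all: by end_near. Qed.

Lemma null_plane : {ae prodS lam lam, forall x, x.1 != 0 :> R}.
Proof.
exists ([set 0 : R] `*` setT); split.
- by apply: measurableX => //; exact: measurable_set1.
- have -> : (prodS lam lam ([set 0 : R] `*` setT)) = (lam [set 0%R : R] * lam setT)%E.
    by apply: product_measure1E => //; exact: measurable_set1.
  by rewrite lebesgue_measure_set1 mul0e.
- by move=> x /= /negP/negPn/eqP.
Qed.

(** The condition [x.1.1 != 0] discards a null set of vertical lines, among them the axis. On each
    remaining line the integral of the derivative vanishes by the fundamental theorem, and Fubini
    sums up. *)
Lemma vline_ibp (F dF : R3 R -> R) (M : R) : 0 < M ->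
  (forall x : R3 R, x.1.1 != 0 -> is_derive x.2 1 (fun z => F (x.1, z)) (dF x)) ->
  (forall x' : R * R, x'.1 != 0 -> continuous (fun z => dF (x', z))) ->
  (forall x : R3 R, M <= `|x.2| -> F x = 0) ->
  intg leb3 setT dF -> \int[leb3]_x dF x = 0.
Proof.
move=> M0 hd hc hM hi; rewrite /Rintegral.
have H := @integral12_prod_meas1 _ _ _ _ R (prodS lam lam) lam (EFin \o dF) hi.
rewrite -[X in fine X](H) (_ : (\int[_]_x _)%E = 0%E)//.
transitivity (\int[prodS lam lam]_x (cst 0 x))%E; last by rewrite integral0.
apply: ae_eq_integral => //.
  exact: (@measurable_fubini_F _ _ _ _ R (prodS lam lam) lam (EFin \o dF) hi).
apply: ae_imp null_plane => x' x'0 _.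
apply: (@int_compact_derive (fun z => F (x', z)) (fun z => dF (x', z)) M) => //.
- by move=> z; exact: (hd (x', z)).
- exact: hc.
- by move=> z; exact: (hM (x', z)).
Qed.

End Lines.

Section SmoothCalculus.
Variable R : realType.
Implicit Types (U : set (R3 R)) (f g : R3 R -> R).

(** [smooth_on] quantifies over lists of partial derivatives of one function. Closure under products
    and compositions is an induction on the order of differentiation, for which this graded form is
    suited. *)
Fixpoint Ck (n : nat) U f : Prop :=
  match n with
  | 0%N => forall x, U x -> {for x, continuous f}
  | m.+1 => (forall x, U x -> {for x, continuous f}) /\
     forall j, (forall x, U x -> derivable f x (basis3 R j)) /\ Ck m U (partial j f)
  end.

Lemma smooth_partial U f j : smooth_on U f -> smooth_on U (partial j f).
Proof.
move=> h s x Ux; have := h (rcons s j) x Ux.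
by rewrite /iter_partial foldr_rcons.
Qed.

Lemma smooth_onP U f : smooth_on U f <-> forall n, Ck n U f.
Proof.
split.
  move=> h n; elim: n f h => [|n IH] f h /=.
    by move=> x Ux; have [] := h [::] x Ux.
  split; first by move=> x Ux; have [] := h [::] x Ux.
  move=> j; split; first by move=> x Ux; have [_] := h [::] x Ux; apply.
  exact/IH/smooth_partial.
move=> h s; elim/last_ind: s f h => [|s j IH] f h x Ux.
  by have [/= h1 h2] := h 1%N; split; [exact: h1|move=> j; exact: (h2 j).1].
have h' n : Ck n U (partial j f) by have [_ /(_ j)[]] := h n.+1.
by have := IH _ h' x Ux; rewrite /iter_partial foldr_rcons.
Qed.

Lemma CkW n U f : Ck n.+1 U f -> Ck n U f.
Proof.
elim: n f => [|n IH] f; first by case.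
move=> [h1 h2]; split=> // j; split; first exact: (h2 j).1.
exact: IH (h2 j).2.
Qed.

Lemma eq_on_near U f g x : open U -> (forall x, U x -> f x = g x) -> U x ->
  \forall y \near x, f y = g y.
Proof.
move=> oU fg Ux; have : nbhs x U by exact: open_nbhs_nbhs.
by apply: filterS => y; exact: fg.
Qed.

Lemma near_partial f g x j : (\forall y \near x, f y = g y) ->
  partial j f x = partial j g x.
Proof. by move=> fg; rewrite /partial; apply: near_eq_derive => //. Qed.

Lemma Ck_ext n U f g : open U -> (forall x, U x -> f x = g x) -> Ck n U f -> Ck n U g.
Proof.
move=> oU; elim: n f g => [|n IH] f g fg /=.
  move=> h x Ux; rewrite /prop_for /continuous_at -fg//.
  by apply: cvg_trans (h x Ux); apply: near_eq_cvg; exact: (eq_on_near oU fg).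
move=> [h1 h2]; split.
  move=> x Ux; rewrite /prop_for /continuous_at -fg//.
  by apply: cvg_trans (h1 x Ux); apply: near_eq_cvg; exact: (eq_on_near oU fg).
move=> j; split.
  move=> x Ux; have := (h2 j).1 x Ux.
  by apply: near_eq_derivable => //; exact: (eq_on_near oU fg).
apply: IH (h2 j).2 => x Ux; apply: near_partial.
exact: (eq_on_near oU fg).
Qed.

Lemma smooth_ext U f g : open U -> (forall x, U x -> f x = g x) -> smooth_on U f -> smooth_on U g.
Proof. by move=> oU fg /smooth_onP h; apply/smooth_onP => n; exact: Ck_ext (h n). Qed.

Lemma Ck_cst n U (c : R) : open U -> Ck n U (fun=> c).
Proof.
move=> oU; elim: n c => [|n IH] c /=; first by move=> x _; exact: cvg_cst.
split; first by move=> x _; exact: cvg_cst.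
move=> j; split; first by move=> x _; exact: derivable_cst.
apply: (Ck_ext oU) (IH 0) => x Ux.
by rewrite /partial derive_cst.
Qed.

Lemma CkD n U f g : open U -> Ck n U f -> Ck n U g -> Ck n U (fun x => f x + g x).
Proof.
move=> oU; elim: n f g => [|n IH] f g /=.
  by move=> h1 h2 x Ux; apply: cvgD; [exact: h1|exact: h2].
move=> [h1 h2] [k1 k2]; split.
  by move=> x Ux; apply: cvgD; [exact: h1|exact: k1].
move=> j; split.
  by move=> x Ux; apply: derivableD; [exact: (h2 j).1|exact: (k2 j).1].
apply: (Ck_ext oU) (IH _ _ (h2 j).2 (k2 j).2) => x Ux.
by rewrite /partial deriveD//; [exact: (h2 j).1|exact: (k2 j).1].
Qed.

Lemma CkM n U f g : open U -> Ck n U f -> Ck n U g -> Ck n U (fun x => f x * g x).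
Proof.
move=> oU; elim: n f g => [|n IH] f g.
  by move=> h1 h2 x Ux; apply: cvgM; [exact: h1|exact: h2].
move=> hf hg; have [h1 h2] := hf; have [k1 k2] := hg; split.
  by move=> x Ux; apply: cvgM; [exact: h1|exact: k1].
move=> j; split.
  by move=> x Ux; apply: derivableM; [exact: (h2 j).1|exact: (k2 j).1].
apply: (Ck_ext oU) (CkD oU (IH _ _ (CkW hf) (k2 j).2) (IH _ _ (CkW hg) (h2 j).2)) => x Ux.
by rewrite /partial deriveM//; [exact: (h2 j).1|exact: (k2 j).1].
Qed.

Lemma is_derive1_cont (G : R -> R) (y d : R) : is_derive y 1 G d -> {for y, continuous G}.
Proof. by case=> h _; apply: differentiable_continuous; apply/derivable1_diffP. Qed.

(** The outer function comes as a sequence [G] of successive derivatives, because the induction on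
    the order replaces [G m] by [G m.+1]. The set [V] admits functions, such as inverses and roots,
    that are differentiable on a part of the line only. *)
Lemma Ck_comp n U (V : set R) (G : nat -> R -> R) f m : open U ->
  (forall k y, V y -> is_derive y 1 (G k) (G k.+1 y)) ->
  Ck n U f -> (forall x, U x -> V (f x)) -> Ck n U (fun x => G m (f x)).
Proof.
move=> oU hG; elim: n m f => [|n IH] m f.
  move=> h fV x Ux; apply: (continuous_comp (h x Ux)).
  exact/is_derive1_cont/hG/fV.
move=> hf fV; have [h1 h2] := hf.
have D x j : U x -> is_derive x (basis3 R j) (G m \o f) (G m.+1 (f x) * partial j f x).
  move=> Ux; apply: is_derive_comp1; last exact/hG/fV.
  exact/derivableP/(h2 j).1.
split.
  move=> x Ux; apply: (continuous_comp (h1 x Ux)).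
  exact/is_derive1_cont/hG/fV.
move=> j; split; first by move=> x Ux; case: (D x j Ux).
apply: (Ck_ext oU) (CkM oU (IH m.+1 _ (CkW hf) fV) (h2 j).2) => x Ux.
by rewrite /partial; case: (D x j Ux) => _ ->.
Qed.

Lemma smooth_cst U c : open U -> smooth_on U (fun=> c).
Proof. by move=> oU; apply/smooth_onP => n; exact: Ck_cst. Qed.
Lemma smoothD U f g : open U -> smooth_on U f -> smooth_on U g ->
  smooth_on U (fun x => f x + g x).
Proof. by move=> oU /smooth_onP h /smooth_onP k; apply/smooth_onP => n; exact: CkD. Qed.
Lemma smoothM U f g : open U -> smooth_on U f -> smooth_on U g ->
  smooth_on U (fun x => f x * g x).
Proof. by move=> oU /smooth_onP h /smooth_onP k; apply/smooth_onP => n; exact: CkM. Qed.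
Lemma smoothN U f : open U -> smooth_on U f -> smooth_on U (fun x => - f x).
Proof.
move=> oU h; have := smoothM oU (smooth_cst (-1) oU) h.
by apply: smooth_ext => // x _; rewrite mulN1r.
Qed.
Lemma smoothB U f g : open U -> smooth_on U f -> smooth_on U g ->
  smooth_on U (fun x => f x - g x).
Proof. by move=> oU h k; exact: (smoothD oU h (smoothN oU k)). Qed.
Lemma smoothX U f n : open U -> smooth_on U f -> smooth_on U (fun x => f x ^+ n).
Proof.
move=> oU h; elim: n => [|n IH].
  by apply: smooth_ext (smooth_cst 1 oU) => // x _; rewrite expr0.
by apply: smooth_ext (smoothM oU h IH) => // x _; rewrite exprS.
Qed.
Lemma smooth_comp U (V : set R) (G : nat -> R -> R) f m : open U ->
  (forall k y, V y -> is_derive y 1 (G k) (G k.+1 y)) ->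
  smooth_on U f -> (forall x, U x -> V (f x)) -> smooth_on U (fun x => G m (f x)).
Proof.
by move=> oU hG /smooth_onP h fV; apply/smooth_onP => n; exact: (Ck_comp _ oU hG).
Qed.

Lemma is_derive_affine (a c : R) : is_derive (0 : R) 1 (fun h => a + h * c) c.
Proof.
have d0 := @is_derive_cst _ _ _ a (0 : R) 1.
have d1 := is_deriveM (@is_derive_id _ _ (0 : R) 1) (@is_derive_cst _ _ _ c (0 : R) 1).
have := is_deriveD d0 d1.
by rewrite /GRing.scale/= mulr0 mulr1 !add0r.
Qed.

Lemma is_derive_coord x j :
  [/\ is_derive x (basis3 R j) (fun x : R3 R => x.1.1) (val j == 0%N)%:R,
      is_derive x (basis3 R j) (fun x : R3 R => x.1.2) (val j == 1%N)%:R &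
      is_derive x (basis3 R j) (fun x : R3 R => x.2) (val j == 2%N)%:R].
Proof.
by split; apply/is_derive_line; exact: is_derive_affine.
Qed.

Lemma cont_coord x : [/\ {for x, continuous (fun x : R3 R => x.1.1)},
  {for x, continuous (fun x : R3 R => x.1.2)} & {for x, continuous (fun x : R3 R => x.2)}].
Proof.
split.
- by apply: (@cvg_comp _ _ _ fst fst _ (nbhs x.1)); [exact: cvg_fst|exact: cvg_fst].
- by apply: (@cvg_comp _ _ _ fst snd _ (nbhs x.1)); [exact: cvg_fst|exact: cvg_snd].
- exact: cvg_snd.
Qed.

Lemma smooth_coord U : open U -> [/\ smooth_on U (fun x => x.1.1),
  smooth_on U (fun x => x.1.2) & smooth_on U (fun x => x.2)].
Proof.
move=> oU.
have H (f : R3 R -> R) (c : 'I_3 -> R) : (forall x, {for x, continuous f}) ->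
    (forall x j, is_derive x (basis3 R j) f (c j)) -> smooth_on U f.
  move=> cf df; apply/smooth_onP => -[|n] /=; first by move=> x _; exact: cf.
  split=> [x _|j]; first exact: cf.
  split=> [x _|]; first by case: (df x j).
  by apply: Ck_ext (Ck_cst n (c j) oU) => // x _; rewrite /partial; case: (df x j) => _ ->.
split.
- by apply: (H _ (fun j => (val j == 0%N)%:R)) => [x|x j]; [case: (cont_coord x)|case: (is_derive_coord x j)].
- by apply: (H _ (fun j => (val j == 1%N)%:R)) => [x|x j]; [case: (cont_coord x)|case: (is_derive_coord x j)].
- by apply: (H _ (fun j => (val j == 2%N)%:R)) => [x|x j]; [case: (cont_coord x)|case: (is_derive_coord x j)].
Qed.

Lemma smooth_sub U V f : V `<=` U -> smooth_on U f -> smooth_on V f.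
Proof. by move=> VU h s x Vx; exact/h/VU. Qed.

(** Meant for points where the formula of a function changes: the origin for [flat], the points [-1]
    and [1] for [huber]. *)
Lemma is_derive_quad (f : R -> R) (x d C : R) :
  (forall h, `|f (x + h) - f x - h * d| <= C * h ^+ 2) -> is_derive x 1 f d.
Proof.
move=> H.
have H2 : (fun h : R => h^-1 *: ((f \o shift x) (h *: (1 : R)) - f x)) @ 0^' --> d.
  apply/cvgrPdist_le => e e0.
  near=> h.
  have h0 : h != 0 by near: h; exact: nbhs_dnbhs_neq.
  have -> : d - h^-1 *: ((f \o shift x) (h *: (1 : R)) - f x) = - h^-1 * (f (x + h) - f x - h * d).
    by rewrite /= /GRing.scale/= mulr1 (addrC h); field.
  rewrite normrM normrN normfV.
  rewrite ler_pdivrMl ?normr_gt0//.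
  apply: le_trans (H h) _.
  have -> : h ^+ 2 = `|h| * `|h| by rewrite -expr2 real_normK ?num_real.
  suff H1 : `|C| * `|h| <= e by move: (ler_norm C) (normr_ge0 h); nra.
  have : `|h| <= e / (`|C| + 1).
    near: h; apply: dnbhs0_le; apply: divr_gt0 => //; have := normr_ge0 C; lra.
  rewrite ler_pdivlMr; last by have := normr_ge0 C; lra.
  have := normr_ge0 h; have := normr_ge0 C; nra.
apply: DeriveDef; first by apply/cvg_ex; exists d.
exact/cvg_lim.
Unshelve. all: by end_near. Qed.

End SmoothCalculus.

(** * Flat functions and cutoffs *)

Section FlatFunction.
Variable R : realType.
Implicit Types p : {poly R}.

Lemma pow_exp_bound n : exists C : R, forall t, 0 <= t -> t ^+ n * expR (- t) <= C.
Proof.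
case: n => [|n].
  by exists 1 => t t0; rewrite expr0 mul1r -expR0 ler_expR oppr_le0.
exists (n.+1%:R ^+ n.+1) => t t0.
rewrite expRN ler_pdivrMr ?expR_gt0//.
have -> : t = t / n.+1%:R * n.+1%:R by rewrite divfK// pnatr_eq0.
rewrite exprMn [leRHS]mulrC ler_wpM2r ?exprn_ge0//.
rewrite expRM_natr.
apply: lerXn2r; rewrite ?nnegrE ?divr_ge0 ?expR_ge0//.
by apply: le_trans (expR_ge1Dx _); rewrite lerDr.
Qed.

Lemma poly_exp_bound p k : exists C : R, forall t, 0 <= t -> `|p.[t]| * t ^+ k * expR (- t) <= C.
Proof.
elim/poly_ind: p k => [|p c IH] k.
  by exists 0 => t t0; rewrite horner0 normr0 !mul0r.
have [C1 H1] := IH k.+1; have [C2 H2] := pow_exp_bound k.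
exists (C1 + `|c| * C2) => t t0.
have E0 := expR_ge0 (- t).
have Tk : 0 <= t ^+ k by exact: exprn_ge0.
have := H1 t t0; have := H2 t t0.
rewrite !hornerE exprS => h2 h1.
apply: le_trans (lerD h1 (ler_wpM2l (normr_ge0 c) h2)).
have : `|p.[t] * t + c| <= `|p.[t]| * t + `|c|.
  by apply: le_trans (ler_normD _ _) _; rewrite normrM (ger0_norm t0).
move=> h; have := ler_wpM2r (mulr_ge0 Tk E0) h.
by rewrite !mulrA mulrDl mulrDl; nra.
Qed.

(** This class is closed under differentiation, which replaces [p] by [X^2 (p - p')]. The classical
    flat function is the case [p = 1], so all its derivatives are explicit. *)
Definition flat p (y : R) : R := if 0 < y then p.[y^-1] * expR (- y^-1) else 0.

Lemma flat_bound p k : exists C : R, forall y, `|flat p y| <= C * `|y| ^+ k.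
Proof.
have [C H] := poly_exp_bound p k.
exists (`|C|) => y; rewrite /flat; case: ifPn => y0; last by rewrite normr0 mulr_ge0.
have := H y^-1 (ltW (_ : 0 < y^-1)); rewrite invr_gt0 => /(_ y0).
rewrite normrM (ger0_norm (expR_ge0 _)) (gtr0_norm y0) exprVn mulrAC ler_pdivrMr ?exprn_gt0// => h.
by apply: le_trans h _; rewrite ler_wpM2r ?ler_norm// exprn_ge0 ?ltW.
Qed.

Lemma flat_derive p (y : R) : is_derive y 1 (flat p) (flat ('X^2 * (p - p^`())) y).
Proof.
have [y0|y0|y0] := ltrgtP y 0.
- rewrite {2}/flat ltNge ltW//=.
  have e : \forall t \near y, flat p t = (cst 0 : R -> R) t.
    have : nbhs y [set t | t < 0] by apply: open_nbhs_nbhs; split => //; exact: open_lt.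
    by apply: filterS => t /= t0; rewrite /flat ltNge ltW.
  exact: near_is_derive e (@is_derive_cst _ _ _ _ _ _).
- have e : \forall t \near y, flat p t = (fun t : R => p.[t^-1] * expR (- t^-1)) t.
    have : nbhs y [set t | 0 < t] by apply: open_nbhs_nbhs; split => //; exact: open_gt.
    by apply: filterS => t /= t0; rewrite /flat t0.
  have yN : y != 0 by rewrite gt_eqF.
  have dv : is_derive y 1 (fun t : R => t^-1) (- y ^- 2).
    by have := @is_deriveV R id y 1 1 yN (@is_derive_id _ _ _ _); rewrite /GRing.scale/= mulr1.
  have d1 : is_derive y 1 (fun t : R => p.[t^-1]) (p^`().[y^-1] * - y ^- 2).
    by apply: (is_derive_comp1 dv); exact: is_derive_poly.
  have d2 : is_derive y 1 (fun t : R => expR (- t^-1)) (expR (- y^-1) * y ^- 2).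
    have dn : is_derive y 1 (fun t : R => - t^-1) (y ^- 2).
      by have := is_deriveN dv; rewrite opprK.
    exact: (is_derive_comp1 dn (is_derive_expR _)).
  have d3 := is_deriveM d1 d2.
  have E : p.[y^-1] *: (expR (- y^-1) * y ^- 2) + expR (- y^-1) *: (p^`().[y^-1] * - y ^- 2)
     = flat ('X^2 * (p - p^`())) y.
    rewrite /flat y0 !scalE hornerM hornerXn hornerD hornerN; set e1 := expR _; set a := p.[_]; set b := p^`().[_].
    by field.
  rewrite -E; exact: near_is_derive e d3.
- rewrite y0; rewrite {2}/flat ltxx.
  (* At the origin the exponential beats every power; the bound by [C * y ^+ 2] gives the derivative
     0. *)
  have [C H] := flat_bound p 2.
  apply: (@is_derive_quad _ _ _ _ C) => h.
  rewrite add0r mulr0 subr0 {2}/flat ltxx subr0.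
  by rewrite -(real_normK (num_real h)); exact: H.
Qed.

Fixpoint flatp (n : nat) : {poly R} := if n is m.+1 then 'X^2 * (flatp m - (flatp m)^`()) else 1.
Definition E_ (n : nat) : R -> R := flat (flatp n).
Definition E0 : R -> R := E_ 0.
Definition E1 : R -> R := E_ 1.

Lemma E_derive n (y : R) : is_derive y 1 (E_ n) (E_ n.+1 y).
Proof. exact: flat_derive. Qed.

Lemma E0_pos y : 0 < y -> E0 y = expR (- y^-1).
Proof. by move=> y0; rewrite /E0 /E_ /flat y0 /= hornerE mul1r. Qed.
Lemma E0_neg y : y <= 0 -> E0 y = 0.
Proof. by move=> y0; rewrite /E0 /E_ /flat ltNge y0. Qed.
Lemma E1_pos y : 0 < y -> E1 y = y ^- 2 * expR (- y^-1).
Proof. by move=> y0; rewrite /E1 /E_ /flat y0 /= derivC subr0 mulr1 !hornerE exprVn. Qed.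
Lemma E1_neg y : y <= 0 -> E1 y = 0.
Proof. by move=> y0; rewrite /E1 /E_ /flat ltNge y0. Qed.
Lemma E0_ge0 y : 0 <= E0 y.
Proof. by have [h|h] := ltP 0 y; [rewrite E0_pos// expR_ge0|rewrite E0_neg]. Qed.
Lemma E0_gt0 y : 0 < y -> 0 < E0 y.
Proof. by move=> h; rewrite E0_pos// expR_gt0. Qed.
Lemma E0_le1 y : E0 y <= 1.
Proof.
have [h|h] := ltP 0 y; last by rewrite E0_neg.
by rewrite E0_pos// -expR0 ler_expR oppr_le0 invr_ge0 ltW.
Qed.
Lemma E1_ge0 y : 0 <= E1 y.
Proof.
have [h|h] := ltP 0 y; last by rewrite E1_neg.
by rewrite E1_pos// mulr_ge0 ?expR_ge0// invr_ge0 sqr_ge0.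
Qed.
Lemma E1_bound : exists C : R, forall y, E1 y <= C.
Proof.
have [C H] := flat_bound (flatp 1) 0.
by exists C => y; apply: le_trans (ler_norm _) _; have := H y; rewrite expr0 mulr1.
Qed.
Lemma E0_mono x y : x <= y -> E0 x <= E0 y.
Proof.
move=> xy; have [hx|hx] := ltP 0 x; last by rewrite E0_neg// E0_ge0.
have hy : 0 < y by exact: lt_le_trans xy.
by rewrite !E0_pos// ler_expR lerN2 lef_pV2 ?posrE.
Qed.

Definition stepden y : R := E0 y + E0 (1 - y).
Lemma stepden_gt0 y : 0 < stepden y.
Proof.
rewrite /stepden; have [h|h] := ltP 0 y.
  by have := E0_gt0 h; have := E0_ge0 (1 - y); lra.
by have := @E0_gt0 (1 - y) ltac:(lra); have := E0_ge0 y; lra.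
Qed.
(** The usual smooth transition from 0 on [y <= 0] to 1 on [1 <= y]. Its derivative [step'] is kept
    explicit because bounds on it enter the dominated convergence arguments. *)
Definition step y : R := E0 y / stepden y.
Definition step' y : R := (E1 y * E0 (1 - y) + E0 y * E1 (1 - y)) / stepden y ^+ 2.

Lemma step_derive (y : R) : is_derive y 1 step (step' y).
Proof.
have d0 := E_derive 0 y.
have dl : is_derive y 1 (fun t : R => 1 - t) (-1).
  by have := is_deriveB (@is_derive_cst _ _ _ (1 : R) y 1) (@is_derive_id _ _ y (1 : R)); rewrite sub0r.
have d1 := is_derive_comp1 dl (E_derive 0 (1 - y)).
have dd := is_deriveD d0 d1.
have dv := @is_deriveV R _ y _ 1 (lt0r_neq0 (stepden_gt0 y)) dd.
have := is_deriveM d0 dv.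
congr is_derive; rewrite /step' /GRing.scale/= -/(E1 y) -/(E1 (1 - y)).
rewrite -/(E0 y) -/(stepden y).
have := stepden_gt0 y; rewrite /stepden -/(E0 y) -/(E0 (1 - y)) => h.
by field; rewrite gt_eqF.
Qed.

Lemma step_ge0 y : 0 <= step y.
Proof. by rewrite divr_ge0 ?E0_ge0// ltW// stepden_gt0. Qed.
Lemma step_le1 y : step y <= 1.
Proof. by rewrite ler_pdivrMr ?stepden_gt0// mul1r lerDl E0_ge0. Qed.
Lemma step0 y : y <= 0 -> step y = 0.
Proof. by move=> h; rewrite /step E0_neg// mul0r. Qed.
Lemma step1 y : 1 <= y -> step y = 1.
Proof.
move=> h; rewrite /step /stepden (@E0_neg (1 - y)) ?addr0 ?divff//; last by lra.
by rewrite gt_eqF// E0_gt0; lra.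
Qed.
Lemma step'0 y : y <= 0 -> step' y = 0.
Proof. by move=> h; rewrite /step' (E0_neg h) (E1_neg h) !mul0r addr0 mul0r. Qed.
Lemma step'1 y : 1 <= y -> step' y = 0.
Proof. by move=> h; rewrite /step' (@E0_neg (1 - y)) ?(@E1_neg (1 - y)) ?mulr0 ?addr0 ?mul0r//; lra. Qed.
Lemma step'_ge0 y : 0 <= step' y.
Proof. by rewrite divr_ge0 ?sqr_ge0// addr_ge0// mulr_ge0 ?E0_ge0 ?E1_ge0. Qed.
Lemma step'_bound : exists C : R, 0 <= C /\ forall y, step' y <= C.
Proof.
have [C H] := E1_bound.
have C0 : 0 <= C by have := H 0; rewrite E1_neg.
have e0 : 0 < E0 (2^-1) by rewrite E0_gt0// invr_gt0.
(* One of [y] and [1 - y] is at least 1/2, and [E0] is nondecreasing. *)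
have dlow y : E0 (2^-1) <= stepden y.
  rewrite /stepden; have [h|h] := leP (2^-1) y.
    by have := E0_mono h; have := E0_ge0 (1 - y); lra.
  by have := @E0_mono (2^-1) (1 - y) ltac:(lra); have := E0_ge0 y; lra.
exists (2 * C / E0 (2^-1) ^+ 2); split; first by rewrite divr_ge0 ?sqr_ge0//; lra.
move=> y; rewrite /step'; apply: ler_pM.
- by rewrite addr_ge0// mulr_ge0 ?E0_ge0 ?E1_ge0.
- by rewrite invr_ge0 sqr_ge0.
- have := H y; have := H (1 - y); have := E0_le1 y; have := E0_le1 (1 - y).
  have := E0_ge0 y; have := E0_ge0 (1 - y); have := E1_ge0 y; have := E1_ge0 (1 - y); nra.
- rewrite lef_pV2 ?posrE ?exprn_gt0 ?stepden_gt0//.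
  by rewrite lerXn2r ?nnegrE ?(ltW e0) ?(ltW (stepden_gt0 _)).
Qed.

End FlatFunction.

(** * Integration by parts *)

Section LineIBP.
Variable R : realType.
Local Notation mR := (measurableTypeR R).
Local Notation lam := (@lebesgue_measure R).
Local Notation leb3 := (leb3 R).
Implicit Types (x : R3 R) (j : 'I_3).

Definition rho2 x : R := x.1.1 ^+ 2 + x.1.2 ^+ 2.
Definition offaxis : set (R3 R) := [set x | rho2 x != 0].

Lemma offaxis1 x : x.1.1 != 0 -> offaxis x.
Proof. by move=> h; rewrite /offaxis/= /rho2 paddr_eq0 ?sqr_ge0// !sqrf_eq0 negb_and h. Qed.
Lemma offaxis2 x : x.1.2 != 0 -> offaxis x.
Proof. by move=> h; rewrite /offaxis/= /rho2 paddr_eq0 ?sqr_ge0// !sqrf_eq0 negb_and h orbT. Qed.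

Lemma rho2_ge0 x : 0 <= rho2 x.
Proof. by rewrite addr_ge0// sqr_ge0. Qed.
Lemma rho2_gt0 x : offaxis x -> 0 < rho2 x.
Proof. by move=> h; rewrite lt0r h rho2_ge0. Qed.

Lemma cont3D (f g : R3 R -> R) x : {for x, continuous f} -> {for x, continuous g} ->
  {for x, continuous (fun x => f x + g x)}.
Proof. by move=> hf hg; apply: cvgD. Qed.
Lemma cont3M (f g : R3 R -> R) x : {for x, continuous f} -> {for x, continuous g} ->
  {for x, continuous (fun x => f x * g x)}.
Proof. by move=> hf hg; apply: cvgM. Qed.

Lemma cont_pair (T U V : topologicalType) (f : T -> U) (g : T -> V) (t : T) :
  {for t, continuous f} -> {for t, continuous g} ->
  {for t, continuous (fun t => (f t, g t))}.
Proof. by move=> hf hg; exact: (cvg_pair hf hg). Qed.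

Lemma rho2_cont x : {for x, continuous rho2}.
Proof.
have [h1 h2 _] := cont_coord x.
by apply: cont3D; rewrite /prop_for; apply: cont3M.
Qed.

Lemma open_offaxis : open offaxis.
Proof.
have -> : offaxis = rho2 @^-1` [set y | y != 0] by [].
apply: open_comp; first by move=> x _; exact: rho2_cont.
exact: open_neq.
Qed.

Lemma null_axis : {ae leb3, forall x, offaxis x}.
Proof.
have mA : measurable ([set 0 : R] : set mR) by exact: measurable_set1.
exists ((([set 0 : R] : set mR) `*` (setT : set mR)) `*` (setT : set mR)); split.
- by apply: measurableX => //; exact: measurableX.
- transitivity ((prodS lam lam : set _ -> \bar R) (([set 0%R : R] : set mR) `*` (setT : set mR)) * lam setT)%E.
    by apply: (@product_measure1E _ _ _ _ R (prodS lam lam) lam) => //; exact: measurableX.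
  have -> : ((prodS lam lam : set _ -> \bar R) (([set 0%R : R] : set mR) `*` (setT : set mR))) = (lam [set 0%R : R] * lam setT)%E.
    by apply: product_measure1E.
  by rewrite lebesgue_measure_set1 !mul0e.
- move=> x /= h; split=> //; split=> //=.
  by apply: contrapT => /eqP h'; apply: h; exact: offaxis1.
Qed.

Lemma is_derive_vert (F : R3 R -> R) x d (j : 'I_3) : val j = 2%N ->
  is_derive x (basis3 R j) F d -> is_derive x.2 1 (fun z => F (x.1, z)) d.
Proof.
move=> hj /is_derive_line h; apply/is_derive_shift1.
move: h; congr is_derive; apply/funext => h; congr F.
rewrite /basis3 hj /=.
by case: x => -[a b] c; congr (_, _, _); rewrite /= /GRing.scale/= ?mulr0 ?addr0 ?mulr1.
Qed.

(** [perm3' j] carries the vertical direction to the direction [j], and [perm3 j] undoes it.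
    Integration along any coordinate direction is thereby reduced to vertical lines. *)
Definition perm3 j : R3 R -> R3 R :=
  match val j with
  | 0%N => fun x => (x.1.2, x.2, x.1.1)
  | 1%N => fun x => (x.1.1, x.2, x.1.2)
  | _ => id end.
Definition perm3' j : R3 R -> R3 R :=
  match val j with
  | 0%N => fun x => (x.2, x.1.1, x.1.2)
  | 1%N => fun x => (x.1.1, x.2, x.1.2)
  | _ => id end.

Lemma perm3K' j : cancel (perm3' j) (perm3 j).
Proof. by move=> [[a b] c]; rewrite /perm3 /perm3'; case: (val j) => [|[|n]]. Qed.

Lemma mpres_id : mpres leb3 id.
Proof. by split; first exact: measurable_id. Qed.

Lemma perm3'_mpres j : mpres leb3 (perm3' j).
Proof.
rewrite /perm3'; case: (val j) => [|[|n]]; last exact: mpres_id.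
  have -> : (fun x : R3 R => (x.2, x.1.1, x.1.2)) = @swap12 R \o @swap23 R by apply/funext => -[[a b] c].
  exact: mpres_comp (swap12_mpres R) (swap23_mpres R).
exact: swap23_mpres.
Qed.

Definition ord2 : 'I_3 := @Ordinal 3 2 isT.

Lemma is_derive_perm (F : R3 R -> R) x j d : is_derive (perm3' j x) (basis3 R j) F d ->
  is_derive x (basis3 R ord2) (F \o perm3' j) d.
Proof.
move=> /is_derive_line h; apply/is_derive_line; move: h; congr is_derive.
apply/funext => h /=; congr F; rewrite /perm3' /basis3 /=.
by case: x => -[a b] c; case: j => -[|[|[|//]]] ? /=.
Qed.

Lemma perm3'_cont j x : {for x, continuous (perm3' j)}.
Proof.
have [h1 h2 h3] := cont_coord x.
rewrite /perm3'; case: (val j) => [|[|n]]; last exact: cvg_id.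
  exact: cont_pair (cont_pair h3 h1) h2.
exact: cont_pair (cont_pair h1 h3) h2.
Qed.

Definition boxed (M : R) x := [/\ `|x.1.1| < M, `|x.1.2| < M & `|x.2| < M].

(* Integration along lines parallel to e_j; almost every such line misses the axis. *)
Lemma line_ibp j (F dF : R3 R -> R) (M : R) : 0 < M ->
  (forall x, offaxis x -> is_derive x (basis3 R j) F (dF x)) ->
  (forall x, offaxis x -> {for x, continuous dF}) ->
  (forall x, ~ boxed M x -> F x = 0) ->
  intg leb3 setT dF -> \int[leb3]_x dF x = 0.
Proof.
move=> M0 hd hc hM hi.
have mi := intg_meas hi.
rewrite -(mpres_Rint (perm3'_mpres j) mi).
have off x : x.1.1 != 0 -> offaxis (perm3' j x).
  rewrite /perm3'; case: (val j) => [|[|n]] h /=; first exact: offaxis2.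
    exact: offaxis1.
  exact: offaxis1.
apply: (@vline_ibp R (F \o perm3' j) (dF \o perm3' j) M) => //.
- move=> x x0; apply: (@is_derive_vert (F \o perm3' j) x (dF (perm3' j x)) ord2) => //.
  by apply: is_derive_perm; exact/hd/off.
- move=> x' x'0 z.
  have c1 : {for z, continuous (fun z => (x', z) : R3 R)} by apply: cont_pair; [exact: cvg_cst|exact: cvg_id].
  apply: (continuous_comp c1).
  have c2 := @perm3'_cont j (x', z).
  by apply: (continuous_comp c2); apply/hc/off.
- move=> x hx; apply: hM => -[]; rewrite /perm3'.
  by case: (val j) => [|[|n]] /= *; lra.
- exact: mpres_intg (perm3'_mpres j) hi.
Qed.

End LineIBP.

(** * Weak derivatives *)

Section PiLambda.
Context d d' (X : measurableType d) (Y : measurableType d') (R : realType).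
Variable mu : {measure set X -> \bar R}.

Lemma Rint_limit0 (C : R) (k : X -> R) (p_ : nat -> X -> R) (p : X -> R) :
  intg mu setT k -> (forall n, measurable_fun setT (p_ n)) ->
  (forall n x, `|p_ n x| <= C) -> (forall x, p_ ^~ x @ \oo --> p x) ->
  (forall n, \int[mu]_x (k x * p_ n x) = 0) -> \int[mu]_x (k x * p x) = 0.
Proof.
move=> ik mp bp cp H; have mk := intg_meas ik.
have mp' : measurable_fun setT p.
  by apply: (measurable_fun_cvg (h := p_)) => // x _; exact: cp.
have := @Rint_dct _ _ _ mu setT (fun n x => k x * p_ n x) (fun x => k x * p x) (fun x => C * `|k x|) measurableT.
move=> /(_ _ _ _ _ _)/wrap[].
- by move=> n; exact: measurable_funM.
- exact: measurable_funM.
- by apply: aeW => x _; apply: cvgM => //; exact: cvg_cst.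
- exact/intgZ/intg_abs.
- by apply: aeW => x n _; rewrite normrM mulrC ler_wpM2r.
under eq_fun do rewrite H.
by move=> /cvg_lim <-//; rewrite lim_cst.
Qed.

(** The sets [A] with vanishing integral form a lambda system: differences by linearity, increasing
    unions by dominated convergence with [|k|]. The total integral is assumed to vanish so that the
    whole space belongs to it. *)
Lemma Rint_pi_lambda (k : X -> R) (pi : X -> Y) (G : set (set Y)) :
  intg mu setT k -> measurable_fun setT pi -> @measurable _ Y = <<s G >> -> setI_closed G ->
  \int[mu]_x k x = 0 ->
  (forall A, G A -> \int[mu]_x (k x * \1_A (pi x)) = 0) ->
  forall A, measurable A -> \int[mu]_x (k x * \1_A (pi x)) = 0.
Proof.
move=> ik mpi mG GI k0 HG.
pose H := [set A : set Y | measurable A /\ \int[mu]_x (k x * \1_A (pi x)) = 0].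
have mk := intg_meas ik.
have m1 (A : set Y) : measurable A -> measurable_fun setT (fun x => \1_A (pi x) : R).
  by move=> mA; apply: (measurableT_comp _ mpi); exact: measurable_indic.
have i1 (A : set Y) : measurable A -> intg mu setT (fun x => k x * \1_A (pi x)).
  move=> mA; apply: (@intg_le _ _ _ _ _ _ (fun x => `|k x|)) => //.
  - by apply: measurable_funM => //; exact: m1.
  - exact: intg_abs.
  - by move=> x _; rewrite normrM ler_piMr// indicE; case: (_ \in _); rewrite /= ?normr1 ?normr0.
have LS : lambda_system setT H.
  split => //.
  - split => //; rewrite -[RHS]k0; apply: eq_Rintegral => x _.
    by rewrite indicT mulr1.
  - move=> A B BA [mA hA] [mB hB]; split; first exact: measurableD.
    transitivity (\int[mu]_x (k x * \1_A (pi x) - k x * \1_B (pi x))).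
      apply: eq_Rintegral => x _; rewrite -mulrBr; congr (_ * _).
      rewrite !indicE in_setD; case: (boolP (pi x \in B)) => hx /=; last by rewrite andbT subr0.
      by rewrite (mem_set (BA _ (set_mem hx))) subrr.
    by rewrite RintegralB// ?hA ?hB ?subrr//; exact: i1.
  - move=> F ndF HF; split; first by apply: bigcup_measurable => n _; case: (HF n).
    apply: (@Rint_limit0 1 _ (fun n x => \1_(F n) (pi x))) => //.
    + by move=> n; apply: m1; case: (HF n).
    + by move=> n x; rewrite indicE; case: (_ \in _); rewrite /= ?normr1 ?normr0.
    + move=> x; rewrite [X in _ --> X]indicE; case: (boolP (pi x \in _)) => /=.
        rewrite inE => -[n _ Fn]; apply: cvg_near_cst; near=> m.
        rewrite indicE mem_set//; have : (n <= m)%N by near: m; exact: nbhs_infty_ge.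
        by move=> /ndF /subsetPset; apply.
      rewrite notin_setE => hx; apply: cvg_near_cst; apply: nearW => m.
      by rewrite indicE memNset// => Fm; apply: hx; exists m.
    + by move=> n; case: (HF n).
have sub := lambda_system_subset GI LS.
move=> A mA; suff [] : H A by [].
apply: sub => //; last by rewrite -mG.
by move=> B GB; split; [rewrite mG; exact: sub_sigma_algebra|exact: HG].
Unshelve. all: by end_near. Qed.

Lemma Rint_sets0 (k : X -> R) : intg mu setT k ->
  (forall A, measurable A -> \int[mu]_x (k x * \1_A x) = 0) ->
  {ae mu, forall x, k x = 0}.
Proof.
move=> ik H; have mk := intg_meas ik.
have h : ae_eq mu setT (EFin \o k) (cst 0%E).
  apply: integral_ae_eq => //.
  move=> E _ mE; rewrite integral_cst// mul0e.
  have iE : mu.-integrable E (EFin \o k) by apply: integrableS ik.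
  rewrite -(fineK (integrable_fin_num mE iE)); congr EFin.
  rewrite -[RHS](H E mE) /Rintegral integral_mkcond; congr fine.
  apply: eq_integral => x _; rewrite patchE indicE.
  by case: (x \in E); rewrite /= ?mulr1 ?mulr0.
by apply: ae_imp h => x /(_ I) /= [].
Qed.
End PiLambda.

(** * The fundamental lemma of the calculus of variations on the whole space *)

Section DuBoisReymond.
Variable R : realType.
Local Notation mR := (measurableTypeR R).
Local Notation leb3 := (leb3 R).
Local Notation T3 := (mR * mR * mR)%type.

(* The derivative of u E0(n u), u = y - a: it tends to the indicator of y > a and
   has an explicit smooth antiderivative. *)
Definition ray (n : nat) (a : R) (y : R) : R :=
  E0 (n%:R * (y - a)) + n%:R * (y - a) * E1 (n%:R * (y - a)).

Lemma E0E1_bound (t : R) : 0 <= t * E1 t <= 1.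
Proof.
have [t0|t0] := ltP 0 t; last by rewrite E1_neg// mulr0 lexx ler01.
rewrite mulr_ge0 ?E1_ge0 ?(ltW t0)//= E1_pos//.
have -> : t * (t ^- 2 * expR (- t^-1)) = t^-1 * expR (- t^-1).
  by field; rewrite gt_eqF.
apply: ltW; rewrite expRN ltr_pdivrMr ?expR_gt0// mul1r.
by apply: lt_le_trans (expR_ge1Dx _); rewrite ltrDr.
Qed.

Lemma ray_le n a y : `|ray n a y| <= 2.
Proof.
rewrite /ray; set t := _ * _; have /andP[h1 h2] := E0E1_bound t.
have := E0_ge0 t; have := E0_le1 t => *; rewrite ger0_norm; lra.
Qed.

Lemma cvg_ray (t_ : nat -> R) : (\forall n \near \oo, n%:R <= t_ n) ->
  (fun n => E0 (t_ n) + t_ n * E1 (t_ n)) @ \oo --> (1 : R).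
Proof.
move=> h; have cN : (fun n : nat => n%:R^-1 : R) @ \oo --> (0 : R).
  apply/gtr0_cvgV0; last exact: cvgr_idn.
  by near=> n; rewrite ltr0n; near: n; exact: nbhs_infty_gt.
apply: (@squeeze_cvgr _ _ _ _ (fun n : nat => 1 - n%:R^-1) (fun n : nat => 1 + n%:R^-1)).
- near=> n.
  have n0 : (0 < n)%N by near: n; exact: nbhs_infty_gt.
  have nt : n%:R <= t_ n by near: n.
  have t0 : 0 < t_ n by apply: lt_le_trans nt; rewrite ltr0n.
  have ti : (t_ n)^-1 <= n%:R^-1 by rewrite lef_pV2 ?posrE ?ltr0n.
  have /andP[h1 _] := E0E1_bound (t_ n).
  have h2 : t_ n * E1 (t_ n) <= (t_ n)^-1.
    rewrite E1_pos// -[leRHS]mulr1.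
    have -> : t_ n * (t_ n ^- 2 * expR (- (t_ n)^-1)) = (t_ n)^-1 * expR (- (t_ n)^-1).
      by field; rewrite gt_eqF.
    by rewrite ler_wpM2l ?invr_ge0 ?(ltW t0)// -expR0 ler_expR oppr_le0 invr_ge0 ltW.
  have h3 : 1 - (t_ n)^-1 <= E0 (t_ n) by rewrite E0_pos//; apply: le_trans (expR_ge1Dx _).
  have h4 := E0_le1 (t_ n); apply/andP; split; lra.
- by rewrite -[X in _ --> X]subr0; apply: cvgB; first exact: cvg_cst.
- by rewrite -[X in _ --> X]addr0; apply: cvgD; first exact: cvg_cst.
Unshelve. all: by end_near. Qed.

(** The scale is [n ^ 2] because [n ^ 2 * (y - a) >= n] as soon as [n >= (y - a)^-1], which is the
    growth that [cvg_ray] asks for. *)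
Lemma ray_cvg a y : (fun n => ray (n ^ 2) a y) @ \oo --> (\1_(`]a, +oo[%classic : set R) y : R).
Proof.
rewrite indicE; case: (boolP (_ \in _)) => /=.
  rewrite inE/= in_itv/= andbT => ay; apply: cvg_ray.
  near=> n; rewrite natrX expr2 -mulrA ler_peMr//.
  have : (y - a)^-1 <= n%:R by near: n; exact: nbhs_infty_ger.
  have ya : 0 < y - a by rewrite subr_gt0.
  by move=> h; have := ler_wpM2r (ltW ya) h; rewrite mulVf// gt_eqF.
rewrite notin_setE/= in_itv/= andbT => /negP; rewrite -leNgt => ya.
have h n : n%:R * (y - a) <= 0 by rewrite mulr_ge0_le0// subr_le0.
apply: cvg_near_cst; apply: nearW => n.
by rewrite /ray (E0_neg (h _)) (E1_neg (h _)) mulr0 addr0.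
Unshelve. all: by end_near. Qed.

Lemma ray_cvg1 (y : R) : (fun n => ray n (- n%:R) y) @ \oo --> (\1_([set: R]) y : R).
Proof.
rewrite indicT; apply: cvg_ray; near=> n.
rewrite ler_peMr// opprK.
have : 1 - y <= n%:R by near: n; exact: nbhs_infty_ger.
lra.
Unshelve. all: by end_near. Qed.

Lemma ray_cont n a : continuous (ray n a).
Proof.
move=> y; have c : {for y, continuous (fun y => n%:R * (y - a))}.
  by apply: cvgM; [exact: cvg_cst|apply: cvgB; [exact: cvg_id|exact: cvg_cst]].
apply: cvgD.
  apply: (@continuous_comp _ _ _ (fun y => n%:R * (y - a)) (@E0 R)) => //.
  exact: (is_derive1_cont (E_derive 0 _)).
apply: cvgM => //.
apply: (@continuous_comp _ _ _ (fun y => n%:R * (y - a)) (@E1 R)) => //.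
exact: (is_derive1_cont (E_derive 1 _)).
Qed.

Definition rayint (n : nat) (a : R) (y : R) : R := (y - a) * E0 (n%:R * (y - a)).

Lemma rayint_derive n a (y : R) : is_derive y 1 (rayint n a) (ray n a y).
Proof.
have d0 : is_derive y 1 (fun y : R => y - a) 1.
  by have := is_deriveB (@is_derive_id _ _ y (1 : R)) (@is_derive_cst _ _ _ a y 1); rewrite subr0.
have d1 : is_derive y 1 (fun y : R => n%:R * (y - a)) n%:R.
  by have := is_deriveM (@is_derive_cst _ _ _ (n%:R : R) y 1) d0; rewrite !scalE mulr0 addr0 mulr1.
have d2 := is_derive_comp1 d1 (E_derive 0 _).
have := is_deriveM d0 d2.
by congr is_derive; rewrite !scalE mulr1 /ray /E0 /E1 /=; ring.
Qed.

Lemma ray_meas n a : measurable_fun setT (ray n a : mR -> R).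
Proof. exact: (continuous_measurable_fun (@ray_cont n a)). Qed.

Definition rays : set (set R) := [set A | A = setT \/ exists a, A = `]a, +oo[%classic].

Lemma rays_setI : setI_closed rays.
Proof.
move=> A B [->|[a ->]] [->|[b ->]]; rewrite ?setIT ?setTI.
- by left.
- by right; exists b.
- by right; exists a.
right; exists (Num.max a b); apply/seteqP; split=> x /=; rewrite !in_itv/= !andbT gt_max.
  by move=> [-> ->].
by move=> /andP.
Qed.

Lemma measR_rays : @measurable _ mR = <<s rays >>.
Proof.
rewrite (RGenOInfty.measurableE R); apply/seteqP; split.
  apply: sub_sigma_algebra2 => _ [a ->]; right; by exists a.
apply: smallest_sub; first exact: smallest_sigma_algebra.
move=> _ [->|[a ->]]; last by apply: sub_sigma_algebra; exists a.
exact: measurableT.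
Qed.

(** The vanishing of the total integral of [k], needed to start the pi-lambda argument, comes from
    the same limit: the rays issuing from [- n] fill the line. *)
Lemma ray_limit (k : T3 -> R) (pi : T3 -> mR) : intg leb3 setT k -> measurable_fun setT pi ->
  (forall n a, \int[leb3]_x (k x * ray n a (pi x)) = 0) ->
  forall A, measurable A -> \int[leb3]_x (k x * \1_A (pi x)) = 0.
Proof.
move=> ik mpi H.
have HR A : rays A -> \int[leb3]_x (k x * \1_A (pi x)) = 0.
  move=> [->|[a ->]].
    apply: (@Rint_limit0 _ _ _ leb3 2 k (fun n x => ray n (- n%:R) (pi x))) => //.
    - by move=> n; apply: (measurableT_comp (ray_meas n _) mpi).
    - by move=> n x; exact: ray_le.
    - by move=> x; exact: ray_cvg1.
  apply: (@Rint_limit0 _ _ _ leb3 2 k (fun n x => ray (n ^ 2) a (pi x))) => //.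
  - by move=> n; apply: (measurableT_comp (ray_meas _ _) mpi).
  - by move=> n x; exact: ray_le.
  - by move=> x; exact: ray_cvg.
apply: (Rint_pi_lambda ik mpi measR_rays rays_setI _ HR).
rewrite -[RHS](HR setT (or_introl erefl)); apply: eq_Rintegral => x _.
by rewrite indicT mulr1.
Qed.

(** The ray functions are replaced by indicators in one coordinate after the other. The resulting
    products of measurable sets generate the sigma-algebra in two stages, since [R^3] is an iterated
    product. *)
Lemma dbr_global (k : T3 -> R) : intg leb3 setT k ->
  (forall n a m b l c, \int[leb3]_x (k x * (ray n a x.1.1 * ray m b x.1.2 * ray l c x.2)) = 0) ->
  {ae leb3, forall x, k x = 0}.
Proof.
move=> ik H; have mk := intg_meas ik.
have ib (q : T3 -> R) : measurable_fun setT q -> (forall x, `|q x| <= 4) ->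
    intg leb3 setT (fun x => k x * q x).
  move=> mq bq; apply: (@intg_le _ _ _ _ _ _ (fun x => 4 * `|k x|)) => //.
  - exact: measurable_funM.
  - exact/intgZ/intg_abs.
  - by move=> x _; rewrite normrM mulrC ler_wpM2r.
have m1 := @meas_x1 R; have m2 := @meas_x2 R; have m3 := @meas_x3 R.
have mr n a (pi : T3 -> mR) : measurable_fun setT pi -> measurable_fun setT (fun x => ray n a (pi x)).
  by move=> mpi; apply: (measurableT_comp (ray_meas n a) mpi).
have mi (A : set mR) (pi : T3 -> mR) : measurable A -> measurable_fun setT pi ->
    measurable_fun setT (fun x => \1_A (pi x) : R).
  by move=> mA mpi; apply: (measurableT_comp _ mpi); exact: measurable_indic.
have bi (A : set mR) y : `|\1_A y : R| <= 2.
  by rewrite indicE; case: (_ \in _); rewrite /= ?normr1 ?normr0; lra.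
have bM (a b : R) : `|a| <= 2 -> `|b| <= 2 -> `|a * b| <= 4.
  by move=> ha hb; rewrite normrM; have := normr_ge0 a; have := normr_ge0 b; nra.
have S1 m b l c (A : set mR) : measurable A ->
    \int[leb3]_x (k x * (ray m b x.1.2 * ray l c x.2) * \1_A x.1.1) = 0.
  apply: (ray_limit (k := fun x => k x * (ray m b x.1.2 * ray l c x.2)) _ m1).
    apply: ib; first by apply: measurable_funM; exact: mr.
    by move=> x; apply: bM; exact: ray_le.
  move=> n a; rewrite -[RHS](H n a m b l c); apply: eq_Rintegral => x _; ring.
have S2 l c (A B : set mR) : measurable A -> measurable B ->
    \int[leb3]_x (k x * (\1_A x.1.1 * ray l c x.2) * \1_B x.1.2) = 0.
  move=> mA; apply: (ray_limit (k := fun x => k x * (\1_A x.1.1 * ray l c x.2)) _ m2).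
    apply: ib; first by apply: measurable_funM; [exact: mi|exact: mr].
    by move=> x; apply: bM; [exact: bi|exact: ray_le].
  move=> n a; rewrite -[RHS](S1 n a l c A mA); apply: eq_Rintegral => x _; ring.
have S3 (A B C : set mR) : measurable A -> measurable B -> measurable C ->
    \int[leb3]_x (k x * (\1_A x.1.1 * \1_B x.1.2) * \1_C x.2) = 0.
  move=> mA mB; apply: (ray_limit (k := fun x => k x * (\1_A x.1.1 * \1_B x.1.2)) _ m3).
    apply: ib; first by apply: measurable_funM; exact: mi.
    by move=> x; apply: bM; exact: bi.
  move=> n a; rewrite -[RHS](S2 n a A B mA mB); apply: eq_Rintegral => x _; ring.
have XI d1 d2 (T1 : measurableType d1) (T2 : measurableType d2) :
    setI_closed [set A `*` B | A in @measurable _ T1 & B in @measurable _ T2].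
  move=> _ _ [A mA [B mB <-]] [C mC [D mD <-]]; rewrite -setXI.
  by exists (A `&` C); [exact: measurableI|exists (B `&` D) => //; exact: measurableI].
have XE d1 d2 (T1 : measurableType d1) (T2 : measurableType d2) (A : set T1) (B : set T2) (y : T1 * T2) :
    \1_(A `*` B) y = \1_A y.1 * \1_B y.2 :> R.
  by rewrite !indicE in_setX; case: (_ \in _); case: (_ \in _); rewrite /= ?mulr1 ?mulr0.
have S4 (A : set (mR * mR)%type) (C : set mR) : measurable A -> measurable C ->
    \int[leb3]_x (k x * \1_C x.2 * \1_A x.1) = 0.
  move=> + mC; apply: (@Rint_pi_lambda _ _ _ _ R leb3 (fun x => k x * \1_C x.2) fst
    [set A `*` B | A in @measurable _ mR & B in @measurable _ mR]).
  - apply: ib => //; first exact: mi.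
    by move=> x; apply: le_trans (bi C x.2) _; lra.
  - exact: measurable_fst.
  - exact: measurable_prod_measurableType.
  - exact: XI.
  - rewrite -[RHS](S3 setT setT C measurableT measurableT mC); apply: eq_Rintegral => x _.
    by rewrite !indicT !mulr1.
  - move=> _ [A' mA [B mB <-]]; rewrite -[RHS](S3 A' B C mA mB mC); apply: eq_Rintegral => x _.
    by rewrite XE; ring.
apply: Rint_sets0 => // A; apply: (@Rint_pi_lambda _ _ _ _ R leb3 k id
    [set A `*` B | A in @measurable _ (mR * mR)%type & B in @measurable _ mR]) => //.
- exact: measurable_prod_measurableType.
- exact: XI.
- rewrite -[RHS](S4 setT setT measurableT measurableT); apply: eq_Rintegral => x _.
  by rewrite !indicT !mulr1.
- move=> _ [A' mA [B mB <-]]; rewrite -[RHS](S4 A' B mA mB); apply: eq_Rintegral => x _.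
  by rewrite XE; ring.
Qed.

End DuBoisReymond.

(** * Balls, test functions and the fundamental lemma on a ball *)

Section Geometry.
Variable R : realType.
Local Notation mR := (measurableTypeR R).
Local Notation leb3 := (leb3 R).
Local Notation T3 := (mR * mR * mR)%type.
Implicit Types (x : R3 R) (j : 'I_3) (Om : set (R3 R)).

Definition nsq x : R := x.1.1 ^+ 2 + x.1.2 ^+ 2 + x.2 ^+ 2.

Lemma nsq_ge0 x : 0 <= nsq x.
Proof. by rewrite !addr_ge0// sqr_ge0. Qed.
Lemma nsqE x : norm3 x ^+ 2 = nsq x.
Proof. by rewrite sqr_sqrtr// nsq_ge0. Qed.
Lemma norm3_ge0 x : 0 <= norm3 x. Proof. exact: sqrtr_ge0. Qed.
Lemma nsq_rho2 x : nsq x = rho2 x + x.2 ^+ 2. Proof. by []. Qed.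
Lemma rho2_le_nsq x : rho2 x <= nsq x.
Proof. by rewrite nsq_rho2 lerDl sqr_ge0. Qed.
Lemma nsq_eq0 x : (nsq x == 0) = (x == 0).
Proof.
case: x => -[a b] c; rewrite /nsq/= paddr_eq0 ?addr_ge0 ?sqr_ge0// paddr_eq0 ?sqr_ge0// !sqrf_eq0.
by rewrite -[in RHS]pair_eqE /pair_eq/= -[in RHS]pair_eqE /pair_eq/=.
Qed.
Lemma nsq_gt0 x : x != 0 -> 0 < nsq x.
Proof. by rewrite lt0r nsq_eq0 nsq_ge0 andbT. Qed.
Lemma off_neq0 x : offaxis x -> x != 0.
Proof. by move=> h; rewrite -nsq_eq0 gt_eqF// (lt_le_trans (rho2_gt0 h) (rho2_le_nsq x)). Qed.

Lemma smooth_nsq U : open U -> smooth_on U nsq.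
Proof.
move=> oU; have [h1 h2 h3] := smooth_coord oU.
exact: smoothD oU (smoothD oU (smoothX 2 oU h1) (smoothX 2 oU h2)) (smoothX 2 oU h3).
Qed.

Lemma smooth_rho2 U : open U -> smooth_on U (@rho2 R).
Proof.
move=> oU; have [h1 h2 h3] := smooth_coord oU.
exact: smoothD oU (smoothX 2 oU h1) (smoothX 2 oU h2).
Qed.

Lemma smooth_cont U f x : smooth_on U f -> U x -> {for x, continuous f}.
Proof. by move=> h Ux; have [] := h [::] x Ux. Qed.

Lemma smooth_derivable U f x j : smooth_on U f -> U x -> is_derive x (basis3 R j) f (partial j f x).
Proof. by move=> h Ux; have [_ /(_ j) k] := h [::] x Ux; exact/derivableP. Qed.

Lemma nsq_cont x : {for x, continuous nsq}.
Proof. exact: (smooth_cont (smooth_nsq openT)). Qed.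

Lemma Ball3E (r : R) x : 0 < r -> Ball3 r x <-> nsq x < r ^+ 2.
Proof.
move=> r0; rewrite -nsqE ltr_pXn2r ?nnegrE ?norm3_ge0 ?ltW//.
Qed.

Lemma open_Ball3 r : open (@Ball3 R r).
Proof.
have -> : @Ball3 R r = (fun x => norm3 x) @^-1` [set y | y < r] by [].
apply: open_comp; last exact: open_lt.
move=> x _; apply: (@continuous_comp _ _ _ nsq (fun y => Num.sqrt y)); first exact: nsq_cont.
exact: sqrt_continuous.
Qed.

Lemma meas_Ball3 r : measurable (Ball3 r : set T3).
Proof. exact: (open_measurable3 (@open_Ball3 r)). Qed.

Lemma closed_nsq_le M : closed [set x | nsq x <= M].
Proof.
have -> : [set x | nsq x <= M] = nsq @^-1` [set y | y <= M] by [].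
by apply: closed_comp; [move=> x _; exact: nsq_cont|exact: closed_le].
Qed.

Lemma closed_nsq_ge M : closed [set x | M <= nsq x].
Proof.
have -> : [set x | M <= nsq x] = nsq @^-1` [set y | M <= y] by [].
by apply: closed_comp; [move=> x _; exact: nsq_cont|exact: closed_ge].
Qed.

Lemma compact_box (M : R) : compact [set x : R3 R | [/\ `|x.1.1| <= M, `|x.1.2| <= M & `|x.2| <= M]].
Proof.
have c := @segment_compact R (- M) M.
have := compact_setX (compact_setX c c) c.
congr (compact _); apply/seteqP; split=> x /=; rewrite !in_itv/= -!ler_norml.
  by move=> [[]].
by move=> [].
Qed.

Lemma sqr_le_norm (a M : R) : 0 <= M -> a ^+ 2 <= M ^+ 2 -> `|a| <= M.
Proof. by move=> M0; rewrite -(real_normK (num_real a)) ler_pXn2r ?nnegrE. Qed.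

Lemma nsq_bound x M : 0 <= M -> nsq x <= M ^+ 2 -> [/\ `|x.1.1| <= M, `|x.1.2| <= M & `|x.2| <= M].
Proof.
move=> M0; rewrite /nsq => h.
have := sqr_ge0 x.1.1; have := sqr_ge0 x.1.2; have := sqr_ge0 x.2 => *.
by split; apply: sqr_le_norm => //; lra.
Qed.

Lemma closed_bounded_compact3 (C : set (R3 R)) M : closed C -> (forall x, C x -> nsq x <= M) -> compact C.
Proof.
move=> cC bC.
have [M0|M0] := leP 0 M; last first.
  have -> : C = set0.
    by apply/seteqP; split=> // x /bC h; have := nsq_ge0 x; lra.
  exact: compact0.
apply: (subclosed_compact cC (@compact_box (Num.sqrt M))) => x /bC h.
by apply: nsq_bound; [exact: sqrtr_ge0|rewrite sqr_sqrtr].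
Qed.

Lemma mk_test Om phi (C : set (R3 R)) M : smooth_on setT phi -> closed C -> C `<=` Om ->
  (forall x, C x -> nsq x <= M) -> (forall x, phi x != 0 -> C x) -> test_fun Om phi.
Proof.
move=> sphi cC CO bC pC.
have sC : supp phi `<=` C by rewrite (closure_id C).1//; exact: closureS.
split => //; last by move=> x /sC /CO.
apply: (@closed_bounded_compact3 _ M); first exact: closed_closure.
by move=> x /sC /bC.
Qed.

Lemma supp0 (phi : R3 R -> R) x : ~ supp phi x -> phi x = 0.
Proof.
move=> h; apply: contrapT => /eqP h'; apply: h; exact: subset_closure.
Qed.

Lemma supp_near (phi : R3 R -> R) x : ~ supp phi x -> \forall y \near x, phi y = 0.
Proof.
move=> h; have o : open (~` supp phi) by exact/closed_openC/closed_closure.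
have : nbhs x (~` supp phi) by exact: open_nbhs_nbhs.
by apply: filterS => y /supp0.
Qed.

Lemma partial_supp0 (phi : R3 R -> R) x j : ~ supp phi x -> partial j phi x = 0.
Proof.
move=> /supp_near h; rewrite /partial.
have := @near_is_derive R _ phi (cst 0) x (basis3 R j) 0 h (@is_derive_cst _ _ _ _ _ _).
by case.
Qed.

Lemma test_partial Om phi j : test_fun Om phi -> test_fun Om (partial j phi).
Proof.
move=> [s c sO].
have sub : supp (partial j phi) `<=` supp phi.
  rewrite (closure_id (supp phi)).1; last exact: closed_closure.
  apply: closureS => x /= /eqP h; apply: contrapT => h'; apply: h.
  exact: partial_supp0.
split; first exact: smooth_partial.
  by apply: subclosed_compact c sub; exact: closed_closure.
by move=> x /sub /sO.
Qed.

Lemma testM Om phi g : test_fun Om phi -> smooth_on setT g -> test_fun Om (fun x => g x * phi x).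
Proof.
move=> [s c sO] sg.
have sub : supp (fun x => g x * phi x) `<=` supp phi.
  apply: closureS => x /=; apply: contra_neq => ->; exact: mulr0.
split; first exact: smoothM openT sg s.
  by apply: subclosed_compact c sub; exact: closed_closure.
by move=> x /sub /sO.
Qed.

Lemma cont_bounded3 (K : set (R3 R)) (f : R3 R -> R) : compact K ->
  (forall x, {for x, continuous f}) -> exists C, 0 <= C /\ forall x, K x -> `|f x| <= C.
Proof.
move=> cK cf.
have : compact (f @` K) by apply: continuous_compact => //; apply: continuous_subspaceT => x; exact: cf.
move=> /compact_bounded [M [_ H]].
exists (`|M| + 1); split; first by have := normr_ge0 M; lra.
move=> x Kx; apply: (H (`|M| + 1)); first by have := ler_norm M; lra.
by exists x.
Qed.

Lemma test_bounded Om phi : test_fun Om phi -> exists C, 0 <= C /\ forall x, `|phi x| <= C.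
Proof.
move=> [s c sO].
have [C [C0 H]] := cont_bounded3 c (fun x => smooth_cont s I).
exists C; split=> // x; have [/H//|/supp0 ->] := pselect (supp phi x).
by rewrite normr0.
Qed.

Lemma test_out Om phi x : test_fun Om phi -> ~ Om x -> phi x = 0.
Proof. by move=> [_ _ sO] h; apply: supp0 => /sO. Qed.

Lemma smooth_meas phi : smooth_on setT phi -> measurable_fun setT (phi : T3 -> R).
Proof. by move=> s; apply: (cont_measurable3 openT) => x _; exact: (smooth_cont s). Qed.

Lemma compact_meas3 (K : set (R3 R)) : compact K -> measurable (K : set T3).
Proof. move=> c; apply: closed_measurable3; exact: compact_closed.
Qed.

Lemma intg_extend (K Om : set T3) (g : T3 -> R) : measurable K -> measurable Om -> K `<=` Om ->
  (forall x, Om x -> ~ K x -> g x = 0) -> intg leb3 K g -> intg leb3 Om g.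
Proof.
move=> mK mO KO g0 /(intg_mkcond _ _ mK) i; apply/(intg_mkcond _ _ mO).
apply: eq_intg i => // x _; rewrite !patchE.
case: ifPn => [/set_mem Kx|]; first by rewrite mem_set//; exact: KO.
rewrite notin_setE => nK; case: ifPn => // /set_mem Ox; exact/esym/g0.
Qed.

Lemma locint_test Om f phi : open Om -> locally_integrable3 Om f -> test_fun Om phi ->
  intg leb3 Om (fun x => f x * phi x).
Proof.
move=> oO [mf lf] t; have [s c sO] := t; have [C [C0 H]] := test_bounded t.
have mO := open_measurable3 oO; have mK := compact_meas3 c.
apply: (@intg_extend (supp phi) Om) => //.
  by move=> x _ /supp0 ->; rewrite mulr0.
have := @intgMl _ _ _ leb3 (supp phi) C phi f mK _ (fun x _ => H x) (lf _ c sO).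
move=> /(_ (measurable_funS measurableT (@subsetT _ _) (smooth_meas s))).
by apply: eq_intg => // x _; rewrite mulrC.
Qed.

Lemma smooth_E0 U f : open U -> smooth_on U f -> smooth_on U (fun x => E0 (f x)).
Proof.
by move=> oU s; exact: (@smooth_comp R U setT (@E_ R) f 0 oU (fun k y _ => E_derive k y) s (fun _ _ => I)).
Qed.

(** The successive derivatives of the inverse, in the form that [smooth_comp] takes. *)
Definition inv_fam (n : nat) (y : R) : R := (-1) ^+ n * (n`!)%:R / y ^+ n.+1.
Lemma inv_fam_derive k (y : R) : y != 0 -> is_derive y 1 (inv_fam k) (inv_fam k.+1 y).
Proof.
move=> y0.
have d1 : is_derive y 1 (fun t : R => t ^+ k.+1) (k.+1%:R * y ^+ k).
  have := is_derive_poly ('X^(k.+1) : {poly R}) y; rewrite derivXn hornerMn hornerXn mulr_natl.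
  by congr is_derive; apply/funext => t; rewrite hornerXn.
have d2 := @is_deriveV R (fun t : R => t ^+ k.+1) y _ 1 (expf_neq0 _ y0) d1.
have := is_deriveM (@is_derive_cst _ _ _ ((-1) ^+ k * (k`!)%:R : R) y 1) d2.
congr is_derive; rewrite !scalE mulr0 addr0 /inv_fam factS natrM exprS [y ^+ k.+2]exprS [y ^+ k.+1]exprS [(-1) ^+ k.+1]exprS.
have := expf_neq0 k y0 => yk; have cE (a : R) : cst a y = a by [].
rewrite cE.
by field; rewrite y0 yk.
Qed.

Lemma smooth_inv U f : open U -> smooth_on U f -> (forall x, U x -> f x != 0) ->
  smooth_on U (fun x => (f x)^-1).
Proof.
move=> oU s h.
have := @smooth_comp R U [set y | y != 0] inv_fam f 0 oU inv_fam_derive s h.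
by apply: smooth_ext => // x Ux; rewrite /inv_fam/= expr0 fact0 !mul1r expr1.
Qed.

Lemma smooth_step U f : open U -> smooth_on U f -> smooth_on U (fun x => step (f x)).
Proof.
move=> oU s; have s1 := smooth_E0 oU s.
have s2 := smoothD oU s1 (smooth_E0 oU (smoothB oU (smooth_cst 1 oU) s)).
have s3 := smooth_inv oU s2 (fun x _ => lt0r_neq0 (stepden_gt0 (f x))).
exact: smoothM oU s1 s3.
Qed.

Lemma smooth_E1 U f : open U -> smooth_on U f -> smooth_on U (fun x => E1 (f x)).
Proof.
by move=> oU s; exact: (@smooth_comp R U setT (@E_ R) f 1 oU (fun k y _ => E_derive k y) s (fun _ _ => I)).
Qed.

Lemma smooth_ray n a f : smooth_on setT f -> smooth_on setT (fun x => ray n a (f x)).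
Proof.
move=> s.
have st := smoothM openT (smooth_cst n%:R openT) (smoothB openT s (smooth_cst a openT)).
exact: smoothD openT (smooth_E0 openT st) (smoothM openT st (smooth_E1 openT st)).
Qed.

Lemma smooth_rayint n a f : smooth_on setT f -> smooth_on setT (fun x => rayint n a (f x)).
Proof.
move=> s; have sb := smoothB openT s (smooth_cst a openT).
have st := smoothM openT (smooth_cst n%:R openT) sb.
exact: smoothM openT sb (smooth_E0 openT st).
Qed.

(** Products of ray functions have no compact support, but their products with [zeta] do;
    [dbr_global] is applied to [h * zeta], which is integrable. *)
Lemma dbr_test Om h zeta : open Om -> locally_integrable3 Om h ->
  (forall phi, test_fun Om phi -> \int[leb3]_(x in Om) (h x * phi x) = 0) ->
  test_fun Om zeta -> {ae leb3, forall x, Om x -> h x * zeta x = 0}.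
Proof.
move=> oO lh H tz; have mO := open_measurable3 oO.
have i0 := locint_test oO lh tz.
have i1 := (intg_mkcond leb3 _ mO).1 i0.
have := dbr_global i1; move=> /(_ _)/wrap[].
  move=> n a m b l c.
  have [s1 s2 s3] := @smooth_coord R setT openT.
  have t1 := testM tz (smoothM openT (smoothM openT (smooth_ray n a s1) (smooth_ray m b s2)) (smooth_ray l c s3)).
  rewrite -[RHS](H _ t1) [RHS]Rintegral_mkcond; apply: eq_Rintegral => x _.
  by rewrite !patchE; case: ifP => _; [ring|rewrite mul0r].
by apply: ae_imp => x; rewrite patchE => h0 Ox; move: h0; rewrite mem_set.
Qed.

Lemma dbr_ball (r : R) h : 0 < r -> locally_integrable3 (Ball3 r) h ->
  (forall phi, test_fun (Ball3 r) phi -> \int[leb3]_(x in Ball3 r) (h x * phi x) = 0) ->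
  {ae leb3, forall x, Ball3 r x -> h x = 0}.
Proof.
move=> r0 lh H.
(* The test functions [zeta n] are positive exactly on the balls [nsq x < M n], which exhaust
   [Ball3 r]. *)
pose M (n : nat) : R := r ^+ 2 - n.+1%:R^-1.
pose zeta n x : R := E0 (M n - nsq x).
have tz n : test_fun (Ball3 r) (zeta n).
  apply: (@mk_test _ _ [set x | nsq x <= M n] (M n)) => //.
  - apply: smooth_E0 openT _; apply: smoothB openT (smooth_cst _ openT) (smooth_nsq openT).
  - exact: closed_nsq_le.
  - move=> x /= hx; apply/Ball3E => //; apply: le_lt_trans hx _.
    by rewrite /M ltrBlDr ltrDl invr_gt0 ltr0n.
  - move=> x; rewrite /zeta/=; apply: contra_neqP => /negP; rewrite -ltNge => hx.
    by rewrite E0_neg// subr_le0 ltW.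
have : {ae leb3, forall x, forall n, Ball3 r x -> h x * zeta n x = 0}.
  by apply/ae_foralln => n; have := dbr_test (@open_Ball3 r) lh H (tz n).
apply: ae_imp => x hx Bx.
have h2 : 0 < r ^+ 2 - nsq x by rewrite subr_gt0; exact/Ball3E.
have [n hn] : exists n : nat, n.+1%:R^-1 < r ^+ 2 - nsq x.
  have := @cvg_harmonic R => /cvgrPdist_lt /(_ _ h2) [n _ /(_ n (leqnn n))] /=.
  by rewrite sub0r normrN ger0_norm ?invr_ge0//; exists n.
have := hx n Bx => /eqP; rewrite mulf_eq0 => /orP[/eqP//|].
suff z0 : 0 < zeta n x by rewrite gt_eqF.
have -> : zeta n x = E0 (r ^+ 2 - n.+1%:R^-1 - nsq x) by [].
by apply: E0_gt0; move: hn; set c := n.+1%:R^-1; lra.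
Qed.

End Geometry.

(** * Local integrability of the inverse square of the distance to the origin *)

Section InverseSquare.
Variable R : realType.
Local Notation mR := (measurableTypeR R).
Local Notation lam := (@lebesgue_measure R).
Local Notation leb3 := (leb3 R).
Local Notation T3 := (mR * mR * mR)%type.
Implicit Types (x : R3 R).

Definition cube (s : R) : set (R3 R) :=
  ((`]-s, s[%classic : set R) `*` (`]-s, s[%classic : set R)) `*` (`]-s, s[%classic : set R).

Lemma cubeP s x : cube s x <-> boxed s x.
Proof.
rewrite /cube /boxed /= !in_itv/= !ltr_norml; split; first by move=> [[h1 h2] h3].
by move=> [h1 h2 h3].
Qed.

Lemma meas_cube s : measurable (cube s : set T3).
Proof.
apply: measurableX; last exact: measurable_itv.
by apply: measurableX; exact: measurable_itv.
Qed.

Lemma leb3_cube (s : R) : 0 < s -> leb3 (cube s) = ((2 * s) ^+ 3)%:E.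
Proof.
move=> s0; pose I : set mR := `]-s, s[%classic.
have mi : measurable I by exact: measurable_itv.
have li : lam I = (2 * s)%:E.
  rewrite lebesgue_measure_itv/= lte_fin ifT; last by lra.
  by rewrite -EFinD; congr EFin; lra.
transitivity ((prodS lam lam : set _ -> \bar R) (I `*` I) * lam I)%E.
  by apply: (@product_measure1E _ _ _ _ R (prodS lam lam) lam) => //; exact: measurableX.
have -> : ((prodS lam lam : set _ -> \bar R) (I `*` I) = lam I * lam I)%E.
  by apply: product_measure1E.
by rewrite li -!EFinM; congr EFin; ring.
Qed.

Lemma finite_intg_cst (A : set T3) (c : R) : measurable A -> (leb3 A < +oo)%E ->
  intg leb3 A (fun=> c).
Proof.
move=> mA hA; apply/integrableP; split; first exact/measurable_EFinP.
by rewrite integral_cst// lte_mul_pinfty.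
Qed.

Lemma meas_inv_nsq : measurable_fun setT ((fun x => (nsq x)^-1) : T3 -> R).
Proof.
have m : measurable_fun setT (@nsq R : T3 -> R) by exact: smooth_meas (smooth_nsq openT).
apply: (measurable_funS measurableT (@subsetT _ [set: T3])).
have -> : (fun x : R3 R => (nsq x)^-1) = (fun x : R3 R => nsq x `^ (-1)).
  by apply/funext => x; rewrite powR_inv1 ?nsq_ge0.
exact: (measurableT_comp (measurable_powR _) m).
Qed.

(** Dyadic decomposition: a point of [cube (a n)] outside [cube (a n.+1)] has
    [nsq x >= a n.+1 ^+ 2], so the series of the [g n] dominates the integrand. The integral of
    [g n] is [64 * s / 2 ^ (n + 1)], a summable sequence. *)
Lemma inv_nsq_intg_cube (s : R) : 0 < s -> intg leb3 (cube s) (fun x => (nsq x)^-1).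
Proof.
move=> s0.
pose a n : R := s / 2 ^+ n.
have a0 n : 0 < a n by rewrite divr_gt0// exprn_gt0.
pose g n (x : R3 R) : \bar R := ((a n.+1) ^- 2 * \1_(cube (a n)) x)%:E.
have g0 n x : (0 <= g n x)%E by rewrite lee_fin mulr_ge0// invr_ge0 exprn_ge0// ltW.
have mg n : measurable_fun setT (g n : T3 -> \bar R).
  apply: (measurableT_comp (@EFin_measurable R setT)); apply: measurable_funM => //.
  by apply: measurable_indic; exact: meas_cube.
have me : measurable_fun setT ((fun x => ((nsq x)^-1)%:E) : T3 -> \bar R).
  exact: (measurableT_comp (@EFin_measurable R setT) meas_inv_nsq).
have mc := meas_cube s.
apply/integrableP; split; first exact: measurable_funTS me.
apply: (@le_lt_trans _ _ (\int[leb3]_x (\sum_(0 <= n <oo) g n x))%E).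
  apply: (@le_trans _ _ (\int[leb3]_(x in cube s) (\sum_(0 <= n <oo) g n x))%E); last first.
    apply: ge0_subset_integral => //.
    - by apply: ge0_emeasurable_sum.
    - by move=> x _; exact: nneseries_ge0.
  rewrite [leLHS](_ : _ = (\int[leb3]_(x in cube s) ((nsq x)^-1)%:E)%E); last first.
    by apply: eq_integral => x _; rewrite /= ger0_norm// invr_ge0 nsq_ge0.
  apply: ge0_le_integral => //.
  - by move=> x _; rewrite lee_fin invr_ge0 nsq_ge0.
  - exact: measurable_funTS me.
  - by apply: measurable_funTS; apply: ge0_emeasurable_sum.
  - move=> x cx.
    have [x0|x0] := eqVneq (nsq x) 0.
      by rewrite x0 invr0; exact: nneseries_ge0.
    have xp : 0 < nsq x by rewrite lt0r x0 nsq_ge0.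
    have ex : exists n, ~~ `[< cube (a n) x >].
      have : (fun n => (a n) ^+ 2 * 3) @ \oo --> (0 ^+ 2 * 3 : R).
        apply: cvgM; last exact: cvg_cst.
        have ca : a @ \oo --> (0 : R).
          rewrite -[X in _ --> X](mulr0 s); apply: cvgM; first exact: cvg_cst.
          under eq_fun do rewrite -exprVn.
          by apply: cvg_expr; rewrite ger0_norm ?invr_ge0// invf_lt1// ltr1n.
        by rewrite expr2; under eq_fun do rewrite expr2; exact: cvgM.
      rewrite expr2 !mul0r => /cvgrPdist_lt/(_ _ xp)[n _ /(_ n (leqnn n))] /=.
      have h4 : 0 <= a n ^+ 2 * 3 by rewrite mulr_ge0// sqr_ge0.
      rewrite sub0r normrN ger0_norm// => hn; exists n.
      apply/asboolPn => /cubeP[h1 h2 h3].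
      have : nsq x <= a n ^+ 2 * 3.
        rewrite /nsq; move: (normr_ge0 x.1.1) (normr_ge0 x.1.2) (normr_ge0 x.2).
        rewrite -(real_normK (num_real x.1.1)) -(real_normK (num_real x.1.2)) -(real_normK (num_real x.2)).
        move: h1 h2 h3 (a0 n); nra.
      lra.
    have [n hn min] := ex_minnP ex.
    case: n hn min => [|n] hn min.
      by move: hn; rewrite /a expr0 divr1 => /asboolP; case.
    have hin : cube (a n) x.
      by apply: contrapT => h; have := min n; rewrite ltnn => /(_ (introN (asboolP _) h)).
    apply: (@le_trans _ _ (g n x)); last first.
      have := @nneseries_split _ (fun k => g k x) 0 n.+1.
      move=> ->; last by move=> k _; exact: g0.
      rewrite add0n big_nat_recr//= -[leLHS]add0e -addeA leeD//.
        by apply: sume_ge0 => k _; exact: g0.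
      by rewrite leeDl// nneseries_ge0.
    rewrite /g indicE mem_set// mulr1 /= lee_fin.
    rewrite lef_pV2 ?posrE ?exprn_gt0//.
    move/asboolPn: hn => hn; rewrite leNgt; apply/negP => lt; apply: hn; apply/cubeP.
    have H (y : R) : y ^+ 2 <= nsq x -> `|y| < a n.+1.
      move=> hy; have : `|y| ^+ 2 < a n.+1 ^+ 2 by rewrite real_normK ?num_real//; lra.
      by rewrite ltr_pXn2r// ?nnegrE// ltW.
    have := sqr_ge0 x.1.1; have := sqr_ge0 x.1.2; have := sqr_ge0 x.2 => *.
    by split; apply: H; rewrite /nsq; lra.
rewrite integral_nneseries//.
have -> : (\sum_(0 <= n <oo) \int[leb3]_x g n x)%E = (\sum_(0 <= n <oo) ((64 * s) / (2 ^ (n + 1))%:R)%:E)%E.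
  apply: eq_eseriesr => n _; rewrite /g.
  under eq_integral do rewrite EFinM.
  rewrite ge0_integralZl_EFin//.
  - rewrite integral_indic//; last exact: meas_cube.
    rewrite setIT leb3_cube// -EFinM; congr EFin.
    rewrite /a natrX addn1 !exprS; have : (2 : R) ^+ n != 0 by rewrite expf_neq0.
    by move: s0 => /gt_eqF/negbT s0 h; field; rewrite h s0.
  - apply: (measurableT_comp (@EFin_measurable R setT)); apply: measurable_indic; exact: meas_cube.
  - by rewrite invr_ge0 exprn_ge0// ltW.
have := @cvg_geometric_eseries_half R (64 * s) 0 => /(cvg_lim (@ereal_hausdorff R)).
by move=> ->; rewrite ltry.
Qed.

Lemma inv_nsq_intg (r : R) : intg leb3 (Ball3 r) (fun x => (nsq x)^-1).
Proof.
pose s := `|r| + 1; have s0 : 0 < s by have := normr_ge0 r; rewrite /s; lra.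
apply: (intg_sub (meas_cube s) (meas_Ball3 r) _ (inv_nsq_intg_cube s0)).
move=> x hx; apply/cubeP.
have : nsq x <= `|r| ^+ 2.
  rewrite -nsqE ler_pXn2r ?nnegrE ?norm3_ge0//.
  by apply: le_trans (ltW hx) _; exact: ler_norm.
move=> /(nsq_bound (normr_ge0 r)) [h1 h2 h3].
by rewrite /boxed /s; split; lra.
Qed.

Lemma Ball3_finite (r : R) : (leb3 (Ball3 r) < +oo)%E.
Proof.
pose s := `|r| + 1; have s0 : 0 < s by have := normr_ge0 r; rewrite /s; lra.
apply: (@le_lt_trans _ _ (leb3 (cube s))); last by rewrite leb3_cube// ltry.
apply: le_measure; rewrite ?inE; [exact: meas_Ball3|exact: meas_cube|].
move=> x hx; apply/cubeP.
have : nsq x <= `|r| ^+ 2.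
  rewrite -nsqE ler_pXn2r ?nnegrE ?norm3_ge0//.
  by apply: le_trans (ltW hx) _; exact: ler_norm.
move=> /(nsq_bound (normr_ge0 r)) [h1 h2 h3].
by rewrite /boxed /s; split; lra.
Qed.

Lemma Ball3_intg_cst (r c : R) : intg leb3 (Ball3 r) (fun=> c).
Proof. by apply: finite_intg_cst; [exact: meas_Ball3|exact: Ball3_finite]. Qed.

End InverseSquare.

(** * Weak gradients and the energy *)

Section WeakDerivatives.
Variable R : realType.
Local Notation mR := (measurableTypeR R).
Local Notation leb3 := (leb3 R).
Local Notation T3 := (mR * mR * mR)%type.
Implicit Types (x : R3 R) (i : 'I_5) (j : 'I_3) (f g h : R3 R -> R) (r : R).

Lemma intg_locint Om f : open Om -> intg leb3 Om f -> locally_integrable3 Om f.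
Proof.
move=> oO h; split; first exact: (intg_meas h).
move=> K cK KO; apply: (intg_sub (open_measurable3 oO) (compact_meas3 cK) KO h).
Qed.

Lemma locintB Om f g : locally_integrable3 Om f -> locally_integrable3 Om g ->
  locally_integrable3 Om (fun x => f x - g x).
Proof.
move=> [mf lf] [mg lg]; split.
  exact: (@measurable_funB _ T3 R Om f g mf mg).
move=> K cK KO; have mK := compact_meas3 cK.
exact: (intgB mK (lf K cK KO) (lg K cK KO)).
Qed.

Lemma weak_partial_unique r j f g h : 0 < r -> is_weak_partial (Ball3 r) j f g ->
  is_weak_partial (Ball3 r) j f h -> {ae leb3, forall x, Ball3 r x -> g x = h x}.
Proof.
move=> r0 [_ lg Hg] [_ lh Hh]; have oB := @open_Ball3 R r; have mB := meas_Ball3 r.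
have := dbr_ball r0 (locintB lg lh); move=> /(_ _)/wrap[].
  move=> phi t.
  transitivity (\int[leb3]_(x in Ball3 r) (g x * phi x - h x * phi x)).
    by apply: eq_Rintegral => x _; rewrite mulrBl.
  rewrite RintegralB//; [|exact: locint_test oB lg t|exact: locint_test oB lh t].
  by apply/eqP; rewrite subr_eq0 -eqr_opp -Hg// -Hh.
by apply: ae_imp => x h0 Bx; apply/eqP; rewrite -subr_eq0 h0.
Qed.

Lemma sqr_intg_intg r f : measurable_fun (Ball3 r : set T3) f ->
  intg leb3 (Ball3 r) (fun x => f x ^+ 2) -> intg leb3 (Ball3 r) f.
Proof.
move=> mf h; have mB := meas_Ball3 r.
apply: (intg_le mB mf (intgD mB (Ball3_intg_cst r 1) h)) => x _.
rewrite -[f x ^+ 2](real_normK (num_real _)).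
have := sqr_ge0 (`|f x| - 2^-1); have := normr_ge0 (f x); nra.
Qed.

(** The energy is defined with a chosen weak gradient. Once some weak gradient exists the choice is
    one as well, and by uniqueness it differs from [g] on a null set only. *)
Lemma energy_weak r (w : R3 R -> RCC R) (g : 'I_5 -> 'I_3 -> R3 R -> R) : 0 < r ->
  (forall i j, is_weak_partial (Ball3 r) j (comp5 i w) (g i j)) ->
  (forall i j, square_integrable (Ball3 r) (g i j)) ->
  intg leb3 (Ball3 r) (fun x => \sum_(i < 5) \sum_(j < 3) g i j x ^+ 2) /\
  energy w r = (2^-1 * \int[leb3]_(x in Ball3 r) (\sum_(i < 5) \sum_(j < 3) g i j x ^+ 2))%:E.
Proof.
move=> r0 Hw Hg; have mB := meas_Ball3 r.
have ig : intg leb3 (Ball3 r) (fun x => \sum_(i < 5) \sum_(j < 3) g i j x ^+ 2).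
  by apply: intg_sum => // i; apply: intg_sum => // j; case: (Hg i j).
split=> //.
have wk i j : is_weak_partial (Ball3 r) j (comp5 i w) (weak_partial (Ball3 r) j (comp5 i w)).
  by apply: (@xgetI _ (fun=> 0) [set g | is_weak_partial (Ball3 r) j (comp5 i w) g] (g i j)); exact: Hw.
have ae1 : {ae leb3, forall x, forall i j, Ball3 r x -> g i j x = weak_partial (Ball3 r) j (comp5 i w) x}.
  have h i j := weak_partial_unique r0 (Hw i j) (wk i j).
  (* Countable unions of null sets are indexed by [nat], hence the detour through the values of the
     finite indices. *)
  have : {ae leb3, forall x, forall n m : nat, forall i j, val i = n -> val j = m -> Ball3 r x ->
     g i j x = weak_partial (Ball3 r) j (comp5 i w) x}.
    apply/ae_foralln => n; apply/ae_foralln => m.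
    have [n5|n5] := ltnP n 5; last first.
      by apply: aeW => x i j e _; have := ltn_ord i; rewrite -[X in (X < _)%N]/(val i) e ltnNge n5.
    have [m3|m3] := ltnP m 3; last first.
      by apply: aeW => x i j _ e; have := ltn_ord j; rewrite -[X in (X < _)%N]/(val j) e ltnNge m3.
    apply: ae_imp (h (Ordinal n5) (Ordinal m3)) => x hx i j ei ej.
    have -> : i = Ordinal n5 by exact: val_inj.
    have -> : j = Ordinal m3 by exact: val_inj.
    by [].
  by apply: ae_imp => x hx i j; exact: (hx (val i) (val j)).
rewrite /energy EFinM; congr (_ * _)%E.
have mw i j : measurable_fun (Ball3 r : set T3) (weak_partial (Ball3 r) j (comp5 i w)).
  by have [_ [m _] _] := wk i j; exact: m.
have ms : measurable_fun (Ball3 r : set T3) (fun x => \sum_(i < 5) \sum_(j < 3) weak_partial (Ball3 r) j (comp5 i w) x ^+ 2).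
  by apply: measurable_sum => i; apply: measurable_sum => j; apply: measurable_funX.
rewrite /Rintegral fineK; last exact: integrable_fin_num.
apply: ae_eq_integral => //.
- exact/measurable_EFinP.
- by apply/measurable_EFinP; exact: (intg_meas ig).
- apply: ae_imp ae1 => x hx Bx; congr EFin.
  by apply: eq_bigr => i _; apply: eq_bigr => j _; rewrite hx.
Qed.

Definition c1off f := forall x, offaxis x -> {for x, continuous f} /\
  forall j, derivable f x (basis3 R j) /\ {for x, continuous (partial j f)}.

(** The value 0 on the axis makes this measurable on the whole space, whatever [f] does there. *)
Definition pd j f x : R := if rho2 x != 0 then partial j f x else 0.

Lemma pdE j f x : offaxis x -> pd j f x = partial j f x.
Proof. by rewrite /pd => ->. Qed.

Lemma meas_off f : (forall x, offaxis x -> {for x, continuous f}) ->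
  (forall x, ~ offaxis x -> f x = 0) -> measurable_fun setT (f : T3 -> R).
Proof.
move=> cf f0; have mo := open_measurable3 (@open_offaxis R).
have m1 : measurable_fun (@offaxis R : set T3) (f : T3 -> R) by exact: cont_measurable3 (@open_offaxis R) cf.
have -> : (f : T3 -> R) = f \_ (@offaxis R).
  by apply/funext => x; rewrite patchE; case: ifPn => //; rewrite notin_setE => /f0.
by apply/(measurable_restrictT (f : T3 -> R) mo).
Qed.

Lemma meas_pd j f : c1off f -> measurable_fun setT (pd j f : T3 -> R).
Proof.
move=> cf; apply: meas_off; last by rewrite /pd => x /negP/negbTE ->.
move=> x ox; have [_ /(_ j) [_ c]] := cf x ox.
rewrite /prop_for /continuous_at pdE//; apply: cvg_trans c.
apply: near_eq_cvg.
apply: (eq_on_near (@open_offaxis R)) => // y oy; by rewrite pdE.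
Qed.

Lemma bounded_locint Om f (C : R) : open Om -> measurable_fun (Om : set T3) f ->
  (forall x, `|f x| <= C) -> locally_integrable3 Om f.
Proof.
move=> oO mf bf; split; first exact: mf.
move=> K cK KO; have mK := compact_meas3 cK.
have [M hM] : exists M, forall x, K x -> nsq x <= M.
  have [M [_ H]] := cont_bounded3 cK (@nsq_cont R).
  by exists M => x /H; apply: le_trans; exact: ler_norm.
have K1 : K `<=` Ball3 (Num.sqrt (`|M| + 1)).
  have M0 := normr_ge0 M; have M1 := ler_norm M.
  move=> x /hM h; apply/Ball3E; first by rewrite sqrtr_gt0; lra.
  by rewrite sqr_sqrtr; lra.
have ic := intg_sub (meas_Ball3 _) mK K1 (Ball3_intg_cst _ C).
apply: (intg_le mK _ ic) => //.
exact: measurable_funS (open_measurable3 oO) KO mf.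
Qed.

(** Almost every line parallel to a coordinate direction misses the axis, so a bounded function with
    integrable classical gradient off the axis has that gradient as its weak one. *)
Lemma weak_partial_c1off r j f (C : R) : 0 < r -> measurable_fun setT (f : T3 -> R) ->
  (forall x, `|f x| <= C) -> c1off f -> intg leb3 (Ball3 r) (pd j f) ->
  is_weak_partial (Ball3 r) j f (pd j f).
Proof.
move=> r0 mf bf cf ip; have oB := @open_Ball3 R r; have mB := meas_Ball3 r.
have lf : locally_integrable3 (Ball3 r) f.
  by apply: bounded_locint bf => //; exact: measurable_funTS.
have lp := intg_locint oB ip.
split=> // phi t; have tp := test_partial j t.
have i1 := locint_test oB lp t; have i2 := locint_test oB lf tp.
have [s _ _] := t.
have i3 := intgD mB i1 i2.
have H : \int[leb3]_x (pd j f x * phi x + f x * partial j phi x) = 0.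
  apply: (@line_ibp R j (fun x => f x * phi x) _ r) => //.
  - move=> x ox; have [_ /(_ j) [/derivableP d _]] := cf x ox.
    have := is_deriveM d (smooth_derivable j s I).
    by congr is_derive; rewrite pdE// !scalE addrC mulrC [partial j f x * _]mulrC.
  - move=> x ox; have [c /(_ j) [_ cp]] := cf x ox.
    apply: cont3D; rewrite /prop_for; apply: cont3M => //.
    + rewrite /prop_for /continuous_at pdE//; apply: cvg_trans cp; apply: near_eq_cvg.
      by apply: (eq_on_near (@open_offaxis R)) => // y oy; rewrite pdE.
    + exact: smooth_cont s I.
    + exact: smooth_cont (smooth_partial j s) I.
  - move=> x nb; rewrite (test_out t) ?mulr0// => /Ball3E -/(_ r0) hx; apply: nb.
    have := sqr_ge0 x.1.1; have := sqr_ge0 x.1.2; have := sqr_ge0 x.2 => *.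
    have H (y : R) : y ^+ 2 <= nsq x -> `|y| < r.
      move=> hy; have : `|y| ^+ 2 < r ^+ 2 by rewrite real_normK ?num_real//; lra.
      by rewrite ltr_pXn2r// ?nnegrE// ltW.
    by split; apply: H; rewrite /nsq; lra.
  - apply: (intg_extend mB measurableT) i3 => // x _ nB.
    by rewrite (test_out t)// (test_out tp)// !mulr0 addr0.
have E (q : R3 R -> R) : (forall x, ~ Ball3 r x -> q x = 0) ->
    \int[leb3]_(x in Ball3 r) q x = \int[leb3]_x q x.
  move=> q0; rewrite Rintegral_mkcond; apply: eq_Rintegral => x _.
  by rewrite patchE; case: ifPn => //; rewrite notin_setE => /q0.
have : \int[leb3]_(x in Ball3 r) (pd j f x * phi x + f x * partial j phi x) = 0.
  rewrite E// => x nB; by rewrite (test_out t)// (test_out tp)// !mulr0 addr0.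
by rewrite RintegralD// => /eqP; rewrite addr_eq0 => /eqP ->; rewrite opprK.
Qed.

(** The tangent maps and all competitors constructed from them are of this kind; their energy is the
    integral of the classical [density]. *)
Definition nice r (w : R3 R -> RCC R) := forall i,
  [/\ measurable_fun setT (comp5 i w : T3 -> R), exists C, forall x, `|comp5 i w x| <= C,
      c1off (comp5 i w) &
      forall j, intg leb3 (Ball3 r) (fun x => pd j (comp5 i w) x ^+ 2)].

Definition density (w : R3 R -> RCC R) x : R := \sum_(i < 5) \sum_(j < 3) pd j (comp5 i w) x ^+ 2.

Lemma nice_weak r w i j : 0 < r -> nice r w ->
  is_weak_partial (Ball3 r) j (comp5 i w) (pd j (comp5 i w)) /\
  square_integrable (Ball3 r) (pd j (comp5 i w)).
Proof.
move=> r0 /(_ i) [mw [C bw] cw iw].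
have mp := measurable_funTS (meas_pd j cw).
split; last by split; [exact: mp|exact: iw].
apply: (weak_partial_c1off r0 mw bw cw).
by apply: sqr_intg_intg => //; exact: mp.
Qed.

Lemma energy_nice r w : 0 < r -> nice r w -> intg leb3 (Ball3 r) (density w) /\
  energy w r = (2^-1 * \int[leb3]_(x in Ball3 r) density w x)%:E.
Proof.
by move=> r0 nw; apply: energy_weak => // i j; case: (nice_weak i j r0 nw).
Qed.

Lemma W12_nice r w : 0 < r -> nice r w -> {ae leb3, forall x, Ball3 r x -> Sphere4 (w x)} ->
  W12_S4 (Ball3 r) w.
Proof.
move=> r0 nw sw; split=> //.
- move=> i; have [mw [C bw] cw iw] := nw i.
  split; first exact: measurable_funTS mw.
  apply: (intg_le (meas_Ball3 r) _ (Ball3_intg_cst r (C ^+ 2))).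
    by apply: measurable_funX; exact: measurable_funTS mw.
  move=> x _; rewrite normrX ler_pXn2r// nnegrE; apply: le_trans (bw x) => //.
- move=> i j; exists (pd j (comp5 i w)); by have [] := nice_weak i j r0 nw.
Qed.

End WeakDerivatives.

(** * Integration by parts for primitives of integrable functions *)

Section AbsolutelyContinuous.
Variable R : realType.
Local Notation mR := (measurableTypeR R).
Local Notation lam := (@lebesgue_measure R).

Lemma cont_bounded_itv (P : R -> R) (B : R) : continuous P ->
  exists C, 0 <= C /\ forall y, `|y| <= B -> `|P y| <= C.
Proof.
move=> cP; have : compact (P @` `[- B, B]).
  by apply: continuous_compact; [apply: continuous_subspaceT|exact: segment_compact].
move=> /compact_bounded [M [_ H]].
exists (`|M| + 1); split; first by have := normr_ge0 M; lra.
move=> y yB; apply: (H (`|M| + 1)); first by have := ler_norm M; lra.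
by exists y => //; rewrite /= in_itv/= -ler_norml.
Qed.

Variables (M : R) (k P p Ga ga : R -> R).
Hypotheses (M0 : 0 < M)
  (ik : intg lam (`[- M, M]%classic : set R) k)
  (dP : forall y : R, is_derive y 1 P (p y)) (cp : continuous p)
  (dG : forall y : R, is_derive y 1 Ga (ga y)) (cg : continuous ga)
  (GM : Ga M = 0) (PG : P 0 * Ga (- M) = 0).

Let D : set mR := `[- M, M]%classic.
Let prim (k : R -> R) (z : R) : R := \int[lam]_(s in (`[- M, z]%classic : set R)) k s.

Lemma prim_diff (h l : R -> R) z : intg lam D h -> intg lam D l -> D z ->
  `|prim h z - prim l z| <= \int[lam]_(s in D) `|h s - l s|.
Proof.
move=> ih il; rewrite /D /= in_itv/= => /andP[z1 z2].
have mD : measurable D by exact: measurable_itv.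
have mz : measurable (`[- M, z]%classic : set mR) by exact: measurable_itv.
have sub : (`[- M, z]%classic : set R) `<=` D.
  by move=> s /=; rewrite /D/= !in_itv/= => /andP[-> h1]; exact: le_trans h1 z2.
have ih' := intg_sub mD mz sub ih; have il' := intg_sub mD mz sub il.
rewrite /prim -RintegralB//.
apply: le_trans (le_normr_Rintegral _ _) _ => //; first exact: intgB.
have ia := intg_abs mD (intgB mD ih il).
apply: fine_le.
- by apply: integrable_fin_num => //; exact: (intg_sub mD mz sub ia).
- exact: integrable_fin_num.
- apply: ge0_subset_integral => //.
  + by have /integrableP[] := ia.
Qed.

Lemma ibp_smooth (h : R -> R) : continuous h -> intg lam D h ->
  \int[lam]_(z in D) (P (prim h z) * ga z) = - \int[lam]_(z in D) (p (prim h z) * h z * Ga z).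
Proof.
move=> ch ih.
have MM : - M < M by rewrite gtrN.
have dp z : z \in `]- M, M[ -> is_derive z 1 (prim h) (h z).
  rewrite in_itv/= => /andP[z1 z2].
  have [d1 d2] := @continuous_FTC1 R h (BLeft (- M)) z M z2 ih z1 (ch z).
  by apply: (DeriveDef d1); rewrite -derive1E d2.
have cpr := @parameterized_integral_continuous R (- M) M h (ltW MM) ih.
have p0 : prim h (- M) = 0.
  by rewrite /prim set_itv1 Rintegral_set1.
have dPp z : z \in `]- M, M[ -> is_derive z 1 (P \o prim h) (p (prim h z) * h z).
  by move=> zM; apply: is_derive_comp1 (dp z zM) (dP _).
have cP : continuous P by move=> y; exact: (is_derive1_cont (dP y)).
have cw : {within `[- M, M], continuous prim h} by exact: cpr.
have := @Rintegration_by_parts R (P \o prim h) Ga (fun z => p (prim h z) * h z) ga (- M) M MM.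
rewrite /= p0 GM PG mulr0 subrr sub0r; apply.
- have ch' : {within `[- M, M], continuous h} by exact: continuous_subspaceT.
  move=> z; apply: cvgM; last exact: ch'.
  by apply: continuous_comp; [exact: cw|exact: cp].
- split.
  + by move=> z zM; case: (dPp z zM).
  + have := @parameterized_integral_cvg_left R (- M) M h MM ih => c.
    apply: (@cvg_comp _ _ _ (prim h) P _ (nbhs (prim h (- M)))); last exact: cP.
    by rewrite p0; apply: cvg_at_right_filter.
  + have := @parameterized_integral_cvg_at_left R (- M) M h MM ih => c.
    by apply: (@cvg_comp _ _ _ (prim h) P _ (nbhs (prim h M))); last exact: cP.
- by move=> z zM; rewrite derive1E; case: (dPp z zM).
- exact: continuous_subspaceT.
- have cG : continuous Ga by move=> y; exact: (is_derive1_cont (dG y)).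
  split; first by move=> z _; case: (dG z).
  + by apply: cvg_at_right_filter; exact: cG.
  + by apply: cvg_at_left_filter; exact: cG.
- by move=> z _; rewrite derive1E; case: (dG z).
Qed.

(** The primitive of an integrable [k] need not be differentiable everywhere. Continuous functions
    approximate [k] in L^1, their primitives converge uniformly by [prim_diff], and both sides of
    [ibp_smooth] pass to the limit. *)
Lemma ac_ibp : \int[lam]_(z in D) (P (prim k z) * ga z) = - \int[lam]_(z in D) (p (prim k z) * k z * Ga z).
Proof.
have MM : - M <= M by rewrite ge0_cp ?ltW.
have mD : measurable D by exact: measurable_itv.
have lD : (lam D < +oo)%E by rewrite /D lebesgue_measure_itv/=; case: ifP => _; rewrite ltry.
have [h_ [ch ih hk]] := approximation_continuous_integrable mD lD ik.
have cP : continuous P by move=> y; exact: (is_derive1_cont (dP y)).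
have cG : continuous Ga by move=> y; exact: (is_derive1_cont (dG y)).
pose de n : R := \int[lam]_(z in D) `|k z - h_ n z|.
have ide n : intg lam D (fun z => `|k z - h_ n z|) by apply: intg_abs => //; exact: (intgB mD ik (ih n)).
have cde : de @ \oo --> (0 : R).
  rewrite /de /Rintegral; apply: fine_cvg => /=.
  by move: hk; congr (_ @ _ --> _).
(* Dropping the first [N] terms keeps all the primitives within [A + 1] of 0, where [P] and [p] are
   bounded by common constants. *)
have [N _ HN] : \forall n \near \oo, de n < 1.
  have /cvgrPdist_lt/(_ 1 ltr01) := cde; apply: filterS => n /=.
  by rewrite sub0r normrN; apply: le_lt_trans; exact: ler_norm.
pose g_ n := h_ (n + N)%N.
have ig n : intg lam D (g_ n) by exact: ih.
have den n : de (n + N)%N < 1 by apply: HN => /=; exact: leq_addl.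
have cden : (fun n => de (n + N)%N) @ \oo --> (0 : R) by move: cde; rewrite -(cvg_shiftn N).
pose A := \int[lam]_(z in D) `|k z|.
have bk z : D z -> `|prim k z| <= A.
  move=> Dz; have := prim_diff ik (intg0 _ _) Dz.
  rewrite {2}/prim Rintegral_cst ?mul0r ?subr0; last exact: measurable_itv.
  by under [X in _ <= X -> _]eq_Rintegral do rewrite subr0.
have pd n z : D z -> `|prim k z - prim (g_ n) z| <= de (n + N)%N by move=> Dz; exact: prim_diff.
have bg n z : D z -> `|prim (g_ n) z| <= A + 1.
  move=> Dz; have := pd n z Dz; have := bk z Dz; have := den n.
  have := ler_norm (prim k z - prim (g_ n) z); have := ler_norm (- (prim k z - prim (g_ n) z)).
  rewrite normrN => *; rewrite ler_norml.
  apply/andP; move: (ler_norm (prim k z)) (ler_norm (- prim k z)); rewrite normrN; lra.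
have A0 : 0 <= A by apply: Rintegral_ge0.
have bk' z : D z -> `|prim k z| <= A + 1 by move=> /bk; lra.
have [C1 [C10 HP]] := cont_bounded_itv (A + 1) cP.
have [C2 [C20 Hp]] := cont_bounded_itv (A + 1) cp.
have [C3 [C30 HG]] := cont_bounded_itv M cG.
have [C4 [C40 Hg]] := cont_bounded_itv M cg.
have Dn z : D z -> `|z| <= M by rewrite /D/= in_itv/= -ler_norml.
have mpr h : intg lam D h -> measurable_fun D (prim h : mR -> R).
  move=> ihh; apply: subspace_continuous_measurable_fun => //.
  exact: (@parameterized_integral_continuous R (- M) M h MM ihh).
have mc (q : R -> R) (E : set mR) : continuous q -> measurable_fun E (q : mR -> R).
  by move=> cq; apply: measurable_funTS; exact: continuous_measurable_fun.
have mcp (q : R -> R) h : continuous q -> intg lam D h -> measurable_fun D ((q \o prim h) : mR -> R).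
  by move=> cq ihh; apply: (measurableT_comp (mc q setT cq) (mpr h ihh)).
have icst c : intg lam D (fun=> c).
  apply/integrableP; split; first exact/measurable_EFinP.
  by rewrite integral_cst// lte_mul_pinfty.
have cpn z : D z -> (fun n => prim (g_ n) z) @ \oo --> prim k z.
  move=> Dz; apply/cvgrPdist_le => e e0.
  have /cvgrPdist_le/(_ e e0) := cden; apply: filterS => n /=.
  rewrite sub0r normrN => h; apply: le_trans (pd n z Dz) _.
  by apply: le_trans h; exact: ler_norm.
have L1 : (fun n => \int[lam]_(z in D) (P (prim (g_ n) z) * ga z)) @ \oo -->
    \int[lam]_(z in D) (P (prim k z) * ga z).
  apply: (@Rint_dct _ _ _ lam D _ _ (fun=> C1 * C4)) => //.
  - by move=> n; apply: measurable_funM; [exact: mcp|exact: mc].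
  - by apply: measurable_funM; [exact: mcp|exact: mc].
  - apply: aeW => z Dz; apply: cvgM; last exact: cvg_cst.
    by apply: continuous_cvg; [exact: cP|exact: cpn].
  - apply: aeW => z n Dz; rewrite normrM ler_pM//; first exact/HP/bg.
    exact/Hg/Dn.
have i1 n : intg lam D (fun z => p (prim (g_ n) z) * Ga z * (g_ n z - k z)).
  apply: (@intgMl _ _ _ lam D (C2 * C3)) => //.
  - by apply: measurable_funM; [exact: mcp|exact: mc].
  - by move=> z Dz; rewrite normrM ler_pM//; [exact/Hp/bg|exact/HG/Dn].
  - exact: intgB.
have i2 n : intg lam D (fun z => p (prim (g_ n) z) * Ga z * k z).
  apply: (@intgMl _ _ _ lam D (C2 * C3)) => //.
  - by apply: measurable_funM; [exact: mcp|exact: mc].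
  - by move=> z Dz; rewrite normrM ler_pM//; [exact/Hp/bg|exact/HG/Dn].
have E2 n : \int[lam]_(z in D) (p (prim (g_ n) z) * g_ n z * Ga z) =
    \int[lam]_(z in D) (p (prim (g_ n) z) * Ga z * (g_ n z - k z)) +
    \int[lam]_(z in D) (p (prim (g_ n) z) * Ga z * k z).
  by rewrite -(RintegralD mD (i1 n) (i2 n)); apply: eq_Rintegral => z _; ring.
have L2 : (fun n => \int[lam]_(z in D) (p (prim (g_ n) z) * Ga z * k z)) @ \oo -->
    \int[lam]_(z in D) (p (prim k z) * Ga z * k z).
  apply: (@Rint_dct _ _ _ lam D _ _ (fun z => C2 * C3 * `|k z|)) => //.
  - by move=> n; exact: (intg_meas (i2 n)).
  - apply: measurable_funM; last exact: (intg_meas ik).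
    by apply: measurable_funM; [exact: mcp|exact: mc].
  - apply: aeW => z Dz; apply: cvgM; last exact: cvg_cst.
    apply: cvgM; last exact: cvg_cst.
    by apply: continuous_cvg; [exact: cp|exact: cpn].
  - exact/intgZ/intg_abs.
  - apply: aeW => z n Dz; rewrite !normrM ler_wpM2r// ler_pM//; first exact/Hp/bg.
    exact/HG/Dn.
have L3 : (fun n => \int[lam]_(z in D) (p (prim (g_ n) z) * Ga z * (g_ n z - k z))) @ \oo --> (0 : R).
  apply/cvgrPdist_le => e e0.
  have c2 : (fun n => C2 * C3 * de (n + N)%N) @ \oo --> (0 : R).
    by rewrite -[X in _ --> X](mulr0 (C2 * C3)); apply: cvgM => //; exact: cvg_cst.
  have /cvgrPdist_le/(_ e e0) := c2; apply: filterS => n /=.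
  rewrite !sub0r !normrN => h; apply: le_trans (le_normr_Rintegral mD (i1 n)) _.
  apply: le_trans h; apply: le_trans (ler_norm _).
  rewrite /de -(RintegralZl (C2 * C3) mD (ide (n + N)%N)); apply: le_Rintegral => //.
  - exact/intg_abs/i1.
  - exact/intgZ/ide.
  - move=> z Dz; rewrite !normrM distrC ler_wpM2r// ler_pM//; first exact/Hp/bg.
    exact/HG/Dn.
have L4 := cvgD L3 L2; rewrite add0r in L4.
have L5 : (fun n => \int[lam]_(z in D) (P (prim (g_ n) z) * ga z)) @ \oo -->
    - \int[lam]_(z in D) (p (prim k z) * Ga z * k z).
  rewrite [X in X @ _ --> _](_ : _ = (fun n => - (\int[lam]_(z in D) (p (prim (g_ n) z) * Ga z * (g_ n z - k z)) +
    \int[lam]_(z in D) (p (prim (g_ n) z) * Ga z * k z)))); first by apply: cvgN; exact: L4.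
  by apply/funext => n; rewrite -E2; exact: (ibp_smooth (ch _) (ig n)).
have := cvg_unique _ L1 L5 => -> //.
by congr (- _); apply: eq_Rintegral => z _; ring.
Qed.

End AbsolutelyContinuous.

Section RealFubini.
Context d1 d2 (T1 : measurableType d1) (T2 : measurableType d2) (R : realType).
Variables (m1 : {sigma_finite_measure set T1 -> \bar R}) (m2 : {sigma_finite_measure set T2 -> \bar R}).
Variable q : T1 * T2 -> R.
Hypothesis iq : intg (m1 \x m2)%E setT q.

Lemma Rfub_ae : {ae m1, forall y, intg m2 setT (fun s => q (y, s))}.
Proof. exact: (ae_integrable1 iq). Qed.

Lemma Rfub_fin : {ae m1, forall y, fubini_F m2 (EFin \o q) y = (\int[m2]_s q (y, s))%:E}.
Proof.
apply: ae_imp Rfub_ae => y iy.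
by rewrite /fubini_F /Rintegral fineK//; exact: integrable_fin_num.
Qed.

Lemma Rfub_meas : measurable_fun setT (fun y => \int[m2]_s q (y, s)).
Proof.
have := measurable_fubini_F iq => h.
exact: (measurableT_comp (fine_measurable measurableT) h).
Qed.

Lemma Rfub_intg : intg m1 setT (fun y => \int[m2]_s q (y, s)).
Proof.
have h := integrable_fubini_F iq; apply/integrableP; split.
  exact/measurable_EFinP/Rfub_meas.
rewrite (_ : (\int[m1]_x _)%E = (\int[m1]_x `|fubini_F m2 (EFin \o q) x|)%E); first by case/integrableP: h.
apply: ae_eq_integral => //.
- by apply: measurableT_comp => //; exact/measurable_EFinP/Rfub_meas.
- by apply: measurableT_comp => //; exact: (measurable_fubini_F iq).
- by apply: ae_imp Rfub_fin => y /= -> _.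
Qed.

Lemma Rfub : \int[(m1 \x m2)%E]_x q x = \int[m1]_y \int[m2]_s q (y, s).
Proof.
rewrite [LHS]/Rintegral -[X in fine X](integral12_prod_meas1 iq) /Rintegral; congr fine.
apply: ae_eq_integral => //.
- exact: (measurable_fubini_F iq).
- exact/measurable_EFinP/Rfub_meas.
- by apply: ae_imp Rfub_fin => y /= -> _.
Qed.
End RealFubini.

Section Tensor.
Context d1 d2 (T1 : measurableType d1) (T2 : measurableType d2) (R : realType).
Variables (m1 : {sigma_finite_measure set T1 -> \bar R}) (m2 : {sigma_finite_measure set T2 -> \bar R}).

Lemma tensor_intg (h : T1 -> R) (l : T2 -> R) : intg m1 setT h -> intg m2 setT l ->
  intg (m1 \x m2)%E setT (fun x => h x.1 * l x.2).
Proof.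
move=> ih il.
have mq : measurable_fun setT (fun x : T1 * T2 => h x.1 * l x.2).
  apply: measurable_funM.
    exact: (measurableT_comp (intg_meas ih) measurable_fst).
  exact: (measurableT_comp (intg_meas il) measurable_snd).
apply/(integrable12ltyP _); first exact/measurable_EFinP.
rewrite (_ : (\int[m1]_x _)%E = (\int[m1]_x (`|(h x)%:E| * \int[m2]_y `|(l y)%:E|))%E); last first.
  apply: eq_integral => x _ /=; rewrite -ge0_integralZl//.
    by apply: eq_integral => y _; rewrite -EFinM normrM.
  by apply/measurable_EFinP; exact: (measurableT_comp _ (intg_meas il)).
have /integrableP[_ h1] := ih; have /integrableP[_ l1] := il.
rewrite ge0_integralZr//.
- by apply: lte_mul_pinfty => //; [exact: integral_ge0|rewrite ge0_fin_numE//; exact: integral_ge0].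
- by apply: measurableT_comp => //; exact/measurable_EFinP/(intg_meas ih).
- exact: integral_ge0.
Qed.
End Tensor.

(** * Primitives along vertical lines *)

Section Slices.
Variable R : realType.
Local Notation mR := (measurableTypeR R).
Local Notation lam := (@lebesgue_measure R).
Local Notation leb3 := (leb3 R).
Local Notation T3 := (mR * mR * mR)%type.
Variables (M : R) (K : T3 -> R).
Hypotheses (M0 : 0 < M) (iK : intg leb3 setT K) (KD : forall x, ~ (`[- M, M]%classic : set R) x.2 -> K x = 0).

Let D : set mR := `[- M, M]%classic.

(** The indicator cuts off above height [M], where the primitive would stay constant; with it
    [vprim] is integrable on the whole space. *)
Definition vprim (x : T3) : R := \1_D x.2 * \int[lam]_(s in (`[- M, x.2]%classic : set R)) K (x.1, s).

Let lam_D : (lam D < +oo)%E.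
Proof. by rewrite /D lebesgue_measure_itv/=; case: ifP => _; rewrite ltry. Qed.

Let mD : measurable D. Proof. exact: measurable_itv. Qed.

Lemma vprim_intg : intg leb3 setT vprim.
Proof.
(* A function of four real variables whose integral over the last one is [vprim]. It is bounded by a
   tensor product of [K] and an indicator, up to a swap of the last two variables. *)
pose Q (z : T3 * mR) : R := ((z.2 : R) <= z.1.2)%R%:R * (- M <= z.2)%R%:R * (K (z.1.1, z.2) * \1_D z.1.2).
have i1 : intg lam setT (\1_D : mR -> R).
  apply/integrableP; split; first exact/measurable_EFinP/measurable_indic.
  rewrite (_ : (\int[lam]_x _)%E = (\int[lam]_x (\1_D x)%:E)%E); first by rewrite integral_indic// setIT.
  by apply: eq_integral => x _ /=; rewrite ger0_norm// indicE.
have iQ : intg (leb3S R \x lam)%E setT Q.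
  have h := @tensor_intg _ _ _ _ R (leb3S R) lam K (\1_D : mR -> R) iK i1.
  have [ms hs] : mpres ((prodS lam lam \x lam) \x lam)%E (fun x : mR * mR * mR * mR => (x.1.1, x.2, x.1.2)).
    by split; [exact: meas_swap23|exact: swap23_int].
  have h2 := mpres_intg (conj ms hs) h.
  apply: (@intgMl _ _ _ _ setT 1) => //.
  - have mz : measurable_fun setT (fun z : T3 * mR => z.1.2 : R) by exact: (measurableT_comp measurable_snd measurable_fst).
    have mb (b : T3 * mR -> bool) : measurable_fun setT b -> measurable_fun setT (fun z => (b z)%:R : R).
      by move=> mb; exact: (measurableT_comp (f := fun b : bool => b%:R : R) _ mb).
    apply: measurable_funM; apply: mb.
    + by apply: measurable_fun_ler => //; exact: measurable_snd.
    + by apply: measurable_fun_ler => //; exact: measurable_snd.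
  - by move=> z _; rewrite -natrM mulnb; case: (_ && _); rewrite ?normr0 ?normr1.
have := Rfub_intg iQ; rewrite (_ : (fun _ => _) = vprim)//.
apply/funext => x; rewrite /vprim indicE.
case: (boolP (_ \in _)) => xD; last first.
  rewrite mul0r -[RHS](_ : \int[lam]_(s in setT) (0 : R) = 0); last first.
    by rewrite /Rintegral integral0.
  by apply: eq_Rintegral => s _; rewrite /Q/= indicE (negbTE xD) !mulr0.
rewrite mul1r [RHS]Rintegral_mkcond; apply: eq_Rintegral => s _.
rewrite /Q/= indicE xD mulr1 /patch mem_setE in_itv/= -natrM mulnb andbC.
by case: ifP; rewrite ?mul0r ?mul1r.
Qed.

Lemma vprim_out x : ~ D x.2 -> vprim x = 0.
Proof. by move=> h; rewrite /vprim indicE memNset// mul0r. Qed.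

(** [K] is integrable on almost every vertical line, where [ac_ibp] applies; Fubini sums up. At the
    lower end the boundary term vanishes because the primitive starts at 0 and [P 0 = 0]. *)
Lemma slice_ibp (P p : R -> R) (C C' : R) (Phi dPhi : T3 -> R) :
  (forall y : R, is_derive y 1 P (p y)) -> continuous p -> P 0 = 0 ->
  (forall y, `|P y| <= C * `|y|) -> (forall y, `|p y| <= C) ->
  (forall x, is_derive (x.2 : R) 1 (fun z : R => Phi (x.1, z)) (dPhi x)) ->
  (forall y, continuous (fun z : R => dPhi (y, z))) ->
  (forall y, Phi (y, M) = 0) ->
  measurable_fun setT Phi -> measurable_fun setT dPhi ->
  (forall x, D x.2 -> `|Phi x| <= C') -> (forall x, D x.2 -> `|dPhi x| <= C') ->
  \int[leb3]_x (P (vprim x) * dPhi x) = - \int[leb3]_x (p (vprim x) * K x * Phi x).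
Proof.
move=> dP cp P0 bP bp dPh cPh PhM mPh mdPh bPh bdPh.
have iV := vprim_intg; have mV := intg_meas iV.
have cP : continuous P by move=> y; exact: (is_derive1_cont (dP y)).
have mc (q : R -> R) : continuous q -> measurable_fun setT (fun x => q (vprim x)).
  by move=> cq; apply: (measurableT_comp (continuous_measurable_fun cq) mV).
have m1 : measurable_fun setT (fun x : T3 => \1_D x.2 : R).
  have h1 : measurable_fun setT (\1_D : mR -> R) by exact: measurable_indic.
  exact: (measurableT_comp h1 (@meas_x3 R)).
have b1 (q : T3 -> R) : (forall x, D x.2 -> `|q x| <= C') -> forall x, setT x -> `|\1_D x.2 * q x| <= C'.
  move=> bq x _; rewrite indicE; case: (boolP (_ \in _)) => [/set_mem/bq|_]; first by rewrite mul1r.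
  by rewrite mul0r normr0; apply: le_trans (bq (x.1, M) _) => //=; rewrite /D/= in_itv/= lexx andbT; rewrite ge0_cp// ltW.
have i1 : intg leb3 setT (fun x => P (vprim x) * dPhi x).
  have : intg leb3 setT (fun x => (\1_D x.2 * dPhi x) * P (vprim x)).
    apply: (@intgMl _ _ _ _ setT C') => //; [exact: measurable_funM|exact: b1|].
    apply: (@intg_le _ _ _ _ setT _ (fun x => C * `|vprim x|)) => //; first exact: mc.
    exact/intgZ/intg_abs.
  apply: eq_intg => // x _; rewrite indicE; case: (boolP (_ \in _)) => [_|]; first by rewrite mul1r mulrC.
  by rewrite notin_setE => h; rewrite vprim_out// P0 !mul0r.
have i2 : intg leb3 setT (fun x => p (vprim x) * K x * Phi x).
  have : intg leb3 setT (fun x => (\1_D x.2 * Phi x) * (p (vprim x) * K x)).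
    apply: (@intgMl _ _ _ _ setT C') => //; [exact: measurable_funM|exact: b1|].
    by apply: (@intgMl _ _ _ _ setT C) => //; exact: mc.
  apply: eq_intg => // x _; rewrite indicE; case: (boolP (_ \in _)) => [_|]; first by rewrite mul1r mulrC.
  by rewrite notin_setE => h; rewrite KD// mulr0 !mul0r.
rewrite [LHS](@Rfub _ _ _ _ R (prodS lam lam) lam _ i1) [X in - X](@Rfub _ _ _ _ R (prodS lam lam) lam _ i2).
have j2 := @Rfub_intg _ _ _ _ R (prodS lam lam) lam _ i2.
rewrite -[RHS]mulN1r -(RintegralZl _ measurableT j2).
apply: Rint_ae_eq => //.
- exact: (@Rfub_meas _ _ _ _ R (prodS lam lam) lam _ i1).
- by apply: measurable_funM => //; exact: (@Rfub_meas _ _ _ _ R (prodS lam lam) lam _ i2).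
apply: ae_imp (@Rfub_ae _ _ _ _ R (prodS lam lam) lam _ iK) => y iy _.
have iyD : intg lam (`[- M, M]%classic : set R) (fun s => K (y, s)).
  exact: (intg_sub measurableT mD _ iy).
have cphi : continuous (fun z => dPhi (y, z)) by exact: cPh.
have := @ac_ibp R M (fun s => K (y, s)) P p (fun z => Phi (y, z)) (fun z => dPhi (y, z)) M0 iyD dP cp
  (fun z => dPh (y, z)) (cPh y) (PhM y).
rewrite P0 mul0r => /(_ erefl) H.
have VD s : (`[- M, M]%classic : set R) s -> vprim (y, s) = \int[lam]_(s in (`[- M, s]%classic : set R)) K (y, s).
  by move=> Ds; rewrite /vprim indicE mem_set// mul1r.
transitivity (\int[lam]_(s in D) (P (vprim (y, s)) * dPhi (y, s))).
  rewrite [RHS]Rintegral_mkcond; apply: eq_Rintegral => s _; rewrite /patch.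
  case: ifPn => //; rewrite notin_setE => Ds.
  by rewrite vprim_out// P0 mul0r.
rewrite mulN1r (_ : \int[lam]_s _ = \int[lam]_(s in D) (p (vprim (y, s)) * K (y, s) * Phi (y, s))); last first.
  rewrite [RHS]Rintegral_mkcond; apply: eq_Rintegral => s _; rewrite /patch.
  by case: ifPn => //; rewrite notin_setE => Ds; rewrite KD// mulr0 mul0r.
rewrite (_ : \int[lam]_(s in D) _ = \int[lam]_(s in D) (P (\int[lam]_(s in (`[- M, s]%classic : set R)) K (y, s)) * dPhi (y, s))); last first.
  by apply: eq_Rintegral => s; rewrite inE => Ds; rewrite VD.
rewrite H; congr (- _).
by apply: eq_Rintegral => s; rewrite inE => Ds; rewrite VD.
Qed.

End Slices.

(** * Chain rule for weak derivatives *)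

Section ChainRule.
Variable R : realType.
Local Notation mR := (measurableTypeR R).
Local Notation leb3 := (leb3 R).
Local Notation T3 := (mR * mR * mR)%type.
Implicit Types (x : R3 R) (j : 'I_3) (f g h : R3 R -> R) (r : R).

Definition plateau (a b : R) x : R := step ((b - nsq x) / (b - a)).

Lemma plateau_smooth a b : smooth_on setT (plateau a b).
Proof.
apply: (smooth_step openT); apply: smoothM openT _ (smooth_cst _ openT).
exact: (@smoothB _ _ (fun=> b) (@nsq R) openT (smooth_cst _ openT) (smooth_nsq openT)).
Qed.

Lemma plateau1 a b x : a < b -> nsq x <= a -> plateau a b x = 1.
Proof. by move=> ab h; rewrite /plateau step1// ler_pdivlMr ?subr_gt0// mul1r lerB. Qed.

Lemma plateau0 a b x : a < b -> b <= nsq x -> plateau a b x = 0.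
Proof. by move=> ab h; rewrite /plateau step0// pmulr_lle0 ?subr_le0// invr_gt0 subr_gt0. Qed.

Lemma plateau_test a b r : 0 < r -> a < b -> b < r ^+ 2 -> test_fun (Ball3 r) (plateau a b).
Proof.
move=> r0 ab br; apply: (@mk_test _ _ _ [set x | nsq x <= b] b) => //.
- exact: plateau_smooth.
- exact: closed_nsq_le.
- by move=> x /= hx; apply/Ball3E => //; exact: le_lt_trans br.
- by move=> x /=; apply: contra_neqP => /negP; rewrite -ltNge => /ltW hx; rewrite plateau0.
Qed.

Lemma compact_in_ball (K : set (R3 R)) r : 0 < r -> compact K -> K `<=` Ball3 r ->
  exists a, 0 <= a /\ a < r ^+ 2 /\ forall x, K x -> nsq x <= a.
Proof.
move=> r0 cK KB; have [->|/set0P K0] := eqVneq K set0.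
  by exists 0; split => //; split => //; rewrite exprn_gt0.
have cn : continuous (@nsq R) by exact: (@nsq_cont R).
have [c cK' H] := compact_EVT_max K0 cK (continuous_subspaceT cn).
exists (nsq c); split; first exact: nsq_ge0; split.
  by apply/Ball3E => //; apply: KB; exact: set_mem.
by move=> x Kx; apply: H; exact: mem_set.
Qed.

Lemma test_support_in r phi : 0 < r -> test_fun (Ball3 r) phi ->
  exists a b, [/\ 0 <= a, a < b, b < r ^+ 2 & forall x, supp phi x -> nsq x < a].
Proof.
move=> r0 [_ c sB]; have [a [a0 [ar H]]] := compact_in_ball r0 c sB.
exists (a + (r ^+ 2 - a) / 3), (a + (r ^+ 2 - a) / 2).
split; [lra|lra|lra|] => x /H; lra.
Qed.

Lemma lip_bound (P p : R -> R) (C : R) : (forall y : R, is_derive y 1 P (p y)) -> P 0 = 0 ->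
  (forall y, `|p y| <= C) -> forall y, `|P y| <= C * `|y|.
Proof.
move=> dP P0 bp y.
have cP z : {for z, continuous P} by exact: (is_derive1_cont (dP z)).
have [y0|y0|->] := ltgtP y 0; last by rewrite P0 !normr0 mulr0.
- have [c _] := MVT y0 (fun z _ => dP z) (continuous_subspaceT cP).
  rewrite P0 !sub0r => h; have : P y = p c * y by apply: oppr_inj; rewrite h mulrN.
  by move=> ->; rewrite normrM ler_wpM2r.
- have [c _] := MVT y0 (fun z _ => dP z) (continuous_subspaceT cP).
  by rewrite P0 !subr0 => ->; rewrite normrM ler_wpM2r.
Qed.

Lemma slice_test j psi x : smooth_on setT psi ->
  is_derive x.2 1 (fun z => (psi \o perm3' j) (x.1, z)) (partial j psi (perm3' j x)).
Proof.
move=> s; apply: (@is_derive_vert _ (psi \o perm3' j) x _ (ord2)) => //.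
by apply: is_derive_perm; exact: smooth_derivable s I.
Qed.

Lemma slice_test_cont j psi (y : R * R) : smooth_on setT psi ->
  continuous (fun z : R => (psi \o perm3' j) (y, z)).
Proof.
move=> s z; have c1 : {for z, continuous (fun z => (y, z) : R3 R)} by apply: cont_pair; [exact: cvg_cst|exact: cvg_id].
apply: (continuous_comp c1).
have c2 := @perm3'_cont R j (y, z).
apply: (continuous_comp c2); exact: smooth_cont s I.
Qed.

Lemma smooth_perm_coord j : [/\ smooth_on setT (fun x => (perm3 j x).1.1),
  smooth_on setT (fun x => (perm3 j x).1.2) & smooth_on setT (fun x => (perm3 j x).2)].
Proof.
have [s1 s2 s3] := @smooth_coord R setT openT.
by rewrite /perm3; case: (val j) => [|[|n]]; [exact: And3 s2 s3 s1|exact: And3 s1 s3 s2|exact: And3 s1 s2 s3].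
Qed.

Variables (r : R) (j : 'I_3) (f g : R3 R -> R).
Hypotheses (r0 : 0 < r) (fg : is_weak_partial (Ball3 r) j f g).

Section Cutoff.
Variable chi : R3 R -> R.
Hypothesis tchi : test_fun (Ball3 r) chi.

Definition cutf : R3 R -> R := (fun x => f x * chi x) \_ (Ball3 r).
Definition cutg : R3 R -> R := (fun x => g x * chi x + f x * partial j chi x) \_ (Ball3 r).

Lemma cutf_intg : intg leb3 setT cutf.
Proof.
have [lf _ _] := fg; apply: ((intg_mkcond leb3 _ (meas_Ball3 r)).1 _).
exact: locint_test (@open_Ball3 R r) lf tchi.
Qed.

Lemma cutg_intg : intg leb3 setT cutg.
Proof.
have [lf lg _] := fg; apply: ((intg_mkcond leb3 _ (meas_Ball3 r)).1 _).
apply: intgD (meas_Ball3 r) _ _; first exact: locint_test (@open_Ball3 R r) lg tchi.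
exact: locint_test (@open_Ball3 R r) lf (test_partial j tchi).
Qed.

Lemma cut_weak psi : smooth_on setT psi ->
  \int[leb3]_x (cutf x * partial j psi x) = - \int[leb3]_x (cutg x * psi x).
Proof.
move=> s; have [lf lg H] := fg.
have mB := meas_Ball3 r; have oB := @open_Ball3 R r.
have E (q l : R3 R -> R) : \int[leb3]_x ((q \_ (Ball3 r)) x * l x) = \int[leb3]_(x in Ball3 r) (q x * l x).
  rewrite [RHS]Rintegral_mkcond; apply: eq_Rintegral => x _.
  by rewrite !patchE; case: ifP => //; rewrite mul0r.
rewrite /cutf /cutg !E.
have sp := smooth_partial j s; have [sc _ _] := tchi.
have t1 : test_fun (Ball3 r) (fun x => psi x * chi x) by exact: (testM tchi).
have t2 : test_fun (Ball3 r) (fun x => psi x * partial j chi x) by exact: (testM (test_partial j tchi) s).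
have t3 : test_fun (Ball3 r) (fun x => partial j psi x * chi x) by exact: (testM tchi).
have P1 x : partial j (fun x => psi x * chi x) x = psi x * partial j chi x + partial j psi x * chi x.
  have := is_deriveM (smooth_derivable (x := x) j s I) (smooth_derivable (x := x) j sc I).
  by move=> [_]; rewrite /partial => ->; rewrite !scalE [X in _ + X = _]mulrC.
have := H _ t1.
under [X in X = _ -> _]eq_Rintegral do rewrite P1 mulrDr.
rewrite RintegralD//; [|exact: locint_test oB lf t2|exact: locint_test oB lf t3].
move=> H1.
have -> : \int[leb3]_(x in Ball3 r) ((g x * chi x + f x * partial j chi x) * psi x) =
   \int[leb3]_(x in Ball3 r) (g x * (psi x * chi x)) + \int[leb3]_(x in Ball3 r) (f x * (psi x * partial j chi x)).
  rewrite -RintegralD//; [|exact: locint_test oB lg t1|exact: locint_test oB lf t2].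
  by apply: eq_Rintegral => x _; ring.
have -> : \int[leb3]_(x in Ball3 r) (f x * chi x * partial j psi x) = \int[leb3]_(x in Ball3 r) (f x * (partial j psi x * chi x)).
  by apply: eq_Rintegral => x _; ring.
by move: H1; move: (Rintegral _ _ _) (Rintegral _ _ _) (Rintegral _ _ _) => a b c; lra.
Qed.

Let K : T3 -> R := cutg \o perm3' j.
Let F : T3 -> R := cutf \o perm3' j.

Let iK : intg leb3 setT K.
Proof.
have := mpres_intg (perm3'_mpres R j) cutg_intg.
by [].
Qed.
Let iF : intg leb3 setT F.
Proof.
have := mpres_intg (perm3'_mpres R j) cutf_intg.
by [].
Qed.

Lemma perm_ball x : Ball3 r (perm3' j x) -> (`[- r, r]%classic : set R) x.2.
Proof.
move=> /Ball3E -/(_ r0) h; rewrite /= in_itv/= -ler_norml; apply: sqr_le_norm; first exact: ltW.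
apply: ltW; apply: le_lt_trans h.
rewrite /nsq /perm3'; have := sqr_ge0 x.1.1; have := sqr_ge0 x.1.2; have := sqr_ge0 x.2.
by case: (val j) => [|[|n]] /= *; lra.
Qed.

Let KD x : ~ (`[- r, r]%classic : set R) x.2 -> K x = 0.
Proof. by move=> h; rewrite /K/= /cutg patchE memNset// => /perm_ball. Qed.

(** The cut-off function coincides almost everywhere with the primitive of its weak derivative along
    the lines of direction [j]. Both have the same integrals against products of ray functions: for
    [F] this is the definition of a weak derivative, for the primitive it is [slice_ibp] with [P]
    the identity. *)
Lemma slice_rep : {ae leb3, forall x, F x = vprim r K x}.
Proof.
have iV := vprim_intg r iK.
have mV := intg_meas iV; have mF := intg_meas iF.
have : {ae leb3, forall x, F x - vprim r K x = 0}; last by apply: ae_imp => x /eqP; rewrite subr_eq0 => /eqP.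
apply: dbr_global; first exact: intgB.
move=> n a m b l c.
pose al x : R := ray n a x.1.1 * ray m b x.1.2.
(* An antiderivative of the ray function, normalized to vanish at the upper end [r]. The function
   [psi] has no compact support, but [cutf] and [cutg] vanish off the ball, so [cut_weak] applies to
   it. *)
pose G (y : R) : R := rayint l c y - rayint l c r.
pose psi : R3 R -> R := fun x => al (perm3 j x) * G (perm3 j x).2.
have [s1 s2 s3] := smooth_perm_coord j.
have sp : smooth_on setT psi.
  apply: smoothM openT (smoothM openT (smooth_ray n a s1) (smooth_ray m b s2)) _.
  exact: smoothB openT (smooth_rayint l c s3) (smooth_cst _ openT).
have psiE x : (psi \o perm3' j) x = al x * G x.2 by rewrite /psi/= perm3K'.
have dG (y : R) : is_derive y 1 G (ray l c y).
  by have := is_deriveB (rayint_derive l c y) (@is_derive_cst _ _ _ (rayint l c r) y 1); rewrite subr0.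
have dpsi x : is_derive x.2 1 (fun z => (psi \o perm3' j) (x.1, z)) (al x * ray l c x.2).
  have := is_deriveM (@is_derive_cst _ _ _ (al x) x.2 1) (dG x.2).
  rewrite !scalE mulr0 addr0; congr is_derive.
  by apply/funext => z; rewrite psiE.
have dE x : partial j psi (perm3' j x) = al x * ray l c x.2.
  by have [_ <-] := slice_test j x sp; have [_ <-] := dpsi x.
have sdp := smooth_partial j sp.
have cP2 : continuous ((fun=> 1) : R -> R) by move=> y; exact: cvg_cst.
have [CG [CG0 HG]] := cont_bounded_itv r (fun y => is_derive1_cont (dG y)).
have bal x : `|al x| <= 4.
  by rewrite /al normrM (_ : 4 = 2 * 2) ?ler_pM ?ray_le//; ring.
have inD x : (`[- r, r]%classic : set R) x.2 -> `|x.2| <= r by rewrite /= in_itv/= -ler_norml.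
have := @slice_ibp R r K r0 iK KD (id : R -> R) ((fun=> 1) : R -> R) 1 (4 * CG + 8) (psi \o perm3' j) (partial j psi \o perm3' j)
  (fun y : R => is_derive_id y 1) cP2 erefl (fun y => _) (fun y => _) (fun x => slice_test j x sp)
  (fun y => @slice_test_cont j _ y sdp).
move=> /(_ _ _ _ _ _ _ _)/wrap[].
- by move=> y; rewrite mul1r.
- by move=> y; rewrite normr1.
- by move=> y; rewrite psiE/= /G subrr mulr0.
- exact: (measurableT_comp (smooth_meas sp) (perm3'_mpres R j).1).
- exact: (measurableT_comp (smooth_meas sdp) (perm3'_mpres R j).1).
- move=> x /inD/HG h; rewrite psiE normrM.
  by have : `|al x| * `|G x.2| <= 4 * CG by [rewrite ler_pM]; lra.
- move=> x _; rewrite /= dE normrM.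
  have : `|al x| * `|ray l c x.2| <= 4 * 2 by rewrite ler_pM// ray_le.
  lra.
move=> H1.
have := cut_weak sp.
have sdm := smooth_meas sdp; have sm := smooth_meas sp.
rewrite -(mpres_Rint (perm3'_mpres R j)); last by apply: measurable_funM => //; exact: (intg_meas cutf_intg).
rewrite -[in RHS](mpres_Rint (perm3'_mpres R j)); last by apply: measurable_funM => //; exact: (intg_meas cutg_intg).
move=> H2.
have i1 : intg leb3 setT (fun x => al x * ray l c x.2 * F x).
  apply: (@intgMl _ _ _ _ setT 8) => //.
    have : measurable_fun setT (partial j psi \o perm3' j : T3 -> R) by exact: (measurableT_comp sdm (perm3'_mpres R j).1).
    by congr measurable_fun; apply/funext => x; rewrite /= dE.
  move=> x _; rewrite normrM.
  have : `|al x| * `|ray l c x.2| <= 4 * 2 by rewrite ler_pM// ray_le.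
  lra.
have i2 : intg leb3 setT (fun x => al x * ray l c x.2 * vprim r K x).
  apply: (@intgMl _ _ _ _ setT 8) => //.
    have : measurable_fun setT (partial j psi \o perm3' j : T3 -> R) by exact: (measurableT_comp sdm (perm3'_mpres R j).1).
    by congr measurable_fun; apply/funext => x; rewrite /= dE.
  move=> x _; rewrite normrM.
  have : `|al x| * `|ray l c x.2| <= 4 * 2 by rewrite ler_pM// ray_le.
  lra.
transitivity (\int[leb3]_x (al x * ray l c x.2 * F x) - \int[leb3]_x (al x * ray l c x.2 * vprim r K x)).
  rewrite -(RintegralB measurableT i1 i2); apply: eq_Rintegral => x _.
  by rewrite /al; ring.
apply/eqP; rewrite subr_eq0; apply/eqP.
transitivity (- \int[leb3]_x (cutg (perm3' j x) * psi (perm3' j x))).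
  rewrite -H2; apply: eq_Rintegral => x _; by rewrite dE mulrC.
transitivity (- \int[leb3]_x (1 * K x * (psi \o perm3' j) x)).
  by congr (- _); apply: eq_Rintegral => x _; rewrite mul1r.
rewrite -H1; apply: eq_Rintegral => x _; by rewrite /= dE mulrC.
Qed.

Lemma cut_chain (P p : R -> R) (C : R) phi :
  (forall y : R, is_derive y 1 P (p y)) -> continuous p -> P 0 = 0 -> (forall y, `|p y| <= C) ->
  test_fun (Ball3 r) phi ->
  \int[leb3]_x (P (cutf x) * partial j phi x) = - \int[leb3]_x (p (cutf x) * cutg x * phi x).
Proof.
move=> dP cp P0 bp t; have [s _ _] := t.
have tp := test_partial j t; have [sp _ _] := tp.
have [C1 [C10 b1]] := test_bounded t; have [C2 [C20 b2]] := test_bounded tp.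
have sdm := smooth_meas sp; have sm := smooth_meas s.
have cP : continuous P by move=> y; exact: (is_derive1_cont (dP y)).
have mf := intg_meas cutf_intg; have mg := intg_meas cutg_intg.
have mc (q : R -> R) : continuous q -> measurable_fun setT (fun x : T3 => q (cutf x)).
  by move=> cq; apply: (measurableT_comp (continuous_measurable_fun cq) mf).
rewrite -(mpres_Rint (perm3'_mpres R j)); last by apply: measurable_funM => //; exact: mc.
rewrite -[in RHS](mpres_Rint (perm3'_mpres R j)); last first.
  by apply: measurable_funM => //; apply: measurable_funM => //; exact: mc.
have mV := intg_meas (vprim_intg r iK).
have mF := intg_meas iF; have mK := intg_meas iK.
have mcF (q : R -> R) (h : T3 -> R) : continuous q -> measurable_fun setT h -> measurable_fun setT (fun x : T3 => q (h x)).
  by move=> cq mh; apply: (measurableT_comp (continuous_measurable_fun cq) mh).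
have mp : measurable_fun setT (phi \o perm3' j : T3 -> R) by exact: (measurableT_comp sm (perm3'_mpres R j).1).
have mdp : measurable_fun setT (partial j phi \o perm3' j : T3 -> R) by exact: (measurableT_comp sdm (perm3'_mpres R j).1).
have := @slice_ibp R r K r0 iK KD P p C (C1 + C2) (phi \o perm3' j) (partial j phi \o perm3' j)
  dP cp P0 (lip_bound dP P0 bp) bp (fun x => slice_test j x s)
  (fun y => @slice_test_cont j _ y sp).
move=> /(_ _ mp mdp _ _)/wrap[].
- move=> y; apply: (test_out t) => /Ball3E -/(_ r0); rewrite /nsq /perm3' /=.
  have := sqr_ge0 y.1; have := sqr_ge0 y.2.
  by case: (val j) => [|[|n]] /= *; lra.
- by move=> x _; apply: le_trans (b1 _) _; rewrite lerDl.
- by move=> x _; apply: le_trans (b2 _) _; rewrite lerDr.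
move=> H.
transitivity (\int[leb3]_x (P (vprim r K x) * (partial j phi \o perm3' j) x)).
  apply: Rint_ae_eq => //; try by apply: measurable_funM => //; exact: mcF.
  by apply: ae_imp slice_rep => x /= <- _.
rewrite H; congr (- _).
apply: Rint_ae_eq => //; try by apply: measurable_funM => //; apply: measurable_funM => //; exact: mcF.
by apply: ae_imp slice_rep => x /= <- _.
Qed.
End Cutoff.

(** The plateau function is 1 near the support of [phi], so the cutoff in [cut_chain] changes
    neither side. Boundedness of [p] and [P 0 = 0] give [P] linear growth, hence integrability of
    [P (f x)] where [f] is integrable. *)
Lemma chain_rule (P p : R -> R) (C : R) phi :
  (forall y : R, is_derive y 1 P (p y)) -> continuous p -> P 0 = 0 -> (forall y, `|p y| <= C) ->
  test_fun (Ball3 r) phi ->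
  \int[leb3]_(x in Ball3 r) (P (f x) * partial j phi x) = - \int[leb3]_(x in Ball3 r) (p (f x) * g x * phi x).
Proof.
move=> dP cp P0 bp t.
have [a [b [a0 ab br H]]] := test_support_in r0 t.
have tc := plateau_test r0 ab br.
have := cut_chain tc dP cp P0 bp t.
have tp := test_partial j t.
have E1 x : supp phi x -> Ball3 r x /\ cutf (plateau a b) x = f x /\ cutg (plateau a b) x = g x.
  move=> sx; have Bx : Ball3 r x by have [_ _] := t; apply.
  split=> //; rewrite /cutf /cutg !patchE mem_set// plateau1 ?mulr1 ?(ltW (H _ sx))//; split=> //.
  suff -> : partial j (plateau a b) x = 0 by rewrite mulr0 addr0.
  rewrite (@near_partial _ _ (fun=> 1)); first by have [_ h] := @is_derive_cst _ _ _ (1 : R) x (basis3 R j); exact: h.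
  have oU : open [set x | nsq x < a].
    rewrite (_ : [set x | nsq x < a] = ~` [set x | a <= nsq x]); first exact: closed_openC (@closed_nsq_ge R a).
    by apply/seteqP; split=> y /=; rewrite ltNge => /negP.
  by apply: (eq_on_near oU) => [y /= /ltW|]; [exact: plateau1|exact: H].
have E2 (q l : R3 R -> R) : (forall x, ~ supp phi x -> q x = 0) -> (forall x, supp phi x -> l x = q x) ->
    (forall x, ~ supp phi x -> l x = 0) ->
    \int[leb3]_x q x = \int[leb3]_(x in Ball3 r) l x.
  move=> q0 lq l0; rewrite [RHS]Rintegral_mkcond; apply: eq_Rintegral => x _.
  rewrite patchE; have [sx|nsx] := pselect (supp phi x).
    by rewrite mem_set ?lq//; exact: (E1 x sx).1.
  by rewrite q0// l0//; case: ifP.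
rewrite (E2 _ (fun x => P (f x) * partial j phi x)); first last.
- by move=> x /partial_supp0 ->; rewrite mulr0.
- by move=> x /E1[_ [-> _]].
- by move=> x /partial_supp0 ->; rewrite mulr0.
rewrite (E2 _ (fun x => p (f x) * g x * phi x)) //.
- by move=> x /supp0 ->; rewrite mulr0.
- by move=> x /E1[_ [-> ->]].
- by move=> x /supp0 ->; rewrite mulr0.
Qed.

End ChainRule.

(** * Chain rule along curves *)

Section CurveChain.
Variable R : realType.
Implicit Types (x y : R3 R) (j : 'I_3) (F : R3 R -> R).

Lemma is_derive_quotient (G : R -> R) (t d : R) :
  (fun h => h^-1 * (G (t + h) - G t)) @ 0^' --> d -> is_derive t 1 G d.
Proof.
move=> H; have fE : (fun h : R => h^-1 *: (G (h *: (1 : R) + t) - G t)) = (fun h => h^-1 * (G (t + h) - G t)).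
  by apply/funext => h; rewrite !scalE mulr1 [_ + t]addrC.
have H' : (fun h : R => h^-1 *: (G (h *: (1 : R) + t) - G t)) @ 0^' --> d by rewrite fE.
apply: DeriveDef; first by apply/cvg_ex; exists d.
exact: (cvg_lim _ H').
Qed.

Lemma quotient_is_derive (G : R -> R) (t d : R) : is_derive t 1 G d ->
  (fun h => h^-1 * (G (t + h) - G t)) @ 0^' --> d.
Proof.
have fE : (fun h : R => h^-1 *: (G (h *: (1 : R) + t) - G t)) = (fun h => h^-1 * (G (t + h) - G t)).
  by apply/funext => h; rewrite !scalE mulr1 [_ + t]addrC.
move=> [/cvg_ex[l H] D]; have E : d = l by rewrite -D; exact: (cvg_lim _ H).
by rewrite E -fE.
Qed.

Lemma mvt_unordered (G g : R -> R) (a b : R) :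
  (forall z, Num.min a b <= z <= Num.max a b -> is_derive z 1 G (g z)) ->
  exists2 z, Num.min a b <= z <= Num.max a b & G b - G a = g z * (b - a).
Proof.
move=> H; have [ab|ab|<-] := ltgtP a b.
- move: H; rewrite (min_l (ltW ab)) (max_r (ltW ab)) => H.
  have H' z : z \in `[a, b] -> is_derive z 1 G (g z) by rewrite in_itv/= => /H.
  have c : {within `[a, b], continuous G}.
    apply: derivable_within_continuous => z zab; by have [] := H' z zab.
  have [z zab ->] := MVT ab (fun z zab => H' z (subset_itv_oo_cc zab)) c.
  by exists z => //; have := subset_itv_oo_cc zab; rewrite in_itv.
- move: H; rewrite (min_r (ltW ab)) (max_l (ltW ab)) => H.
  have H' z : z \in `[b, a] -> is_derive z 1 G (g z) by rewrite in_itv/= => /H.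
  have c : {within `[b, a], continuous G}.
    apply: derivable_within_continuous => z zab; by have [] := H' z zab.
  have [z zab E] := MVT ab (fun z zab => H' z (subset_itv_oo_cc zab)) c.
  exists z; first by have := subset_itv_oo_cc zab; rewrite in_itv.
  by rewrite -opprB E -mulrN opprB.
by exists a; rewrite ?minxx ?maxxx ?lexx// !subrr mulr0.
Qed.

Definition c1_near F x := \forall y \near x,
  forall j, derivable F y (basis3 R j) /\ {for y, continuous (partial j F)}.

Definition ord0_3 : 'I_3 := @Ordinal 3 0 isT.
Definition ord1_3 : 'I_3 := @Ordinal 3 1 isT.

Lemma line0 F y : derivable F y (basis3 R ord0_3) ->
  is_derive y.1.1 1 (fun s : R => F (s, y.1.2, y.2)) (partial ord0_3 F y).
Proof.
move=> /derivableP/is_derive_line h; apply/is_derive_shift1; move: h; congr is_derive.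
apply/funext => h /=; congr F; case: y => [[a b] c].
have -> : (a, b, c) + h *: basis3 R ord0_3 = (a + h * 1, b + h * 0, c + h * 0) by [].
by rewrite !mulr0 mulr1 !addr0.
Qed.

Lemma line1 F y : derivable F y (basis3 R ord1_3) ->
  is_derive y.1.2 1 (fun s : R => F (y.1.1, s, y.2)) (partial ord1_3 F y).
Proof.
move=> /derivableP/is_derive_line h; apply/is_derive_shift1; move: h; congr is_derive.
apply/funext => h /=; congr F; case: y => [[a b] c].
have -> : (a, b, c) + h *: basis3 R ord1_3 = (a + h * 0, b + h * 1, c + h * 0) by [].
by rewrite !mulr0 mulr1 !addr0.
Qed.

Lemma line2 F y : derivable F y (basis3 R (ord2)) ->
  is_derive y.2 1 (fun s : R => F (y.1.1, y.1.2, s)) (partial (ord2) F y).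
Proof.
move=> /derivableP/is_derive_line h; apply/is_derive_shift1; move: h; congr is_derive.
apply/funext => h /=; congr F; case: y => [[a b] c].
have -> : (a, b, c) + h *: basis3 R ord2 = (a + h * 0, b + h * 0, c + h * 1) by [].
by rewrite !mulr0 mulr1 !addr0.
Qed.

Lemma between_dist (a b z : R) : Num.min a b <= z <= Num.max a b -> `|a - z| <= `|a - b|.
Proof.
by move=> /andP[]; rewrite ge_min le_max => /orP[] h1 /orP[] h2; rewrite ler_norml;
  have := ler_norm (a - b); have := ler_norm (- (a - b)); rewrite normrN => *; apply/andP; split; lra.
Qed.

Lemma three_term (p0 p1 p2 q0 q1 q2 a b c e : R) :
  `|p0 - q0| <= e -> `|p1 - q1| <= e -> `|p2 - q2| <= e ->
  `|q0 * a + q1 * b + q2 * c - (p0 * a + p1 * b + p2 * c)| <= e * (`|a| + `|b| + `|c|).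
Proof.
move=> b0 b1 b2.
have -> : q0 * a + q1 * b + q2 * c - (p0 * a + p1 * b + p2 * c) = - ((p0 - q0) * a + (p1 - q1) * b + (p2 - q2) * c) by ring.
rewrite normrN !mulrDr; apply: le_trans (ler_normD _ _) _; apply: lerD; last by rewrite normrM ler_wpM2r.
by apply: le_trans (ler_normD _ _) _; apply: lerD; rewrite normrM ler_wpM2r.
Qed.

Lemma scaled_sum (i A p a q b c d : R) :
  i * A - (p * (i * a) + q * (i * b) + c * (i * d)) = i * (A - (p * a + q * b + c * d)).
Proof. ring. Qed.

(** The increment is split along the three coordinates and the mean value theorem is applied to each
    part. Balls of the sup norm are boxes, so they contain the intermediate points. *)
Lemma c1_diff F x : c1_near F x -> forall e : R, 0 < e -> \forall y \near x,
  `|F y - F x - (partial ord0_3 F x * (y.1.1 - x.1.1) + partial ord1_3 F x * (y.1.2 - x.1.2)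
     + partial (ord2) F x * (y.2 - x.2))| <=
  e * (`|y.1.1 - x.1.1| + `|y.1.2 - x.1.2| + `|y.2 - x.2|).
Proof.
move=> H e e0.
have H0 := nbhs_singleton H.
have C j : \forall y \near x, `|partial j F x - partial j F y| <= e.
  have [_ c] := H0 j; move/cvgrPdist_le : c => /(_ e e0); exact.
have : \forall y \near x, (forall j, derivable F y (basis3 R j)) /\
  [/\ `|partial ord0_3 F x - partial ord0_3 F y| <= e, `|partial ord1_3 F x - partial ord1_3 F y| <= e &
   `|partial (ord2) F x - partial (ord2) F y| <= e].
  apply: filterS (filterI (filterI (C ord0_3) (C ord1_3)) (filterI (C ord2) H)).
  by move=> y [[h0 h1] [h2 h3]]; split=> // j; exact: (h3 j).1.
move=> /nbhs_ballP[d /= d0 Hd]; apply/nbhs_ballP; exists d => //= y [[/= y1 y2] y3].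
have inb a b c : `|x.1.1 - a| <= `|x.1.1 - y.1.1| -> `|x.1.2 - b| <= `|x.1.2 - y.1.2| ->
    `|x.2 - c| <= `|x.2 - y.2| -> ball x d (a, b, c).
  by move=> h1 h2 h3; split; [split|]; apply: le_lt_trans; [exact: h1|exact: y1|exact: h2|exact: y2|exact: h3|exact: y3].
have z00 : `|x.1.1 - x.1.1| <= `|x.1.1 - y.1.1| by rewrite subrr normr0.
have z11 : `|x.1.2 - x.1.2| <= `|x.1.2 - y.1.2| by rewrite subrr normr0.
have [z0 z0i E0] := @mvt_unordered (fun s => F (s, y.1.2, y.2)) (fun s => partial ord0_3 F (s, y.1.2, y.2)) x.1.1 y.1.1
  (fun z zi => line0 ((Hd _ (inb z y.1.2 y.2 (between_dist zi) (lexx _) (lexx _))).1 ord0_3)).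
have [z1 z1i E1] := @mvt_unordered (fun s => F (x.1.1, s, y.2)) (fun s => partial ord1_3 F (x.1.1, s, y.2)) x.1.2 y.1.2
  (fun z zi => line1 ((Hd _ (inb x.1.1 z y.2 z00 (between_dist zi) (lexx _))).1 ord1_3)).
have [z2 z2i E2] := @mvt_unordered (fun s => F (x.1.1, x.1.2, s)) (fun s => partial (ord2) F (x.1.1, x.1.2, s)) x.2 y.2
  (fun z zi => line2 ((Hd _ (inb x.1.1 x.1.2 z z00 z11 (between_dist zi))).1 (ord2))).
have [_ [b0 _ _]] := Hd _ (inb z0 y.1.2 y.2 (between_dist z0i) (lexx _) (lexx _)).
have [_ [_ b1 _]] := Hd _ (inb x.1.1 z1 y.2 z00 (between_dist z1i) (lexx _)).
have [_ [_ _ b2]] := Hd _ (inb x.1.1 x.1.2 z2 z00 z11 (between_dist z2i)).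
have xE : x = (x.1.1, x.1.2, x.2) by case: (x) => [[]].
have yE : y = (y.1.1, y.1.2, y.2) by case: (y) => [[]].
have -> : F y - F x = partial ord0_3 F (z0, y.1.2, y.2) * (y.1.1 - x.1.1) + partial ord1_3 F (x.1.1, z1, y.2) * (y.1.2 - x.1.2)
   + partial (ord2) F (x.1.1, x.1.2, z2) * (y.2 - x.2).
  rewrite -E0 -E1 -E2 -xE -yE; ring.
exact: three_term.
Qed.

Lemma is_derive_curve F (g1 g2 g3 : R -> R) (t d1 d2 d3 : R) :
  c1_near F (g1 t, g2 t, g3 t) ->
  is_derive t 1 g1 d1 -> is_derive t 1 g2 d2 -> is_derive t 1 g3 d3 ->
  is_derive t 1 (fun s => F (g1 s, g2 s, g3 s))
    (partial ord0_3 F (g1 t, g2 t, g3 t) * d1 + partial ord1_3 F (g1 t, g2 t, g3 t) * d2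
     + partial (ord2) F (g1 t, g2 t, g3 t) * d3).
Proof.
move=> H D1 D2 D3; set x := (g1 t, g2 t, g3 t).
have q1 := quotient_is_derive D1; have q2 := quotient_is_derive D2; have q3 := quotient_is_derive D3.
apply: is_derive_quotient.
pose L (h : R) := partial ord0_3 F x * (h^-1 * (g1 (t + h) - g1 t)) + partial ord1_3 F x * (h^-1 * (g2 (t + h) - g2 t))
  + partial (ord2) F x * (h^-1 * (g3 (t + h) - g3 t)).
have cL : L h @[h --> 0^'] --> partial ord0_3 F x * d1 + partial ord1_3 F x * d2 + partial (ord2) F x * d3.
  by apply: cvgD; [apply: cvgD|]; apply: cvgM => //; exact: cvg_cst.
rewrite -[X in _ --> X]addr0.
rewrite [X in X @ _ --> _](_ : _ = (fun h => L h + (h^-1 * (F (g1 (t + h), g2 (t + h), g3 (t + h)) - F x) - L h))); last first.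
  by apply/funext => h; ring.
apply: cvgD => //.
pose S := `|d1| + `|d2| + `|d3| + 3.
have S0 : 0 < S by rewrite /S; have := normr_ge0 d1; have := normr_ge0 d2; have := normr_ge0 d3; lra.
apply/cvgrPdist_le => e e0.
have cg (g : R -> R) d : is_derive t 1 g d -> g (t + h) @[h --> 0^'] --> g t.
  move=> /is_derive1_cont c.
  have H0 : (fun h => g (t + h)) @ nbhs (0 : R) --> g t.
    apply: (@cvg_comp _ _ _ (fun h => t + h) g (nbhs (0 : R)) (nbhs t)); last exact: c.
    have : (fun h => t + h) @ nbhs (0 : R) --> t + 0 by apply: cvgD; [exact: cvg_cst|exact: cvg_id].
    by rewrite addr0.
  by move=> A nA; apply: (@cvg_within _ (nbhs (0 : R))); exact: H0.
have cx : (fun h => (g1 (t + h), g2 (t + h), g3 (t + h))) @ 0^' --> x.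
  exact: (cvg_pair (cvg_pair (cg _ _ D1) (cg _ _ D2)) (cg _ _ D3)).
have B (g : R -> R) d : is_derive t 1 g d -> \forall h \near 0^', `|h^-1 * (g (t + h) - g t)| <= `|d| + 1.
  move=> /quotient_is_derive /cvgrPdist_le /(_ 1 ltr01); apply: filterS => h hh.
  rewrite -[X in `|X|](subrK d) addrC; apply: le_trans (ler_normD _ _) _; rewrite lerD2l.
  by rewrite distrC.
have := cx _ (c1_diff H (divr_gt0 e0 S0)).
rewrite /nbhs/= => N1.
near=> h.
have h0 : h != 0 by near: h; exact: nbhs_dnbhs_neq.
have B1 : `|h^-1 * (g1 (t + h) - g1 t)| <= `|d1| + 1 by near: h; exact: B.
have B2 : `|h^-1 * (g2 (t + h) - g2 t)| <= `|d2| + 1 by near: h; exact: B.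
have B3 : `|h^-1 * (g3 (t + h) - g3 t)| <= `|d3| + 1 by near: h; exact: B.
have : (fun y => `|F y - F x - (partial ord0_3 F x * (y.1.1 - x.1.1) + partial ord1_3 F x * (y.1.2 - x.1.2)
     + partial (ord2) F x * (y.2 - x.2))| <=
  e / S * (`|y.1.1 - x.1.1| + `|y.1.2 - x.1.2| + `|y.2 - x.2|)) (g1 (t + h), g2 (t + h), g3 (t + h)).
  by near: h; exact: N1.
rewrite /= => hh.
rewrite sub0r normrN.
have -> : h^-1 * (F (g1 (t + h), g2 (t + h), g3 (t + h)) - F x) - L h =
  h^-1 * (F (g1 (t + h), g2 (t + h), g3 (t + h)) - F x - (partial ord0_3 F x * (g1 (t + h) - g1 t) +
          partial ord1_3 F x * (g2 (t + h) - g2 t) + partial (ord2) F x * (g3 (t + h) - g3 t))).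
  exact: scaled_sum.
rewrite normrM; apply: le_trans (ler_wpM2l (normr_ge0 _) hh) _.
move: B1 B2 B3; rewrite !normrM => B1 B2 B3.
rewrite mulrCA !mulrDr.
apply: (@le_trans _ _ (e / S * S)); last by rewrite divfK// gt_eqF.
rewrite -mulrDr -mulrDr ler_wpM2l ?divr_ge0 ?(ltW e0) ?(ltW S0)//.
apply: le_trans (lerD (lerD B1 B2) B3) _; rewrite /S; move: `|d1| `|d2| `|d3| => a b c; lra.
Unshelve. all: by end_near. Qed.

Lemma smooth_c1_near U F x : open U -> smooth_on U F -> U x -> c1_near F x.
Proof.
move=> oU s Ux; have : nbhs x U by exact: open_nbhs_nbhs.
apply: filterS => y Uy j; split; first by have [_ h] := s [::] y Uy; exact: h.
by have [h _] := s [:: j] y Uy; exact: h.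
Qed.

End CurveChain.

(** * Rotations and equivariance *)

Section Rotation.
Variable R : realType.
Local Notation mR := (measurableTypeR R).
Local Notation leb3 := (leb3 R).
Local Notation T3 := (mR * mR * mR)%type.
Implicit Types (x : R3 R) (i : 'I_5) (j : 'I_3) (f g : R3 R -> R) (r : R).

Definition shear2 (k : R) x : R3 R := (x.1.1, x.1.2 + k * x.1.1, x.2).
Definition shear1 (k : R) x : R3 R := (x.1.1 + k * x.1.2, x.1.2, x.2).

Lemma shear2_mpres k : mpres leb3 (shear2 k).
Proof.
have m : measurable_fun setT (fun y : mR * mR => k * y.1).
  by apply: measurable_funM => //; exact: measurable_fst.
have v := vshift_mpres m.
exact: (mpres_comp (swap23_mpres R) (mpres_comp v (swap23_mpres R))).
Qed.

Lemma shear1_mpres k : mpres leb3 (shear1 k).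
Proof. exact: (mpres_comp (swap12_mpres R) (mpres_comp (shear2_mpres k) (swap12_mpres R))). Qed.

(** A rotation is a product of three shears, the outer two with coefficient [- t],
    [t = tan (a / 2)]. Small angles suffice, since only derivatives at angle 0 are taken. *)
Lemma rot3_mpres a : 0 < 1 + cos a -> mpres leb3 (rot3 a).
Proof.
move=> c0; pose t := sin a / (1 + cos a).
have t1 : t * (1 + cos a) = sin a by rewrite divfK// gt_eqF.
have t2 : 1 - t * sin a = cos a.
  have h : (1 + cos a) * (1 - t * sin a) = (1 + cos a) * cos a.
    by have := cos2Dsin2 a; rewrite mulrBr mulrA [_ * t]mulrC t1 => h; lra.
  by apply: (mulfI _ h); rewrite gt_eqF.
have -> : rot3 a = shear1 (- t) \o (shear2 (sin a) \o shear1 (- t)).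
  apply/funext => x; rewrite /rot3 /shear1 /shear2 /=; congr (_, _, _).
        have t3 : sin a = t + t * cos a by rewrite -t1; ring.
    transitivity ((1 - t * sin a) * x.1.1 - (t + t * (1 - t * sin a)) * x.1.2); last by ring.
    by rewrite t2 -t3.

  by rewrite -[X in _ + X * _]t2; ring.
exact: mpres_comp (shear1_mpres _) (mpres_comp (shear2_mpres _) (shear1_mpres _)).
Qed.

Lemma nsq_rot a x : nsq (rot3 a x) = nsq x.
Proof. by rewrite /nsq /rot3/=; have := cos2Dsin2 a; move: (cos a) (sin a) => c s h; rewrite -[x.1.1 ^+ 2]mul1r -[x.1.2 ^+ 2]mul1r -h; ring. Qed.

Lemma rho2_rot a x : rho2 (rot3 a x) = rho2 x.
Proof. by rewrite /rho2 /rot3/=; have := cos2Dsin2 a; move: (cos a) (sin a) => c s h; rewrite -[x.1.1 ^+ 2]mul1r -[x.1.2 ^+ 2]mul1r -h; ring. Qed.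

Lemma rot3K a x : rot3 (- a) (rot3 a x) = x.
Proof.
rewrite /rot3/= cosN sinN; case: x => [[x1 x2] x3] /=; have := cos2Dsin2 a; move: (cos a) (sin a) => c s h.
by congr (_, _, _); [rewrite -[RHS]mul1r -h; ring|rewrite -[RHS]mul1r -h; ring].
Qed.

Lemma norm3_rot a x : norm3 (rot3 a x) = norm3 x.
Proof. by rewrite /norm3 -!/(nsq _) nsq_rot. Qed.

Lemma Ball3_rot a r x : Ball3 r (rot3 a x) <-> Ball3 r x.
Proof. by rewrite /Ball3/= norm3_rot. Qed.

(** [wt i] is the weight of the circle action on the real coordinate [i], and [Jc i] is that
    coordinate after multiplication of both complex factors by the imaginary unit; [wt i * Jc i] is
    the infinitesimal action. *)
Definition wt i : R := nth 0 [:: 0; 1; 1; 2; 2] i.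
Definition Jc i (y : RCC R) : R :=
  nth 0 [:: 0; - complex.Im y.1.2; complex.Re y.1.2; - complex.Im y.2; complex.Re y.2] i.

Lemma coord5_rot i a (y : RCC R) :
  coord5 i (rot5 a y) = cos (wt i * a) * coord5 i y + sin (wt i * a) * Jc i y.
Proof.
case: y => [[t [a1 b1]] [a2 b2]]; case: i => [[|[|[|[|[|//]]]]] hi];
 rewrite /coord5 /wt /Jc !(tnth_nth 0) /= ?mul0r ?cos0 ?sin0 ?mul1r; ring.
Qed.

(** The derivative along the rotations [rot3 (- a)]: the angle changes sign when a rotation is moved
    from the map to the test function. *)
Definition angular phi x : R := x.1.2 * partial (ord0_3) phi x - x.1.1 * partial (ord1_3) phi x.

Lemma rot_curve phi x (a : R) : smooth_on setT phi ->
  is_derive a 1 (fun a => phi (rot3 (- a) x)) (angular phi (rot3 (- a) x)).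
Proof.
move=> s.
have dc : is_derive a 1 (fun a : R => cos (- a)) (sin (- a)).
  by rewrite sinN; under eq_fun do rewrite cosN; exact: is_derive_cos.
have ds : is_derive a 1 (fun a : R => sin (- a)) (- cos (- a)).
  rewrite cosN; under eq_fun do rewrite sinN; exact: is_deriveN.
have d1 : is_derive a 1 (fun a : R => cos (- a) * x.1.1 - sin (- a) * x.1.2) (rot3 (- a) x).1.2.
  have := is_deriveB (is_deriveM dc (@is_derive_cst _ _ _ x.1.1 a 1)) (is_deriveM ds (@is_derive_cst _ _ _ x.1.2 a 1)).
  by congr is_derive; rewrite !scalE /rot3/= /cst/=; ring.
have d2 : is_derive a 1 (fun a : R => sin (- a) * x.1.1 + cos (- a) * x.1.2) (- (rot3 (- a) x).1.1).
  have := is_deriveD (is_deriveM ds (@is_derive_cst _ _ _ x.1.1 a 1)) (is_deriveM dc (@is_derive_cst _ _ _ x.1.2 a 1)).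
  by congr is_derive; rewrite !scalE /rot3/= /cst/=; ring.
have d3 := @is_derive_cst _ _ _ x.2 a (1 : R).
have := is_derive_curve (smooth_c1_near openT s I) d1 d2 d3.
congr is_derive; rewrite /angular /rot3 /=; rewrite mulr0 addr0 [_ * partial ord0_3 _ _]mulrC -[(_, _, _)]/(rot3 (- a) x).
by move: (partial _ _ _) (partial _ _ _) => p q; ring.
Qed.

Lemma testB Om phi psi : test_fun Om phi -> test_fun Om psi -> test_fun Om (fun x => phi x - psi x).
Proof.
move=> [s1 c1 o1] [s2 c2 o2].
have sub : supp (fun x => phi x - psi x) `<=` supp phi `|` supp psi.
  rewrite /supp -closureU; apply: closureS => x /= h.
  have [h1|h1] := eqVneq (phi x) 0; last by left.
  by right; move: h; rewrite h1 sub0r oppr_eq0.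
split; first exact: smoothB openT s1 s2.
- by apply: (subclosed_compact _ (compactU c1 c2) sub); exact: closed_closure.
- by move=> x /sub[/o1|/o2].
Qed.

Lemma angular_test Om phi : test_fun Om phi -> test_fun Om (angular phi).
Proof.
move=> t; have [s1 s2 _] := @smooth_coord R setT openT.
exact: testB (testM (test_partial _ t) s2) (testM (test_partial _ t) s1).
Qed.

(** A sequence of parameters in []0, 1[] tending to 0; as angles they satisfy the hypothesis of
    [rot3_mpres]. *)
Definition harm n : R := n.+2%:R^-1.
Lemma harm_gt0 n : 0 < harm n. Proof. by rewrite invr_gt0 ltr0n. Qed.
Lemma harm_lt1 n : harm n < 1. Proof. by rewrite invf_lt1 ?ltr0n// ltr1n. Qed.
Lemma harm_cvg : harm @ \oo --> (0 : R).
Proof. by have := @cvg_harmonic R; rewrite -(cvg_shiftS (fun n => n.+1%:R^-1 : R)). Qed.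

Lemma harm_rot n : 0 < 1 + cos (harm n).
Proof.
have h : 0 < cos (harm n).
  apply: cos_gt0_pihalf; have := @pi_ge2 R; have := harm_gt0 n; have := harm_lt1 n => h1 h2 h3.
  by apply/andP; split; [|]; rewrite ?ltr_pdivlMr//; lra.
lra.
Qed.

Lemma harm_quotient (P : R -> R) d : is_derive (0 : R) 1 P d -> P 0 = 0 ->
  (fun n => P (harm n) / harm n) @ \oo --> d.
Proof.
move=> /quotient_is_derive h P0.
have c : harm @ \oo --> 0^'.
  move=> A [e /= e0 H]; have /cvgrPdist_lt/(_ e e0) := harm_cvg.
  apply: filterS => n /= hn; apply: H => //; by rewrite gt_eqF// harm_gt0.
have <- : (fun h : R => h^-1 * (P (0 + h) - P 0)) \o harm = (fun n => P (harm n) / harm n).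
  by apply/funext => n /=; rewrite add0r P0 subr0 mulrC.
exact: (cvg_comp _ _ c h).
Qed.

Lemma lip_theta phi C x : smooth_on setT phi -> (forall x, `|angular phi x| <= C) ->
  forall a, `|phi (rot3 (- a) x) - phi x| <= C * `|a|.
Proof.
move=> s H a.
have d (y : R) : is_derive y 1 (fun a => phi (rot3 (- a) x) - phi x) (angular phi (rot3 (- y) x)).
  by have := is_deriveB (rot_curve x y s) (@is_derive_cst _ _ _ (phi x) y 1); rewrite subr0.
apply: (lip_bound d); last by move=> y; exact: H.
by rewrite oppr0 /rot3 cos0 sin0 !mul1r !mul0r subr0 add0r; case: (x) => [[? ?] ?]; rewrite subrr.
Qed.

Variables (r : R) (w : R3 R -> RCC R).
Hypotheses (r0 : 0 < r) (ew : ae_equivariant_on (Ball3 r) w)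
  (sw : forall i, square_integrable (Ball3 r) (comp5 i w)).

Let mB := meas_Ball3 r.
Let oB := @open_Ball3 R r.

Lemma w_intg i : intg leb3 (Ball3 r) (comp5 i w).
Proof. by have [m h] := sw i; exact: sqr_intg_intg. Qed.

Lemma Jc_coord i : exists (k : 'I_5) (c : R), forall y, Jc i y = c * coord5 k y.
Proof.
have e (y : RCC R) := (tnth_nth (0 : R) [tuple y.1.1; complex.Re y.1.2; complex.Im y.1.2; complex.Re y.2; complex.Im y.2]).
case: i => [[|[|[|[|[|//]]]]] hi]; rewrite /Jc /coord5 /=.
- by exists ord0, 0 => y; rewrite mul0r.
- by exists ix2, (-1) => y; rewrite e mulN1r.
- by exists ix1, 1 => y; rewrite e mul1r.
- by exists ix4, (-1) => y; rewrite e mulN1r.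
- by exists ix3, 1 => y; rewrite e mul1r.
Qed.

Lemma Jw_intg i : intg leb3 (Ball3 r) (fun x => Jc i (w x)).
Proof.
have [k [c H]] := Jc_coord i.
have := intgZ c mB (w_intg k); apply: eq_intg => // x _; by rewrite H.
Qed.

Lemma rot_test phi i n : test_fun (Ball3 r) phi ->
  \int[leb3]_(x in Ball3 r) (comp5 i w x * ((phi (rot3 (- harm n) x) - phi x) / harm n)) =
  (cos (wt i * harm n) - 1) / harm n * \int[leb3]_(x in Ball3 r) (comp5 i w x * phi x) +
  sin (wt i * harm n) / harm n * \int[leb3]_(x in Ball3 r) (Jc i (w x) * phi x).
Proof.
move=> t; have [s _ _] := t; have sm := smooth_meas s.
have [C [C0 bphi]] := test_bounded t.
have mr := rot3_mpres (harm_rot n); set a := harm n in mr *.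
have mr' : measurable_fun setT (fun x : T3 => phi (rot3 (- a) x)).
  apply: (cont_measurable3 openT) => x _.
  have c1 : {for x, continuous (rot3 (- a) : R3 R -> R3 R)}.
    have [c1 c2 c3] := cont_coord x.
    apply: cont_pair => //; apply: cont_pair.
      by apply: cvgB; apply: cvgM => //; exact: cvg_cst.
    by apply: cvgD; apply: cvgM => //; exact: cvg_cst.
  by apply: (continuous_comp c1); exact: smooth_cont s I.
have iw := w_intg i; have mw := intg_meas iw.
have mB' q : measurable_fun setT q -> measurable_fun (Ball3 r : set T3) (q : T3 -> R).
  by move=> mq; exact: measurable_funTS.
have i1 : intg leb3 (Ball3 r) (fun x => comp5 i w x * phi (rot3 (- a) x)).
  have := @intgMl _ _ _ leb3 (Ball3 r) C (fun x => phi (rot3 (- a) x)) _ mB (mB' _ mr') (fun x _ => bphi _) iw.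
  by apply: eq_intg => // x _; rewrite mulrC.
have i2 : intg leb3 (Ball3 r) (fun x => comp5 i w x * phi x).
  have := @intgMl _ _ _ leb3 (Ball3 r) C phi _ mB (mB' _ sm) (fun x _ => bphi _) iw.
  by apply: eq_intg => // x _; rewrite mulrC.
have i3 : intg leb3 (Ball3 r) (fun x => Jc i (w x) * phi x).
  have := @intgMl _ _ _ leb3 (Ball3 r) C phi _ mB (mB' _ sm) (fun x _ => bphi _) (Jw_intg i).
  by apply: eq_intg => // x _; rewrite mulrC.
have H : \int[leb3]_(x in Ball3 r) (comp5 i w x * phi (rot3 (- a) x)) =
   cos (wt i * a) * \int[leb3]_(x in Ball3 r) (comp5 i w x * phi x) +
   sin (wt i * a) * \int[leb3]_(x in Ball3 r) (Jc i (w x) * phi x).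
  rewrite -(RintegralZl _ mB i2) -(RintegralZl _ mB i3).
  rewrite -(RintegralD mB (intgZ _ mB i2) (intgZ _ mB i3)).
  rewrite [LHS]Rintegral_mkcond.
  have mQ : measurable_fun setT ((fun x => comp5 i w x * phi (rot3 (- a) x)) \_ (Ball3 r)).
    exact: intg_meas ((intg_mkcond _ _ mB).1 i1).
  rewrite -(mpres_Rint mr mQ) [RHS]Rintegral_mkcond.
  apply: Rint_ae_eq => //.
  - exact: (measurableT_comp mQ mr.1).
  - exact: intg_meas ((intg_mkcond _ _ mB).1 (intgD mB (intgZ _ mB i2) (intgZ _ mB i3))).
  apply: ae_imp (ew a) => x hx _; rewrite !patchE.
  have [Bx|nBx] := pselect (Ball3 r x); last first.
    by rewrite !memNset// => /Ball3_rot.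
  rewrite !mem_set//; last exact/Ball3_rot.
  by rewrite rot3K /comp5 hx// coord5_rot; ring.
have a0 : a != 0 by rewrite gt_eqF// harm_gt0.
transitivity (\int[leb3]_(x in Ball3 r) (a^-1 * (comp5 i w x * phi (rot3 (- a) x) - comp5 i w x * phi x))).
  by apply: eq_Rintegral => x _; ring.
rewrite RintegralZl//; last exact: intgB.
rewrite RintegralB// H; move: (Rintegral _ _ _) (Rintegral _ _ _) => p q; ring.
Qed.

(** The exceptional null set depends on the angle, so equivariance cannot be differentiated
    pointwise. The rotation is moved to the smooth test function instead, and the difference
    quotients along [harm] converge dominatedly. *)
Lemma rot_derivative phi i : test_fun (Ball3 r) phi ->
  \int[leb3]_(x in Ball3 r) (comp5 i w x * angular phi x) =
  wt i * \int[leb3]_(x in Ball3 r) (Jc i (w x) * phi x).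
Proof.
move=> t; have [s _ _] := t; have ta := angular_test t; have [sa _ _] := ta.
have [C [C0 bth]] := test_bounded ta.
have iw := w_intg i; have mw := intg_meas iw.
have L1 : (fun n => \int[leb3]_(x in Ball3 r) (comp5 i w x * ((phi (rot3 (- harm n) x) - phi x) / harm n))) @ \oo -->
    \int[leb3]_(x in Ball3 r) (comp5 i w x * angular phi x).
  apply: (@Rint_dct _ _ _ leb3 (Ball3 r) _ _ (fun x => C * `|comp5 i w x|)) => //.
  - move=> n; apply: measurable_funM => //; apply: measurable_funTS.
    apply: (cont_measurable3 openT) => x _; apply: cvgM; last exact: cvg_cst.
    apply: cvgB; last exact: smooth_cont s I.
    have c1 : {for x, continuous (rot3 (- harm n) : R3 R -> R3 R)}.
      have [c1 c2 c3] := cont_coord x.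
      apply: cont_pair => //; apply: cont_pair.
        by apply: cvgB; apply: cvgM => //; exact: cvg_cst.
      by apply: cvgD; apply: cvgM => //; exact: cvg_cst.
    by apply: (continuous_comp c1); exact: smooth_cont s I.
  - by apply: measurable_funM => //; apply: measurable_funTS; exact: smooth_meas sa.
  - apply: aeW => x _; apply: cvgM; first exact: cvg_cst.
    have d : is_derive (0 : R) 1 (fun a => phi (rot3 (- a) x) - phi x) (angular phi (rot3 (- 0) x)).
      by have := is_deriveB (rot_curve x 0 s) (@is_derive_cst _ _ _ (phi x) (0 : R) 1); rewrite subr0.
    have r00 : rot3 (- 0) x = x.
      by rewrite oppr0 /rot3 cos0 sin0 !mul1r !mul0r subr0 add0r; case: (x) => [[? ?] ?].
    by have := harm_quotient d; rewrite r00 subrr; exact.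
  - exact/intgZ/intg_abs.
  - apply: aeW => x n _; rewrite normrM mulrC ler_wpM2r// normrM normfV [`|harm n|]gtr0_norm ?harm_gt0//.
    by rewrite ler_pdivrMr ?harm_gt0//; have := lip_theta x s bth (harm n); rewrite [`|harm n|]gtr0_norm ?harm_gt0.
have dlin : is_derive (0 : R) 1 (fun a => wt i * a) (wt i).
  by have := is_deriveM (@is_derive_cst _ _ _ (wt i) (0 : R) 1) (@is_derive_id _ _ (0 : R) 1); rewrite !scalE mulr1 mulr0 addr0.
have dc : is_derive (0 : R) 1 (fun a => cos (wt i * a) - 1) 0.
  have := is_deriveB (is_derive_comp1 dlin (is_derive_cos (wt i * 0))) (@is_derive_cst _ _ _ (1 : R) (0 : R) 1).
  by congr is_derive; rewrite mulr0 sin0; ring.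
have ds : is_derive (0 : R) 1 (fun a => sin (wt i * a)) (wt i).
  by have := is_derive_comp1 dlin (is_derive_sin (wt i * 0)); rewrite mulr0 cos0 mul1r.
have L2 := cvgD (cvgM (harm_quotient dc _) (@cvg_cst _ (\int[leb3]_(x in Ball3 r) (comp5 i w x * phi x)) _ \oo _))
  (cvgM (harm_quotient ds _) (@cvg_cst _ (\int[leb3]_(x in Ball3 r) (Jc i (w x) * phi x)) _ \oo _)).
have z1 : cos (wt i * 0) - 1 = 0 by rewrite mulr0 cos0 subrr.
have z2 : sin (wt i * 0) = 0 by rewrite mulr0 sin0.
have L3 := L2 _ _ z1 _ _ z2 _; rewrite mul0r add0r in L3.
apply: (cvg_unique _ L1) => //.
rewrite (_ : (fun n => \int[leb3]_(x in Ball3 r) (comp5 i w x * ((phi (rot3 (- harm n) x) - phi x) / harm n))) =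
  (fun n : nat => (cos (wt i * harm n) - 1) / harm n) \*
   (fun=> \int[leb3]_(x in Ball3 r) (comp5 i w x * phi x)) +
   (fun n : nat => sin (wt i * harm n) / harm n) \*
   (fun=> \int[leb3]_(x in Ball3 r) (Jc i (w x) * phi x))); first exact: L3.
by apply/funext => n; rewrite rot_test.
Qed.

Lemma inf_equivariance i g1 g2 :
  is_weak_partial (Ball3 r) ord0_3 (comp5 i w) g1 -> square_integrable (Ball3 r) g1 ->
  is_weak_partial (Ball3 r) ord1_3 (comp5 i w) g2 -> square_integrable (Ball3 r) g2 ->
  {ae leb3, forall x, Ball3 r x -> x.1.1 * g2 x - x.1.2 * g1 x = wt i * Jc i (w x)}.
Proof.
move=> [lw lg1 H1] [mg1 sg1] [_ lg2 H2] [mg2 sg2].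
have j1 := sqr_intg_intg mg1 sg1; have j2 := sqr_intg_intg mg2 sg2.
have [s1 s2 _] := @smooth_coord R setT openT.
have bd x : Ball3 r x -> `|x.1.1| <= r /\ `|x.1.2| <= r.
  move=> /Ball3E -/(_ r0) /ltW h; have [] := nsq_bound (ltW r0) h; by [].
have k1 : intg leb3 (Ball3 r) (fun x => x.1.2 * g1 x).
  by apply: (@intgMl _ _ _ _ _ r) => //; [exact: (measurable_funTS (@meas_x2 R))|move=> x /bd[]].
have k2 : intg leb3 (Ball3 r) (fun x => x.1.1 * g2 x).
  by apply: (@intgMl _ _ _ _ _ r) => //; [exact: (measurable_funTS (@meas_x1 R))|move=> x /bd[]].
have k3 : intg leb3 (Ball3 r) (fun x => wt i * Jc i (w x)) by exact/intgZ/Jw_intg.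
have k := intgB mB (intgB mB k2 k1) k3.
have : {ae leb3, forall x, Ball3 r x -> x.1.1 * g2 x - x.1.2 * g1 x - wt i * Jc i (w x) = 0}; last first.
  by apply: ae_imp => x h /h /eqP; rewrite subr_eq0 => /eqP.
apply: dbr_ball => //; first exact: intg_locint.
move=> phi t; have [s _ _] := t.
have [C [C0 bphi]] := test_bounded t; have sm := smooth_meas s.
have bm q : intg leb3 (Ball3 r) q -> intg leb3 (Ball3 r) (fun x => q x * phi x).
  by move=> iq; exact: locint_test oB (intg_locint oB iq) t.
have E0 : \int[leb3]_(x in Ball3 r) ((x.1.1 * g2 x - x.1.2 * g1 x - wt i * Jc i (w x)) * phi x) =
  \int[leb3]_(x in Ball3 r) (x.1.1 * g2 x * phi x) - \int[leb3]_(x in Ball3 r) (x.1.2 * g1 x * phi x)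
  - \int[leb3]_(x in Ball3 r) (wt i * Jc i (w x) * phi x).
  rewrite -(RintegralB mB (bm _ k2) (bm _ k1)) -RintegralB//.
  - by apply: eq_Rintegral => x _; ring.
  - by apply: intgB => //; exact: bm.
  - exact: bm.
have E3 : \int[leb3]_(x in Ball3 r) (wt i * Jc i (w x) * phi x) = \int[leb3]_(x in Ball3 r) (comp5 i w x * angular phi x).
  rewrite (rot_derivative i t) -(RintegralZl _ mB (bm _ (Jw_intg i))).
  by apply: eq_Rintegral => x _; ring.
have t1 : test_fun (Ball3 r) (fun x => x.1.2 * phi x) by exact: testM.
have t2 : test_fun (Ball3 r) (fun x => x.1.1 * phi x) by exact: testM.
have P1 x : partial ord0_3 (fun x => x.1.2 * phi x) x = x.1.2 * partial ord0_3 phi x.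
  have [_ d2 _] := is_derive_coord x ord0_3.
  have [_] := is_deriveM d2 (smooth_derivable (x := x) ord0_3 s I).
  by rewrite /partial => ->; rewrite !scalE mulr0 addr0.
have P2 x : partial ord1_3 (fun x => x.1.1 * phi x) x = x.1.1 * partial ord1_3 phi x.
  have [d1 _ _] := is_derive_coord x ord1_3.
  have [_] := is_deriveM d1 (smooth_derivable (x := x) ord1_3 s I).
  by rewrite /partial => ->; rewrite !scalE mulr0 addr0.
have F1 := H1 _ t1; have F2 := H2 _ t2.
have Q : \int[leb3]_(x in Ball3 r) (comp5 i w x * angular phi x) =
  \int[leb3]_(x in Ball3 r) (comp5 i w x * partial ord0_3 (fun x => x.1.2 * phi x) x) -
  \int[leb3]_(x in Ball3 r) (comp5 i w x * partial ord1_3 (fun x => x.1.1 * phi x) x).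
  rewrite -RintegralB//; try exact: locint_test oB lw (test_partial _ _).
  by apply: eq_Rintegral => x _; rewrite P1 P2 /angular mulrBr.
have G1 : \int[leb3]_(x in Ball3 r) (x.1.2 * g1 x * phi x) = \int[leb3]_(x in Ball3 r) (g1 x * (x.1.2 * phi x)).
  by apply: eq_Rintegral => x _; rewrite -mulrA mulrCA.
have G2 : \int[leb3]_(x in Ball3 r) (x.1.1 * g2 x * phi x) = \int[leb3]_(x in Ball3 r) (g2 x * (x.1.1 * phi x)).
  by apply: eq_Rintegral => x _; rewrite -mulrA mulrCA.
rewrite E0 E3 Q F1 F2 G1 G2.
by move: (Rintegral _ _ _) (Rintegral _ _ _) => p q; ring.
Qed.

End Rotation.

Section SumIntegral.
Context d (T : measurableType d) (R : realType) (mu : {measure set T -> \bar R}).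
Lemma Rint_sum (D : set T) (I : Type) (s : seq I) (F : I -> T -> R) : measurable D ->
  (forall i, intg mu D (F i)) ->
  \int[mu]_(x in D) (\sum_(i <- s) F i x) = \sum_(i <- s) \int[mu]_(x in D) F i x.
Proof.
move=> mD h; elim: s => [|i s IH].
  rewrite big_nil; under eq_Rintegral do rewrite big_nil.
  by rewrite /Rintegral integral0.
rewrite big_cons -IH -(RintegralD mD (h i) (intg_sum s mD h)).
by apply: eq_Rintegral => x _; rewrite big_cons.
Qed.
End SumIntegral.

(** * The functions of the first coordinate used by the calibration *)

Section Primitives.
Variable R : realType.
Local Notation lam := (@lebesgue_measure R).

Definition clamp (s : R) : R := Num.max (- 1) (Num.min s 1).
(** [s ^+ 2] on [[-1, 1]], the range of a coordinate of a sphere-valued map, continued linearly so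
    that the derivative [2 * clamp s] is bounded, as [chain_rule] demands. *)
Definition huber (s : R) : R :=
  if s < - 1 then - 2 * s - 1 else if 1 < s then 2 * s - 1 else s ^+ 2.

Lemma clampE (s : R) : clamp s = if s < - 1 then - 1 else if 1 < s then 1 else s.
Proof. by rewrite /clamp /Order.max /Order.min; case: (ltP s (-1)) => h1; case: (ltP 1 s) => h2; case: (ltP s 1) => h3; case: ltP; lra. Qed.

Lemma clamp_id (s : R) : `|s| <= 1 -> clamp s = s.
Proof. by rewrite ler_norml clampE => /andP[h1 h2]; rewrite !ltNge h1 h2. Qed.

Lemma huber_sqr (s : R) : `|s| <= 1 -> huber s = s ^+ 2.
Proof. by rewrite ler_norml /huber => /andP[h1 h2]; rewrite !ltNge h1 h2. Qed.

Lemma clamp_bound (s : R) : `|clamp s| <= 1.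
Proof. by rewrite clampE ler_norml; case: (ltP s (-1)) => h1; [|case: (ltP 1 s) => h2]; apply/andP; split; lra. Qed.

Lemma huber_derive (s : R) : is_derive s 1 huber (2 * clamp s).
Proof.
apply: (@is_derive_quad R _ _ _ 1) => h; rewrite mul1r clampE /huber ler_norml.
case: (ltP s (-1)) => h1; [|case: (ltP 1 s) => h2];
  (case: (ltP (s + h) (-1)) => h3; [|case: (ltP 1 (s + h)) => h4]); apply/andP; split; nra.
Qed.

Lemma clamp_cont : continuous (fun s => 2 * clamp s).
Proof.
move=> s; apply: cvgM; first exact: cvg_cst.
have c1 : {for s, continuous (fun=> - 1 : R)} by exact: cvg_cst.
have c2 : {for s, continuous (fun s : R => Num.min s 1)}.
  by apply: continuous_min; [exact: cvg_id|exact: cvg_cst].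
exact: (continuous_max c1 c2).
Qed.

(** The square root of [1 - s ^+ 2], continued by 0. The calibration integrates it through its
    primitive [arcint]. *)
Definition arcden (s : R) : R := Num.sqrt (Num.max 0 (1 - s ^+ 2)).

Lemma arcden_cont : continuous arcden.
Proof.
move=> s; apply: (@continuous_comp _ _ _ (fun s : R => Num.max 0 (1 - s ^+ 2)) (@Num.sqrt R)); last exact: sqrt_continuous.
apply: continuous_max; first exact: cvg_cst.
by apply: cvgB; [exact: cvg_cst|exact: exprn_continuous].
Qed.

Lemma arcden_out (s : R) : 1 <= `|s| -> arcden s = 0.
Proof.
move=> h; rewrite /arcden (max_l _) ?sqrtr0// subr_le0 -(real_normK (num_real s)).
by rewrite -[1](expr1n _ 2) ler_pXn2r ?nnegrE.
Qed.

Lemma arcden_in (s : R) : `|s| <= 1 -> arcden s = Num.sqrt (1 - s ^+ 2).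
Proof.
move=> h; rewrite /arcden (max_r _)// subr_ge0 -(real_normK (num_real s)).
by rewrite -[X in _ <= X](expr1n _ 2) ler_pXn2r ?nnegrE.
Qed.

Lemma arcden_bound (s : R) : `|arcden s| <= 1.
Proof.
rewrite ger0_norm ?sqrtr_ge0// -[X in _ <= X]sqrtr1 ler_sqrt ?ltr01// ge_max ler01/=.
by rewrite gerBl sqr_ge0.
Qed.

(** The base point lies strictly below [-1], so the fundamental theorem covers a neighbourhood of
    [[-1, 1]]; further below the integrand vanishes. *)
Definition arcint0 (s : R) : R := \int[lam]_(t in (`[- 2, s]%classic : set R)) arcden t.
Definition arcint (s : R) : R := arcint0 s - arcint0 0.

Lemma arcint00 : arcint 0 = 0. Proof. by rewrite /arcint subrr. Qed.

Lemma arcint_derive (s : R) : is_derive s 1 arcint (arcden s).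
Proof.
suff h : is_derive s 1 arcint0 (arcden s).
  by have := is_deriveB h (@is_derive_cst _ _ _ (arcint0 0) s 1); rewrite subr0.
have [s2|s2] := ltP s (- 3 / 2).
  rewrite arcden_out; last by rewrite ltr0_norm; lra.
  apply: (near_is_derive _ (@is_derive_cst _ _ _ (0 : R) s 1)).
  near=> t; have t1 : t < - 1 by near: t; apply: lt_nbhsl; lra.
  rewrite /arcint0 /cst (_ : 0 = \int[lam]_(t in (`[- 2, t]%classic : set R)) 0); last by rewrite /Rintegral integral0.
  apply: eq_Rintegral => z; rewrite inE/= in_itv/= => /andP[_ zt].
  by rewrite arcden_out// ltr0_norm; lra.
have i : lam.-integrable `[- 2, s + 1]%classic (EFin \o arcden).
  apply: continuous_compact_integrable; first exact: segment_compact.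
  by apply: continuous_subspaceT; exact: arcden_cont.
have h1 : s < s + 1 by lra.
have h2 : - 2 < s by lra.
have [d1 d2] := @continuous_FTC1 R arcden (BLeft (- 2)) s (s + 1) h1 i h2 (@arcden_cont s).
by apply: (DeriveDef d1); rewrite -derive1E d2.
Unshelve. all: by end_near. Qed.
End Primitives.

(** * Calibration of the model map *)

Section Calibration.
Variable R : realType.
Local Notation mR := (measurableTypeR R).
Local Notation leb3 := (leb3 R).
Local Notation T3 := (mR * mR * mR)%type.
Implicit Types (x : R3 R) (i : 'I_5) (j : 'I_3).

Lemma sphere_sum (y : RCC R) : Sphere4 y -> \sum_(i < 5) coord5 i y ^+ 2 = 1.
Proof.
rewrite /Sphere4/= /norm5 => h.
by rewrite -[LHS]sqr_sqrtr ?h ?expr1n// sumr_ge0// => i _; exact: sqr_ge0.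
Qed.

Lemma coord5_le1 (y : RCC R) i : Sphere4 y -> `|coord5 i y| <= 1.
Proof.
move=> /sphere_sum; rewrite (bigD1 i)//= => h; apply: sqr_le_norm => //.
by rewrite expr1n -h lerDl sumr_ge0// => k _; exact: sqr_ge0.
Qed.

Lemma test_int0 r j phi : 0 < r -> test_fun (Ball3 r) phi -> \int[leb3]_(x in Ball3 r) partial j phi x = 0.
Proof.
move=> r0 t.
have pd0 k x : pd k (fun=> 1 : R) x = 0.
  by rewrite /pd; case: ifP => // _; have [_] := @is_derive_cst _ _ _ (1 : R) x (basis3 R k).
have c1 : c1off (fun=> 1 : R).
  move=> x ox; split; first exact: cvg_cst.
  move=> k; split; first by have [h _] := @is_derive_cst _ _ _ (1 : R) x (basis3 R k).
  rewrite (_ : partial k (fun=> 1) = fun=> 0); first exact: cvg_cst.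
  by apply/funext => y; have [_] := @is_derive_cst _ _ _ (1 : R) y (basis3 R k).
have ip : intg leb3 (Ball3 r) (pd j (fun=> 1 : R)).
  by rewrite (_ : pd j (fun=> 1) = fun=> 0); [exact: intg0|apply/funext => x; exact: pd0].
have b1 x : `|(fun=> 1 : R) x : R| <= 1 by rewrite normr1.
have [_ _ H] := @weak_partial_c1off R r j (fun=> 1) 1 r0 (measurable_cst _) b1 c1 ip.
have := H _ t; under eq_Rintegral do rewrite mul1r.
move=> ->; rewrite (_ : \int[leb3]_(x in _) _ = \int[leb3]_(x in Ball3 r) (0 : R)); first by rewrite /Rintegral integral0 oppr0.
by apply: eq_Rintegral => x _; rewrite pd0 mul0r.
Qed.

(** What the calibration uses of a map, with a weak gradient [g] fixed once and for all. *)
Record admissible r (v : R3 R -> RCC R) (g : 'I_5 -> 'I_3 -> R3 R -> R) : Prop := Admissible {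
  adm_weak : forall i j, is_weak_partial (Ball3 r) j (comp5 i v) (g i j);
  adm_sqr : forall i j, square_integrable (Ball3 r) (g i j);
  adm_map : forall i, square_integrable (Ball3 r) (comp5 i v);
  adm_sphere : {ae leb3, forall x, Ball3 r x -> Sphere4 (v x)};
  adm_equiv : ae_equivariant_on (Ball3 r) v }.

Lemma cauchy4 (y1 y2 y3 y4 r1 r2 r3 r4 : R) :
  (y1 * r1 + y2 * r2 + y3 * r3 + y4 * r4) ^+ 2 <=
  (y1 ^+ 2 + y2 ^+ 2 + y3 ^+ 2 + y4 ^+ 2) * (r1 ^+ 2 + r2 ^+ 2 + r3 ^+ 2 + r4 ^+ 2).
Proof.
rewrite -subr_ge0 (_ : _ - _ = (y1 * r2 - y2 * r1) ^+ 2 + (y1 * r3 - y3 * r1) ^+ 2 + (y1 * r4 - y4 * r1) ^+ 2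
  + (y2 * r3 - y3 * r2) ^+ 2 + (y2 * r4 - y4 * r2) ^+ 2 + (y3 * r4 - y4 * r3) ^+ 2); last by ring.
by rewrite !addr_ge0// sqr_ge0.
Qed.

(** The projection of the first basis vector to the tangent space at [y] has length [q]. In
    coordinates: Cauchy-Schwarz for the last four ones, together with [r0 ^+ 2 = y0 ^+ 2 * r0 ^+ 2 +
    q ^+ 2 * r0 ^+ 2]. *)
Lemma tangent_bound (y0 y1 y2 y3 y4 r0 r1 r2 r3 r4 q : R) : 0 <= q -> q ^+ 2 = 1 - y0 ^+ 2 ->
  y0 ^+ 2 + y1 ^+ 2 + y2 ^+ 2 + y3 ^+ 2 + y4 ^+ 2 = 1 ->
  y0 * r0 + y1 * r1 + y2 * r2 + y3 * r3 + y4 * r4 = 0 ->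
  `|r0| <= q * Num.sqrt (r0 ^+ 2 + r1 ^+ 2 + r2 ^+ 2 + r3 ^+ 2 + r4 ^+ 2).
Proof.
move=> q0 qE Y T; set S := r0 ^+ 2 + _ + _ + _ + _.
have S0 : 0 <= S by rewrite !addr_ge0// sqr_ge0.
have h := cauchy4 y1 y2 y3 y4 r1 r2 r3 r4.
have e1 : y1 * r1 + y2 * r2 + y3 * r3 + y4 * r4 = - (y0 * r0) by lra.
have e2 : y1 ^+ 2 + y2 ^+ 2 + y3 ^+ 2 + y4 ^+ 2 = q ^+ 2 by lra.
have e3 : r1 ^+ 2 + r2 ^+ 2 + r3 ^+ 2 + r4 ^+ 2 = S - r0 ^+ 2 by rewrite /S; lra.
move: h; rewrite e1 e2 e3 sqrrN exprMn mulrBr => h.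
apply: sqr_le_norm; first by rewrite mulr_ge0// sqrtr_ge0.
rewrite exprMn sqr_sqrtr//.
have e4 : r0 ^+ 2 = y0 ^+ 2 * r0 ^+ 2 + q ^+ 2 * r0 ^+ 2 by rewrite qE; ring.
lra.
Qed.

(** The gradient is split into its parts radial from the axis, angular and vertical. Equivariance
    makes the angular part at least [q ^+ 2 / rho ^+ 2], as the weights of both complex factors are
    at least 1; [tangent_bound] controls the first coordinate of the other two parts. The first
    conclusion serves to dominate the error made by the cutoff at the axis. *)
Lemma calib_pointwise (x1 x2 rho q sg y0 y1 y2 y3 y4 a0 a1 a2 a3 a4 b0 b1 b2 b3 b4 c0 c1 c2 c3 c4 : R) :
  0 < rho -> rho ^+ 2 = x1 ^+ 2 + x2 ^+ 2 -> 0 <= q -> q ^+ 2 = 1 - y0 ^+ 2 -> `|sg| = 1 ->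
  y0 ^+ 2 + y1 ^+ 2 + y2 ^+ 2 + y3 ^+ 2 + y4 ^+ 2 = 1 ->
  y0 * a0 + y1 * a1 + y2 * a2 + y3 * a3 + y4 * a4 = 0 ->
  y0 * b0 + y1 * b1 + y2 * b2 + y3 * b3 + y4 * b4 = 0 ->
  y0 * c0 + y1 * c1 + y2 * c2 + y3 * c3 + y4 * c4 = 0 ->
  x1 * b1 - x2 * a1 = - y2 -> x1 * b2 - x2 * a2 = y1 ->
  x1 * b3 - x2 * a3 = - 2 * y4 -> x1 * b4 - x2 * a4 = 2 * y3 ->
  let G := a0 ^+ 2 + b0 ^+ 2 + c0 ^+ 2 + (a1 ^+ 2 + b1 ^+ 2 + c1 ^+ 2) + (a2 ^+ 2 + b2 ^+ 2 + c2 ^+ 2)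
     + (a3 ^+ 2 + b3 ^+ 2 + c3 ^+ 2) + (a4 ^+ 2 + b4 ^+ 2 + c4 ^+ 2) in
  (1 - y0 ^+ 2) / rho ^+ 2 <= G /\
  `|- (2 * y0 * a0 * (x1 / rho ^+ 2)) - 2 * y0 * b0 * (x2 / rho ^+ 2) + 2 * sg * q * c0 / rho| <= G.
Proof.
move=> rho0 rhoE q0 qE sg1 Y Ta Tb Tc m1 m2 m3 m4 G.
pose S1 := (x1 * a0 + x2 * b0) ^+ 2 + (x1 * a1 + x2 * b1) ^+ 2 + (x1 * a2 + x2 * b2) ^+ 2
   + (x1 * a3 + x2 * b3) ^+ 2 + (x1 * a4 + x2 * b4) ^+ 2.
pose S3 := c0 ^+ 2 + c1 ^+ 2 + c2 ^+ 2 + c3 ^+ 2 + c4 ^+ 2.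
have S10 : 0 <= S1 by rewrite !addr_ge0// sqr_ge0.
have S30 : 0 <= S3 by rewrite !addr_ge0// sqr_ge0.
have rho20 : 0 < rho ^+ 2 by rewrite exprn_gt0.
have H1 : rho ^+ 2 * G = S1 + (x1 * b0 - x2 * a0) ^+ 2 + (x1 * b1 - x2 * a1) ^+ 2 + (x1 * b2 - x2 * a2) ^+ 2
  + (x1 * b3 - x2 * a3) ^+ 2 + (x1 * b4 - x2 * a4) ^+ 2 + rho ^+ 2 * S3.
  by rewrite rhoE /S1 /S3 /G; ring.
have H2 : S1 + q ^+ 2 + rho ^+ 2 * S3 <= rho ^+ 2 * G.
  rewrite H1 m1 m2 m3 m4; have := sqr_ge0 (x1 * b0 - x2 * a0); have := sqr_ge0 y3; have := sqr_ge0 y4.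
  rewrite sqrrN !exprMn; lra.
have S3' : 0 <= rho ^+ 2 * S3 by rewrite mulr_ge0// ltW.
split; first by rewrite -qE ler_pdivrMr// mulrC; lra.
have B1 : `|x1 * a0 + x2 * b0| <= q * Num.sqrt S1.
  apply: (@tangent_bound y0 y1 y2 y3 y4) => //.
  transitivity (x1 * (y0 * a0 + y1 * a1 + y2 * a2 + y3 * a3 + y4 * a4) + x2 * (y0 * b0 + y1 * b1 + y2 * b2 + y3 * b3 + y4 * b4)).
    by ring.
  by rewrite Ta Tb !mulr0 addr0.
have B3 : `|c0| <= q * Num.sqrt S3 by exact: (@tangent_bound y0 y1 y2 y3 y4).
rewrite -(ler_pM2l rho20) -{1}(gtr0_norm rho20) -normrM.
have -> : rho ^+ 2 * (- (2 * y0 * a0 * (x1 / rho ^+ 2)) - 2 * y0 * b0 * (x2 / rho ^+ 2) + 2 * sg * q * c0 / rho)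
   = - (2 * y0 * (x1 * a0 + x2 * b0)) + 2 * sg * q * rho * c0.
  by field; rewrite gt_eqF.
apply: le_trans H2; apply: le_trans (ler_normD _ _) _.
rewrite normrN !normrM sg1 mulr1 (gtr0_norm rho0) (ger0_norm q0) (ger0_norm (ler0n R 2)).
set A := Num.sqrt S1 in B1; set B := Num.sqrt S3 in B3.
have A2 : A ^+ 2 = S1 by rewrite sqr_sqrtr.
have B2 : B ^+ 2 = S3 by rewrite sqr_sqrtr.
rewrite -A2 -B2.
have C1 : 2 * `|y0| * `|x1 * a0 + x2 * b0| <= 2 * `|y0| * (q * A) by rewrite ler_wpM2l// mulr_ge0.
have C3 : 2 * q * rho * `|c0| <= 2 * q * rho * (q * B) by rewrite ler_wpM2l// !mulr_ge0// ltW.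
have N : `|y0| ^+ 2 = 1 - q ^+ 2 by rewrite real_normK ?num_real// qE; ring.
(* As [|y0| ^+ 2 + q ^+ 2 = 1], the pair [(A, rho * B)] may be rotated, and the difference of the
   two sides becomes the sum of these two squares. *)
have D1 := sqr_ge0 (q - (`|y0| * A + q * (rho * B))).
have D2 := sqr_ge0 (q * A - `|y0| * (rho * B)).
have E : (q - (`|y0| * A + q * (rho * B))) ^+ 2 + (q * A - `|y0| * (rho * B)) ^+ 2 =
   q ^+ 2 + (`|y0| ^+ 2 + q ^+ 2) * (A ^+ 2 + rho ^+ 2 * B ^+ 2) - 2 * `|y0| * (q * A) - 2 * q * rho * (q * B) by ring.
rewrite N subrK mul1r in E; lra.
Qed.

Variables (r : R) (v : R3 R -> RCC R) (g : 'I_5 -> 'I_3 -> R3 R -> R).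
Hypotheses (r0 : 0 < r) (A : admissible r v g).

Let mB := meas_Ball3 r.
Let oB := @open_Ball3 R r.

Lemma g_intg i j : intg leb3 (Ball3 r) (g i j).
Proof. by have [m s] := adm_sqr A i j; exact: sqr_intg_intg. Qed.

Lemma ae_ball_sum (I : finType) (P : I -> R3 R -> Prop) :
  (forall k, {ae leb3, forall x, P k x}) -> {ae leb3, forall x, forall k, P k x}.
Proof.
move=> H; have : {ae leb3, forall x, forall k : I, k \in enum I -> P k x}.
  elim: (enum I) => [|i s IH]; first by apply: aeW.
  have := ae_and (H i) IH; apply: ae_imp => x [h1 h2] k; rewrite inE => /orP[/eqP ->//|]; exact: h2.
by apply: ae_imp => x h i; apply: h; rewrite mem_enum.
Qed.

Lemma huber_test j phi : test_fun (Ball3 r) phi -> forall i,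
  \int[leb3]_(x in Ball3 r) (huber (comp5 i v x) * partial j phi x) =
  - \int[leb3]_(x in Ball3 r) (2 * clamp (comp5 i v x) * g i j x * phi x).
Proof.
move=> t i; have h0 : huber (0 : R) = 0 by rewrite huber_sqr ?normr0 ?ler01// expr0n.
apply: (chain_rule r0 (adm_weak A i j) (@huber_derive R) (@clamp_cont R) h0 _ t (C := 2)).
by move=> y; rewrite normrM ger0_norm// -[X in _ <= X]mulr1 ler_wpM2l// clamp_bound.
Qed.

Lemma arcint_test phi : test_fun (Ball3 r) phi ->
  \int[leb3]_(x in Ball3 r) (arcint (comp5 ord0 v x) * partial ord2 phi x) =
  - \int[leb3]_(x in Ball3 r) (arcden (comp5 ord0 v x) * g ord0 ord2 x * phi x).
Proof.
move=> t; apply: (chain_rule r0 (adm_weak A ord0 ord2) (@arcint_derive R) (@arcden_cont R) (arcint00 R) _ t (C := 1)).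
exact: arcden_bound.
Qed.

Lemma v_meas i : measurable_fun (Ball3 r : set T3) (comp5 i v).
Proof. by have [m _] := adm_map A i. Qed.

Lemma cont_v_meas i (q : R -> R) : continuous q -> measurable_fun (Ball3 r : set T3) (fun x => q (comp5 i v x)).
Proof. by move=> cq; apply: (measurableT_comp (continuous_measurable_fun cq) (v_meas i)). Qed.

Lemma clamp_g_intg i j : intg leb3 (Ball3 r) (fun x => 2 * clamp (comp5 i v x) * g i j x).
Proof.
apply: (@intgMl _ _ _ _ _ 2) => //; last exact: g_intg.
- exact: (cont_v_meas i (@clamp_cont R)).
- by move=> x _; rewrite normrM ger0_norm// -[X in _ <= X]mulr1 ler_wpM2l// clamp_bound.
Qed.

(** The functions [huber (v_i)] sum to 1 almost everywhere, so the weak derivative of the sum, given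
    by the chain rule, vanishes by du Bois-Reymond. *)
Lemma sphere_tangent j : {ae leb3, forall x, Ball3 r x -> \sum_(i < 5) coord5 i (v x) * g i j x = 0}.
Proof.
have H : {ae leb3, forall x, Ball3 r x -> \sum_(i < 5) 2 * clamp (comp5 i v x) * g i j x = 0}.
  apply: dbr_ball => //.
    by apply: intg_locint => //; apply: intg_sum => // i; exact: clamp_g_intg.
  move=> phi t; have tp := test_partial j t.
  have ip := locint_test oB (intg_locint oB (Ball3_intg_cst r 1)) tp.
  have ih i : intg leb3 (Ball3 r) (fun x => huber (comp5 i v x) * partial j phi x).
    have [C [C0 bC]] := test_bounded tp.
    have [m s] := adm_map A i.
    apply: (@intg_le _ T3 _ leb3 (Ball3 r) _ (fun x => C * (comp5 i v x ^+ 2))) => //.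
    - apply: measurable_funM.
        by apply: cont_v_meas => y; exact: (is_derive1_cont (huber_derive y)).
      by apply: measurable_funTS; apply: smooth_meas; case: tp.
    - exact: intgZ.
    - move=> x _; rewrite normrM mulrC ler_pM// /huber ler_norml.
      by case: (ltP (comp5 i v x) (-1)) => h1; [|case: (ltP 1 (comp5 i v x)) => h2]; apply/andP; split; nra.
  transitivity (\sum_(i < 5) \int[leb3]_(x in Ball3 r) (2 * clamp (comp5 i v x) * g i j x * phi x)).
    rewrite -Rint_sum//; last by move=> i; exact: locint_test oB (intg_locint oB (clamp_g_intg i j)) t.
    by apply: eq_Rintegral => x _; rewrite mulr_suml.
  have -> : \sum_(i < 5) \int[leb3]_(x in Ball3 r) (2 * clamp (comp5 i v x) * g i j x * phi x) =
      - \sum_(i < 5) \int[leb3]_(x in Ball3 r) (huber (comp5 i v x) * partial j phi x).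
    by rewrite -sumrN; apply: eq_bigr => i _; rewrite (huber_test j t) opprK.
  rewrite -Rint_sum//; apply/eqP; rewrite oppr_eq0; apply/eqP.
  transitivity (\int[leb3]_(x in Ball3 r) partial j phi x); last exact: (test_int0 j r0 t).
  have ms := intg_sum (index_enum 'I_5) mB ih.
  apply: Rint_ae_eq => //; first exact: intg_meas ms.
    by apply: measurable_funTS; apply: smooth_meas; case: tp.
  apply: ae_imp (adm_sphere A) => x hx Bx; rewrite -mulr_suml.
  rewrite (eq_bigr (fun i => coord5 i (v x) ^+ 2)) ?sphere_sum ?mul1r//; first exact: hx.
  by move=> i _; rewrite huber_sqr//; exact: coord5_le1 (hx Bx).
apply: ae_imp (ae_and H (adm_sphere A)) => x [hx sx] Bx.
have := hx Bx; under eq_bigr do rewrite -mulrA; rewrite -mulr_sumr => /eqP; rewrite mulf_eq0 pnatr_eq0/= => /eqP h.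
rewrite -[RHS]h; apply: eq_bigr => i _; rewrite clamp_id//; exact: coord5_le1 (sx Bx).
Qed.

End Calibration.

(** * Cutoff near the axis *)

Section AxisCutoff.
Variable R : realType.
Implicit Types (x : R3 R) (i : 'I_5) (j : 'I_3) (f h : R3 R -> R).

(** [isq_fam k] is the k-th derivative of the inverse square root; the coefficients are products of
    [- 1 / 2], [- 3 / 2] and so on. *)
Fixpoint isq_coef (k : nat) : R := if k is k'.+1 then - (k'%:R + 2^-1) * isq_coef k' else 1.
Definition isq_fam (k : nat) (y : R) : R := isq_coef k * (Num.sqrt y)^-1 ^+ (k.*2.+1).

Lemma isq_derive (y : R) : 0 < y -> is_derive y 1 (fun y : R => (Num.sqrt y)^-1) (- 2^-1 * (Num.sqrt y)^-1 ^+ 3).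
Proof.
move=> y0; have s0 : Num.sqrt y != 0 by rewrite gt_eqF// sqrtr_gt0.
have := @is_deriveV R (@Num.sqrt R) y (2 * Num.sqrt y)^-1 1 s0 (is_derive1_sqrt y0).
by congr is_derive; rewrite scalE; field.
Qed.

Lemma isq_fam_derive k (y : R) : 0 < y -> is_derive y 1 (isq_fam k) (isq_fam k.+1 y).
Proof.
move=> y0; have d := isq_derive y0; set t := (Num.sqrt y)^-1 in d.
have d1 : is_derive t 1 (fun t : R => t ^+ k.*2.+1) (k.*2.+1%:R * t ^+ k.*2).
  have := is_derive_poly ('X^(k.*2.+1) : {poly R}) t; rewrite derivXn hornerMn hornerXn mulr_natl.
  by congr is_derive; apply/funext => z; rewrite hornerXn.
have := is_deriveM (@is_derive_cst _ _ _ (isq_coef k) y 1) (is_derive_comp1 d d1).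
congr is_derive; rewrite !scalE [X in _ + X]mulr0 addr0 /isq_fam /= doubleS -/t !exprS.
rewrite -[k.*2.+1]addn1 -muln2 natrD natrM; move: (t ^+ (k * 2)%N) => z.
by rewrite /cst; field.
Qed.

Lemma smooth_isq U f : open U -> smooth_on U f -> (forall x, U x -> 0 < f x) ->
  smooth_on U (fun x => (Num.sqrt (f x))^-1).
Proof.
move=> oU s H.
have := @smooth_comp R U [set y | 0 < y] isq_fam f 0 oU (fun k y => @isq_fam_derive k y) s H.
by apply: smooth_ext => // x _; rewrite /isq_fam /= mul1r expr1.
Qed.

Lemma smooth_sqrt U f : open U -> smooth_on U f -> (forall x, U x -> 0 < f x) ->
  smooth_on U (fun x => Num.sqrt (f x)).
Proof.
move=> oU s H; have := smoothM oU s (smooth_isq oU s H).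
apply: smooth_ext => // x Ux; have f0 := H x Ux.
by rewrite -{1}(sqr_sqrtr (ltW f0)) expr2 mulfK// gt_eqF// sqrtr_gt0.
Qed.

Definition axcut (n : nat) x : R := step (n%:R ^+ 2 * rho2 x - 1).

Lemma smooth_axcut n : smooth_on setT (axcut n).
Proof.
apply: (smooth_step openT).
exact: (smoothB openT (smoothM openT (smooth_cst _ openT) (smooth_rho2 openT)) (smooth_cst 1 openT)).
Qed.

Lemma axcut_le1 n x : axcut n x <= 1. Proof. exact: step_le1. Qed.
Lemma axcut_ge0 n x : 0 <= axcut n x. Proof. exact: step_ge0. Qed.

Lemma axcut_cvg x : offaxis x -> axcut ^~ x @ \oo --> (1 : R).
Proof.
move=> /rho2_gt0 h; apply: cvg_near_cst; near=> n.
rewrite /axcut step1// lerBrDr.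
have n1 : 2 / rho2 x + 1 <= n%:R by near: n; exact: nbhs_infty_ger.
have n2 : 2 <= n%:R * rho2 x.
  have : 2 / rho2 x <= n%:R by lra.
  by rewrite ler_pdivrMr.
have i0 : 0 < 2 / rho2 x by rewrite divr_gt0.
have : n%:R * rho2 x <= n%:R ^+ 2 * rho2 x by rewrite ler_wpM2r ?(ltW h)// expr2 ler_peMr//; lra.
lra.
Unshelve. all: by end_near. Qed.

Lemma open_rho2_lt (c : R) : open [set x | rho2 x < c].
Proof.
rewrite (_ : [set x | _] = (@rho2 R) @^-1` [set y | y < c])//.
by apply: open_comp; [move=> x _; exact: rho2_cont|exact: open_lt].
Qed.

Lemma smooth_union U V f : smooth_on U f -> smooth_on V f -> smooth_on (U `|` V) f.
Proof. by move=> hU hV s x [/hU|/hV]; apply. Qed.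

Lemma axcut_smooth n h : (0 < n)%N -> smooth_on (@offaxis R) h -> smooth_on setT (fun x => axcut n x * h x).
Proof.
move=> n0 sh; pose V := [set x : R3 R | rho2 x < (n%:R ^+ 2)^-1].
have n2 : 0 < (n%:R ^+ 2 : R) by rewrite exprn_gt0// ltr0n.
have oV : open V by exact: open_rho2_lt.
have -> : [set: R3 R] = (@offaxis R) `|` V.
  apply/seteqP; split=> // x _; have [h0|h0] := eqVneq (rho2 x) 0; last by left.
  by right; rewrite /V/= h0 invr_gt0.
apply: smooth_union.
  exact: (smoothM (@open_offaxis R) (smooth_sub (@subsetT _ _) (smooth_axcut n)) sh).
apply: (smooth_ext oV _ (smooth_cst 0 oV)) => x; rewrite /V/= => hx.
rewrite /axcut step0 ?mul0r// subr_le0 mulrC -ler_pdivlMr// div1r; exact: ltW.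
Qed.

(** Normalized so that the gradient of [axcut n] is [axcut' n x] times the horizontal part of
    [x]. *)
Definition axcut' n x : R := 2 * n%:R ^+ 2 * step' (n%:R ^+ 2 * rho2 x - 1).

Lemma is_derive_mul (W : normedModType R) (p q : W -> R) (z v : W) (dp dq : R) : is_derive z v p dp ->
  is_derive z v q dq -> is_derive z v (fun y : W => p y * q y) (p z * dq + q z * dp).
Proof. by move=> d1 d2; exact: (is_deriveM d1 d2). Qed.

Lemma is_derive_rho2 x j : is_derive x (basis3 R j) (@rho2 R)
  (2 * x.1.1 * (val j == 0%N)%:R + 2 * x.1.2 * (val j == 1%N)%:R).
Proof.
have [d1 d2 _] := is_derive_coord x j.
have := is_deriveD (is_deriveM d1 d1) (is_deriveM d2 d2).
by congr is_derive; rewrite !scalE; ring.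
Qed.

Lemma is_derive_axcut n x j : is_derive x (basis3 R j) (axcut n)
  (axcut' n x * (x.1.1 * (val j == 0%N)%:R + x.1.2 * (val j == 1%N)%:R)).
Proof.
have d := is_deriveB (is_deriveM (@is_derive_cst _ _ _ (n%:R ^+ 2 : R) x (basis3 R j)) (is_derive_rho2 x j))
  (@is_derive_cst _ _ _ (1 : R) x (basis3 R j)).
have := is_derive_comp1 d (step_derive _).
congr is_derive; rewrite !scalE mulr0 addr0 subr0 /axcut' /=; ring.
Qed.

Lemma is_derive_invrho2 x j : offaxis x -> is_derive x (basis3 R j) (fun x => (rho2 x)^-1)
  (- (rho2 x)^-2 * (2 * x.1.1 * (val j == 0%N)%:R + 2 * x.1.2 * (val j == 1%N)%:R)).
Proof.
move=> ox; have := @is_deriveV R id (rho2 x) 1 1 ox (is_derive_id _ _).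
move=> /(is_derive_comp1 (is_derive_rho2 x j)).
by congr is_derive; rewrite scalE mulr1.
Qed.

(** The field [(x_1, x_2, 0) / rho ^ 2] is divergence free off the axis, so only the derivative of
    the cutoff is left. *)
Lemma axcut_divergence n x : offaxis x ->
  partial ord0_3 (fun x => axcut n x * (x.1.1 / rho2 x)) x +
  partial ord1_3 (fun x => axcut n x * (x.1.2 / rho2 x)) x = axcut' n x.
Proof.
move=> ox; have r0 := rho2_gt0 ox.
have [a1 _ _] := is_derive_coord x ord0_3; have [_ b2 _] := is_derive_coord x ord1_3.
have [_ e0] := is_derive_mul (is_derive_axcut n x ord0_3) (is_derive_mul a1 (is_derive_invrho2 ord0_3 ox)).
have [_ e1] := is_derive_mul (is_derive_axcut n x ord1_3) (is_derive_mul b2 (is_derive_invrho2 ord1_3 ox)).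
rewrite /partial e0 e1 /=.
move: (axcut n x) (axcut' n x) => c c'; rewrite /rho2; case: (x) r0 => [[y1 y2] y3] /=; rewrite /rho2/= => r0.
by field; rewrite gt_eqF.
Qed.

Lemma axcut_vertical n x : offaxis x ->
  partial ord2 (fun x => axcut n x * (Num.sqrt (rho2 x))^-1) x = 0.
Proof.
move=> ox; have r0 := rho2_gt0 ox.
have d := is_derive_comp1 (is_derive_rho2 x ord2) (isq_derive r0).
have [_ e] := is_deriveM (is_derive_axcut n x ord2) d.
by rewrite /partial e !scalE /= !mulr0 !addr0 !mulr0 addr0.
Qed.

(** In the variable [t = n ^ 2 * rho ^ 2] the quantity is [2 * t * step' (t - 1)], and [step']
    vanishes for [t >= 2]; so the bound is uniform in [n]. *)
Lemma axcut'_bound : exists C : R, 0 <= C /\ forall n x, `|rho2 x * axcut' n x| <= C.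
Proof.
have [C [C0 H]] := @step'_bound R.
exists (4 * C); split; first by lra.
move=> n x; rewrite /axcut'; have := rho2_ge0 x; set t := n%:R ^+ 2 * rho2 x => r0.
have -> : rho2 x * (2 * n%:R ^+ 2 * step' (t - 1)) = 2 * t * step' (t - 1) by rewrite /t; ring.
have t0 : 0 <= t by rewrite mulr_ge0// sqr_ge0.
have [h|h] := leP 2 t.
  by rewrite step'1 ?mulr0 ?normr0//; lra.
have := @step'_ge0 R (t - 1); have := H (t - 1) => h1 h2.
rewrite ger0_norm; last by apply: mulr_ge0 => //; apply: mulr_ge0.
nra.
Qed.

Lemma step'_cont : continuous (@step' R).
Proof.
move=> y; have c0 : continuous (@E0 R) by move=> z; exact: (is_derive1_cont (E_derive 0 z)).
have c1 : continuous (@E1 R) by move=> z; exact: (is_derive1_cont (E_derive 1 z)).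
have cs : continuous (fun z : R => 1 - z) by move=> z; apply: cvgB; [exact: cvg_cst|exact: cvg_id].
have c0' : continuous (fun z : R => E0 (1 - z)) by move=> z; apply: (continuous_comp (@cs z)); exact: c0.
have c1' : continuous (fun z : R => E1 (1 - z)) by move=> z; apply: (continuous_comp (@cs z)); exact: c1.
rewrite /step'; apply: cvgM.
  by apply: cvgD; apply: cvgM; [exact: c1|exact: c0'|exact: c0|exact: c1'].
apply: cvgV; first by rewrite expf_neq0// gt_eqF// stepden_gt0.
by apply: cvgM; apply: cvgD; [exact: c0|exact: c0'|exact: c0|exact: c0'].
Qed.

Lemma axcut'_cvg x : offaxis x -> \forall n \near \oo, axcut' n x = 0.
Proof.
move=> /rho2_gt0 h; near=> n; rewrite /axcut' step'1 ?mulr0// lerBrDr.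
have n1 : 2 / rho2 x + 1 <= n%:R by near: n; exact: nbhs_infty_ger.
have n2 : 2 <= n%:R * rho2 x.
  have : 2 / rho2 x <= n%:R by lra.
  by rewrite ler_pdivrMr.
have i0 : 0 < 2 / rho2 x by rewrite divr_gt0.
have : n%:R * rho2 x <= n%:R ^+ 2 * rho2 x by rewrite ler_wpM2r ?(ltW h)// expr2 ler_peMr//; lra.
lra.
Unshelve. all: by end_near. Qed.

End AxisCutoff.

(** * Comparison of maps through the calibration *)

Section Comparison.
Variable R : realType.
Local Notation mR := (measurableTypeR R).
Local Notation leb3 := (leb3 R).
Local Notation T3 := (mR * mR * mR)%type.
Implicit Types (x : R3 R) (i : 'I_5) (j : 'I_3) (phi : R3 R -> R).
Variables (r sg : R).
Hypotheses (r0 : 0 < r) (sg1 : `|sg| = 1).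

Let mB := meas_Ball3 r.
Let oB := @open_Ball3 R r.

Lemma sum5E (F : 'I_5 -> R) : \sum_(i < 5) F i =
  F ord0 + F ix1 + F ix2 + F ix3 + F ix4.
Proof.
rewrite !big_ord_recl big_ord0 addr0 !addrA.
by congr (_ + _ + _ + _ + _); congr F; apply: val_inj.
Qed.

Lemma sum3E (F : 'I_3 -> R) : \sum_(i < 3) F i = F ord0_3 + F ord1_3 + F ord2.
Proof.
rewrite !big_ord_recl big_ord0 addr0 !addrA.
by congr (_ + _ + _); congr F; apply: val_inj.
Qed.

Definition wdens (g : 'I_5 -> 'I_3 -> R3 R -> R) x : R := \sum_(i < 5) \sum_(j < 3) g i j x ^+ 2.

(** The calibrating lower bound of the energy density. The sphere constraint holds only almost
    everywhere, so [clamp] and [arcden] replace the coordinate and the square root. *)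
Definition cal (v : R3 R -> RCC R) (g : 'I_5 -> 'I_3 -> R3 R -> R) x : R :=
  - (2 * clamp (comp5 ord0 v x) * g ord0 ord0_3 x * (x.1.1 / rho2 x))
  - 2 * clamp (comp5 ord0 v x) * g ord0 ord1_3 x * (x.1.2 / rho2 x)
  + 2 * sg * (arcden (comp5 ord0 v x) * g ord0 ord2 x) * (Num.sqrt (rho2 x))^-1.

Lemma meas_inv_rho2 : measurable_fun setT (fun x : T3 => (rho2 x)^-1 : R).
Proof.
apply: meas_off; last by move=> x /negP/negPn/eqP ->; rewrite invr0.
move=> x ox; apply: cvgV => //; exact: rho2_cont.
Qed.

Lemma meas_isq_rho2 : measurable_fun setT (fun x : T3 => (Num.sqrt (rho2 x))^-1 : R).
Proof.
apply: meas_off; last by move=> x /negP/negPn/eqP ->; rewrite sqrtr0 invr0.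
move=> x ox; have s := smooth_isq (@open_offaxis R) (smooth_rho2 (@open_offaxis R)) (fun x ox => rho2_gt0 ox).
exact: smooth_cont s ox.
Qed.

Section CalibrationDensity.
Variables (v : R3 R -> RCC R) (g : 'I_5 -> 'I_3 -> R3 R -> R).
Hypothesis A : admissible r v g.

Lemma wdens_intg : intg leb3 (Ball3 r) (wdens g).
Proof.
apply: intg_sum => // i; apply: intg_sum => // j.
by have [_ s] := adm_sqr A i j.
Qed.

Lemma cal_ae : {ae leb3, forall x, Ball3 r x ->
  [/\ `|comp5 ord0 v x| <= 1, (1 - comp5 ord0 v x ^+ 2) / rho2 x <= wdens g x & `|cal v g x| <= wdens g x]}.
Proof.
have T : {ae leb3, forall x, forall j, Ball3 r x -> \sum_(i < 5) coord5 i (v x) * g i j x = 0}.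
  by apply: ae_ball_sum => j; exact: (sphere_tangent r0 A j).
have E : {ae leb3, forall x, forall i, Ball3 r x -> x.1.1 * g i ord1_3 x - x.1.2 * g i ord0_3 x = wt R i * Jc i (v x)}.
  apply: ae_ball_sum => i; apply: (inf_equivariance r0 (adm_equiv A) (adm_map A)).
  - exact: adm_weak A _ _.
  - exact: adm_sqr A _ _.
  - exact: adm_weak A _ _.
  - exact: adm_sqr A _ _.
apply: ae_imp (ae_and (ae_and T E) (ae_and (adm_sphere A) (null_axis R))) => x [[hT hE] [hS ox]] Bx.
have S := hS Bx; have v1 : `|comp5 ord0 v x| <= 1 by exact: coord5_le1.
have := sphere_sum S; rewrite sum5E => Y.
have Ta := hT ord0_3 Bx; have Tb := hT ord1_3 Bx; have Tc := hT ord2 Bx.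
rewrite !sum5E in Ta Tb Tc.
have E1 := hE ix1 Bx; have E2 := hE ix2 Bx.
have E3 := hE ix3 Bx; have E4 := hE ix4 Bx.
rewrite /wt /Jc /= in E1 E2 E3 E4.
have ro := rho2_gt0 ox.
have q0 : 0 <= arcden (comp5 ord0 v x) by exact: sqrtr_ge0.
have qE : arcden (comp5 ord0 v x) ^+ 2 = 1 - comp5 ord0 v x ^+ 2.
  rewrite arcden_in// sqr_sqrtr// subr_ge0 -(real_normK (num_real _)).
  by rewrite -[X in _ <= X](expr1n _ 2) ler_pXn2r ?nnegrE.
have s0 : 0 < Num.sqrt (rho2 x) by rewrite sqrtr_gt0.
have sE : Num.sqrt (rho2 x) ^+ 2 = x.1.1 ^+ 2 + x.1.2 ^+ 2 by rewrite sqr_sqrtr// ltW.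
have C2 (y : RCC R) : coord5 ix1 y = complex.Re y.1.2 by [].
have C3 (y : RCC R) : coord5 ix2 y = complex.Im y.1.2 by [].
have C4 (y : RCC R) : coord5 ix3 y = complex.Re y.2 by [].
have C5 (y : RCC R) : coord5 ix4 y = complex.Im y.2 by [].
have := @calib_pointwise R x.1.1 x.1.2 (Num.sqrt (rho2 x)) (arcden (comp5 ord0 v x)) sg
  _ _ _ _ _ _ _ _ _ _ _ _ _ _ _ _ _ _ _ _ s0 sE q0 qE sg1 Y Ta Tb Tc.
move=> /(_ _ _ _ _)/wrap[].
- by rewrite E1 mul1r.
- by rewrite E2 mul1r.
- by rewrite E3 mulrN mulNr.
- by rewrite E4.
move=> /=; rewrite sqr_sqrtr ?(ltW ro)// => -[H1 H2].
have G : wdens g x = g ord0 ord0_3 x ^+ 2 + g ord0 ord1_3 x ^+ 2 + g ord0 ord2 x ^+ 2 +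
   (g ix1 ord0_3 x ^+ 2 + g ix1 ord1_3 x ^+ 2 + g ix1 ord2 x ^+ 2) +
   (g ix2 ord0_3 x ^+ 2 + g ix2 ord1_3 x ^+ 2 + g ix2 ord2 x ^+ 2) +
   (g ix3 ord0_3 x ^+ 2 + g ix3 ord1_3 x ^+ 2 + g ix3 ord2 x ^+ 2) +
   (g ix4 ord0_3 x ^+ 2 + g ix4 ord1_3 x ^+ 2 + g ix4 ord2 x ^+ 2).
  by rewrite /wdens sum5E !sum3E.
rewrite G; split=> //.
apply: le_trans H2; rewrite /cal clamp_id// le_eqVlt; apply/orP; left; apply/eqP; congr (`| _ |).
by rewrite /comp5 !mulrA.
Qed.

Lemma cal_meas : measurable_fun (Ball3 r : set T3) (cal v g).
Proof.
have m1 := measurable_funTS (D := Ball3 r) (@meas_x1 R); have m2 := measurable_funTS (D := Ball3 r) (@meas_x2 R).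
have mi := measurable_funTS (D := Ball3 r) meas_inv_rho2.
have ms := measurable_funTS (D := Ball3 r) meas_isq_rho2.
have mg j : measurable_fun (Ball3 r : set T3) (g ord0 j) by have [] := adm_sqr A ord0 j.
have mc := cont_v_meas A ord0 (@clamp_cont R); have ma := cont_v_meas A ord0 (@arcden_cont R).
apply: measurable_funD.
  apply: measurable_funB.
    apply: measurableT_comp => //; apply: measurable_funM; last exact: measurable_funM.
    exact: measurable_funM.
  by apply: measurable_funM; [exact: measurable_funM|exact: measurable_funM].
apply: measurable_funM => //; apply: measurable_funM; first exact: measurable_cst.
exact: measurable_funM.
Qed.

Lemma cal_intg : intg leb3 (Ball3 r) (cal v g).
Proof.
have := wdens_intg => ig.
(* The domination by [wdens g] is known almost everywhere only; the truncation satisfies it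
   everywhere and agrees with [cal v g] off a null set. *)
pose c x := Num.max (- wdens g x) (Num.min (cal v g x) (wdens g x)).
have mc := cal_meas; have mg := intg_meas ig.
have W0 x : 0 <= wdens g x by rewrite /wdens sumr_ge0// => i _; rewrite sumr_ge0// => j _; exact: sqr_ge0.
apply: (@intg_ae _ _ _ leb3 (Ball3 r) c) => //.
  apply: ae_imp cal_ae => x h Bx; have [_ _] := h Bx; rewrite ler_norml => /andP[h1 h2].
  by rewrite /c (min_l h2) (max_r h1).
apply: (@intg_le _ T3 _ leb3 (Ball3 r) _ (wdens g)) => //.
  apply: measurable_maxr; first exact: measurableT_comp.
  exact: measurable_minr.
move=> x _; rewrite /c ler_norml le_max lexx/= ge_max ge_min lexx orbT andbT.
by have := W0 x; lra.
Qed.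

Variable chi : R3 R -> R.
Hypothesis tchi : test_fun (Ball3 r) chi.
Variable n : nat.
Hypothesis n0 : (0 < n)%N.

(** The singular coefficients of [cal], cut off at the axis and near the sphere, become the test
    functions for the chain rule. *)
Definition cphi1 x : R := axcut n x * (x.1.1 / rho2 x) * chi x.
Definition cphi2 x : R := axcut n x * (x.1.2 / rho2 x) * chi x.
Definition cphi3 x : R := axcut n x * (Num.sqrt (rho2 x))^-1 * chi x.

Lemma cphi_test : [/\ test_fun (Ball3 r) cphi1, test_fun (Ball3 r) cphi2 & test_fun (Ball3 r) cphi3].
Proof.
have oO := @open_offaxis R.
have [s1 s2 _] := smooth_coord oO.
have si := smooth_inv oO (smooth_rho2 oO) (fun x ox => ox).
have sq := smooth_isq oO (smooth_rho2 oO) (fun x ox => rho2_gt0 ox).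
split.
- exact: testM tchi (axcut_smooth n0 (smoothM oO s1 si)).
- exact: testM tchi (axcut_smooth n0 (smoothM oO s2 si)).
- exact: testM tchi (axcut_smooth n0 sq).
Qed.

Lemma huber_intg phi : test_fun (Ball3 r) phi -> intg leb3 (Ball3 r) (fun x => huber (comp5 ord0 v x) * phi x).
Proof.
move=> t; have [C [C0 bC]] := test_bounded t.
have [m s] := adm_map A ord0.
apply: (@intg_le _ T3 _ leb3 (Ball3 r) _ (fun x => C * (comp5 ord0 v x ^+ 2))) => //.
- apply: measurable_funM.
    by apply: (cont_v_meas A) => y; exact: (is_derive1_cont (huber_derive y)).
  by apply: measurable_funTS; apply: smooth_meas; case: t.
- exact: intgZ.
- move=> x _; rewrite normrM mulrC ler_pM // /huber ler_norml.
  by case: (ltP (comp5 ord0 v x) (-1)) => h1; [|case: (ltP 1 (comp5 ord0 v x)) => h2]; apply/andP; split; nra.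
Qed.

Lemma arcint_intg phi : test_fun (Ball3 r) phi -> intg leb3 (Ball3 r) (fun x => arcint (comp5 ord0 v x) * phi x).
Proof.
move=> t; have [C [C0 bC]] := test_bounded t.
have [m s] := adm_map A ord0.
have iv := sqr_intg_intg m s.
apply: (@intg_le _ T3 _ leb3 (Ball3 r) _ (fun x => C * `|comp5 ord0 v x|)) => //.
- apply: measurable_funM.
    by apply: (cont_v_meas A) => y; exact: (is_derive1_cont (arcint_derive y)).
  by apply: measurable_funTS; apply: smooth_meas; case: t.
- exact/intgZ/intg_abs.
- move=> x _; rewrite normrM mulrC ler_pM //.
  by have := lip_bound (@arcint_derive R) (arcint00 R) (@arcden_bound R) (comp5 ord0 v x); rewrite mul1r.
Qed.

Lemma cal_test : \int[leb3]_(x in Ball3 r) (cal v g x * (axcut n x * chi x)) =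
  \int[leb3]_(x in Ball3 r) (huber (comp5 ord0 v x) * partial ord0_3 cphi1 x)
  + \int[leb3]_(x in Ball3 r) (huber (comp5 ord0 v x) * partial ord1_3 cphi2 x)
  - 2 * sg * \int[leb3]_(x in Ball3 r) (arcint (comp5 ord0 v x) * partial ord2 cphi3 x).
Proof.
have [t1 t2 t3] := cphi_test.
rewrite (huber_test r0 A ord0_3 t1) (huber_test r0 A ord1_3 t2) (arcint_test r0 A t3).
have i1 := locint_test oB (intg_locint oB (clamp_g_intg A ord0 ord0_3)) t1.
have i2 := locint_test oB (intg_locint oB (clamp_g_intg A ord0 ord1_3)) t2.
have ia : intg leb3 (Ball3 r) (fun x => arcden (comp5 ord0 v x) * g ord0 ord2 x).
  apply: (@intgMl _ _ _ _ _ 1) => //; last exact: (g_intg A).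
  - exact: (cont_v_meas A ord0 (@arcden_cont R)).
  - by move=> x _; exact: arcden_bound.
have i3 := locint_test oB (intg_locint oB ia) t3.
rewrite mulrN opprK -(RintegralZl _ mB i3).
have i12 := intgD mB i1 i2; have i3' := intgZ (2 * sg) mB i3.
rewrite -opprD -(RintegralD mB i1 i2) addrC -(RintegralB mB i3' i12).
apply: eq_Rintegral => x _; rewrite /cal /cphi1 /cphi2 /cphi3; ring.
Qed.
End CalibrationDensity.

Section CalibrationInequality.
Variables (v v' : R3 R -> RCC R) (g g' : 'I_5 -> 'I_3 -> R3 R -> R).
Hypotheses (A : admissible r v g) (A' : admissible r v' g').
Variable a' : R.
Hypotheses (ar : a' < r ^+ 2)
  (agree : {ae leb3, forall x, Ball3 r x -> a' < nsq x -> comp5 ord0 v x = comp5 ord0 v' x}).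

(** Where [a' < nsq x] the two maps agree; elsewhere the plateau function is locally 1, and the
    divergence of the cut-off horizontal field is [axcut' n], the vertical field contributing
    nothing. *)
Lemma cal_diff a b n : (0 < n)%N -> a' < a -> a < b -> b < r ^+ 2 ->
  \int[leb3]_(x in Ball3 r) ((cal v g x - cal v' g' x) * (axcut n x * plateau a b x)) =
  \int[leb3]_(x in Ball3 r) ((huber (comp5 ord0 v x) - huber (comp5 ord0 v' x)) * axcut' n x).
Proof.
move=> n0 aa ab br.
have tc := plateau_test r0 ab br.
have [t1 t2 t3] := cphi_test tc n0.
have tx : test_fun (Ball3 r) (fun x => axcut n x * plateau a b x) by exact: (testM tc (@smooth_axcut R n)).
have ic := locint_test oB (intg_locint oB (cal_intg A)) tx.
have ic' := locint_test oB (intg_locint oB (cal_intg A')) tx.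
under eq_Rintegral do rewrite mulrBl.
rewrite (RintegralB mB ic ic') (cal_test A tc n0) (cal_test A' tc n0).
have u1 := test_partial ord0_3 t1; have u2 := test_partial ord1_3 t2; have u3 := test_partial ord2 t3.
have h1 := huber_intg A u1; have h2 := huber_intg A u2; have h3 := arcint_intg A u3.
have k1 := huber_intg A' u1; have k2 := huber_intg A' u2; have k3 := arcint_intg A' u3.
set D1 := partial ord0_3 _ in h1 k1 *; set D2 := partial ord1_3 _ in h2 k2 *; set D3 := partial ord2 _ in h3 k3 *.
have l1 := intgB mB h1 k1; have l2 := intgB mB h2 k2; have l3 := intgB mB h3 k3.
transitivity (\int[leb3]_(x in Ball3 r) (huber (comp5 ord0 v x) * D1 x - huber (comp5 ord0 v' x) * D1 x
   + (huber (comp5 ord0 v x) * D2 x - huber (comp5 ord0 v' x) * D2 x)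
   - 2 * sg * (arcint (comp5 ord0 v x) * D3 x - arcint (comp5 ord0 v' x) * D3 x))).
  rewrite (RintegralB mB (intgD mB l1 l2) (intgZ _ mB l3)) (RintegralD mB l1 l2) (RintegralZl _ mB l3).
  rewrite (RintegralB mB h1 k1) (RintegralB mB h2 k2) (RintegralB mB h3 k3).
  by do 6! move: (Rintegral _ _ _); move=> p1 p2 p3 p4 p5 p6; ring.
have ml := intg_meas (intgB mB (intgD mB l1 l2) (intgZ (2 * sg) mB l3)).
apply: Rint_ae_eq => //.
  have mh (w : R3 R -> RCC R) g0 : admissible r w g0 -> measurable_fun (Ball3 r : set T3) (fun x => huber (comp5 ord0 w x)).
    by move=> Aw; apply: (cont_v_meas Aw) => y; exact: (is_derive1_cont (huber_derive y)).
  apply: measurable_funM; first by apply: measurable_funB; [exact: mh A|exact: mh A'].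
  apply: measurable_funTS; apply: (cont_measurable3 openT) => x _.
  apply: cvgM; first exact: cvg_cst.
  have c1 : {for x, continuous (fun x => n%:R ^+ 2 * rho2 x - 1 : R)}.
    by apply: cvgB; [apply: cvgM; [exact: cvg_cst|exact: rho2_cont]|exact: cvg_cst].
  apply: (continuous_comp c1); exact: step'_cont.
apply: ae_imp (ae_and agree (null_axis R)) => x [hx ox] Bx.
have [nx|nx] := ltP a' (nsq x); first by rewrite hx//; ring.
have nxa : nsq x < a by lra.
have oU : open [set x : R3 R | nsq x < a].
  rewrite (_ : [set x | _] = (@nsq R) @^-1` [set y | y < a])//.
  by apply: open_comp; [move=> y _; exact: nsq_cont|exact: open_lt].
have near_chi (q : R3 R -> R) j : partial j (fun x => q x * plateau a b x) x = partial j q x.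
  by apply: near_partial; apply: (eq_on_near oU) => // y /= /ltW hy; rewrite plateau1// mulr1.
have E12 : D1 x + D2 x = axcut' n x.
  rewrite -axcut_divergence//; congr (_ + _).
    exact: (near_chi (fun x => axcut n x * (x.1.1 / rho2 x)) ord0_3).
  exact: (near_chi (fun x => axcut n x * (x.1.2 / rho2 x)) ord1_3).
have E3 : D3 x = 0.
  by rewrite -(axcut_vertical n ox); exact: (near_chi (fun x => axcut n x * (Num.sqrt (rho2 x))^-1) ord2).
rewrite E3 -E12; ring.
Qed.

(** Removal of the plateau: its inner radius tends to [r], by dominated convergence. *)
Lemma cal_diff_axis n : (0 < n)%N ->
  \int[leb3]_(x in Ball3 r) ((cal v g x - cal v' g' x) * axcut n x) =
  \int[leb3]_(x in Ball3 r) ((huber (comp5 ord0 v x) - huber (comp5 ord0 v' x)) * axcut' n x).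
Proof.
move=> n0.
pose d := r ^+ 2 - Num.max a' 0.
have d0 : 0 < d by rewrite subr_gt0 gt_max ar exprn_gt0.
pose a k : R := r ^+ 2 - d * harm R k. pose b k : R := r ^+ 2 - d * harm R k / 2.
have hk k : [/\ a' < a k, a k < b k & b k < r ^+ 2].
  have h1 := harm_gt0 R k; have h2 := harm_lt1 R k.
  have h3 : 0 < d * harm R k by rewrite mulr_gt0.
  have h4 : d * harm R k < d by rewrite gtr_pMr.
  split; [|by rewrite /a /b; lra|by rewrite /b; lra].
  apply: (@le_lt_trans _ _ (Num.max a' 0)); first by rewrite le_max lexx.
  by move: h4; rewrite /a /d; lra.
have id := intgB mB (cal_intg A) (cal_intg A').
have md := intg_meas id.
have mx : measurable_fun (Ball3 r : set T3) (axcut n).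
  by apply: measurable_funTS; exact: smooth_meas (@smooth_axcut R n).
have bx x : `|axcut n x| <= 1 by rewrite ger0_norm ?axcut_ge0// axcut_le1.
have L : (fun k => \int[leb3]_(x in Ball3 r) ((cal v g x - cal v' g' x) * (axcut n x * plateau (a k) (b k) x))) @ \oo -->
   \int[leb3]_(x in Ball3 r) ((cal v g x - cal v' g' x) * axcut n x).
  apply: (@Rint_dct _ _ _ leb3 (Ball3 r) _ _ (fun x => `|cal v g x - cal v' g' x|)) => //.
  - move=> k; apply: measurable_funM => //; apply: measurable_funM => //.
    by apply: measurable_funTS; exact: smooth_meas (@plateau_smooth R _ _).
  - exact: measurable_funM.
  - apply: aeW => x Bx; apply: cvgM; first exact: cvg_cst.
    rewrite -[X in _ --> X]mulr1; apply: cvgM; first exact: cvg_cst.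
    apply: cvg_near_cst.
    have dx : 0 < (r ^+ 2 - nsq x) / d by rewrite divr_gt0// subr_gt0; exact/Ball3E.
    have /cvgrPdist_lt/(_ _ dx) := @harm_cvg R; apply: filterS => k /=.
    rewrite sub0r normrN gtr0_norm ?harm_gt0// ltr_pdivlMr// => hd.
    have [_ ab _] := hk k; rewrite plateau1// /a; move: hd; rewrite mulrC; lra.
  - exact: intg_abs.
  - apply: aeW => x k _; rewrite normrM ler_piMr// normrM.
    rewrite mulr_ile1// [`|plateau _ _ _|]ger0_norm; [exact: step_le1|exact: step_ge0].
apply/esym; apply: (cvg_unique _ _ L) => //.
apply: cvg_near_cst; apply: nearW => k; have [h1 h2 h3] := hk k.
by rewrite (cal_diff n0 h1 h2 h3).
Qed.

(** Removal of the cutoff at the axis. The difference of the squares is rewritten with [1 - v_0 ^ 2]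
    and [1 - v'_0 ^ 2], each at most [rho ^ 2] times an energy density by [cal_ae]; since
    [rho ^ 2 * axcut'] is bounded, the error is dominated and tends to 0. *)
Lemma cal_eq : \int[leb3]_(x in Ball3 r) cal v g x = \int[leb3]_(x in Ball3 r) cal v' g' x.
Proof.
have id := intgB mB (cal_intg A) (cal_intg A').
have md := intg_meas id.
have bx n x : `|axcut n x : R| <= 1 by rewrite ger0_norm ?axcut_ge0// axcut_le1.
have L1 : (fun n => \int[leb3]_(x in Ball3 r) ((cal v g x - cal v' g' x) * axcut n.+1 x)) @ \oo -->
   \int[leb3]_(x in Ball3 r) (cal v g x - cal v' g' x).
  apply: (@Rint_dct _ _ _ leb3 (Ball3 r) _ _ (fun x => `|cal v g x - cal v' g' x|)) => //.
  - by move=> k; apply: measurable_funM => //; apply: measurable_funTS; exact: smooth_meas (@smooth_axcut R _).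
  - apply: ae_imp (null_axis R) => x ox Bx; rewrite -[X in _ --> X]mulr1.
    apply: cvgM; first exact: cvg_cst.
    by have := axcut_cvg ox; rewrite -(cvg_shiftS (fun n => axcut n x)).
  - exact: intg_abs.
  - by apply: aeW => x k _; rewrite normrM ler_piMr.
have [C [C0 bC]] := @axcut'_bound R.
have ig := intgD mB (wdens_intg A) (wdens_intg A').
have mh (w : R3 R -> RCC R) g0 : admissible r w g0 -> measurable_fun (Ball3 r : set T3) (fun x => huber (comp5 ord0 w x)).
  by move=> Aw; apply: (cont_v_meas Aw) => y; exact: (is_derive1_cont (huber_derive y)).
have mH : measurable_fun (Ball3 r : set T3) (fun x => huber (comp5 ord0 v x) - huber (comp5 ord0 v' x)).
  by apply: measurable_funB; [exact: mh A|exact: mh A'].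
have L2 : (fun n => \int[leb3]_(x in Ball3 r) ((huber (comp5 ord0 v x) - huber (comp5 ord0 v' x)) * axcut' n.+1 x)) @ \oo -->
   \int[leb3]_(x in Ball3 r) (0 : R).
  apply: (@Rint_dct _ _ _ leb3 (Ball3 r) _ _ (fun x => C * (wdens g x + wdens g' x))) => //.
  - move=> k; apply: measurable_funM => //.
    apply: measurable_funTS; apply: (cont_measurable3 openT) => x _.
    apply: cvgM; first exact: cvg_cst.
    have c1 : {for x, continuous (fun x => k.+1%:R ^+ 2 * rho2 x - 1 : R)}.
      by apply: cvgB; [apply: cvgM; [exact: cvg_cst|exact: rho2_cont]|exact: cvg_cst].
    by apply: (continuous_comp c1); exact: step'_cont.
  - apply: ae_imp (null_axis R) => x ox Bx; apply: cvg_near_cst.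
    have [N _ HN] := axcut'_cvg ox; exists N => // k /= Nk.
    by rewrite HN ?mulr0//=; exact: leq_trans Nk (leqnSn k).
  - exact: intgZ.
  - apply: ae_imp (ae_and (ae_and (cal_ae A) (cal_ae A')) (null_axis R)) => x [[h1 h2] ox] n Bx.
    have [v1 H1 _] := h1 Bx; have [v2 H2 _] := h2 Bx; have ro := rho2_gt0 ox.
    rewrite !huber_sqr//.
    have -> : (comp5 ord0 v x ^+ 2 - comp5 ord0 v' x ^+ 2) * axcut' n.+1 x =
       ((1 - comp5 ord0 v' x ^+ 2) / rho2 x - (1 - comp5 ord0 v x ^+ 2) / rho2 x) * (rho2 x * axcut' n.+1 x).
      by field; rewrite gt_eqF.
    have P (w : R) : `|w| <= 1 -> 0 <= (1 - w ^+ 2) / rho2 x.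
      move=> hw; rewrite divr_ge0 ?(ltW ro)// subr_ge0 -(real_normK (num_real w)).
      by rewrite -[X in _ <= X](expr1n _ 2) ler_pXn2r ?nnegrE.
    rewrite normrM mulrC ler_pM//; apply: le_trans (ler_normB _ _) _.
    by rewrite !ger0_norm ?P// addrC lerD.
have E : \int[leb3]_(x in Ball3 r) (cal v g x - cal v' g' x) = \int[leb3]_(x in Ball3 r) (0 : R).
  apply: (cvg_unique _ L1) => //.
  move: L2; rewrite (_ : (fun n => \int[leb3]_(x in Ball3 r) ((huber (comp5 ord0 v x) - huber (comp5 ord0 v' x)) * axcut' n.+1 x)) =
    (fun n => \int[leb3]_(x in Ball3 r) ((cal v g x - cal v' g' x) * axcut n.+1 x))) //.
  by apply/funext => n; rewrite cal_diff_axis.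
move: E; rewrite (RintegralB mB (cal_intg A) (cal_intg A')) [RHS](_ : _ = 0) => [/eqP|]; last by rewrite /Rintegral integral0.
by rewrite subr_eq0 => /eqP.
Qed.

Lemma cal_energy_le : {ae leb3, forall x, Ball3 r x -> cal v' g' x = wdens g' x} ->
  \int[leb3]_(x in Ball3 r) wdens g' x <= \int[leb3]_(x in Ball3 r) wdens g x.
Proof.
move=> eqc; have iw := wdens_intg A'; have iw1 := wdens_intg A.
rewrite -(Rint_ae_eq mB (intg_meas (cal_intg A')) (intg_meas iw) eqc) -cal_eq.
have id := intgB mB iw1 (cal_intg A).
rewrite -subr_ge0 -(RintegralB mB iw1 (cal_intg A)).
rewrite (@Rint_ae_eq _ _ _ leb3 (Ball3 r) _ (fun x => `|wdens g x - cal v g x|) mB (intg_meas id)).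
- by apply: Rintegral_ge0.
- exact: intg_meas (intg_abs mB id).
- apply: ae_imp (cal_ae A) => x h Bx; have [_ _] := h Bx; rewrite ler_norml => /andP[_ h2].
  by rewrite ger0_norm// subr_ge0.
Qed.

End CalibrationInequality.
End Comparison.

(** * The model map is minimizing *)

Section ModelMap.
Variable R : realType.
Local Notation mR := (measurableTypeR R).
Local Notation leb3 := (leb3 R).
Local Notation T3 := (mR * mR * mR)%type.
Implicit Types (x : R3 R) (i : 'I_5) (j : 'I_3) (u w : R3 R -> RCC R).

(** The essential support misses the sphere, so open sets on which the maps agree almost everywhere
    cover it, and by compactness one of them contains it. What is left of the closed ball is a
    compact subset of the open one. *)
Lemma sphere_shell r u w : 0 < r ->
  ess_supp (Ball3 r) (fun x => u x - w x) `<=` Ball3 r ->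
  exists a, a < r ^+ 2 /\ {ae leb3, forall x, Ball3 r x -> a < nsq x -> u x = w x}.
Proof.
move=> r0 H.
pose S := [set x : R3 R | nsq x = r ^+ 2].
pose D := [set V : set (R3 R) | open V /\ {ae leb3, forall z, V z -> Ball3 r z -> u z = w z}].
have cS : compact S.
  apply: (@closed_bounded_compact3 R S (r ^+ 2)); last by move=> x ->.
  rewrite (_ : S = [set x | nsq x <= r ^+ 2] `&` [set x | r ^+ 2 <= nsq x]).
    by apply: closedI; [exact: closed_nsq_le|exact: closed_nsq_ge].
  by apply/seteqP; split=> x; rewrite /S /=; [move=> ->; rewrite lexx|move=> [h1 h2]; apply/eqP; rewrite eq_le h1].
have cov x : S x -> exists2 V, D V & V x.
  move=> Sx; have : ~ ess_supp (Ball3 r) (fun x => u x - w x) x.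
    by move=> /H/Ball3E -/(_ r0); rewrite Sx ltxx.
  rewrite /ess_supp/= => /existsNP[V /not_implyP[oV /not_implyP[Vx /contrapT h]]].
  exists V => //; split=> //; apply: ae_imp h => z hz Vz Bz.
  by apply/eqP; rewrite -subr_eq0; apply/eqP; exact: hz.
have DU V V' : D V -> D V' -> D (V `|` V').
  move=> [p1 h1] [p2 h2]; split; first exact: openU.
  by apply: ae_imp (ae_and h1 h2) => z [k1 k2] [/k1|/k2].
(* The complements in S of the open sets on which u and w agree generate a filter. *)
have [W DW SW] : exists2 W, D W & S `<=` W.
  apply: contrapT => nW.
  pose F : set_system (R3 R) := [set A | exists2 V, D V & S `<=` V `|` A].
  have FF : Filter F.
    split.
    - by exists set0; [split; [exact: open0|exact: aeW]|rewrite set0U].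
    - move=> A B [V DV h1] [V' DV' h2]; exists (V `|` V'); first exact: DU.
      by move=> x Sx; have [|h] := h1 x Sx; [left; left|have [|k] := h2 x Sx; [left; right|right]].
    - by move=> A B AB [V DV h]; exists V => // x /h[|/AB]; [left|right].
  have PF : ProperFilter F.
    by apply: Build_ProperFilter => [[V DV h]]; apply: nW; exists V => // x /h[].
  have [x [Sx cx]] := cS F PF (ex_intro2 _ _ set0 (conj open0 (aeW _ (fun _ => False_ind _))) (fun x h => or_intror h)).
  have [V DV Vx] := cov x Sx.
  have nV : nbhs x V by apply: open_nbhs_nbhs; split=> //; exact: DV.1.
  have FV : F (~` V) by exists V => // y _; have [h|h] := pselect (V y); [left|right].
  by have [y [h1 h2]] := cx _ _ FV nV.
have [oW aeW] := DW.
have cK : compact ([set x | nsq x <= r ^+ 2] `&` ~` W).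
  apply: (@closed_bounded_compact3 R _ (r ^+ 2)); last by move=> x [].
  by apply: closedI; [exact: closed_nsq_le|exact: open_closedC].
have KB : [set x | nsq x <= r ^+ 2] `&` ~` W `<=` Ball3 r.
  move=> x [/= h1 h2]; apply/Ball3E => //; rewrite lt_neqAle h1 andbT.
  by apply/eqP => h3; apply: h2; exact: SW.
have [a [_ [ar Ha]]] := compact_in_ball r0 cK KB.
exists a; split=> //; apply: ae_imp aeW => x h Bx ax; apply: h => //.
apply: contrapT => nW; have : nsq x <= a.
  by apply: Ha; split=> //=; apply/ltW; exact/Ball3E.
by rewrite leNgt ax.
Qed.

Lemma minimizing_of_calibration r sg u g : 0 < r -> `|sg| = 1 -> admissible r u g ->
  {ae leb3, forall x, Ball3 r x -> cal sg u g x = wdens g x} ->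
  forall w, W12_S4 (Ball3 r) w -> ae_equivariant_on (Ball3 r) w ->
    ess_supp (Ball3 r) (fun x => u x - w x) `<=` Ball3 r ->
    (energy u r <= energy w r)%E.
Proof.
move=> r0 sg1 Au Hc w [sw iw ww] ew es.
have [gf Hg] : exists gf : 'I_5 -> 'I_3 -> R3 R -> R, forall i j,
    is_weak_partial (Ball3 r) j (comp5 i w) (gf i j) /\ square_integrable (Ball3 r) (gf i j).
  have : forall p : 'I_5 * 'I_3, exists g0, is_weak_partial (Ball3 r) p.2 (comp5 p.1 w) g0 /\ square_integrable (Ball3 r) g0.
    by move=> [i j]; have [g0 h1 h2] := ww i j; exists g0.
  move=> /choice[f Hf]; exists (fun i j => f (i, j)) => i j; exact: (Hf (i, j)).
have Aw : admissible r w gf.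
  by split=> // i j; [have [] := Hg i j|have [] := Hg i j].
have [a [ar agree]] := sphere_shell r0 es.
have ag : {ae leb3, forall x, Ball3 r x -> a < nsq x -> comp5 ord0 w x = comp5 ord0 u x}.
  by apply: ae_imp agree => x h Bx ax; rewrite /comp5 h.
have [_ ->] := energy_weak r0 (adm_weak Au) (adm_sqr Au).
have [_ ->] := energy_weak r0 (adm_weak Aw) (adm_sqr Aw).
rewrite lee_fin ler_wpM2l ?invr_ge0//.
exact: (cal_energy_le r0 sg1 Aw Au ar ag Hc).
Qed.

(** The value at the origin is arbitrary, but a single point does not affect measurability. *)
Lemma meas_off0 (f : R3 R -> R) : (forall x, x != 0 -> {for x, continuous f}) ->
  measurable_fun setT (f : T3 -> R).
Proof.
move=> cf.
have o0 : open [set x : R3 R | x != 0].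
  rewrite (_ : [set x | _] = [set x : R3 R | 0 < nsq x]); last first.
    apply/seteqP; split=> x /=; first exact: nsq_gt0.
    by rewrite -nsq_eq0 => h; rewrite gt_eqF.
  rewrite (_ : [set x | _] = (@nsq R) @^-1` [set y | 0 < y])//.
  by apply: open_comp; [move=> y _; exact: nsq_cont|exact: open_gt].
have m0 := open_measurable3 o0.
have -> : [set: T3] = [set x : R3 R | x != 0] `|` [set 0].
  by apply/seteqP; split=> // x _; have [->|h] := eqVneq (x : R3 R) 0; [right|left].
have ms : measurable ([set 0] : set T3).
  rewrite (_ : [set 0] = ~` [set x : R3 R | x != 0]); first exact: measurableC.
  by apply/seteqP; split=> x /=; [move=> -> /eqP|move=> /negP/negPn/eqP].
apply/measurable_funU => //; split; first exact: cont_measurable3.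
exact: measurable_fun_set1.
Qed.

Lemma smooth_c1off (f : R3 R -> R) : smooth_on (@offaxis R) f -> c1off f.
Proof.
move=> s x ox; split; first exact: smooth_cont s ox.
move=> j; split; first by have [_ h] := s [::] x ox; exact: h.
by have [h _] := s [:: j] x ox; exact: h.
Qed.

Lemma density_off u x : offaxis x -> density u x = \sum_(i < 5) \sum_(j < 3) partial j (comp5 i u) x ^+ 2.
Proof. by move=> ox; apply: eq_bigr => i _; apply: eq_bigr => j _; rewrite pdE. Qed.

Lemma density_ge0 u x : 0 <= density u x.
Proof. by apply: sumr_ge0 => i _; apply: sumr_ge0 => j _; exact: sqr_ge0. Qed.

Lemma nice_intro r u C C' : (forall i, measurable_fun setT (comp5 i u : T3 -> R)) ->
  (forall i x, `|comp5 i u x| <= C) -> (forall i, smooth_on (@offaxis R) (comp5 i u)) ->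
  (forall x, offaxis x -> density u x <= C' / nsq x) -> nice r u.
Proof.
move=> mu bu su du i; have ci := smooth_c1off (su i).
split=> //; first by exists C.
move=> j; have iq := intgZ `|C'| (meas_Ball3 r) (inv_nsq_intg r).
apply: (@intg_le _ T3 _ leb3 (Ball3 r) _ (fun x => `|C'| * (nsq x)^-1)) => //.
- exact: meas_Ball3.
- by apply: measurable_funX; apply: measurable_funTS; exact: meas_pd.
move=> x _; rewrite normrX real_normK ?num_real//.
have [ox|ox] := pselect (offaxis x); last first.
  by rewrite /pd; move/negP/negbTE: ox => ->; rewrite expr0n mulr_ge0// invr_ge0 nsq_ge0.
apply: (@le_trans _ _ (C' / nsq x)); last by rewrite ler_wpM2r ?invr_ge0 ?nsq_ge0// ler_norm.
apply: le_trans (du x ox); rewrite /density (bigD1 i)//= (bigD1 j)//= -addrA lerDl addr_ge0//.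
  by apply: sumr_ge0 => k _; exact: sqr_ge0.
by apply: sumr_ge0 => k _; apply: sumr_ge0 => l _; exact: sqr_ge0.
Qed.

Lemma open_off0 : open [set x : R3 R | x != 0].
Proof.
rewrite (_ : [set x | _] = [set x : R3 R | 0 < nsq x]); last first.
  apply/seteqP; split=> x /=; first exact: nsq_gt0.
  by rewrite -nsq_eq0 => h; rewrite gt_eqF.
rewrite (_ : [set x | _] = (@nsq R) @^-1` [set y | 0 < y])//.
by apply: open_comp; [move=> y _; exact: nsq_cont|exact: open_gt].
Qed.

Definition inorm x : R := (Num.sqrt (nsq x))^-1.

Lemma inormE x : inorm x = (norm3 x)^-1. Proof. by []. Qed.
Lemma inorm_sqr x : x != 0 -> inorm x ^+ 2 * nsq x = 1.
Proof. by move=> /nsq_gt0 h; rewrite /inorm exprVn sqr_sqrtr ?ltW// mulVf// gt_eqF. Qed.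

Lemma smooth_inorm : smooth_on [set x : R3 R | x != 0] inorm.
Proof. exact: (smooth_isq open_off0 (smooth_nsq open_off0) (fun x h => nsq_gt0 h)). Qed.

Definition xc (j : 'I_3) x : R := nth 0 [:: x.1.1; x.1.2; x.2] j.

Lemma is_derive_nsq x j : is_derive x (basis3 R j) (@nsq R) (2 * xc j x).
Proof.
have [d1 d2 d3] := is_derive_coord x j.
have := is_deriveD (is_deriveD (is_deriveM d1 d1) (is_deriveM d2 d2)) (is_deriveM d3 d3).
congr is_derive; rewrite !scalE /xc; case: j d1 d2 d3 => [[|[|[|//]]] hj] _ _ _ /=; ring.
Qed.

Lemma is_derive_inorm x j : x != 0 -> is_derive x (basis3 R j) inorm (- inorm x ^+ 3 * xc j x).
Proof.
move=> x0; have := is_derive_comp1 (is_derive_nsq x j) (isq_derive (nsq_gt0 x0)).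
congr is_derive; rewrite -/(inorm x); move: (inorm x) (xc j x) => t z; by field.
Qed.

Lemma is_derive_xc x k j : is_derive x (basis3 R j) (xc k) (k == j)%:R.
Proof.
have [d1 d2 d3] := is_derive_coord x j.
case: k => [[|[|[|//]]] hk] /=; case: j d1 d2 d3 => [[|[|[|//]]] hj] /= d1 d2 d3; assumption.
Qed.

Definition lin (l : 'I_3 -> R) x : R := \sum_(k < 3) l k * xc k x.

Lemma is_derive_lin l x j : is_derive x (basis3 R j) (lin l) (l j).
Proof.
have d k := is_deriveM (@is_derive_cst _ _ _ (l k) x (basis3 R j)) (is_derive_xc x k j).
have := is_deriveD (is_deriveD (d ord0_3) (d ord1_3)) (d ord2).
rewrite (_ : _ + _ = lin l); last by apply/funext => y; rewrite /lin sum3E.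
congr is_derive; rewrite !scalE !mulr0 !addr0 /cst.
case: j d => [[|[|[|//]]] hj] d /=; rewrite ?mulr1 ?mulr0 ?addr0 ?add0r; congr l; exact: val_inj.
Qed.

Lemma partial_lin l x j : x != 0 ->
  partial j (fun x => lin l x * inorm x) x = l j * inorm x - lin l x * xc j x * inorm x ^+ 3.
Proof.
move=> x0; have [_] := is_derive_mul (is_derive_lin l x j) (is_derive_inorm j x0).
by rewrite /partial => ->; ring.
Qed.

Lemma smooth_lin U l : open U -> smooth_on U (lin l).
Proof.
move=> oU; have [s1 s2 s3] := smooth_coord oU.
have := smoothD oU (smoothD oU (smoothM oU (smooth_cst (l ord0_3) oU) s1) (smoothM oU (smooth_cst (l ord1_3) oU) s2))
  (smoothM oU (smooth_cst (l ord2) oU) s3).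
by apply: smooth_ext => // x _; rewrite /lin sum3E.
Qed.

(** The rows of a matrix of five rows: the model map, rotated by [a] and multiplied by [sg], is this
    matrix applied to [x / |x|]. *)
Definition eqrow (sg a : R) (i : 'I_5) : 'I_3 -> R := fun j =>
  match val i with
  | 0%N => nth 0 [:: 0; 0; sg] j
  | 1%N => nth 0 [:: sg * cos a; - (sg * sin a); 0] j
  | 2%N => nth 0 [:: sg * sin a; sg * cos a; 0] j
  | _ => 0 end.

Variables (u : R3 R -> RCC R) (sg a : R).
Hypotheses (sg1 : sg ^+ 2 = 1)
  (hu : forall x, x != 0 -> forall i, comp5 i u x = lin (eqrow sg a i) x * inorm x).

Let sgN : `|sg| = 1.
Proof. by apply/eqP; rewrite -(@eqrXn2 _ 2 `|sg| 1) ?normr_ge0 ?ler01// real_normK ?num_real// sg1 expr1n. Qed.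

Lemma eq_smooth i : smooth_on [set x : R3 R | x != 0] (comp5 i u).
Proof.
apply: (smooth_ext open_off0 _ (smoothM open_off0 (smooth_lin (eqrow sg a i) open_off0) smooth_inorm)).
by move=> x x0; rewrite hu.
Qed.

Lemma eq_partial i j x : x != 0 ->
  partial j (comp5 i u) x = eqrow sg a i j * inorm x - lin (eqrow sg a i) x * xc j x * inorm x ^+ 3.
Proof.
move=> x0; rewrite -partial_lin//; apply: near_partial.
by apply: (eq_on_near open_off0) => // y y0; rewrite hu.
Qed.

Lemma eq_density x : offaxis x -> density u x = 2 / nsq x.
Proof.
move=> ox; have x0 := off_neq0 ox; rewrite density_off//.
have T := inorm_sqr x0; have n0 := nsq_gt0 x0.
rewrite sum5E !sum3E !eq_partial// /lin !sum3E /eqrow /xc /=.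
have -> : 2 / nsq x = 2 * inorm x ^+ 2 by rewrite -[2 * _]mulr1 -T; field; rewrite gt_eqF.
have cs := cos2Dsin2 a; move: (cos a) (sin a) cs (inorm x) T => c s cs t.
rewrite /nsq; case: (x) => [[y1 y2] y3] /= T.
have c2 : c ^+ 2 = 1 - s ^+ 2 by rewrite -cs; ring.
transitivity (sg ^+ 2 * (t ^+ 2 * (1 + 2 * (c ^+ 2 + s ^+ 2)) - 2 * t ^+ 4 * (y3 ^+ 2 + (c ^+ 2 + s ^+ 2) * (y1 ^+ 2 + y2 ^+ 2))
  + t ^+ 6 * (y3 ^+ 2 + (c ^+ 2 + s ^+ 2) * (y1 ^+ 2 + y2 ^+ 2)) * (y1 ^+ 2 + y2 ^+ 2 + y3 ^+ 2))); first by ring.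
rewrite sg1 cs.
transitivity (3 * t ^+ 2 - 2 * t ^+ 2 * (t ^+ 2 * (y1 ^+ 2 + y2 ^+ 2 + y3 ^+ 2)) + t ^+ 2 * (t ^+ 2 * (y1 ^+ 2 + y2 ^+ 2 + y3 ^+ 2)) ^+ 2); first by ring.
rewrite T; ring.
Qed.

Lemma coord5_inj (y z : RCC R) : (forall i, coord5 i y = coord5 i z) -> y = z.
Proof.
move=> h; have := h ord0; have := h ix1; have := h ix2.
have := h ix3; have := h ix4.
by rewrite /coord5 /=; case: y z {h} => [[t [a1 b1]] [a2 b2]] [[t' [a1' b1']] [a2' b2']] /=;
  rewrite !(tnth_nth 0) /= => -> -> -> -> ->.
Qed.

Lemma inorm_rot b x : inorm (rot3 b x) = inorm x.
Proof. by rewrite /inorm nsq_rot. Qed.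

Lemma rot_neq0 b x : x != 0 -> rot3 b x != 0.
Proof. by rewrite -!nsq_eq0 nsq_rot. Qed.

Lemma eq_equivariant b x : x != 0 -> u (rot3 b x) = rot5 b (u x).
Proof.
move=> x0; apply: coord5_inj => i; rewrite coord5_rot -/(comp5 i u (rot3 b x)) hu ?rot_neq0// inorm_rot.
have C k : coord5 k (u x) = lin (eqrow sg a k) x * inorm x by rewrite -hu.
have C2 : complex.Re (u x).1.2 = coord5 ix1 (u x) by [].
have C3 : complex.Im (u x).1.2 = coord5 ix2 (u x) by [].
have C4 : complex.Re (u x).2 = coord5 ix3 (u x) by [].
have C5 : complex.Im (u x).2 = coord5 ix4 (u x) by [].
rewrite /Jc C2 C3 C4 C5 !C /lin !sum3E /wt /eqrow /xc /rot3.
case: i => [[|[|[|[|[|//]]]]] hi] /=; rewrite ?mul0r ?cos0 ?sin0 ?mul1r; ring.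
Qed.

Lemma eq_sphere x : x != 0 -> Sphere4 (u x).
Proof.
move=> x0; rewrite /Sphere4/= /norm5 -[RHS]sqrtr1; congr Num.sqrt.
have C k : coord5 k (u x) = lin (eqrow sg a k) x * inorm x by rewrite -hu.
rewrite sum5E !C /lin !sum3E /eqrow /xc /= -(inorm_sqr x0) /nsq.
have cs := cos2Dsin2 a; move: (cos a) (sin a) cs (inorm x) => c s cs t.
transitivity (t ^+ 2 * (sg ^+ 2 * ((c ^+ 2 + s ^+ 2) * (x.1.1 ^+ 2 + x.1.2 ^+ 2) + x.2 ^+ 2))); first by ring.
by rewrite cs sg1 !mul1r.
Qed.

Lemma comp_le1 i x : x != 0 -> `|comp5 i u x| <= 1.
Proof. by move=> /eq_sphere; exact: coord5_le1. Qed.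

Lemma eq_nice r : nice r u.
Proof.
apply: (@nice_intro r u (1 + norm5 (u 0)) 2).
- by move=> i; apply: meas_off0 => x x0; exact: smooth_cont (eq_smooth i) x0.
- move=> i x; have [->|x0] := eqVneq x 0; last first.
    by apply: le_trans (comp_le1 i x0) _; rewrite lerDl sqrtr_ge0.
  apply: (@le_trans _ _ (norm5 (u 0))); last by rewrite lerDr.
  apply: sqr_le_norm; first exact: sqrtr_ge0.
  rewrite sqr_sqrtr; last by apply: sumr_ge0 => k _; exact: sqr_ge0.
  by rewrite (bigD1 i)//= lerDl; apply: sumr_ge0 => k _; exact: sqr_ge0.
- by move=> i; apply: smooth_sub (eq_smooth i) => x; exact: off_neq0.
- by move=> x ox; rewrite eq_density.
Qed.

Lemma eq_admissible r : 0 < r -> admissible r u (fun i j => pd j (comp5 i u)).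
Proof.
move=> r0; have n := eq_nice r.
have sp : {ae leb3, forall x, Ball3 r x -> Sphere4 (u x)}.
  by apply: ae_imp (null_axis R) => x /off_neq0 x0 _; exact: eq_sphere.
have [_ sq _] := W12_nice r0 n sp.
split=> //.
- by move=> i j; have [] := nice_weak i j r0 n.
- by move=> i j; have [] := nice_weak i j r0 n.
- by move=> b; apply: ae_imp (null_axis R) => x /off_neq0 x0 _; exact: eq_equivariant.
Qed.

(** Here [v_0 = sg * x_3 / |x|] and the square root of [1 - v_0 ^ 2] is [rho / |x|]; the calibration
    reduces to [2 / |x| ^ 2], the density of [x / |x|]. *)
Lemma eq_cal x : offaxis x -> cal sg u (fun i j => pd j (comp5 i u)) x = density u x.
Proof.
move=> ox; have x0 := off_neq0 ox; have ro := rho2_gt0 ox; have n0 := nsq_gt0 x0.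
have T := inorm_sqr x0.
have t0 : 0 < inorm x by rewrite /inorm invr_gt0 sqrtr_gt0.
rewrite eq_density// /cal !pdE// !eq_partial// clamp_id ?comp_le1// arcden_in ?comp_le1// hu//.
have L0 : lin (eqrow sg a ord0) x = sg * x.2 by rewrite /lin sum3E /eqrow /xc /=; ring.
rewrite L0 (_ : eqrow sg a ord0 ord0_3 = 0)// (_ : eqrow sg a ord0 ord1_3 = 0)// (_ : eqrow sg a ord0 ord2 = sg)//.
rewrite (_ : xc ord0_3 x = x.1.1)// (_ : xc ord1_3 x = x.1.2)// (_ : xc ord2 x = x.2)//.
have -> : 1 - (sg * x.2 * inorm x) ^+ 2 = (Num.sqrt (rho2 x) * inorm x) ^+ 2.
  by rewrite !exprMn (sqr_sqrtr (ltW ro)) -T nsq_rho2 sg1; ring.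
rewrite sqrtr_sqr ger0_norm; last by rewrite mulr_ge0 ?sqrtr_ge0// ltW.
have s0 : 0 < Num.sqrt (rho2 x) by rewrite sqrtr_gt0.
have sE : Num.sqrt (rho2 x) ^+ 2 = rho2 x by rewrite sqr_sqrtr// ltW.
have -> : 2 / nsq x = 2 * inorm x ^+ 2 by rewrite -[2 * _]mulr1 -T; field; rewrite gt_eqF.
transitivity (sg ^+ 2 * (2 * x.2 ^+ 2 * inorm x ^+ 4 * ((x.1.1 ^+ 2 + x.1.2 ^+ 2) / rho2 x)
   + 2 * (inorm x ^+ 2 - x.2 ^+ 2 * inorm x ^+ 4) * (Num.sqrt (rho2 x) / Num.sqrt (rho2 x)))).
  by ring.
rewrite -/(rho2 x) !divff ?gt_eqF// sg1; ring.
Qed.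

Lemma eq_minimizing : locally_minimizing u.
Proof.
move=> r w r0 ww ew es; apply: (minimizing_of_calibration r0 sgN (eq_admissible r0)) => //.
apply: ae_imp (null_axis R) => x ox _; exact: eq_cal.
Qed.

End ModelMap.

Section ModelForm.
Variable R : realType.

Lemma model_coords (u : R3 R -> RCC R) (a : R) :
  ((forall x : R3 R, x != 0 -> u x = rot5 a (hom_ext (@omega_eq1 R) x)) \/
   (forall x : R3 R, x != 0 -> u x = - rot5 a (hom_ext (@omega_eq1 R) x))) <->
  exists2 sg : R, sg = 1 \/ sg = - 1 & forall x, x != 0 -> forall i, comp5 i u x = lin (eqrow sg a i) x * inorm x.
Proof.
have K x i : coord5 i (rot5 a (hom_ext (@omega_eq1 R) x)) = lin (eqrow 1 a i) x * inorm x.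
  rewrite coord5_rot /Jc /lin sum3E /eqrow /xc /wt /hom_ext /omega_eq1 -inormE.
  have S1 : (inorm x *: x).1.1 = inorm x * x.1.1 by [].
  have S2 : (inorm x *: x).1.2 = inorm x * x.1.2 by [].
  have S3 : (inorm x *: x).2 = inorm x * x.2 by [].
  rewrite S1 S2 S3.
  by case: i => [[|[|[|[|[|//]]]]] hi]; rewrite /coord5 (tnth_nth 0) /= ?mul0r ?cos0 ?sin0 ?mul1r; ring.
have N (y : RCC R) i : coord5 i (- y) = - coord5 i y.
  by case: y => [[t [a1 b1]] [a2 b2]]; case: i => [[|[|[|[|[|//]]]]] hi]; rewrite /coord5 !(tnth_nth 0).
have K' x i : lin (eqrow (- 1) a i) x * inorm x = - (lin (eqrow 1 a i) x * inorm x).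
  rewrite /lin !sum3E /eqrow /xc; case: i => [[|[|[|[|[|//]]]]] hi] /=; ring.
split.
- move=> [h|h].
    by exists 1; [left|move=> x x0 i; rewrite /comp5 h].
  by exists (- 1); [right|move=> x x0 i; rewrite /comp5 h// N K K'].
- move=> [sg [->|->] h]; [left|right] => x x0; apply: coord5_inj => i.
    by rewrite K -h.
  by rewrite N K -K' -h.
Qed.
End ModelForm.

Section Composition.
Variable R : realType.
Implicit Types (x : R3 R) (j : 'I_3) (F f : R3 R -> R) (U V : set (R3 R)).

Lemma open_preimage3 V U (pi : R3 R -> R3 R) : open V -> open U ->
  (forall x, V x -> {for x, continuous pi}) -> open [set x | V x /\ U (pi x)].
Proof.
move=> oV oU cpi; rewrite openE => x [Vx Ux]; rewrite /interior/=.
have n1 : nbhs x V by apply: open_nbhs_nbhs.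
have n2 : nbhs (pi x) U by apply: open_nbhs_nbhs.
exact: filterI n1 (cpi x Vx U n2).
Qed.

Lemma Ck_map n V U F (p1 p2 p3 : R3 R -> R) : open V -> open U -> smooth_on U F ->
  smooth_on V p1 -> smooth_on V p2 -> smooth_on V p3 ->
  (forall x, V x -> U (p1 x, p2 x, p3 x)) -> Ck n V (fun x => F (p1 x, p2 x, p3 x)).
Proof.
move=> oV oU sF s1 s2 s3 VU.
have c (G : R3 R -> R) x : smooth_on U G -> V x -> {for x, continuous (fun x => G (p1 x, p2 x, p3 x))}.
  move=> sG Vx.
  have c0 : {for x, continuous (fun x => (p1 x, p2 x, p3 x) : R3 R)}.
    by apply: cont_pair; [apply: cont_pair; [exact: smooth_cont s1 Vx|exact: smooth_cont s2 Vx]|exact: smooth_cont s3 Vx].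
  by apply: (continuous_comp c0); exact: smooth_cont sG (VU x Vx).
elim: n F sF => [|n IH] F sF /=; first by move=> x; exact: c.
have D x j : V x -> is_derive x (basis3 R j) (fun x => F (p1 x, p2 x, p3 x))
   (partial ord0_3 F (p1 x, p2 x, p3 x) * partial j p1 x + partial ord1_3 F (p1 x, p2 x, p3 x) * partial j p2 x
     + partial ord2 F (p1 x, p2 x, p3 x) * partial j p3 x).
  move=> Vx; apply/is_derive_line.
  have l (q : R3 R -> R) : smooth_on V q -> is_derive (0 : R) 1 (fun h => q (x + h *: basis3 R j)) (partial j q x).
    by move=> sq; have /is_derive_line := smooth_derivable j sq Vx.
  have := @is_derive_curve R F _ _ _ 0 _ _ _ _ (l _ s1) (l _ s2) (l _ s3).
  rewrite scale0r addr0; apply; exact: smooth_c1_near oU sF (VU x Vx).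
split; first by move=> x; exact: c.
move=> j; split; first by move=> x Vx; case: (D x j Vx).
have sp k := IH _ (smooth_partial k sF).
have := CkD oV (CkD oV (CkM oV (sp ord0_3) ((smooth_onP _ _).1 (smooth_partial j s1) n))
   (CkM oV (sp ord1_3) ((smooth_onP _ _).1 (smooth_partial j s2) n)))
   (CkM oV (sp ord2) ((smooth_onP _ _).1 (smooth_partial j s3) n)).
by apply: (Ck_ext oV) => x Vx; rewrite /partial; case: (D x j Vx) => _ ->.
Qed.

Lemma smooth_map V U F (p1 p2 p3 : R3 R -> R) : open V -> open U -> smooth_on U F ->
  smooth_on V p1 -> smooth_on V p2 -> smooth_on V p3 ->
  (forall x, V x -> U (p1 x, p2 x, p3 x)) -> smooth_on V (fun x => F (p1 x, p2 x, p3 x)).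
Proof. by move=> oV oU sF s1 s2 s3 VU; apply/smooth_onP => n; exact: (Ck_map n oV oU sF s1 s2 s3 VU). Qed.

End Composition.

(** * Profiles of equivariant harmonic maps *)

Section TangentMap.
Variable R : realType.
Implicit Types (x : R3 R) (i : 'I_5) (j : 'I_3).
Local Notation off0 := [set x : R3 R | x != 0].

Definition proj2 x : R3 R := (inorm x * x.1.1, inorm x * x.1.2, inorm x * x.2).

Lemma proj2E x : (norm3 x)^-1 *: x = proj2 x. Proof. by case: x => [[]]. Qed.

Lemma proj2_sphere x : x != 0 -> Sphere2 (proj2 x).
Proof.
move=> x0; rewrite /Sphere2/= -[RHS]sqrtr1; congr Num.sqrt; rewrite -(inorm_sqr x0) /nsq /=; ring.
Qed.

Lemma inorm_sphere x : Sphere2 x -> inorm x = 1.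
Proof. by rewrite /Sphere2 /inorm /norm3 /= => ->; rewrite invr1. Qed.

Lemma smooth_proj2 : [/\ smooth_on off0 (fun x => inorm x * x.1.1), smooth_on off0 (fun x => inorm x * x.1.2) &
  smooth_on off0 (fun x => inorm x * x.2)].
Proof.
have oO := @open_off0 R; have [s1 s2 s3] := smooth_coord oO; have si := @smooth_inorm R.
by split; apply: smoothM.
Qed.

(** The local smooth extensions are composed with the projection [x / |x|], on whose values they
    agree with [f]. *)
Lemma hom_smooth (f : R3 R -> R) : smooth_on_S2 f -> smooth_on off0 (hom_ext f).
Proof.
move=> sf s x x0; have oO := @open_off0 R.
have [p1 p2 p3] := smooth_proj2.
have [U [F [oU Ux sF fF]]] := sf _ (proj2_sphere x0).
pose V := [set y : R3 R | off0 y /\ U (proj2 y)].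
have oV : open V.
  apply: open_preimage3 => // y y0; apply: cont_pair; last exact: smooth_cont p3 y0.
  by apply: cont_pair; [exact: smooth_cont p1 y0|exact: smooth_cont p2 y0].
have VO : V `<=` off0 by move=> y [].
have sV := smooth_map oV oU sF (smooth_sub VO p1) (smooth_sub VO p2) (smooth_sub VO p3) (fun y h => h.2).
have : smooth_on V (hom_ext f).
  apply: (smooth_ext oV _ sV) => y [y0 Uy]; rewrite /hom_ext proj2E fF//; exact: proj2_sphere.
by apply; split.
Qed.

Variables (u o : R3 R -> RCC R).
Hypotheses (ho : harmonic_S2_S4 o) (eo : equivariant_on (@Sphere2 R) o)
  (hu : forall x, x != 0 -> u x = hom_ext o x).

Lemma comp_hom i x : x != 0 -> comp5 i u x = hom_ext (comp5 i o) x.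
Proof. by move=> x0; rewrite /comp5 hu. Qed.

Lemma u_smooth i : smooth_on off0 (comp5 i u).
Proof.
have [_ so _] := ho.
by apply: (smooth_ext (@open_off0 R) _ (hom_smooth (so i))) => x x0; rewrite comp_hom.
Qed.

Lemma u_sphere x : x != 0 -> Sphere4 (u x).
Proof.
move=> x0; rewrite hu// /hom_ext proj2E; have [so _ _] := ho; apply: so; exact: proj2_sphere.
Qed.

Lemma proj2_rot a x : proj2 (rot3 a x) = rot3 a (proj2 x).
Proof. by rewrite /proj2 inorm_rot /rot3/=; congr (_, _, _); ring. Qed.

Lemma u_equiv a x : x != 0 -> u (rot3 a x) = rot5 a (u x).
Proof.
by move=> x0; rewrite !hu ?rot_neq0// /hom_ext !proj2E proj2_rot eo//; exact: proj2_sphere.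
Qed.

Lemma u_homog c x : 0 < c -> x != 0 -> u (c * x.1.1, c * x.1.2, c * x.2) = u x.
Proof.
move=> c0 x0.
have nE : nsq (c * x.1.1, c * x.1.2, c * x.2) = c ^+ 2 * nsq x by rewrite /nsq /=; ring.
have y0 : (c * x.1.1, c * x.1.2, c * x.2) != 0 :> R3 R.
  by rewrite -nsq_eq0 nE mulf_eq0 negb_or nsq_eq0 x0 andbT expf_neq0// gt_eqF.
rewrite !hu// /hom_ext !proj2E; congr o; rewrite /proj2 /inorm nE sqrtrM ?sqr_ge0//.
rewrite sqrtr_sqr gtr0_norm// invfM /=.
by congr (_, _, _); rewrite mulrACA mulVf ?mul1r ?gt_eqF.
Qed.

Lemma proj2_id x : Sphere2 x -> proj2 x = x.
Proof. by move=> /inorm_sphere h; rewrite /proj2 h !mul1r; case: x {h} => [[]]. Qed.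

Lemma sphere_neq0 x : Sphere2 x -> x != 0.
Proof. by rewrite /Sphere2/= => h; rewrite -nsq_eq0 -nsqE h expr1n oner_eq0. Qed.

Lemma partial_hom i j x : x != 0 -> partial j (comp5 i u) x = partial j (hom_ext (comp5 i o)) x.
Proof.
by move=> x0; apply: near_partial; apply: (eq_on_near (@open_off0 R)) => // y y0; exact: comp_hom.
Qed.

Lemma u_harmonic i x : Sphere2 x -> offaxis x ->
  \sum_(j < 3) partial j (partial j (comp5 i u)) x + density u x * comp5 i u x = 0.
Proof.
move=> Sx ox; have x0 := sphere_neq0 Sx; have [_ _ h] := ho.
have E := h i x Sx; rewrite /laplace_beltrami /laplacian /tgrad_sqr /tgrad in E; rewrite density_off//.
have -> : comp5 i u x = comp5 i o x by rewrite comp_hom// /hom_ext proj2E proj2_id.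
have e1 : \sum_(j < 3) partial j (partial j (comp5 i u)) x = \sum_(j < 3) partial j (partial j (hom_ext (comp5 i o))) x.
  apply: eq_bigr => j _; apply: near_partial.
  by apply: (eq_on_near (@open_off0 R)) => // y y0; exact: partial_hom.
have e2 : \sum_(i < 5) \sum_(j < 3) partial j (comp5 i u) x ^+ 2 = \sum_(i < 5) \sum_(j < 3) partial j (hom_ext (comp5 i o)) x ^+ 2.
  by apply: eq_bigr => k _; apply: eq_bigr => j _; rewrite partial_hom.
by rewrite e1 e2.
Qed.

Lemma u_density_bound : exists C, forall i j x, Sphere2 x -> `|partial j (comp5 i u) x| <= C.
Proof.
have cS : compact (@Sphere2 R).
  apply: (@closed_bounded_compact3 R _ 1); last by move=> x; rewrite -nsqE => ->; rewrite expr1n.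
  rewrite (_ : @Sphere2 R = [set x | nsq x <= 1] `&` [set x | 1 <= nsq x]).
    by apply: closedI; [exact: closed_nsq_le|exact: closed_nsq_ge].
  apply/seteqP; split=> x; rewrite /Sphere2 /= -nsqE.
    by move=> ->; rewrite expr1n lexx.
  move=> [h1 h2]; apply/eqP; rewrite -(@eqrXn2 _ 2) ?norm3_ge0// expr1n eq_le h1//.
have H (p : 'I_5 * 'I_3) : exists C, forall x, Sphere2 x -> `|partial p.2 (comp5 p.1 u) x| <= C.
  have ch : {within @Sphere2 R, continuous (fun x => `|partial p.2 (comp5 p.1 u) x|)}.
    apply: continuous_in_subspaceT => x /set_mem Sx.
    have c := smooth_cont (smooth_partial p.2 (u_smooth p.1)) (sphere_neq0 Sx).
    exact: (continuous_comp c (@norm_continuous _ R _)).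
  have S0 : @Sphere2 R !=set0.
    exists (1, 0, 0); rewrite /Sphere2/= /norm3 /= !expr0n !addr0 expr1n sqrtr1//.
  have [c _ hc] := compact_EVT_max S0 cS ch.
  by exists `|partial p.2 (comp5 p.1 u) c| => x Sx; apply: hc; exact: mem_set.
have [C HC] := choice H.
exists (\sum_p `|C p|) => i j x Sx.
apply: le_trans (HC (i, j) x Sx) _; apply: le_trans (ler_norm _) _.
by rewrite (bigD1 (i, j))//= lerDl; apply: sumr_ge0.
Qed.

End TangentMap.

(** * Conformal coordinates on the sphere minus its poles *)

Section CylindricalCoordinates.
Variable R : realType.
Implicit Types (x : R3 R) (i : 'I_5) (j : 'I_3) (t : R).

Definition sh t : R := (expR t - expR (- t)) / 2.
Definition ch t : R := (expR t + expR (- t)) / 2.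

Lemma is_derive_expN t : is_derive t 1 (fun t : R => expR (- t)) (- expR (- t)).
Proof.
have d : is_derive t 1 (fun t : R => - t) (-1) by exact: is_deriveN (is_derive_id t 1).
by have := is_derive_comp1 d (is_derive_expR (- t)); rewrite mulrN1.
Qed.

Lemma sh_derive t : is_derive t 1 sh (ch t).
Proof.
have := is_deriveM (is_deriveB (is_derive_expR t) (is_derive_expN t)) (@is_derive_cst _ _ _ (2^-1 : R) t 1).
by congr is_derive; rewrite !scalE mulr0 add0r opprK /ch mulrC.
Qed.

Lemma ch_derive t : is_derive t 1 ch (sh t).
Proof.
have := is_deriveM (is_deriveD (is_derive_expR t) (is_derive_expN t)) (@is_derive_cst _ _ _ (2^-1 : R) t 1).
by congr is_derive; rewrite !scalE mulr0 add0r /sh mulrC.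
Qed.

Lemma ch_gt0 t : 0 < ch t.
Proof. by rewrite divr_gt0// addr_gt0// expR_gt0. Qed.

Lemma ch2sh2 t : ch t ^+ 2 = 1 + sh t ^+ 2.
Proof.
have := expRxMexpNx_1 t; rewrite /ch /sh; move: (expR t) (expR (- t)) => a b h.
transitivity (a * b + ((a - b) / 2) ^+ 2); first by field.
by rewrite h.
Qed.

Definition isq x : R := (Num.sqrt (rho2 x))^-1.

Lemma isq_gt0 x : offaxis x -> 0 < isq x.
Proof. by move=> /rho2_gt0 h; rewrite invr_gt0 sqrtr_gt0. Qed.

Lemma isq_sqr x : offaxis x -> isq x ^+ 2 * rho2 x = 1.
Proof. by move=> /rho2_gt0 h; rewrite /isq exprVn sqr_sqrtr ?ltW// mulVf// gt_eqF. Qed.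

Lemma isq_sqrE x : offaxis x -> isq x ^+ 2 = (rho2 x)^-1.
Proof. by move=> /rho2_gt0 h; rewrite /isq exprVn sqr_sqrtr ?ltW. Qed.

Lemma is_derive_isq x j : offaxis x -> is_derive x (basis3 R j) isq
  (- isq x ^+ 3 * (x.1.1 * (val j == 0%N)%:R + x.1.2 * (val j == 1%N)%:R)).
Proof.
move=> ox; have := is_derive_comp1 (is_derive_rho2 x j) (isq_derive (rho2_gt0 ox)).
congr is_derive; rewrite -/(isq x); move: (isq x) => q; by field.
Qed.

(** [T] is the latitude of the Mercator projection, the inverse hyperbolic sine of [x_3 / rho]. Its
    partner, the azimuth, is multivalued and enters only through its cosine [cosx], its sine [sinx]
    and its gradient. *)
Definition expT x : R := (norm3 x + x.2) * isq x.
Definition T x : R := ln (expT x).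

Lemma norm3_inorm x : x != 0 -> norm3 x * inorm x = 1.
Proof. by move=> /nsq_gt0 h; rewrite /inorm -/(norm3 x) mulfV// gt_eqF// sqrtr_gt0. Qed.

Lemma norm3_gt x : offaxis x -> 0 < norm3 x + x.2 /\ 0 < norm3 x - x.2.
Proof.
move=> ox; have r0 := rho2_gt0 ox; have n0 := norm3_ge0 x.
have h : `|x.2| ^+ 2 < norm3 x ^+ 2 by rewrite nsqE nsq_rho2 real_normK ?num_real// ltrDr.
have : `|x.2| < norm3 x by rewrite -(ltr_pXn2r (n := 2))// nnegrE.
by rewrite ltr_norml => /andP[h1 h2]; split; lra.
Qed.

Lemma expT_gt0 x : offaxis x -> 0 < expT x.
Proof. by move=> ox; rewrite mulr_gt0 ?isq_gt0//; case: (norm3_gt ox). Qed.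

Lemma expR_T x : offaxis x -> expR (T x) = expT x.
Proof. by move=> ox; rewrite /T lnK// posrE expT_gt0. Qed.

Lemma expR_NT x : offaxis x -> expR (- T x) = (norm3 x - x.2) * isq x.
Proof.
move=> ox; have h := expT_gt0 ox; rewrite expRN expR_T//.
have e : ((norm3 x - x.2) * isq x) * expT x = 1.
  by rewrite -(isq_sqr ox) /expT (_ : rho2 x = norm3 x ^+ 2 - x.2 ^+ 2); [ring|rewrite nsqE nsq_rho2; ring].
by rewrite -[LHS]mul1r -e mulfK// gt_eqF.
Qed.

Lemma sh_T x : offaxis x -> sh (T x) = x.2 * isq x.
Proof. by move=> ox; rewrite /sh expR_T// expR_NT// /expT; field. Qed.

Lemma ch_T x : offaxis x -> ch (T x) = norm3 x * isq x.
Proof. by move=> ox; rewrite /ch expR_T// expR_NT// /expT; field. Qed.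

(** [Td] and [ph] are the gradients of [T] and of the azimuth. *)
Definition Td j x : R := nth 0 [:: - (x.2 * x.1.1 * inorm x * isq x ^+ 2); - (x.2 * x.1.2 * inorm x * isq x ^+ 2); inorm x] j.
Definition ph j x : R := nth 0 [:: - (x.1.2 * isq x ^+ 2); x.1.1 * isq x ^+ 2; 0] j.

Lemma is_derive_norm3 x j : x != 0 -> is_derive x (basis3 R j) (@norm3 R) (xc j x * inorm x).
Proof.
move=> x0; have := is_derive_comp1 (is_derive_nsq x j) (is_derive1_sqrt (nsq_gt0 x0)).
congr is_derive; rewrite /inorm -/(norm3 x).
have : norm3 x != 0 by rewrite gt_eqF// sqrtr_gt0 nsq_gt0.
by move: (norm3 x) (xc j x) => n y h; field.
Qed.

Lemma is_derive_add (W : normedModType R) (f h : W -> R) (x v : W) (df dh : R) : is_derive x v f df -> is_derive x v h dh ->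
  is_derive x v (fun y : W => f y + h y) (df + dh).
Proof. by move=> d1 d2; exact: (is_deriveD d1 d2). Qed.

Lemma is_derive_T x j : offaxis x -> is_derive x (basis3 R j) T (Td j x).
Proof.
move=> ox; have x0 := off_neq0 ox.
have [_ _ d3] := is_derive_coord x j.
have d := is_derive_comp1 (is_derive_mul (is_derive_add (is_derive_norm3 j x0) d3) (is_derive_isq j ox)) (is_derive1_ln (expT_gt0 ox)).
move: d; congr is_derive; rewrite /expT /=.
have q2 := isq_sqr ox; have nt := norm3_inorm x0; have [np nm] := norm3_gt ox.
have q0 := isq_gt0 ox.
have nE : norm3 x ^+ 2 = rho2 x + x.2 ^+ 2 by rewrite nsqE nsq_rho2.
apply: (mulfI (x := (norm3 x + x.2) * isq x)); first by rewrite mulf_neq0// gt_eqF.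
rewrite mulrA divff ?mul1r; last by rewrite mulf_neq0// gt_eqF.
have tE : inorm x = (norm3 x)^-1 by [].
have n0 : norm3 x != 0 by rewrite gt_eqF// sqrtr_gt0 nsq_gt0.
have key : isq x ^+ 2 * (norm3 x + x.2) * (norm3 x - x.2) = 1.
  by rewrite -q2 (_ : rho2 x = norm3 x ^+ 2 - x.2 ^+ 2); [ring|rewrite nE; ring].
have k2 : isq x ^+ 2 * (norm3 x + x.2) - inorm x = x.2 * inorm x * isq x ^+ 2 * (norm3 x + x.2).
  by rewrite -[X in _ - X = _]mulr1 -{1}key -[X in X - _]mulr1 -nt; ring.
rewrite /xc /Td; case: j {d3} => [[|[|[|//]]] hj] /=.
- transitivity (- (isq x * x.1.1 * (isq x ^+ 2 * (norm3 x + x.2) - inorm x))); first by ring.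
  by rewrite k2; ring.
- transitivity (- (isq x * x.1.2 * (isq x ^+ 2 * (norm3 x + x.2) - inorm x))); first by ring.
  by rewrite k2; ring.
- by rewrite -[X in _ + isq x * (_ + X)]nt; ring.
Qed.

Definition cosx x : R := x.1.1 * isq x.
Definition sinx x : R := x.1.2 * isq x.

Lemma cosx2sinx2 x : offaxis x -> cosx x ^+ 2 + sinx x ^+ 2 = 1.
Proof. by move=> ox; rewrite -(isq_sqr ox) /cosx /sinx /rho2; ring. Qed.

Lemma is_derive_cosx x j : offaxis x -> is_derive x (basis3 R j) cosx (- sinx x * ph j x).
Proof.
move=> ox; have [d1 _ _] := is_derive_coord x j.
have := is_derive_mul d1 (is_derive_isq j ox); congr is_derive.
have q2 := isq_sqr ox; rewrite /sinx /ph; move: q2; rewrite /rho2; move: (isq x) (x.1.1) (x.1.2) => q a b q2.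
case: j {d1} => [[|[|[|//]]] hj] /=; [|ring|ring].
transitivity (a * (- q ^+ 3 * a) + q * (q ^+ 2 * (a ^+ 2 + b ^+ 2))); first by rewrite q2; ring.
ring.
Qed.

Lemma is_derive_sinx x j : offaxis x -> is_derive x (basis3 R j) sinx (cosx x * ph j x).
Proof.
move=> ox; have [_ d1 _] := is_derive_coord x j.
have := is_derive_mul d1 (is_derive_isq j ox); congr is_derive.
have q2 := isq_sqr ox; rewrite /cosx /ph; move: q2; rewrite /rho2; move: (isq x) (x.1.1) (x.1.2) => q a b q2.
case: j {d1} => [[|[|[|//]]] hj] /=; [ring| |ring].
transitivity (b * (- q ^+ 3 * b) + q * (q ^+ 2 * (a ^+ 2 + b ^+ 2))); first by rewrite q2; ring.
ring.
Qed.

(** Cosine and sine of [wt i] times the azimuth, with the double angle formulas written out. *)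
Definition Cw i x : R := nth 0 [:: 1; cosx x; cosx x; cosx x ^+ 2 - sinx x ^+ 2; cosx x ^+ 2 - sinx x ^+ 2] i.
Definition Sw i x : R := nth 0 [:: 0; sinx x; sinx x; 2 * cosx x * sinx x; 2 * cosx x * sinx x] i.

Lemma Cw2Sw2 i x : offaxis x -> Cw i x ^+ 2 + Sw i x ^+ 2 = 1.
Proof.
move=> /cosx2sinx2 h; rewrite /Cw /Sw; case: i => [[|[|[|[|[|//]]]]] hi] //=; first by rewrite expr1n expr0n addr0.
all: transitivity ((cosx x ^+ 2 + sinx x ^+ 2) ^+ 2); by [ring|rewrite h expr1n].
Qed.

Lemma is_derive_sq2 (c s : R3 R -> R) x v (dc ds : R) : is_derive x v c dc -> is_derive x v s ds ->
  is_derive x v (fun x => c x ^+ 2 - s x ^+ 2) (2 * c x * dc - 2 * s x * ds) /\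
  is_derive x v (fun x => 2 * c x * s x) (2 * (c x * ds + s x * dc)).
Proof.
move=> hc hs; split.
  have := is_deriveB (is_deriveM hc hc) (is_deriveM hs hs).
  by congr is_derive; rewrite !scalE; ring.
have := is_derive_mul (@is_derive_cst _ _ _ (2 : R) x v) (is_derive_mul hc hs).
by congr is_derive; [apply/funext => y; rewrite mulrA|ring].
Qed.

Lemma is_derive_CS i x j : offaxis x ->
  is_derive x (basis3 R j) (Cw i) (- (wt R i * Sw i x * ph j x)) /\
  is_derive x (basis3 R j) (Sw i) (wt R i * Cw i x * ph j x).
Proof.
move=> ox; have dc := is_derive_cosx j ox; have ds := is_derive_sinx j ox.
have [d1 d2] := is_derive_sq2 dc ds.
rewrite /Cw /Sw /wt; case: i => [[|[|[|[|[|//]]]]] hi] /=.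
- by rewrite !mul0r oppr0; split; exact: is_derive_cst.
- by rewrite !mul1r -mulNr; split.
- by rewrite !mul1r -mulNr; split.
- by split; [move: d1|move: d2]; congr is_derive; ring.
- by split; [move: d1|move: d2]; congr is_derive; ring.
Qed.

Definition Jn i (F : 'I_5 -> R) : R :=
  nth 0 [:: 0; - F ix2; F ix1; - F ix4; F ix3] i.

(** The equivariant homogeneous map with profile [F]: the profile at [T x], rotated by the azimuth.
    [evJ] is its complex multiple by the imaginary unit, so azimuthal derivatives exchange the two
    up to weight and sign. *)
Definition ev (F : 'I_5 -> R -> R) i x : R := Cw i x * F i (T x) + Sw i x * Jn i (fun k => F k (T x)).
Definition evJ (F : 'I_5 -> R -> R) i x : R := Cw i x * Jn i (fun k => F k (T x)) - Sw i x * F i (T x).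

Lemma is_derive_ev (F F' : 'I_5 -> R -> R) i x j : offaxis x ->
  (forall i t, is_derive t 1 (F i) (F' i t)) ->
  is_derive x (basis3 R j) (ev F i) (Td j x * ev F' i x + ph j x * (wt R i * evJ F i x)) /\
  is_derive x (basis3 R j) (evJ F i) (Td j x * evJ F' i x - ph j x * (wt R i * ev F i x)).
Proof.
move=> ox dF.
have dT k : is_derive x (basis3 R j) (fun x => F k (T x)) (F' k (T x) * Td j x).
  exact: is_derive_comp1 (is_derive_T j ox) (dF k (T x)).
have dJ : is_derive x (basis3 R j) (fun x => Jn i (fun k => F k (T x))) (Jn i (fun k => F' k (T x)) * Td j x).
  rewrite /Jn; case: i => [[|[|[|[|[|//]]]]] hi] /=; rewrite ?mulNr ?mul0r.
  - exact: is_derive_cst.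
  - exact: is_deriveN.
  - exact: dT.
  - exact: is_deriveN.
  - exact: dT.
have [dC dS] := is_derive_CS i j ox.
split.
  have := is_deriveD (is_derive_mul dC (dT i)) (is_derive_mul dS dJ).
  by congr is_derive; rewrite /ev /evJ; ring.
have := is_deriveB (is_derive_mul dC dJ) (is_derive_mul dS (dT i)).
by congr is_derive; rewrite /ev /evJ; ring.
Qed.

Lemma is_derive_isq2 x j : offaxis x -> is_derive x (basis3 R j) (fun x => isq x ^+ 2)
  (- 2 * isq x ^+ 4 * (x.1.1 * (val j == 0%N)%:R + x.1.2 * (val j == 1%N)%:R)).
Proof.
move=> ox; have := is_derive_mul (is_derive_isq j ox) (is_derive_isq j ox).
by congr is_derive; ring.
Qed.

(** Conformality: both gradients have length [1 / rho] and they are orthogonal. With the harmonicity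
    of both coordinates, shown by the two divergence lemmas, the Laplacian becomes [isq x ^+ 2]
    times [f'' - k ^ 2 f]. *)
Lemma coord_identities x : offaxis x ->
  [/\ \sum_j Td j x ^+ 2 = isq x ^+ 2, \sum_j ph j x ^+ 2 = isq x ^+ 2 & \sum_j Td j x * ph j x = 0].
Proof.
move=> ox; rewrite !sum3E /Td /ph /=; have x0 := off_neq0 ox.
have q2 := isq_sqr ox; have t2 := inorm_sqr x0; rewrite nsq_rho2 in t2.
split.
- transitivity (isq x ^+ 2 * (inorm x ^+ 2 * x.2 ^+ 2 * (isq x ^+ 2 * rho2 x)) + inorm x ^+ 2).
    by rewrite /rho2; ring.
  rewrite q2 mulr1 -[X in _ + X]mulr1 -q2 -[RHS]mulr1 -t2; ring.
- transitivity (isq x ^+ 2 * (isq x ^+ 2 * rho2 x)); first by rewrite /rho2; ring.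
  by rewrite q2 mulr1.
- ring.
Qed.

Lemma Td_divergence x : offaxis x -> exists Tdd : 'I_3 -> R,
  (forall j, is_derive x (basis3 R j) (Td j) (Tdd j)) /\ \sum_j Tdd j = 0.
Proof.
move=> ox; have x0 := off_neq0 ox.
have q2 := isq_sqr ox; have t2 := inorm_sqr x0; rewrite nsq_rho2 in t2.
have cd j := is_derive_coord x j.
have d0 : is_derive x (basis3 R ord0_3) (Td ord0_3)
   (- (x.2 * inorm x * isq x ^+ 2) + x.2 * x.1.1 ^+ 2 * inorm x ^+ 3 * isq x ^+ 2 + 2 * x.2 * x.1.1 ^+ 2 * inorm x * isq x ^+ 4).
  have [a b c] := cd ord0_3.
  have := is_deriveN (is_derive_mul (is_derive_mul (is_derive_mul c a) (is_derive_inorm ord0_3 x0)) (is_derive_isq2 ord0_3 ox)).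
  by congr is_derive; rewrite /xc /=; ring.
have d1 : is_derive x (basis3 R ord1_3) (Td ord1_3)
   (- (x.2 * inorm x * isq x ^+ 2) + x.2 * x.1.2 ^+ 2 * inorm x ^+ 3 * isq x ^+ 2 + 2 * x.2 * x.1.2 ^+ 2 * inorm x * isq x ^+ 4).
  have [a b c] := cd ord1_3.
  have := is_deriveN (is_derive_mul (is_derive_mul (is_derive_mul c b) (is_derive_inorm ord1_3 x0)) (is_derive_isq2 ord1_3 ox)).
  by congr is_derive; rewrite /xc /=; ring.
have d2 : is_derive x (basis3 R ord2) (Td ord2) (- (inorm x ^+ 3 * x.2)).
  by have := is_derive_inorm ord2 x0; rewrite mulNr.
exists (fun j => partial j (Td j) x); split.
  move=> j; have [->|[->|->]] : j = ord0_3 \/ j = ord1_3 \/ j = ord2.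
    by case: j => [[|[|[|//]]] hj]; [left|right; left|right; right]; exact: val_inj.
  - by have [h _] := d0; exact/derivableP.
  - by have [h _] := d1; exact/derivableP.
  - by have [h _] := d2; exact/derivableP.
rewrite sum3E /partial; have [_ ->] := d0; have [_ ->] := d1; have [_ ->] := d2.
transitivity (- 2 * (x.2 * inorm x * isq x ^+ 2) + x.2 * inorm x ^+ 3 * (isq x ^+ 2 * rho2 x)
  + 2 * x.2 * inorm x * isq x ^+ 2 * (isq x ^+ 2 * rho2 x) - inorm x ^+ 3 * x.2); first by rewrite /rho2; ring.
rewrite q2; ring.
Qed.

Lemma ph_divergence x : offaxis x -> exists phd : 'I_3 -> R,
  (forall j, is_derive x (basis3 R j) (ph j) (phd j)) /\ \sum_j phd j = 0.
Proof.
move=> ox.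
have cd j := is_derive_coord x j.
have d0 : is_derive x (basis3 R ord0_3) (ph ord0_3) (2 * x.1.1 * x.1.2 * isq x ^+ 4).
  have [a b c] := cd ord0_3.
  have := is_deriveN (is_derive_mul b (is_derive_isq2 ord0_3 ox)).
  by congr is_derive; rewrite /=; ring.
have d1 : is_derive x (basis3 R ord1_3) (ph ord1_3) (- (2 * x.1.1 * x.1.2 * isq x ^+ 4)).
  have [a b c] := cd ord1_3.
  have := is_derive_mul a (is_derive_isq2 ord1_3 ox).
  by congr is_derive; rewrite /=; ring.
have d2 : is_derive x (basis3 R ord2) (ph ord2) 0 by exact: is_derive_cst.
exists (fun j => partial j (ph j) x); split.
  move=> j; have [->|[->|->]] : j = ord0_3 \/ j = ord1_3 \/ j = ord2.
    by case: j => [[|[|[|//]]] hj]; [left|right; left|right; right]; exact: val_inj.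
  - by have [h _] := d0; exact/derivableP.
  - by have [h _] := d1; exact/derivableP.
  - by have [h _] := d2; exact/derivableP.
rewrite sum3E /partial; have [_ ->] := d0; have [_ ->] := d1; have [_ ->] := d2; ring.
Qed.

End CylindricalCoordinates.

(** * The equation of a profile *)

Section Profile.
Variable R : realType.
Implicit Types (x : R3 R) (i : 'I_5) (j : 'I_3) (t : R).
Local Notation off0 := [set x : R3 R | x != 0].

Definition Vpot (f f1 : 'I_5 -> R -> R) t : R :=
  \sum_i f1 i t ^+ 2 + \sum_i wt R i ^+ 2 * f i t ^+ 2.

(* [f] is the profile of [u] along the meridian [t |-> (1, 0, sh t)]; the harmonic map
   equation becomes the second field. *)
Record profile (u : R3 R -> RCC R) (f f1 : 'I_5 -> R -> R) : Prop := Profile {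
  prof_d : forall i t, is_derive t 1 (f i) (f1 i t);
  prof_ode : forall i t, is_derive t 1 (f1 i) ((wt R i ^+ 2 - Vpot f f1 t) * f i t);
  prof_sphere : forall t, \sum_i f i t ^+ 2 = 1;
  prof_decay : exists C, 0 <= C /\ forall t, Vpot f f1 t <= C / ch t ^+ 2;
  prof_rep : forall i x, offaxis x -> comp5 i u x = ev f i x;
  prof_cont : forall i x, x != 0 -> {for x, continuous (comp5 i u)} }.

Lemma ex_angle (c s : R) : c ^+ 2 + s ^+ 2 = 1 -> exists a, cos a = c /\ sin a = s.
Proof.
move=> h; have s0 := sqr_ge0 s.
have c1 : - 1 <= c <= 1 by rewrite -ler_norml; apply: sqr_le_norm => //; rewrite expr1n; lra.
have e : Num.sqrt (1 - c ^+ 2) = `|s| by rewrite -h (_ : c ^+ 2 + s ^+ 2 - c ^+ 2 = s ^+ 2) ?sqrtr_sqr//; ring.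
have [sp|sn] := leP 0 s.
  by exists (acos c); rewrite acosK// sin_acos// e ger0_norm.
by exists (- acos c); rewrite cosN sinN acosK// sin_acos// e ltr0_norm// opprK.
Qed.

Variables (u o : R3 R -> RCC R).
Hypotheses (ho : harmonic_S2_S4 o) (eo : equivariant_on (@Sphere2 R) o)
  (hu : forall x, x != 0 -> u x = hom_ext o x).

Definition mer t : R3 R := (1, 0, sh t).

Lemma mer_neq0 t : mer t != 0.
Proof. by rewrite /mer xpair_eqE/= xpair_eqE oner_eq0. Qed.

Definition uf i t : R := comp5 i u (mer t).
Definition uf1 i t : R := partial ord2 (comp5 i u) (mer t) * ch t.
Definition uf2 i t : R := partial ord2 (partial ord2 (comp5 i u)) (mer t) * ch t * ch t + partial ord2 (comp5 i u) (mer t) * sh t.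

Lemma mer_derive (F : R3 R -> R) t : smooth_on off0 F ->
  is_derive t 1 (fun t => F (mer t)) (partial ord2 F (mer t) * ch t).
Proof.
move=> sF.
have K (p q s c : R) : p * 0 + q * 0 + s * c = s * c by ring.
have D := @is_derive_curve R F (fun=> 1) (fun=> 0) (@sh R) t _ _ _ (smooth_c1_near (@open_off0 R) sF (mer_neq0 t))
  (@is_derive_cst _ _ _ (1 : R) t 1) (@is_derive_cst _ _ _ (0 : R) t 1) (sh_derive t).
rewrite K in D; exact: D.
Qed.

Lemma uf_derive i t : is_derive t 1 (uf i) (uf1 i t).
Proof. exact: mer_derive (u_smooth ho hu i). Qed.

Lemma uf1_derive i t : is_derive t 1 (uf1 i) (uf2 i t).
Proof.
have := is_deriveM (mer_derive t (smooth_partial ord2 (u_smooth ho hu i))) (ch_derive t).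
by congr is_derive; rewrite !scalE /uf2; move: (partial _ _ _) (partial _ _ _) => a b; ring.
Qed.

(** The point [x] arises from [mer (T x)] by the dilation with factor [rho] and the rotation by the
    azimuth; homogeneity and equivariance give the values. *)
Lemma u_rep i x : offaxis x -> comp5 i u x = ev uf i x.
Proof.
move=> ox; have q0 := isq_gt0 ox; have q2 := isq_sqr ox.
have [a [ca sa]] := ex_angle (cosx2sinx2 ox).
have r0 : 0 < rho2 x * isq x by rewrite mulr_gt0// rho2_gt0.
have m0 := mer_neq0 (T x).
pose y : R3 R := (rho2 x * isq x * (mer (T x)).1.1, rho2 x * isq x * (mer (T x)).1.2, rho2 x * isq x * (mer (T x)).2).
have uy : u y = u (mer (T x)) by exact: (u_homog hu r0 m0).
have y0 : y != 0.
  by rewrite -nsq_eq0 /y /nsq /= mulr1 gt_eqF// ltr_pwDl ?sqr_ge0// ltr_pwDl ?sqr_ge0// exprn_gt0.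
have xy : x = rot3 a y.
  have -> : y = (rho2 x * isq x, 0, rho2 x * isq x * (x.2 * isq x)) by rewrite /y /mer /= sh_T// mulr1 mulr0.
  rewrite /rot3 ca sa /= !mulr0 subr0 addr0 /cosx /sinx.
  have k z : z * isq x * (rho2 x * isq x) = z by rewrite -[RHS]mulr1 -q2; ring.
  rewrite !k (_ : rho2 x * isq x * (x.2 * isq x) = x.2); first by case: x {ox q0 q2 ca sa r0 m0 y uy y0 k} => [[]].
  by rewrite -[RHS]mulr1 -q2; ring.
rewrite /comp5 {1}xy (u_equiv eo hu)// coord5_rot uy /ev /Cw /Sw /wt -ca -sa.
have J : Jc i (u (mer (T x))) = Jn i (fun k => uf k (T x)) by [].
rewrite J /uf /comp5; case: i {J} => [[|[|[|[|[|//]]]]] hi] /=; rewrite ?mul0r ?cos0 ?sin0 ?mul1r//.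
- by rewrite mul0r.
- by rewrite [2 * a]mulrC mulr_natr cos_mulr2n sin_mulr2n sin2cos2; congr (_ * _ + _ * _); ring.
- by rewrite [2 * a]mulrC mulr_natr cos_mulr2n sin_mulr2n sin2cos2; congr (_ * _ + _ * _); ring.
Qed.

Lemma u_partial i j x : offaxis x ->
  partial j (comp5 i u) x = Td j x * ev uf1 i x + ph j x * (wt R i * evJ uf i x).
Proof.
move=> ox; rewrite (@near_partial _ _ (ev uf i)); last first.
  by apply: (eq_on_near (@open_offaxis R)) => // y oy; exact: u_rep.
by rewrite /partial; have [[_ ->] _] := is_derive_ev i j ox uf_derive.
Qed.

Lemma ev_norm (F : 'I_5 -> R -> R) x : offaxis x -> \sum_i ev F i x ^+ 2 = \sum_i F i (T x) ^+ 2.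
Proof.
move=> ox; rewrite !sum5E /ev /Jn /=.
have h1 := Cw2Sw2 ix1 ox; have h3 := Cw2Sw2 ix3 ox.
rewrite (_ : Cw ix2 x = Cw ix1 x)// (_ : Sw ix2 x = Sw ix1 x)//.
rewrite (_ : Cw ix4 x = Cw ix3 x)// (_ : Sw ix4 x = Sw ix3 x)//.
rewrite (_ : Cw ord0 x = 1)// (_ : Sw ord0 x = 0)//.
set c := Cw ix1 x in h1 *; set s := Sw ix1 x in h1 *.
set c' := Cw ix3 x in h3 *; set s' := Sw ix3 x in h3 *.
move: (F ord0 _) (F ix1 _) (F ix2 _) (F ix3 _) (F ix4 _) => a0 a1 a2 a3 a4.
transitivity (a0 ^+ 2 + (c ^+ 2 + s ^+ 2) * (a1 ^+ 2 + a2 ^+ 2) + (c' ^+ 2 + s' ^+ 2) * (a3 ^+ 2 + a4 ^+ 2)); first by ring.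
by rewrite h1 h3; ring.
Qed.

Lemma evJ_norm (F : 'I_5 -> R -> R) x : offaxis x ->
  \sum_i (wt R i * evJ F i x) ^+ 2 = \sum_i wt R i ^+ 2 * F i (T x) ^+ 2.
Proof.
move=> ox; rewrite !sum5E /evJ /Jn /wt /=.
have h1 := Cw2Sw2 ix1 ox; have h3 := Cw2Sw2 ix3 ox.
rewrite (_ : Cw ix2 x = Cw ix1 x)// (_ : Sw ix2 x = Sw ix1 x)//.
rewrite (_ : Cw ix4 x = Cw ix3 x)// (_ : Sw ix4 x = Sw ix3 x)//.
set c := Cw ix1 x in h1 *; set s := Sw ix1 x in h1 *.
set c' := Cw ix3 x in h3 *; set s' := Sw ix3 x in h3 *.
move: (F ix1 _) (F ix2 _) (F ix3 _) (F ix4 _) => a1 a2 a3 a4.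
transitivity ((c ^+ 2 + s ^+ 2) * (a1 ^+ 2 + a2 ^+ 2) + 4 * (c' ^+ 2 + s' ^+ 2) * (a3 ^+ 2 + a4 ^+ 2)); first by ring.
by rewrite h1 h3; ring.
Qed.

Lemma u_density x : offaxis x -> density u x = isq x ^+ 2 * Vpot uf uf1 (T x).
Proof.
move=> ox; have [t2 p2 tp] := coord_identities ox.
rewrite density_off// /Vpot mulrDr -(ev_norm uf1 ox) -(evJ_norm uf ox) !mulr_sumr -big_split/=.
apply: eq_bigr => i _; rewrite sum3E !u_partial//; move: t2 p2 tp; rewrite !sum3E.
move: (Td ord0_3 x) (Td ord1_3 x) (Td ord2 x) (ph ord0_3 x) (ph ord1_3 x) (ph ord2 x) => a0 a1 a2 b0 b1 b2 t2 p2 tp.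
move: (ev uf1 i x) (wt R i * evJ uf i x) => A B.
transitivity ((a0 ^+ 2 + a1 ^+ 2 + a2 ^+ 2) * A ^+ 2 + (b0 ^+ 2 + b1 ^+ 2 + b2 ^+ 2) * B ^+ 2 + 2 * (a0 * b0 + a1 * b1 + a2 * b2) * A * B).
  by ring.
by rewrite t2 p2 tp; ring.
Qed.

Lemma u_laplacian i x : offaxis x ->
  \sum_(j < 3) partial j (partial j (comp5 i u)) x = isq x ^+ 2 * (ev uf2 i x - wt R i ^+ 2 * ev uf i x).
Proof.
move=> ox; have [t2 p2 tp] := coord_identities ox.
have [td [dtd std]] := Td_divergence ox; have [pd' [dpd spd]] := ph_divergence ox.
have D j : partial j (partial j (comp5 i u)) x =
   td j * ev uf1 i x + Td j x * (Td j x * ev uf2 i x + ph j x * (wt R i * evJ uf1 i x))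
   + pd' j * (wt R i * evJ uf i x) + ph j x * (wt R i * (Td j x * evJ uf1 i x - ph j x * (wt R i * ev uf i x))).
  rewrite (@near_partial _ _ (fun x => Td j x * ev uf1 i x + ph j x * (wt R i * evJ uf i x))); last first.
    by apply: (eq_on_near (@open_offaxis R)) => // y oy; exact: u_partial.
  have [d1 _] := is_derive_ev i j ox uf1_derive; have [_ d2] := is_derive_ev i j ox uf_derive.
  have [_] := is_derive_add (is_derive_mul (dtd j) d1) (is_derive_mul (dpd j) (is_derive_mul (@is_derive_cst _ _ _ (wt R i) x (basis3 R j)) d2)).
  rewrite /partial => ->; move: (ev uf2 i x) (ev uf i x) (ev uf1 i x) (evJ uf1 i x) (evJ uf i x) => A B C E F.
  rewrite /cst; ring.
rewrite sum3E !D; move: t2 p2 tp std spd; rewrite !sum3E.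
move: (Td ord0_3 x) (Td ord1_3 x) (Td ord2 x) (ph ord0_3 x) (ph ord1_3 x) (ph ord2 x) (td ord0_3) (td ord1_3) (td ord2) (pd' ord0_3) (pd' ord1_3) (pd' ord2) => a0 a1 a2 b0 b1 b2 c0 c1 c2 d0 d1 d2 t2 p2 tp std spd.
move: (ev uf2 i x) (ev uf i x) (ev uf1 i x) (evJ uf1 i x) (evJ uf i x) => A B C E F.
transitivity ((c0 + c1 + c2) * C + (a0 ^+ 2 + a1 ^+ 2 + a2 ^+ 2) * A + 2 * (a0 * b0 + a1 * b1 + a2 * b2) * wt R i * E
  + (d0 + d1 + d2) * wt R i * F - (b0 ^+ 2 + b1 ^+ 2 + b2 ^+ 2) * wt R i ^+ 2 * B); first by ring.
by rewrite t2 p2 tp std spd; ring.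
Qed.

Lemma expR_sh_ch t : sh t + ch t = expR t.
Proof. by rewrite /sh /ch; field. Qed.

(** The harmonic map equation is given on the unit sphere, which [mer] leaves; this is the point of
    the sphere on the same ray. *)
Definition smer t : R3 R := ((ch t)^-1, 0, sh t / ch t).

Lemma smer_facts t : [/\ Sphere2 (smer t), offaxis (smer t), isq (smer t) = ch t, T (smer t) = t & u (smer t) = u (mer t)].
Proof.
have c0 := ch_gt0 t; have cn : ch t != 0 by rewrite gt_eqF.
have r : rho2 (smer t) = (ch t)^-1 ^+ 2 by rewrite /rho2 /smer /= expr0n addr0.
have ox : offaxis (smer t) by rewrite /offaxis/= r expf_neq0// invr_eq0.
have n1 : nsq (smer t) = 1.
  rewrite nsq_rho2 r /smer /=; have := ch2sh2 t; move: (ch t) (sh t) cn => c s cn h.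
  transitivity ((1 + s ^+ 2) / c ^+ 2); first by field.
  by rewrite -h divff// expf_neq0.
have S : Sphere2 (smer t) by rewrite /Sphere2/= /norm3 -/(nsq _) n1 sqrtr1.
have q : isq (smer t) = ch t.
  by rewrite /isq r sqrtr_sqr ger0_norm ?invr_ge0 ?ltW// invrK.
split=> //.
- apply: expR_inj; rewrite expR_T// /expT q S /smer /= -expR_sh_ch; field.
  by rewrite gt_eqF.
- have c1 : 0 < (ch t)^-1 by rewrite invr_gt0.
  rewrite -(u_homog hu c1 (mer_neq0 t)); congr u; rewrite /smer /mer /= mulr1 mulr0.
  by congr (_, _, _); rewrite mulrC.
Qed.

Lemma ev_smer (F : 'I_5 -> R -> R) i t : ev F i (smer t) = F i t.
Proof.
have [_ _ q tT _] := smer_facts t.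
rewrite /ev tT.
have c : cosx (smer t) = 1 by rewrite /cosx q /smer /= mulVf// gt_eqF// ch_gt0.
have s : sinx (smer t) = 0 by rewrite /sinx /smer /= mul0r.
rewrite /Cw /Sw c s; case: i => [[|[|[|[|[|//]]]]] hi] /=; ring.
Qed.

Lemma uf_ode i t : uf2 i t = (wt R i ^+ 2 - Vpot uf uf1 t) * uf i t.
Proof.
have [S ox q tT us] := smer_facts t.
have := u_harmonic ho hu i S ox; rewrite u_laplacian// u_density// !ev_smer q tT.
have -> : comp5 i u (smer t) = uf i t by rewrite /uf /comp5 us.
have c0 : ch t ^+ 2 != 0 by rewrite expf_neq0// gt_eqF// ch_gt0.
move=> h; apply: (mulfI c0); apply/eqP; rewrite -subr_eq0 -h; apply/eqP; ring.
Qed.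

Lemma uf_sphere t : \sum_i uf i t ^+ 2 = 1.
Proof. by have := sphere_sum (u_sphere ho hu (mer_neq0 t)). Qed.

(** The gradient is bounded on the sphere, poles included, and at [smer t] the density is
    [ch t ^+ 2] times the potential. *)
Lemma uf_decay : exists C, 0 <= C /\ forall t, Vpot uf uf1 t <= C / ch t ^+ 2.
Proof.
have [C H] := u_density_bound ho hu.
exists (\sum_(i < 5) \sum_(j < 3) C ^+ 2); split.
  by apply: sumr_ge0 => i _; apply: sumr_ge0 => j _; exact: sqr_ge0.
move=> t; have [S ox q tT _] := smer_facts t.
have := u_density ox; rewrite q tT => E.
rewrite ler_pdivlMr ?exprn_gt0 ?ch_gt0// mulrC -E density_off//.
apply: ler_sum => i _; apply: ler_sum => j _.
have h := H i j _ S; have C0 : 0 <= C by apply: le_trans h.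
by rewrite -(real_normK (num_real _)) ler_pXn2r ?nnegrE.
Qed.

Lemma u_profile : profile u uf uf1.
Proof.
split.
- exact: uf_derive.
- by move=> i t; rewrite -uf_ode; exact: uf1_derive.
- exact: uf_sphere.
- exact: uf_decay.
- exact: u_rep.
- by move=> i x x0; exact: smooth_cont (u_smooth ho hu i) x0.
Qed.

End Profile.

(** * Uniqueness for linear differential equations *)

Section OneDimensional.
Variable R : realType.
Implicit Types (t : R).

Lemma derive_le0_noninc (g g' : R -> R) : (forall t, is_derive t 1 g (g' t)) -> (forall t, g' t <= 0) ->
  forall a b, a <= b -> g b <= g a.
Proof.
move=> d h a b ab; have [z _ E] := @mvt_unordered R g g' a b (fun z _ => d z).
by rewrite -subr_le0 E mulr_le0_ge0// subr_ge0.
Qed.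

Lemma derive0_const (g : R -> R) : (forall t, is_derive t 1 g 0) -> forall a b, g a = g b.
Proof.
move=> d a b; have [z _ E] := @mvt_unordered R g (fun=> 0) a b (fun z _ => d z).
by apply/esym/eqP; rewrite -subr_eq0 E mul0r.
Qed.

Lemma is_derive_expK (K t : R) : is_derive t 1 (fun t : R => expR (K * t)) (K * expR (K * t)).
Proof.
have d : is_derive t 1 (fun t : R => K * t) K.
  by have := is_deriveM (@is_derive_cst _ _ _ K t 1) (@is_derive_id _ _ t (1 : R)); rewrite !scalE mulr1 mulr0 addr0.
by have := is_derive_comp1 d (is_derive_expR (K * t)); rewrite mulrC.
Qed.

Lemma gronwall (e e' : R -> R) (K t0 : R) : (forall t, is_derive t 1 e (e' t)) ->
  (forall t, 0 <= e t) -> (forall t, `|e' t| <= K * e t) -> e t0 = 0 -> forall t, e t = 0.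
Proof.
move=> d e0 b z t; apply/eqP; rewrite eq_le e0 andbT.
have [tt|tt] := leP t0 t.
  have D (s : R) : is_derive s 1 (fun s => e s * expR (- K * s)) ((e' s - K * e s) * expR (- K * s)).
    by have := is_deriveM (d s) (is_derive_expK (- K) s); congr is_derive; rewrite !scalE; ring.
  have N s : (e' s - K * e s) * expR (- K * s) <= 0.
    by rewrite mulr_le0_ge0 ?expR_ge0// subr_le0; apply: le_trans (b s); exact: ler_norm.
  have := derive_le0_noninc D N tt; rewrite z mul0r pmulr_lle0 ?expR_gt0//.
have D (s : R) : is_derive s 1 (fun s => - (e s * expR (K * s))) (- ((e' s + K * e s) * expR (K * s))).
  by have := is_deriveN (is_deriveM (d s) (is_derive_expK K s)); congr is_derive; rewrite !scalE; ring.
have N s : - ((e' s + K * e s) * expR (K * s)) <= 0.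
  rewrite oppr_le0 mulr_ge0 ?expR_ge0//.
  by have := b s; rewrite ler_norml => /andP[h _]; lra.
by have := derive_le0_noninc D N (ltW tt); rewrite z mul0r oppr0 oppr_ge0 pmulr_lle0 ?expR_gt0.
Qed.

Lemma ode_unique (y y1 a : R -> R) (A t0 : R) : (forall t, is_derive t 1 y (y1 t)) ->
  (forall t, is_derive t 1 y1 (a t * y t)) -> (forall t, `|a t| <= A) -> y t0 = 0 -> y1 t0 = 0 ->
  forall t, y t = 0.
Proof.
move=> d d1 b z z1 t.
have D (s : R) : is_derive s 1 (fun s => y s ^+ 2 + y1 s ^+ 2) (2 * y s * y1 s * (1 + a s)).
  have := is_deriveD (is_deriveM (d s) (d s)) (is_deriveM (d1 s) (d1 s)).
  by congr is_derive; rewrite !scalE; ring.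
have E0 s : 0 <= y s ^+ 2 + y1 s ^+ 2 by rewrite addr_ge0// sqr_ge0.
have B s : `|2 * y s * y1 s * (1 + a s)| <= (1 + A) * (y s ^+ 2 + y1 s ^+ 2).
  rewrite normrM mulrC ler_pM//.
    by apply: le_trans (ler_normD _ _) _; rewrite normr1 lerD2l.
  rewrite ler_norml; have := sqr_ge0 (y s + y1 s); have := sqr_ge0 (y s - y1 s).
  by rewrite !sqrrD sqrrN => h1 h2; apply/andP; split; lra.
have z2 : y t0 ^+ 2 + y1 t0 ^+ 2 = 0 by rewrite z z1 !expr0n addr0.
have /eqP := gronwall D E0 B z2 t.
by rewrite paddr_eq0 ?sqr_ge0// => /andP[]; rewrite sqrf_eq0 => /eqP.
Qed.

Lemma ch_ge1 t : 1 <= ch t.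
Proof.
rewrite -(ler_pXn2r (n := 2)) ?nnegrE ?ler01 ?(ltW (ch_gt0 _))// expr1n ch2sh2.
by rewrite lerDl sqr_ge0.
Qed.

Lemma ch_ge t : 0 <= t -> t / 2 <= ch t.
Proof.
move=> t0; rewrite /ch ler_pM2r ?invr_gt0//.
by have := expR_ge1Dx t; have := expR_gt0 (- t); lra.
Qed.

Lemma decay_zero (h C : R) : (forall t, `|h| <= C / ch t ^+ 2) -> h = 0.
Proof.
move=> H; apply/eqP; rewrite -normr_eq0 eq_le normr_ge0 andbT leNgt; apply/negP => h0.
have C0 : 0 <= C by have := H 0; rewrite ler_pdivlMr ?exprn_gt0 ?ch_gt0// => k; apply: le_trans k; rewrite mulr_ge0// sqr_ge0.
pose t := 2 * (C / `|h| + 1).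
have t1 : C / `|h| + 1 <= ch t.
  have c0 : 0 <= C / `|h| by rewrite divr_ge0.
  have e : t / 2 = C / `|h| + 1 by rewrite /t mulrC mulKf.
  by rewrite -e; apply: ch_ge; rewrite /t; lra.
have := H t; rewrite ler_pdivlMr ?exprn_gt0 ?ch_gt0//.
have c1 := ch_ge1 t.
have : ch t <= ch t ^+ 2 by rewrite expr2 ler_peMr//; lra.
have : C < `|h| * ch t.
  by rewrite -ltr_pdivrMl// mulrC; lra.
by move=> h1 h2 h3; have := ler_wpM2l (ltW h0) h2; lra.
Qed.
End OneDimensional.

(** * Conserved quantities and regularity of a profile *)

Section ProfileFacts.
Variable R : realType.
Variables (u : R3 R -> RCC R) (f f1 : 'I_5 -> R -> R).
Hypothesis P : profile u f f1.
Implicit Types (t : R) (i : 'I_5) (x : R3 R).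

Local Notation V := (Vpot f f1).

Lemma V_ge0 t : 0 <= V t.
Proof. by apply: addr_ge0; apply: sumr_ge0 => i _; [exact: sqr_ge0|apply: mulr_ge0; exact: sqr_ge0]. Qed.

Lemma V_bound : exists C, 0 <= C /\ forall t, V t <= C.
Proof.
have [C [C0 H]] := prof_decay P; exists C; split=> // t.
apply: le_trans (H t) _; rewrite ler_pdivrMr ?exprn_gt0 ?ch_gt0//.
by rewrite ler_peMr// -[1](expr1n _ 2) ler_pXn2r ?nnegrE ?ler01 ?ch_ge1// ltW// ch_gt0.
Qed.

Lemma is_derive_sum5 (F F' : 'I_5 -> R -> R) t : (forall i, is_derive t 1 (F i) (F' i t)) ->
  is_derive t 1 (fun t => \sum_i F i t) (\sum_i F' i t).
Proof.
move=> d; rewrite sum5E (_ : (fun t => _) = (F ord0 + F ix1 + F ix2 + F ix3 + F ix4)).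
  by do 4! apply: is_deriveD.
by apply/funext => s; rewrite sum5E.
Qed.

Lemma f_f1 t : \sum_i f i t * f1 i t = 0.
Proof.
have d i : is_derive t 1 (fun t => f i t ^+ 2) (2 * (f i t * f1 i t)).
  have := is_deriveM (prof_d P i t) (prof_d P i t).
  by congr is_derive; rewrite !scalE; ring.
have D : is_derive t 1 (fun t => \sum_i f i t ^+ 2) (\sum_i 2 * (f i t * f1 i t)).
  exact: (@is_derive_sum5 (fun i t => f i t ^+ 2) (fun i t => 2 * (f i t * f1 i t)) t d).
have E : (fun t => \sum_i f i t ^+ 2) = cst 1 by apply/funext => s; rewrite (prof_sphere P).
move: D; rewrite E => -[_]; have [_ ->] := @is_derive_cst _ _ _ (1 : R) t (1 : R).
by rewrite -mulr_sumr => /esym/eqP; rewrite mulf_eq0 pnatr_eq0/= => /eqP.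
Qed.

(** The difference of the two sides is constant by the equation and by [f_f1], and the decay of the
    potential makes it 0. It is the real part of the Hopf differential in the conformal
    coordinates. *)
Lemma hamiltonian t : \sum_i f1 i t ^+ 2 = \sum_i wt R i ^+ 2 * f i t ^+ 2.
Proof.
pose H t := \sum_i (f1 i t ^+ 2 - wt R i ^+ 2 * f i t ^+ 2).
have D (s : R) : is_derive s 1 H 0.
  have d i : is_derive s 1 (fun t => f1 i t ^+ 2 - wt R i ^+ 2 * f i t ^+ 2) (- 2 * V s * (f i s * f1 i s)).
    have := is_deriveB (is_deriveM (prof_ode P i s) (prof_ode P i s))
      (is_derive_mul (@is_derive_cst _ _ _ (wt R i ^+ 2) s 1) (is_derive_mul (prof_d P i s) (prof_d P i s))).
    by congr is_derive; rewrite !scalE /cst; ring.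
  have := @is_derive_sum5 (fun i t => f1 i t ^+ 2 - wt R i ^+ 2 * f i t ^+ 2) (fun i s => - 2 * V s * (f i s * f1 i s)) s d.
  by rewrite -mulr_sumr f_f1 mulr0.
have [C [C0 HC]] := prof_decay P.
have : H t = 0.
  apply: (@decay_zero _ _ C) => s; rewrite (derive0_const D t s); apply: le_trans (HC s).
  rewrite /H sumrB /Vpot; apply: le_trans (ler_normB _ _) _.
  by rewrite !ger0_norm//; apply: sumr_ge0 => i _; [apply: mulr_ge0; exact: sqr_ge0|exact: sqr_ge0].
by rewrite /H sumrB => /eqP; rewrite subr_eq0 => /eqP.
Qed.

(** Both components solve the linear equation [y'' = (1 - V) y], so this is constant, and it is
    bounded by the decaying potential. *)
Lemma wronskian t : f ix1 t * f1 ix2 t - f1 ix1 t * f ix2 t = 0.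
Proof.
pose W t := f ix1 t * f1 ix2 t - f1 ix1 t * f ix2 t.
have D (s : R) : is_derive s 1 W 0.
  have := is_deriveB (is_deriveM (prof_d P ix1 s) (prof_ode P ix2 s)) (is_deriveM (prof_ode P ix1 s) (prof_d P ix2 s)).
  by congr is_derive; rewrite !scalE /wt /=; ring.
have [C [C0 HC]] := prof_decay P.
have : W t = 0; last by [].
apply: (@decay_zero _ _ C) => s; rewrite (derive0_const D t s); apply: le_trans (HC s).
rewrite /W /Vpot !sum5E /wt /= ler_norml.
have := sqr_ge0 (f ix1 s - f1 ix2 s); have := sqr_ge0 (f ix1 s + f1 ix2 s).
have := sqr_ge0 (f ix2 s - f1 ix1 s); have := sqr_ge0 (f ix2 s + f1 ix1 s).
have := sqr_ge0 (f ord0 s); have := sqr_ge0 (f1 ord0 s); have := sqr_ge0 (f ix3 s); have := sqr_ge0 (f ix4 s).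
have := sqr_ge0 (f1 ix3 s); have := sqr_ge0 (f1 ix4 s).
have := sqr_ge0 (f ix1 s); have := sqr_ge0 (f ix2 s); have := sqr_ge0 (f1 ix1 s); have := sqr_ge0 (f1 ix2 s).
rewrite !sqrrD !sqrrN => *; apply/andP; split; lra.
Qed.

(** A combination of the two components solves the same linear equation, so it is enough to
    annihilate its Cauchy data at 0, which [wronskian] permits. The coefficients are read off the
    values at 0, or the derivatives if both values vanish. *)
Lemma exists_normal : exists p q, p ^+ 2 + q ^+ 2 = 1 /\ forall t, p * f ix1 t + q * f ix2 t = 0.
Proof.
suff [p [q [pq H]]] : exists p q, 0 < p ^+ 2 + q ^+ 2 /\ forall t, p * f ix1 t + q * f ix2 t = 0.
  pose n := Num.sqrt (p ^+ 2 + q ^+ 2).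
  have n2 : n ^+ 2 = p ^+ 2 + q ^+ 2 by rewrite sqr_sqrtr// ltW.
  have n0 : n != 0 by rewrite gt_eqF// sqrtr_gt0.
  exists (p / n), (q / n); split.
    transitivity ((p ^+ 2 + q ^+ 2) / n ^+ 2); first by field.
    by rewrite -n2 divff// expf_neq0.
  move=> t; transitivity ((p * f ix1 t + q * f ix2 t) / n); first by ring.
  by rewrite H mul0r.
have [C [C0 HC]] := V_bound.
have U p q : p * f ix1 0 + q * f ix2 0 = 0 -> p * f1 ix1 0 + q * f1 ix2 0 = 0 -> forall t, p * f ix1 t + q * f ix2 t = 0.
  apply: (@ode_unique R (fun t => p * f ix1 t + q * f ix2 t) (fun t => p * f1 ix1 t + q * f1 ix2 t) (fun t => 1 - V t) (1 + C)).
  - move=> t; have := is_deriveD (is_deriveM (@is_derive_cst _ _ _ p t 1) (prof_d P ix1 t)) (is_deriveM (@is_derive_cst _ _ _ q t 1) (prof_d P ix2 t)).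
    by congr is_derive; rewrite !scalE /cst; ring.
  - move=> t; have := is_deriveD (is_deriveM (@is_derive_cst _ _ _ p t 1) (prof_ode P ix1 t)) (is_deriveM (@is_derive_cst _ _ _ q t 1) (prof_ode P ix2 t)).
    by congr is_derive; rewrite !scalE /cst /wt /=; ring.
  - move=> t; apply: le_trans (ler_normB _ _) _; rewrite normr1 lerD2l ger0_norm ?V_ge0//.
have W := wronskian 0.
have [a0|a0] := eqVneq (f ix1 0 ^+ 2 + f ix2 0 ^+ 2) 0.
  move: a0 => /eqP; rewrite paddr_eq0 ?sqr_ge0// !sqrf_eq0 => /andP[/eqP z1 /eqP z2].
  have [b0|b0] := eqVneq (f1 ix1 0 ^+ 2 + f1 ix2 0 ^+ 2) 0.
    move: b0 => /eqP; rewrite paddr_eq0 ?sqr_ge0// !sqrf_eq0 => /andP[/eqP w1 /eqP w2].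
    exists 1, 0; split; first by rewrite expr1n expr0n addr0.
    by apply: U; rewrite ?z1 ?z2 ?w1 ?w2 !mulr0 addr0.
  exists (f1 ix2 0), (- f1 ix1 0); split; first by rewrite sqrrN addrC lt0r b0 addr_ge0// sqr_ge0.
  by apply: U; rewrite ?z1 ?z2 ?mulr0 ?addr0// mulNr mulrC subrr.
exists (f ix2 0), (- f ix1 0); split; first by rewrite sqrrN addrC lt0r a0 addr_ge0// sqr_ge0.
apply: U; first by rewrite mulNr mulrC subrr.
by move: W; lra.
Qed.

Lemma smooth_of_partials (U : set (R3 R)) (F : R3 R -> R) (G : 'I_3 -> R3 R -> R) : open U ->
  (forall x j, U x -> is_derive x (basis3 R j) F (G j x)) -> (forall x, U x -> {for x, continuous F}) ->
  (forall j, smooth_on U (G j)) -> smooth_on U F.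
Proof.
move=> oU d c sG; apply/smooth_onP => -[|n] //=; split=> // j; split; first by move=> x Ux; case: (d x j Ux).
have := (smooth_onP _ _).1 (sG j) n; apply: (Ck_ext oU) => x Ux.
by rewrite /partial; case: (d x j Ux) => _ ->.
Qed.

Lemma smooth_isq_off : smooth_on (@offaxis R) (@isq R).
Proof. exact: (smooth_isq (@open_offaxis R) (smooth_rho2 (@open_offaxis R)) (fun x ox => rho2_gt0 ox)). Qed.

Lemma smooth_inorm_off : smooth_on (@offaxis R) (@inorm R).
Proof. apply: smooth_sub (@smooth_inorm R) => x; exact: off_neq0. Qed.

Lemma smooth_Td j : smooth_on (@offaxis R) (@Td R j).
Proof.
have oO := @open_offaxis R; have [s1 s2 s3] := smooth_coord oO.
have q := smooth_isq_off; have r := smooth_inorm_off; have q2 := smoothX 2 oO q.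
rewrite /Td; case: j => [[|[|[|n]]] hj]; last exact: (False_ind _ (notF hj)).
- exact: smoothN oO (smoothM oO (smoothM oO (smoothM oO s3 s1) r) q2).
- exact: smoothN oO (smoothM oO (smoothM oO (smoothM oO s3 s2) r) q2).
- exact: r.
Qed.

Lemma T_cont x : offaxis x -> {for x, continuous (@T R)}.
Proof.
move=> ox; have oO := @open_offaxis R; have [s1 s2 s3] := smooth_coord oO.
have sn : smooth_on (@offaxis R) (fun x => Num.sqrt (nsq x)).
  apply: (smooth_sqrt oO (smooth_nsq oO)) => y oy; exact/nsq_gt0/off_neq0.
have se := smoothM oO (smoothD oO sn s3) smooth_isq_off.
apply: (continuous_comp (smooth_cont se ox)).
exact: (is_derive1_cont (is_derive1_ln (expT_gt0 ox))).
Qed.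

Lemma smooth_cosx : smooth_on (@offaxis R) (@cosx R) /\ smooth_on (@offaxis R) (@sinx R).
Proof.
have oO := @open_offaxis R; have [s1 s2 s3] := smooth_coord oO.
exact: conj (smoothM oO s1 smooth_isq_off) (smoothM oO s2 smooth_isq_off).
Qed.

Lemma smooth_CS i : smooth_on (@offaxis R) (@Cw R i) /\ smooth_on (@offaxis R) (@Sw R i).
Proof.
have oO := @open_offaxis R; have [c s] := smooth_cosx.
have c2 := smoothB oO (smoothX 2 oO c) (smoothX 2 oO s).
have s2 := smoothM oO (smoothM oO (smooth_cst 2 oO) c) s.
rewrite /Cw /Sw; case: i => [[|[|[|[|[|n]]]]] hi]; last exact: (False_ind _ (notF hi)).
- by split; exact: smooth_cst.
- exact: conj c s.
- exact: conj c s.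
- exact: conj c2 s2.
- exact: conj c2 s2.
Qed.

Lemma f_T_derive i x j : offaxis x -> is_derive x (basis3 R j) (fun x => f i (T x)) (f1 i (T x) * Td j x).
Proof. move=> ox; exact: is_derive_comp1 (is_derive_T j ox) (prof_d P i (T x)). Qed.

Lemma f1_T_derive i x j : offaxis x ->
  is_derive x (basis3 R j) (fun x => f1 i (T x)) ((wt R i ^+ 2 - V (T x)) * f i (T x) * Td j x).
Proof. move=> ox; exact: is_derive_comp1 (is_derive_T j ox) (prof_ode P i (T x)). Qed.

Lemma Ck_sum5 n U (F : 'I_5 -> R3 R -> R) : open U -> (forall i, Ck n U (F i)) -> Ck n U (fun x => \sum_i F i x).
Proof.
move=> oU h; have := CkD oU (CkD oU (CkD oU (CkD oU (h ord0) (h ix1)) (h ix2)) (h ix3)) (h ix4).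
by apply: (Ck_ext oU) => x _; rewrite sum5E.
Qed.

(** Bootstrap: by the profile equation the partial derivatives of these functions are polynomials in
    the functions themselves and in [Td]. *)
Lemma f_T_Ck n i : Ck n (@offaxis R) (fun x => f i (T x)) /\ Ck n (@offaxis R) (fun x => f1 i (T x)).
Proof.
have oO := @open_offaxis R.
have c i' x : offaxis x -> {for x, continuous (fun x => f i' (T x))} /\ {for x, continuous (fun x => f1 i' (T x))}.
  move=> ox; split; apply: (continuous_comp (T_cont ox)).
    exact: (is_derive1_cont (prof_d P i' (T x))).
  exact: (is_derive1_cont (prof_ode P i' (T x))).
elim: n i => [|n IH] i; first by split=> x ox; have [] := c i x ox.
have sT j := (smooth_onP _ _).1 (smooth_Td j) n.
have sq (F : R3 R -> R) : Ck n (@offaxis R) F -> Ck n (@offaxis R) (fun x => F x ^+ 2).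
  by move=> h; have := CkM oO h h; apply: (Ck_ext oO) => x _; rewrite expr2.
have sV : Ck n (@offaxis R) (fun x => V (T x)).
  apply: CkD => //; apply: Ck_sum5 => // k; first by apply: sq; have [] := IH k.
  by apply: CkM => //; [exact: Ck_cst|apply: sq; have [] := IH k].
split; split.
- by move=> x ox; have [] := c i x ox.
- move=> j; split; first by move=> x ox; case: (f_T_derive i j ox).
  have := CkM oO (IH i).2 (sT j); apply: (Ck_ext oO) => x ox.
  by rewrite /partial; case: (f_T_derive i j ox) => _ ->.
- by move=> x ox; have [] := c i x ox.
- move=> j; split; first by move=> x ox; case: (f1_T_derive i j ox).
  have := CkM oO (CkM oO (CkD oO (Ck_cst n (wt R i ^+ 2) oO) (CkM oO (Ck_cst n (-1) oO) sV)) (IH i).1) (sT j).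
  apply: (Ck_ext oO) => x ox; rewrite /partial; case: (f1_T_derive i j ox) => _ ->; by rewrite mulN1r.
Qed.

Lemma smooth_f_T i : smooth_on (@offaxis R) (fun x => f i (T x)).
Proof. by apply/smooth_onP => n; have [] := f_T_Ck n i. Qed.

Lemma smooth_comp_u i : smooth_on (@offaxis R) (comp5 i u).
Proof.
have oO := @open_offaxis R; have [c s] := smooth_CS i.
have sJ : smooth_on (@offaxis R) (fun x => Jn i (fun k => f k (T x))).
  rewrite /Jn; case: i {c s} => [[|[|[|[|[|n]]]]] hi]; last exact: (False_ind _ (notF hi)).
  - exact: smooth_cst.
  - exact: smoothN oO (smooth_f_T ix2).
  - exact: smooth_f_T ix1.
  - exact: smoothN oO (smooth_f_T ix4).
  - exact: smooth_f_T ix3.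
have := smoothD oO (smoothM oO c (smooth_f_T i)) (smoothM oO s sJ).
by apply: (smooth_ext oO) => x ox; rewrite (prof_rep P).
Qed.

End ProfileFacts.

(** * Second variation *)

Section SecondDerivative.
Context d (Y : measurableType d) (R : realType) (mu : {measure set Y -> \bar R}).

Let den (k t : R) : R := 1 + t ^+ 2 * k.

Lemma den_gt0 k t : 0 <= k -> 0 < den k t.
Proof. by move=> k0; rewrite /den ltr_pwDl// mulr_ge0// sqr_ge0. Qed.

(** The energy density of the normalized variation along [m N], as a rational function of the
    parameter: [e] is the density of [u], [k] is [m ^ 2], [G] is [|grad m| ^ 2] and [P] is
    [m ^ 2 * (1 / rho ^ 2 - e)]. [rayl1] and [rayl2] are its derivatives in [t]. *)
Definition rayl (e P G k t : R) : R := 2^-1 * (e + t ^+ 2 * P / (1 + t ^+ 2 * k) + t ^+ 2 * G / (1 + t ^+ 2 * k) ^+ 2).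
Definition rayl1 (P G k t : R) : R := t * P / (1 + t ^+ 2 * k) ^+ 2 + t * G * (1 - t ^+ 2 * k) / (1 + t ^+ 2 * k) ^+ 3.
Definition rayl2 (P G k t : R) : R := P * (1 - 3 * (t ^+ 2 * k)) / (1 + t ^+ 2 * k) ^+ 3
  + G * (1 - 8 * (t ^+ 2 * k) + 3 * (t ^+ 2 * k) ^+ 2) / (1 + t ^+ 2 * k) ^+ 4.

Lemma is_derive_den (k t : R) : is_derive t 1 (den k) (2 * t * k).
Proof.
have D := is_derive_add (@is_derive_cst _ _ _ (1 : R) t 1) (is_derive_mul (is_derive_mul (@is_derive_id _ _ t 1) (@is_derive_id _ _ t 1)) (@is_derive_cst _ _ _ k t 1)).
by move: D; congr is_derive; rewrite /cst /=; ring.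
Qed.

Lemma is_derive_pow (h : R -> R) n (t dh : R) : is_derive t 1 h dh -> is_derive t 1 (fun s => h s ^+ n.+1) (n.+1%:R * h t ^+ n * dh).
Proof.
move=> D; have d1 : is_derive (h t) 1 (fun t : R => t ^+ n.+1) (n.+1%:R * h t ^+ n).
  have := is_derive_poly ('X^(n.+1) : {poly R}) (h t); rewrite derivXn hornerMn hornerXn mulr_natl.
  by congr is_derive; apply/funext => z; rewrite hornerXn.
exact: is_derive_comp1 D d1.
Qed.

Lemma is_derive_inv (h : R -> R) (t dh : R) : h t != 0 -> is_derive t 1 h dh -> is_derive t 1 (fun s => (h s)^-1) (- (h t) ^- 2 * dh).
Proof.
move=> h0 D; have := @is_deriveV R id (h t) 1 1 h0 (is_derive_id _ _).
by move=> /(is_derive_comp1 D); congr is_derive; rewrite scalE mulr1.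
Qed.

Lemma is_derive_rayl (e P G k t : R) : 0 <= k -> is_derive t 1 (rayl e P G k) (rayl1 P G k t).
Proof.
move=> k0; have D0 := den_gt0 t k0; have Dn : den k t != 0 by rewrite gt_eqF.
have dD := is_derive_den k t; have dD2 := is_derive_pow 1 dD.
have dI := is_derive_inv Dn dD; have dI2 := @is_derive_inv (fun s => den k s ^+ 2) _ _ (expf_neq0 2 Dn) dD2.
have dt := is_derive_mul (@is_derive_id _ _ t 1) (@is_derive_id _ _ t 1).
have c a := @is_derive_cst _ _ _ (a : R) t (1 : R).
have D := is_derive_mul (c 2^-1) (is_derive_add (is_derive_add (c e) (is_derive_mul (is_derive_mul dt (c P)) dI)) (is_derive_mul (is_derive_mul dt (c G)) dI2)).
move: D; congr is_derive; rewrite /rayl1 /cst /=; move: Dn; rewrite /den => Dn; field.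
exact: Dn.
Qed.

Lemma is_derive_rayl1 (P G k t : R) : 0 <= k -> is_derive t 1 (rayl1 P G k) (rayl2 P G k t).
Proof.
move=> k0; have D0 := den_gt0 t k0; have Dn : den k t != 0 by rewrite gt_eqF.
have dD := is_derive_den k t; have dD2 := is_derive_pow 1 dD; have dD3 := is_derive_pow 2 dD.
have dI2 := @is_derive_inv (fun s => den k s ^+ 2) _ _ (expf_neq0 2 Dn) dD2; have dI3 := @is_derive_inv (fun s => den k s ^+ 3) _ _ (expf_neq0 3 Dn) dD3.
have c a := @is_derive_cst _ _ _ (a : R) t (1 : R).
have dt := @is_derive_id _ _ t (1 : R).
have dn := is_derive_add (c 1) (is_derive_mul (c (-1)) (is_derive_mul (is_derive_mul dt dt) (c k))).
have D := is_derive_add (is_derive_mul (is_derive_mul dt (c P)) dI2) (is_derive_mul (is_derive_mul (is_derive_mul dt (c G)) dn) dI3).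
have -> : rayl1 P G k = (fun s => s * P * (den k s ^+ 2)^-1 + s * G * (1 + (-1) * (s * s * k)) * (den k s ^+ 3)^-1).
  by apply/funext => s; rewrite /rayl1 /den mulN1r expr2.
move: D; congr is_derive; rewrite /rayl2 /cst /=; move: Dn; rewrite /den => Dn; field.
exact: Dn.
Qed.

Lemma ratio_bound (N D c : R) : 0 < D -> `|N| <= c * D -> `|N / D| <= c.
Proof. by move=> D0 h; rewrite normrM normfV (gtr0_norm D0) ler_pdivrMr. Qed.

Lemma rayl1_bound P G k t : 0 <= k -> `|t| < 1 -> `|rayl1 P G k t| <= `|P| + `|G|.
Proof.
move=> k0 t1; have D0 := den_gt0 t k0; rewrite /rayl1 -/(den k t).
have s0 : 0 <= t ^+ 2 * k by rewrite mulr_ge0// sqr_ge0.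
have D1 : 1 <= den k t by rewrite /den; lra.
have e2 : 1 <= den k t ^+ 2 by rewrite exprn_ege1.
rewrite (le_trans (ler_normD _ _))// lerD//.
  rewrite -mulrA normrM -[leRHS]mul1r; apply: ler_pM => //; first exact: ltW.
  rewrite -[leRHS]mulr1 normrM ler_wpM2l// normfV ger0_norm ?invf_le1 ?(lt_le_trans _ e2)//.
  exact: le_trans e2.
rewrite -!mulrA normrM -[leRHS]mul1r; apply: ler_pM => //; first exact: ltW.
rewrite -[leRHS]mulr1 normrM ler_wpM2l//; apply: ratio_bound; first by rewrite exprn_gt0.
rewrite mul1r; apply: (@le_trans _ _ (den k t)); first by rewrite ler_norml /den; apply/andP; split; lra.
by rewrite exprSr ler_peMl// ltW.
Qed.

Lemma rayl2_bound P G k t : 0 <= k -> `|rayl2 P G k t| <= 8 * (`|P| + `|G|).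
Proof.
move=> k0; have D0 := den_gt0 t k0; rewrite /rayl2 -/(den k t).
have s0 : 0 <= t ^+ 2 * k by rewrite mulr_ge0// sqr_ge0.
have D1 : 1 <= den k t by rewrite /den; lra.
have pw n : 1 <= den k t ^+ n by rewrite exprn_ege1.
rewrite (le_trans (ler_normD _ _))// [leRHS]mulrDr; apply: lerD; rewrite -mulrA normrM [leRHS]mulrC; apply: ler_wpM2l => //; apply: ratio_bound; rewrite ?exprn_gt0//.
  apply: (@le_trans _ _ (8 * den k t)); first by rewrite ler_norml /den; apply/andP; split; lra.
  by rewrite ler_wpM2l// exprSr ler_peMl// ltW.
apply: (@le_trans _ _ (8 * den k t ^+ 2)).
  rewrite /den; move: s0; set s := t ^+ 2 * k => s0; rewrite ler_norml; apply/andP; split; nra.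
by rewrite ler_wpM2l// (exprD _ 2 2) ler_peMl// ltW// exprn_gt0.
Qed.

Lemma meas_invden (B : set Y) (k : Y -> R) t n : (forall y, 0 <= k y) -> measurable_fun B k ->
  measurable_fun B (fun y => ((1 + t ^+ 2 * k y) ^+ n)^-1).
Proof.
move=> k0 mk.
  have cq : continuous (fun s : R => ((1 + `|s|) ^+ n)^-1).
    move=> s; apply: cvgV; first by rewrite expf_neq0// gt_eqF// ltr_pwDl.
    apply: (@continuous_comp _ _ _ (fun s : R => 1 + `|s|) (fun y : R => y ^+ n)); last exact: exprn_continuous.
    by apply: cvgD; [exact: cvg_cst|exact: cvg_norm].
  have mt : measurable_fun B (fun y => t ^+ 2 * k y) by exact: measurable_funM.
  apply: (eq_measurable_fun _ _ (measurableT_comp (continuous_measurable_fun cq) mt)) => y _ /=.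
  by rewrite ger0_norm// mulr_ge0// sqr_ge0.
Qed.

Lemma invden_le1 (k t : R) n : 0 <= k -> `|((1 + t ^+ 2 * k) ^+ n)^-1| <= 1.
Proof.
move=> k0; have den1 : 1 <= 1 + t ^+ 2 * k by rewrite lerDl mulr_ge0// sqr_ge0.
have h : 1 <= (1 + t ^+ 2 * k) ^+ n by exact: exprn_ege1.
by rewrite ger0_norm ?invf_le1 ?(lt_le_trans _ h)// invr_ge0 (le_trans _ h).
Qed.

Lemma intg_invden (B : set Y) (P k : Y -> R) t n : measurable B -> (forall y, 0 <= k y) -> measurable_fun B k ->
  intg mu B P -> intg mu B (fun y => P y / (1 + t ^+ 2 * k y) ^+ n).
Proof.
move=> mB k0 mk iP; apply: (eq_intg (f := fun y => ((1 + t ^+ 2 * k y) ^+ n)^-1 * P y)) => //.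
  by move=> y _; rewrite mulrC.
by apply: (intgMl (C := 1) mB (meas_invden t n k0 mk) _ iP) => y _; exact: invden_le1.
Qed.

Lemma intg_rayl (B : set Y) (e P G k : Y -> R) : measurable B ->
  (forall y, 0 <= k y) -> measurable_fun B k -> intg mu B e -> intg mu B P -> intg mu B G ->
  forall t, intg mu B (fun y => rayl (e y) (P y) (G y) (k y) t).
Proof.
move=> mB k0 mk ie iP iG t; apply: intgZ => //; apply: intgD => //; last by apply: intg_invden => //; exact: intgZ.
apply: intgD => //; apply: (eq_intg (f := fun y => t ^+ 2 * P y / (1 + t ^+ 2 * k y) ^+ 1)) => //.
by apply: intg_invden => //; exact: intgZ.
Qed.

(** Differentiation under the integral, twice. For [|t| < 1] both derivatives are dominated by
    multiples of [|P| + |G|], independently of [k]. *)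
Lemma second_derivative_rayl (B : set Y) (e P G k : Y -> R) : measurable B ->
  (forall y, 0 <= k y) -> measurable_fun B k -> intg mu B e -> intg mu B P -> intg mu B G ->
  derive1n 2 (fun t => \int[mu]_(y in B) rayl (e y) (P y) (G y) (k y) t) 0 = \int[mu]_(y in B) (P y + G y).
Proof.
move=> mB k0 mk ie iP iG.
have mPG := (intg_meas iP, intg_meas iG).
have irayl := intg_rayl mB k0 mk ie iP iG.
have irayl1 t : t \in `]-1, 1[ -> intg mu B (fun y => rayl1 (P y) (G y) (k y) t).
  rewrite in_itv/= -ltr_norml => t1; apply: (intg_le (g := fun y => `|P y| + `|G y|)) => //.
  - apply: measurable_funD.
      by apply: measurable_funM; [apply: measurable_funM => //; exact: mPG.1|exact: meas_invden].
    apply: measurable_funM; last exact: meas_invden.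
    apply: measurable_funM; first by apply: measurable_funM => //; exact: mPG.2.
    by apply: measurable_funB => //; exact: measurable_funM.
  - by apply: intgD => //; exact: intg_abs.
  - by move=> y _; exact: rayl1_bound.
have D1 t : t \in `]-1, 1[ -> derive1 (fun t => \int[mu]_(y in B) rayl (e y) (P y) (G y) (k y) t) t
    = \int[mu]_(y in B) rayl1 (P y) (G y) (k y) t.
  move=> t1; rewrite (@differentiation_under_integral R _ Y mu (fun t y => rayl (e y) (P y) (G y) (k y) t) B mB t (-1) 1 t1 _ _ (fun y => `|P y| + `|G y|)).
  - by apply: eq_Rintegral => y _; rewrite /partial1of2 derive1E; have [_ ->] := is_derive_rayl (e y) (P y) (G y) t (k0 y).
  - by move=> s _; exact: irayl.
  - by move=> s y _ _; have [] := is_derive_rayl (e y) (P y) (G y) s (k0 y).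
  - by move=> y; rewrite addr_ge0.
  - by apply: intgD => //; exact: intg_abs.
  - move=> s y; rewrite /= in_itv/= -ltr_norml => s1 _.
    rewrite /partial1of2 derive1E; have [_ ->] := is_derive_rayl (e y) (P y) (G y) s (k0 y).
    exact: rayl1_bound.
have I0 : (0 : R) \in `]-1, 1[ by rewrite in_itv/= ltrN10 ltr01.
rewrite /derive1n /=.
transitivity (derive1 (fun t => \int[mu]_(y in B) rayl1 (P y) (G y) (k y) t) 0).
  rewrite [LHS]derive1E [RHS]derive1E; apply: near_eq_derive => //.
  by near=> t; apply: D1; near: t; exact: near_in_itvoo.
rewrite (@differentiation_under_integral R _ Y mu (fun t y => rayl1 (P y) (G y) (k y) t) B mB 0 (-1) 1 I0 _ _ (fun y => 8 * (`|P y| + `|G y|))).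
- apply: eq_Rintegral => y _; rewrite /partial1of2 derive1E; have [_ ->] := is_derive_rayl1 (P y) (G y) 0 (k0 y).
  have z2 : (0 : R) ^+ 2 = 0 by rewrite expr0n.
  by rewrite /rayl2 !(z2, mul0r, mulr0, subr0, addr0, expr1n, divr1, mulr1).
- by move=> s s1; exact: irayl1.
- by move=> s y _ _; have [] := is_derive_rayl1 (P y) (G y) s (k0 y).
- by move=> y; rewrite mulr_ge0// addr_ge0.
- by apply: intgZ => //; apply: intgD => //; exact: intg_abs.
- move=> s y; rewrite /= in_itv/= -ltr_norml => s1 _.
  rewrite /partial1of2 derive1E; have [_ ->] := is_derive_rayl1 (P y) (G y) s (k0 y).
  exact: rayl2_bound.
Unshelve. all: by end_near.
Qed.
End SecondDerivative.

Lemma smooth_intg (R : realType) (r : R) (h : R3 R -> R) : 0 < r -> smooth_on setT h -> intg (leb3 R) (Ball3 r) h.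
Proof.
move=> r0 sh; have cK : compact [set x : R3 R | nsq x <= r ^+ 2].
  by apply: (@closed_bounded_compact3 R _ (r ^+ 2)) => //; exact: closed_nsq_le.
have [C [C0 hC]] := cont_bounded3 cK (fun x => smooth_cont sh I).
apply: (@intg_le _ (measurableTypeR R * measurableTypeR R * measurableTypeR R)%type _ (leb3 R) (Ball3 r) _ (fun=> C)) => //.
- exact: meas_Ball3.
- by apply: measurable_funTS; exact: smooth_meas sh.
- exact: Ball3_intg_cst.
- by move=> x hx; apply: hC; apply: ltW; exact/(Ball3E x r0).
Qed.

Section VariationAlgebra.
Variable R : realType.

(** For [U = u + t m N] of length [s], the derivative of [U / s] has squared length
    [|dU| ^ 2 / s ^ 2 - (U . dU) ^ 2 / s ^ 4]. Orthogonality of [u] and [N] gives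
    [U . dU = t ^ 2 * m * mj]; in the proof [Q], [B] and [W] are [|dU| ^ 2], [U . dU] and
    [|U| ^ 2]. *)
Lemma variation_term (u0 u1 u2 u3 u4 a0 a1 a2 a3 a4 N1 N2 n1 n2 m mj t s : R) : s != 0 -> s ^+ 2 = 1 + t ^+ 2 * m ^+ 2 ->
  u0 ^+ 2 + u1 ^+ 2 + u2 ^+ 2 + u3 ^+ 2 + u4 ^+ 2 = 1 ->
  u0 * a0 + u1 * a1 + u2 * a2 + u3 * a3 + u4 * a4 = 0 ->
  u1 * N1 + u2 * N2 = 0 -> N1 ^+ 2 + N2 ^+ 2 = 1 -> N1 * n1 + N2 * n2 = 0 ->
  a1 * N1 + a2 * N2 + u1 * n1 + u2 * n2 = 0 ->
  (a0 / s - u0 * (t ^+ 2 * m * mj / s ^+ 3)) ^+ 2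
  + ((a1 + t * (mj * N1 + m * n1)) / s - (u1 + t * m * N1) * (t ^+ 2 * m * mj / s ^+ 3)) ^+ 2
  + ((a2 + t * (mj * N2 + m * n2)) / s - (u2 + t * m * N2) * (t ^+ 2 * m * mj / s ^+ 3)) ^+ 2
  + (a3 / s - u3 * (t ^+ 2 * m * mj / s ^+ 3)) ^+ 2 + (a4 / s - u4 * (t ^+ 2 * m * mj / s ^+ 3)) ^+ 2 =
  (a0 ^+ 2 + a1 ^+ 2 + a2 ^+ 2 + a3 ^+ 2 + a4 ^+ 2 + t ^+ 2 * mj ^+ 2 + t ^+ 2 * m ^+ 2 * (n1 ^+ 2 + n2 ^+ 2)
    + 2 * t * mj * (a1 * N1 + a2 * N2) + 2 * t * m * (a1 * n1 + a2 * n2)) / s ^+ 2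
  - t ^+ 4 * m ^+ 2 * mj ^+ 2 / s ^+ 4.
Proof.
move=> s0 sE U A UN N Nn D.
set k := t ^+ 2 * m * mj.
pose Q := a0 ^+ 2 + (a1 + t * (mj * N1 + m * n1)) ^+ 2 + (a2 + t * (mj * N2 + m * n2)) ^+ 2 + a3 ^+ 2 + a4 ^+ 2.
pose B := u0 * a0 + (u1 + t * m * N1) * (a1 + t * (mj * N1 + m * n1)) + (u2 + t * m * N2) * (a2 + t * (mj * N2 + m * n2))
   + u3 * a3 + u4 * a4.
pose W := u0 ^+ 2 + (u1 + t * m * N1) ^+ 2 + (u2 + t * m * N2) ^+ 2 + u3 ^+ 2 + u4 ^+ 2.
have EW : W = s ^+ 2.
  transitivity (u0 ^+ 2 + u1 ^+ 2 + u2 ^+ 2 + u3 ^+ 2 + u4 ^+ 2 + 2 * t * m * (u1 * N1 + u2 * N2) + t ^+ 2 * m ^+ 2 * (N1 ^+ 2 + N2 ^+ 2)).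
    by rewrite /W; ring.
  by rewrite U UN N sE; ring.
have EB : B = k.
  transitivity (u0 * a0 + u1 * a1 + u2 * a2 + u3 * a3 + u4 * a4 + t * mj * (u1 * N1 + u2 * N2)
    + t * m * (a1 * N1 + a2 * N2 + u1 * n1 + u2 * n2) + t ^+ 2 * m * mj * (N1 ^+ 2 + N2 ^+ 2) + t ^+ 2 * m ^+ 2 * (N1 * n1 + N2 * n2)).
    by rewrite /B; ring.
  by rewrite A UN D N Nn /k; ring.
have EQ : Q = a0 ^+ 2 + a1 ^+ 2 + a2 ^+ 2 + a3 ^+ 2 + a4 ^+ 2 + t ^+ 2 * mj ^+ 2 + t ^+ 2 * m ^+ 2 * (n1 ^+ 2 + n2 ^+ 2)
    + 2 * t * mj * (a1 * N1 + a2 * N2) + 2 * t * m * (a1 * n1 + a2 * n2).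
  transitivity (a0 ^+ 2 + a1 ^+ 2 + a2 ^+ 2 + a3 ^+ 2 + a4 ^+ 2 + t ^+ 2 * mj ^+ 2 * (N1 ^+ 2 + N2 ^+ 2) + t ^+ 2 * m ^+ 2 * (n1 ^+ 2 + n2 ^+ 2)
    + 2 * t * mj * (a1 * N1 + a2 * N2) + 2 * t * m * (a1 * n1 + a2 * n2) + 2 * t ^+ 2 * m * mj * (N1 * n1 + N2 * n2)).
    by rewrite /Q; ring.
  by rewrite N Nn; ring.
rewrite -EQ.
transitivity (Q / s ^+ 2 - 2 * k * B / s ^+ 4 + k ^+ 2 * W / s ^+ 6); first by rewrite /Q /B /W; field.
by rewrite EB EW /k; field.
Qed.

Lemma variation_sum (D k h a1 a2 : 'I_3 -> R) (t m b N1 N2 s : R) :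
  \sum_j ((D j + t ^+ 2 * k j ^+ 2 + t ^+ 2 * m ^+ 2 * h j ^+ 2 + 2 * t * (k j * h j) * b
    + 2 * t * m * (N1 * (h j * a2 j) - N2 * (h j * a1 j))) / s ^+ 2 - t ^+ 4 * m ^+ 2 * k j ^+ 2 / s ^+ 4) =
  (\sum_j D j + t ^+ 2 * (\sum_j k j ^+ 2) + t ^+ 2 * m ^+ 2 * (\sum_j h j ^+ 2) + 2 * t * b * (\sum_j k j * h j)
    + 2 * t * m * \sum_j (N1 * (h j * a2 j) - N2 * (h j * a1 j))) / s ^+ 2 - t ^+ 4 * m ^+ 2 * (\sum_j k j ^+ 2) / s ^+ 4.
Proof. by rewrite !sum3E -!exprVn; ring. Qed.

Lemma variation_final (d g t k b : R) : 1 + t ^+ 2 * k ^+ 2 != 0 ->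
  (d + t ^+ 2 * g + t ^+ 2 * k ^+ 2 * b ^+ 2) / (1 + t ^+ 2 * k ^+ 2) -
  t ^+ 4 * k ^+ 2 * g / (1 + t ^+ 2 * k ^+ 2) ^+ 2 =
  d + t ^+ 2 * (k ^+ 2 * (b ^+ 2 - d)) / (1 + t ^+ 2 * k ^+ 2) +
  t ^+ 2 * g / (1 + t ^+ 2 * k ^+ 2) ^+ 2.
Proof.
by move=> D1; field; rewrite exprMn.
Qed.
End VariationAlgebra.

(** * The variation along m N *)

Section Variation.
Variable R : realType.
Local Notation mR := (measurableTypeR R).
Local Notation leb3 := (leb3 R).
Local Notation T3 := (mR * mR * mR)%type.
Implicit Types (x : R3 R) (i : 'I_5) (j : 'I_3) (t : R).

(** An integrable bound [H] replaces the multiple of [1 / |x| ^ 2] in [nice_intro]: competitors are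
    not homogeneous and may be singular away from the origin. *)
Lemma nice_intro_intg r (w : R3 R -> RCC R) C (H : R3 R -> R) : (forall i, measurable_fun setT (comp5 i w : T3 -> R)) ->
  (forall i x, `|comp5 i w x| <= C) -> (forall i, smooth_on (@offaxis R) (comp5 i w)) ->
  intg leb3 (Ball3 r) H -> (forall x, 0 <= H x) -> (forall x, offaxis x -> density w x <= H x) -> nice r w.
Proof.
move=> mu bu su iH H0 du i; have ci := smooth_c1off (su i).
split=> //; first by exists C.
move=> j; apply: (@intg_le _ T3 _ leb3 (Ball3 r) _ H) => //.
- exact: meas_Ball3.
- by apply: measurable_funX; apply: measurable_funTS; exact: meas_pd.
move=> x _; rewrite normrX real_normK ?num_real//.
have [ox|ox] := pselect (offaxis x); last first.
  by rewrite /pd; move/negP/negbTE: ox => ->; rewrite expr0n H0.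
apply: le_trans (du x ox); rewrite /density (bigD1 i)//= (bigD1 j)//= -addrA lerDl addr_ge0//.
  by apply: sumr_ge0 => k _; exact: sqr_ge0.
by apply: sumr_ge0 => k _; apply: sumr_ge0 => l _; exact: sqr_ge0.
Qed.

Variables (u o : R3 R -> RCC R).
Hypotheses (ho : harmonic_S2_S4 o) (eo : equivariant_on (@Sphere2 R) o)
  (hu : forall x, x != 0 -> u x = hom_ext o x).
Let f := uf u.
Let f1 := uf1 u.
Let P : profile u f f1 := u_profile ho eo hu.

Variables p q : R.
Hypotheses (pq1 : p ^+ 2 + q ^+ 2 = 1) (pqf : forall t, p * f ix1 t + q * f ix2 t = 0).

(** As a complex number [N] is [p + i q] times the unit number of the azimuth; the choice of [p] and
    [q] makes it orthogonal to [u]. *)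
Definition N1 x : R := p * cosx x - q * sinx x.
Definition N2 x : R := q * cosx x + p * sinx x.

Variables (m : R3 R -> R) (c M r : R).
Hypotheses (r0 : 0 < r) (c0 : 0 < c) (Mr : M < r ^+ 2)
  (sm : smooth_on setT m) (ms : forall x, m x != 0 -> c <= rho2 x /\ nsq x <= M)
  (mr : forall a x, m (rot3 a x) = m x)
  (mp : forall x, offaxis x -> \sum_j partial j m x * ph j x = 0).

Definition Xv x : RCC R := (0, (m x * N1 x) +i* (m x * N2 x), 0)%C.

Lemma Xv_coords x : [/\ coord5 ord0 (Xv x) = 0, coord5 ix1 (Xv x) = m x * N1 x, coord5 ix2 (Xv x) = m x * N2 x,
  coord5 ix3 (Xv x) = 0 & coord5 ix4 (Xv x) = 0].
Proof. by []. Qed.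

Lemma ord5_cases i : [\/ i = ord0, i = ix1, i = ix2 | i = ix3 \/ i = ix4].
Proof.
case: i => [[|[|[|[|[|n]]]]] hi]; last exact: (False_ind _ (notF hi)).
- by constructor 1; exact: val_inj.
- by constructor 2; exact: val_inj.
- by constructor 3; exact: val_inj.
- by constructor 4; left; exact: val_inj.
- by constructor 4; right; exact: val_inj.
Qed.

Lemma smooth_N : smooth_on (@offaxis R) N1 /\ smooth_on (@offaxis R) N2.
Proof.
have oO := @open_offaxis R; have [sc ss] := @smooth_cosx R.
split; first exact: smoothB oO (smoothM oO (smooth_cst p oO) sc) (smoothM oO (smooth_cst q oO) ss).
exact: smoothD oO (smoothM oO (smooth_cst q oO) sc) (smoothM oO (smooth_cst p oO) ss).
Qed.

(** [N] is singular along the axis, but [m] vanishes in a neighbourhood of it. *)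
Lemma smooth_cut h : smooth_on (@offaxis R) h -> smooth_on setT (fun x => m x * h x).
Proof.
move=> sh; pose V := [set x : R3 R | rho2 x < c].
have oV : open V by exact: open_rho2_lt.
have -> : [set: R3 R] = (@offaxis R) `|` V.
  apply/seteqP; split=> // x _; have [h0|h0] := eqVneq (rho2 x) 0; last by left.
  by right; rewrite /V/= h0.
apply: smooth_union.
  exact: (smoothM (@open_offaxis R) (smooth_sub (@subsetT _ _) sm) sh).
apply: (smooth_ext oV _ (smooth_cst 0 oV)) => x; rewrite /V/= => hx.
have [->|m0] := eqVneq (m x) 0; first by rewrite mul0r.
by have [h1 _] := ms m0; lra.
Qed.

Lemma Xv_smooth i : smooth_on setT (comp5 i Xv).
Proof.
have [s1 s2] := smooth_N.
have [-> | -> | -> | [-> | ->]] := ord5_cases i.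
- exact: smooth_cst openT.
- exact: smooth_cut s1.
- exact: smooth_cut s2.
- exact: smooth_cst openT.
- exact: smooth_cst openT.
Qed.

Lemma Xv_zero x : m x = 0 -> Xv x = 0.
Proof. by move=> m0; rewrite /Xv m0 !mul0r. Qed.

Lemma Xv_supp : compact (supp Xv) /\ supp Xv `<=` Ball3 r.
Proof.
have sub : supp Xv `<=` [set x | nsq x <= M].
  rewrite /supp (closure_id [set x | nsq x <= M]).1; last exact: closed_nsq_le.
  apply: closureS => x /=; have [/Xv_zero ->|/ms[_ //]] := eqVneq (m x) 0.
  by rewrite eqxx.
split.
  apply: (@closed_bounded_compact3 R _ M); first exact: closed_closure.
  by move=> x /sub.
by move=> x /sub /= h; apply/Ball3E => //; exact: le_lt_trans h Mr.
Qed.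

Lemma isq_rot a x : isq (rot3 a x) = isq x.
Proof. by rewrite /isq rho2_rot. Qed.

Lemma Xv_equiv : equivariant_on setT Xv.
Proof.
move=> a x _; apply: coord5_inj => i; rewrite coord5_rot /Jc /wt.
have [-> | -> | -> | [-> | ->]] := ord5_cases i; rewrite /coord5 !(tnth_nth 0) /Xv /= ?mr ?mul0r ?mul1r ?mulr0 ?oppr0 ?mulr0 ?addr0//.
- by rewrite /N1 /N2 /cosx /sinx isq_rot /rot3 /=; ring.
- by rewrite /N1 /N2 /cosx /sinx isq_rot /rot3 /=; ring.
Qed.

Lemma N_facts x : offaxis x -> [/\ N1 x ^+ 2 + N2 x ^+ 2 = 1,
  comp5 ix1 u x * N1 x + comp5 ix2 u x * N2 x = 0 &
  forall j, is_derive x (basis3 R j) N1 (- (N2 x * ph j x)) /\ is_derive x (basis3 R j) N2 (N1 x * ph j x)].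
Proof.
move=> ox; have cs := cosx2sinx2 ox; split.
- transitivity ((p ^+ 2 + q ^+ 2) * (cosx x ^+ 2 + sinx x ^+ 2)); first by rewrite /N1 /N2; ring.
  by rewrite pq1 cs mulr1.
- rewrite !(prof_rep P)// /ev /N1 /N2 /Cw /Sw /Jn /=.
  transitivity ((p * f ix1 (T x) + q * f ix2 (T x)) * (cosx x ^+ 2 + sinx x ^+ 2)); first by ring.
  by rewrite pqf mul0r.
move=> j; have dc := is_derive_cosx j ox; have ds := is_derive_sinx j ox.
have cp k := @is_derive_cst _ _ _ k x (basis3 R j) : is_derive x (basis3 R j) (fun=> k : R) 0.
split.
  have := is_deriveB (is_derive_mul (cp p) dc) (is_derive_mul (cp q) ds).
  by congr is_derive; rewrite /N2; ring.
have := is_derive_add (is_derive_mul (cp q) dc) (is_derive_mul (cp p) ds).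
by congr is_derive; rewrite /N1; ring.
Qed.

Definition wv t x : RCC R := normalize5 (u x + scale5 t (Xv x)).

Lemma coord5_scale k (y : RCC R) i : coord5 i (scale5 k y) = k * coord5 i y.
Proof.
case: y => [[y0 [a b]] [a' b']]; have [-> | -> | -> | [-> | ->]] := ord5_cases i;
  rewrite /coord5 !(tnth_nth 0) /scale5 /= ?mul0r ?subr0 ?addr0//.
Qed.

Lemma coord5_add (y z : RCC R) i : coord5 i (y + z) = coord5 i y + coord5 i z.
Proof.
case: y => [[y0 [a b]] [a' b']]; case: z => [[z0 [a1 b1]] [a1' b1']].
by have [-> | -> | -> | [-> | ->]] := ord5_cases i; rewrite /coord5 !(tnth_nth 0).
Qed.

Lemma coord5B (y z : RCC R) i : coord5 i (y - z) = coord5 i y - coord5 i z.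
Proof.
case: y => [[y0 [a b]] [a' b']]; case: z => [[z0 [a1 b1]] [a1' b1']].
by have [-> | -> | -> | [-> | ->]] := ord5_cases i; rewrite /coord5 !(tnth_nth 0).
Qed.

Definition Dv t x : R := 1 + t ^+ 2 * m x ^+ 2.

Lemma Dv_gt0 t x : 0 < Dv t x.
Proof. by rewrite /Dv -exprMn ltr_pwDl// sqr_ge0. Qed.

Lemma u_sph x : x != 0 -> \sum_i comp5 i u x ^+ 2 = 1.
Proof. by move=> x0; exact: sphere_sum (u_sphere ho hu x0). Qed.

Lemma wv_norm t x : x != 0 -> norm5 (u x + scale5 t (Xv x)) = Num.sqrt (Dv t x).
Proof.
move=> x0; rewrite /norm5; congr Num.sqrt; rewrite sum5E !coord5_add !coord5_scale.
have [-> -> -> -> ->] := Xv_coords x; rewrite !mulr0 !addr0.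
have := u_sph x0; rewrite sum5E /comp5 => U.
have [m0|/ms[h _]] := eqVneq (m x) 0.
  by rewrite /Dv m0 !mul0r !mulr0 !addr0 expr0n mulr0 addr0.
have ox : offaxis x by rewrite /offaxis/= gt_eqF//; exact: lt_le_trans h.
have [N UN _] := N_facts ox; rewrite /comp5 in UN.
transitivity (coord5 ord0 (u x) ^+ 2 + coord5 ix1 (u x) ^+ 2 + coord5 ix2 (u x) ^+ 2 + coord5 ix3 (u x) ^+ 2 + coord5 ix4 (u x) ^+ 2
  + 2 * t * m x * (coord5 ix1 (u x) * N1 x + coord5 ix2 (u x) * N2 x) + t ^+ 2 * m x ^+ 2 * (N1 x ^+ 2 + N2 x ^+ 2)); first by ring.
by rewrite U UN N /Dv; ring.
Qed.

Lemma wv_comp t i x : x != 0 -> comp5 i (wv t) x = (comp5 i u x + t * comp5 i Xv x) * (Num.sqrt (Dv t x))^-1.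
Proof. by move=> x0; rewrite /comp5 /wv /normalize5 coord5_scale wv_norm// coord5_add coord5_scale mulrC. Qed.

Lemma smooth_Dv t : smooth_on setT (Dv t).
Proof.
exact: smoothD openT (smooth_cst 1 openT) (smoothM openT (smooth_cst (t ^+ 2) openT) (smoothX 2 openT sm)).
Qed.

Lemma smooth_wv t i : smooth_on (@offaxis R) (comp5 i (wv t)).
Proof.
have oO := @open_offaxis R; have st h := @smooth_sub R setT (@offaxis R) h (@subsetT _ _).
have := smoothM oO (smoothD oO (smooth_comp_u P i) (smoothM oO (smooth_cst t oO) (st _ (Xv_smooth i))))
  (smooth_isq oO (st _ (smooth_Dv t)) (fun x _ => Dv_gt0 t x)).
by apply: (smooth_ext oO) => x /off_neq0 x0; rewrite wv_comp.
Qed.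

Lemma isq_Dv_derive t x j : is_derive x (basis3 R j) (fun x => (Num.sqrt (Dv t x))^-1)
  (- (t ^+ 2 * m x * partial j m x) * (Num.sqrt (Dv t x))^-1 ^+ 3).
Proof.
have dm := smooth_derivable (x := x) j sm I.
have d : is_derive x (basis3 R j) (Dv t) (2 * t ^+ 2 * m x * partial j m x).
  have := is_derive_add (@is_derive_cst _ _ _ (1 : R) x (basis3 R j)) (is_derive_mul (@is_derive_cst _ _ _ (t ^+ 2) x (basis3 R j)) (is_derive_mul dm dm)).
  by congr is_derive; rewrite /cst; move: (partial _ _ _) => k; ring.
have := is_derive_comp1 d (isq_derive (Dv_gt0 t x)).
congr is_derive; move: (partial j m x) (Num.sqrt _)^-1 => k s; by field.
Qed.

Definition grad2 (h : R3 R -> R) x : R := \sum_j partial j h x ^+ 2.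

Lemma wv_partial t i j x : offaxis x -> partial j (comp5 i (wv t)) x =
  (partial j (comp5 i u) x + t * partial j (comp5 i Xv) x) / Num.sqrt (Dv t x)
  - (comp5 i u x + t * comp5 i Xv x) * (t ^+ 2 * m x * partial j m x / Num.sqrt (Dv t x) ^+ 3).
Proof.
move=> ox; have oO := @open_offaxis R.
rewrite (@near_partial _ _ (fun x => (comp5 i u x + t * comp5 i Xv x) * (Num.sqrt (Dv t x))^-1)); last first.
  by apply: (eq_on_near oO) => // y /off_neq0 y0; rewrite wv_comp.
have du := smooth_derivable j (smooth_comp_u P i) ox.
have dX := smooth_derivable (x := x) j (Xv_smooth i) I.
have [_] := is_derive_mul (is_derive_add du (is_derive_mul (@is_derive_cst _ _ _ t x (basis3 R j)) dX)) (isq_Dv_derive t x j).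
rewrite /partial => ->; rewrite -!/(partial _ _ _) -exprVn /cst.
move: (partial j (comp5 i u) x) (partial j (comp5 i Xv) x) (partial j m x) (comp5 i u x) (comp5 i Xv x) (Num.sqrt _)^-1 => a b k y z s.
ring.
Qed.

Lemma Xv_partial j x : offaxis x ->
  [/\ partial j (comp5 ord0 Xv) x = 0, partial j (comp5 ix1 Xv) x = partial j m x * N1 x + m x * (- (N2 x * ph j x)),
   partial j (comp5 ix2 Xv) x = partial j m x * N2 x + m x * (N1 x * ph j x),
   partial j (comp5 ix3 Xv) x = 0 & partial j (comp5 ix4 Xv) x = 0].
Proof.
move=> ox; have [_ _ /(_ j)[d1 d2]] := N_facts ox.
have dm := smooth_derivable (x := x) j sm I.
have [_ e1] := is_derive_mul dm d1; have [_ e2] := is_derive_mul dm d2.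
have [_ e0] := @is_derive_cst _ _ _ (0 : R) x (basis3 R j).
split; [exact: e0|rewrite /partial e1|rewrite /partial e2|exact: e0|exact: e0].
- by rewrite addrC; congr (_ + _); rewrite mulrC.
- by rewrite addrC; congr (_ + _); rewrite mulrC.
Qed.

Lemma u_tangent j x : offaxis x -> \sum_i comp5 i u x * partial j (comp5 i u) x = 0.
Proof.
move=> ox; have d i := smooth_derivable j (smooth_comp_u P i) ox.
have D : is_derive x (basis3 R j) (fun x => \sum_i comp5 i u x ^+ 2) (2 * \sum_i comp5 i u x * partial j (comp5 i u) x).
  have dd i : is_derive x (basis3 R j) (fun x => comp5 i u x ^+ 2) (2 * (comp5 i u x * partial j (comp5 i u) x)).
    by have := is_derive_mul (d i) (d i); congr is_derive; move: (partial _ _ _) => k; ring.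
  have := is_derive_add (is_derive_add (is_derive_add (is_derive_add (dd ord0) (dd ix1)) (dd ix2)) (dd ix3)) (dd ix4).
  rewrite (_ : (fun x => \sum_i comp5 i u x ^+ 2) = (fun x => comp5 ord0 u x ^+ 2 + comp5 ix1 u x ^+ 2 + comp5 ix2 u x ^+ 2
     + comp5 ix3 u x ^+ 2 + comp5 ix4 u x ^+ 2)); last by apply/funext => y; rewrite sum5E.
  by rewrite sum5E !mulrDr.
have [_ z] := near_is_derive (f := fun x => \sum_i comp5 i u x ^+ 2) (eq_on_near (@open_offaxis R) (fun y oy => u_sph (off_neq0 oy)) ox)
  (@is_derive_cst _ _ _ (1 : R) x (basis3 R j)).
have [_ e] := D; rewrite z in e; move/esym/eqP: e; rewrite mulf_eq0 pnatr_eq0/= => /eqP; exact.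
Qed.

(** An identity for every [t], without a term of first order. The cross terms cancel in the sum over
    [j]: [m] does not depend on the azimuth, whereas [N] depends on nothing else; and in the first
    factor the azimuthal derivatives of [u] and [N] are their quarter turns, orthogonal as [u] and
    [N] are. The term [isq x ^+ 2] is the squared gradient of [N]. *)
Lemma wv_density t x : offaxis x -> density (wv t) x =
  density u x + t ^+ 2 * (m x ^+ 2 * (isq x ^+ 2 - density u x)) / Dv t x + t ^+ 2 * grad2 m x / Dv t x ^+ 2.
Proof.
move=> ox; have x0 := off_neq0 ox; have [N UN dN] := N_facts ox.
have [t2 p2 tp] := coord_identities ox.
have D0 := Dv_gt0 t x; set s := Num.sqrt (Dv t x).
have s0 : s != 0 by rewrite gt_eqF// sqrtr_gt0.
have sE : s ^+ 2 = 1 + t ^+ 2 * m x ^+ 2 by rewrite sqr_sqrtr// ltW.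
pose A i j := partial j (comp5 i u) x.
have U := u_sph x0; rewrite sum5E in U.
have UNd j : A ix1 j * N1 x + A ix2 j * N2 x + comp5 ix1 u x * (- (N2 x * ph j x)) + comp5 ix2 u x * (N1 x * ph j x) = 0.
  have [dn1 dn2] := dN j.
  have d1 := smooth_derivable j (smooth_comp_u P ix1) ox; have d2 := smooth_derivable j (smooth_comp_u P ix2) ox.
  have D := is_derive_add (is_derive_mul d1 dn1) (is_derive_mul d2 dn2).
  have UN' y : offaxis y -> comp5 ix1 u y * N1 y + comp5 ix2 u y * N2 y = 0 by move=> /N_facts[].
  have [_ z] := near_is_derive (f := fun x => comp5 ix1 u x * N1 x + comp5 ix2 u x * N2 x) (eq_on_near (@open_offaxis R) UN' ox)
    (@is_derive_cst _ _ _ (0 : R) x (basis3 R j)).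
  have [_ e] := D; rewrite z in e; rewrite [RHS]e /A.
  by move: (partial _ _ _) (partial _ _ _) => a b; ring.
have term j : \sum_i partial j (comp5 i (wv t)) x ^+ 2 =
   (\sum_i A i j ^+ 2 + t ^+ 2 * partial j m x ^+ 2 + t ^+ 2 * m x ^+ 2 * ph j x ^+ 2
     + 2 * t * (partial j m x * ph j x) * (comp5 ix1 u x * N2 x - comp5 ix2 u x * N1 x)
     + 2 * t * m x * (N1 x * (ph j x * A ix2 j) - N2 x * (ph j x * A ix1 j))) / s ^+ 2 - t ^+ 4 * m x ^+ 2 * partial j m x ^+ 2 / s ^+ 4.
  have Tj := u_tangent j ox; rewrite sum5E -!/(A _ j) in Tj.
  have Nn : N1 x * (- (N2 x * ph j x)) + N2 x * (N1 x * ph j x) = 0 by ring.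
  have := variation_term (partial j m x) s0 sE U Tj UN N Nn (UNd j).
  rewrite !sum5E !wv_partial// -/s -!/(A _ j).
  have [q0 q1 q2 q3 q4] := Xv_partial j ox; rewrite q0 q1 q2 ?q3 ?q4.
  have [c0' c1 c2 c3 c4] := Xv_coords x; rewrite -!/(comp5 _ Xv x) in c0' c1 c2 c3 c4.
  rewrite c0' c1 c2 ?c3 ?c4.
  rewrite !mulr0 !addr0 ![t * (m x * _)]mulrA => ->; congr (_ / _ - _).
  have UNj : A ix1 j * N1 x + A ix2 j * N2 x = ph j x * (comp5 ix1 u x * N2 x - comp5 ix2 u x * N1 x).
    by move: (UNd j); move: (A _ _) (A _ _) (ph j x) => a1 a2 b h; apply/eqP; rewrite -subr_eq0 -h; apply/eqP; ring.
  rewrite UNj (_ : (- (N2 x * ph j x)) ^+ 2 + (N1 x * ph j x) ^+ 2 = ph j x ^+ 2); last first.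
    by rewrite -[RHS]mul1r -N; ring.
  move: (partial j m x) (A _ j) (A _ j) => k a1 a2; ring.
have phA i : \sum_j ph j x * A i j = isq x ^+ 2 * (wt R i * evJ f i x).
  transitivity (\sum_j (Td j x * ph j x) * ev f1 i x + \sum_j ph j x ^+ 2 * (wt R i * evJ f i x)).
    rewrite -big_split; apply: eq_bigr => j _; rewrite /A (u_partial ho eo hu)//=.
    by move: (ph j x) (Td j x) => g h; ring.
  by rewrite -!mulr_suml tp p2 mul0r add0r.
have S3 : \sum_j (N1 x * (ph j x * A ix2 j) - N2 x * (ph j x * A ix1 j)) = 0.
  rewrite sumrB -!mulr_sumr !phA.
  have -> : evJ f ix1 x = - comp5 ix2 u x by rewrite (prof_rep P)// /evJ /ev /Cw /Sw /Jn /=; ring.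
  have -> : evJ f ix2 x = comp5 ix1 u x by rewrite (prof_rep P)// /evJ /ev /Cw /Sw /Jn /=; ring.
  rewrite (_ : wt R ix2 = wt R ix1)//.
  transitivity (isq x ^+ 2 * wt R ix1 * (comp5 ix1 u x * N1 x + comp5 ix2 u x * N2 x)); first by ring.
  by rewrite UN mulr0.
rewrite !density_off// [LHS]exchange_big /= (eq_bigr _ (fun j _ => term j)).
rewrite [\sum_i \sum_j partial j (comp5 i u) x ^+ 2]exchange_big /= -/A /grad2.
set d := \sum_j \sum_i partial j (comp5 i u) x ^+ 2; set g := \sum_j partial j m x ^+ 2.
have -> : isq x ^+ 2 = \sum_j ph j x ^+ 2 by rewrite p2.
rewrite variation_sum -/d -/g.
rewrite mp// S3 p2 !mulr0 !addr0 (_ : s ^+ 4 = (s ^+ 2) ^+ 2); last by rewrite -exprM.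
rewrite sqr_sqrtr ?ltW//.
move: (gt_eqF D0) => /negbT; rewrite /Dv; move: d g (isq x) (m x) => d g b k D1.
apply: variation_final. exact: D1.
Qed.

Let Bm := @meas_Ball3 R r.

Lemma u_meas i : measurable_fun setT (comp5 i u : T3 -> R).
Proof. by apply: meas_off0 => x x0; exact: (smooth_cont (u_smooth ho hu i) x0). Qed.

Lemma u_density_le : exists2 C, 0 <= C & forall x, offaxis x -> density u x <= C / nsq x.
Proof.
have [C [C0 VC]] : exists C, 0 <= C /\ forall t, Vpot f f1 t <= C / ch t ^+ 2 := prof_decay P.
exists C => // x ox; have x0 := off_neq0 ox; rewrite (u_density ho eo hu ox).
apply: le_trans (ler_wpM2l (sqr_ge0 _) (VC _)) _.
rewrite ch_T// exprMn nsqE invfM; have := isq_gt0 ox; move: (isq x) => k k0.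
by rewrite le_eqVlt; apply/orP; left; apply/eqP; move: (nsq x)^-1 (gt_eqF k0) => z /negbT k1; field.
Qed.

Lemma u_bound : exists C, 0 <= C /\ forall i x, `|comp5 i u x| <= C.
Proof.
exists (1 + \sum_i `|comp5 i u 0|); have s0 k : 0 <= `|comp5 k u 0| by [].
split; first by rewrite addr_ge0// sumr_ge0.
move=> i x; have [->|x0] := eqVneq x 0.
  by rewrite (bigD1 i)//= addrCA lerDl addr_ge0// sumr_ge0.
by apply: le_trans (coord5_le1 i (u_sphere ho hu x0)) _; rewrite lerDl sumr_ge0.
Qed.

Lemma u_nice : nice r u.
Proof.
have [C [_ bC]] := u_bound; have [C' _ bC'] := u_density_le.
apply: (@nice_intro R r u C C' u_meas bC _ bC') => i; exact: (smooth_comp_u P i).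
Qed.

Let iu : intg leb3 (Ball3 r) (density u) := (energy_nice r0 u_nice).1.

Definition varP x : R := m x ^+ 2 * (isq x ^+ 2 - density u x).

Lemma Ball_closed_bound (h : R3 R -> R) : (forall x, {for x, continuous h}) -> exists C, 0 <= C /\ forall x, Ball3 r x -> `|h x| <= C.
Proof.
move=> ch; have cK : compact [set x : R3 R | nsq x <= r ^+ 2].
  by apply: (@closed_bounded_compact3 R _ (r ^+ 2)) => //; exact: closed_nsq_le.
have [C [C0 hC]] := cont_bounded3 cK ch.
by exists C; split=> // x hx; apply: hC; apply: ltW; exact/(Ball3E x r0).
Qed.

Lemma m_meas : measurable_fun setT (m : T3 -> R). Proof. exact: smooth_meas sm. Qed.

Lemma grad2_intg : intg leb3 (Ball3 r) (grad2 m).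
Proof.
apply: intg_sum => // j; apply: smooth_intg => //.
exact: smoothX 2 openT (smooth_partial j sm).
Qed.

Lemma m_bound : exists C, 0 <= C /\ forall x, Ball3 r x -> `|m x| <= C.
Proof. by apply: Ball_closed_bound => x; exact: (smooth_cont sm I). Qed.

Lemma m2_le x : m x ^+ 2 * isq x ^+ 2 <= m x ^+ 2 / c.
Proof.
have [->|/ms[h _]] := eqVneq (m x) 0; first by rewrite expr0n !mul0r.
have ox : offaxis x by rewrite /offaxis/= gt_eqF//; exact: lt_le_trans h.
by rewrite isq_sqrE// ler_wpM2l ?sqr_ge0// lef_pV2 ?posrE// (lt_le_trans c0).
Qed.

Lemma varP_intg : intg leb3 (Ball3 r) varP.
Proof.
have [C [C0 bC]] := m_bound.
have mm := measurable_funTS (D := Ball3 r) m_meas.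
have mi : measurable_fun (Ball3 r : set T3) (fun x : T3 => isq x) by apply: measurable_funTS; exact: meas_isq_rho2.
have ix2 : intg leb3 (Ball3 r) (fun x => m x ^+ 2 * density u x).
  apply: (intgMl (C := C ^+ 2)) => //; first exact: measurable_funX.
  by move=> x /bC h; rewrite normrX; apply: lerXn2r; rewrite ?nnegrE.
have ix1 : intg leb3 (Ball3 r) (fun x => m x ^+ 2 * isq x ^+ 2).
  apply: (@intg_le _ T3 _ leb3 (Ball3 r) _ (fun=> C ^+ 2 / c)) => //.
  - by apply: measurable_funM; exact: measurable_funX.
  - exact: Ball3_intg_cst.
  - move=> x /bC h; have p0 : 0 <= m x ^+ 2 * isq x ^+ 2 by apply: mulr_ge0; exact: sqr_ge0.
    rewrite ger0_norm//; apply: (le_trans (m2_le x)).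
    rewrite ler_pM2r ?invr_gt0//; rewrite -(real_normK (num_real (m x))); apply: lerXn2r; rewrite ?nnegrE//.
by apply: eq_intg (intgB Bm ix1 ix2) => // x _; rewrite /varP mulrBr.
Qed.

Lemma wv_meas t i : measurable_fun setT (comp5 i (wv t) : T3 -> R).
Proof.
apply: meas_off0 => x x0.
have s := smoothM (@open_off0 R) (smoothD (@open_off0 R) (u_smooth ho hu i) (smoothM (@open_off0 R) (smooth_cst t (@open_off0 R)) (smooth_sub (@subsetT _ _) (Xv_smooth i))))
  (smooth_isq (@open_off0 R) (smooth_sub (@subsetT _ _) (smooth_Dv t)) (fun x _ => Dv_gt0 t x)).
apply: (smooth_cont (smooth_ext (@open_off0 R) _ s) x0) => y y0.
by rewrite wv_comp.
Qed.

Lemma norm5_normalize (y : RCC R) : norm5 y != 0 -> Sphere4 (normalize5 y).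
Proof.
move=> y0; rewrite /Sphere4/= /norm5 /normalize5.
under eq_bigr do rewrite coord5_scale exprMn.
rewrite -mulr_sumr sqrtrM ?sqr_ge0// sqrtr_sqr ger0_norm ?invr_ge0 ?sqrtr_ge0//.
exact: mulVf.
Qed.

Lemma wv_sphere t x : x != 0 -> Sphere4 (wv t x).
Proof. by move=> x0; apply: norm5_normalize; rewrite wv_norm// gt_eqF// sqrtr_gt0 Dv_gt0. Qed.

Let den1 t x : 1 <= Dv t x. Proof. by rewrite /Dv lerDl -exprMn sqr_ge0. Qed.

Lemma wv_densityE t x : offaxis x -> density (wv t) x = 2 * rayl (density u x) (varP x) (grad2 m x) (m x ^+ 2) t.
Proof. by move=> ox; rewrite wv_density// /rayl /varP [RHS]mulrA mulfV ?mul1r ?pnatr_eq0. Qed.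

Lemma grad2_ge0 x : 0 <= grad2 m x. Proof. by apply: sumr_ge0 => j _; exact: sqr_ge0. Qed.

Lemma wv_nice t : nice r (wv t).
Proof.
have [C [C0 bC]] := u_bound.
pose C1 := 1 + \sum_i `|comp5 i (wv t) 0|.
have bw i x : `|comp5 i (wv t) x| <= C1.
  have s0 k : 0 <= `|comp5 k (wv t) 0| by [].
  have [->|x0] := eqVneq x 0.
    by rewrite /C1 (bigD1 i)//= addrCA lerDl addr_ge0// sumr_ge0.
  by apply: le_trans (coord5_le1 i (wv_sphere t x0)) _; rewrite lerDl sumr_ge0.
pose H x := density u x + t ^+ 2 * `|varP x| + t ^+ 2 * grad2 m x.
apply: (nice_intro_intg (wv_meas t) bw (smooth_wv t) (H := H)).
- by apply: intgD => //; [apply: intgD => //; apply: intgZ => //; apply: intg_abs => //; exact: varP_intg|apply: intgZ => //; exact: grad2_intg].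
- move=> x; apply: addr_ge0; last by apply: mulr_ge0; [exact: sqr_ge0|exact: grad2_ge0].
  by apply: addr_ge0; [exact: density_ge0|apply: mulr_ge0 => //; exact: sqr_ge0].
- move=> x ox; rewrite wv_density// -/(varP x) /H.
  have d1 := den1 t x; have d0 := Dv_gt0 t x.
  rewrite lerD ?lerD//.
    rewrite -mulrA ler_wpM2l ?sqr_ge0//; apply: le_trans (ler_norm _) _.
    by rewrite normrM ler_piMr// normfV ger0_norm ?invf_le1// ltW.
  have e1 : 1 <= Dv t x ^+ 2 by exact: exprn_ege1.
  have e0 : 0 <= t ^+ 2 * grad2 m x by apply: mulr_ge0; [exact: sqr_ge0|exact: grad2_ge0].
  by apply: ler_piMr => //; rewrite invf_le1// exprn_gt0.
Qed.

Let m2_meas : measurable_fun (Ball3 r : set T3) (fun x => m x ^+ 2).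
Proof. by apply: measurable_funX; apply: measurable_funTS; exact: m_meas. Qed.

Let m2_ge0 x : 0 <= m x ^+ 2. Proof. exact: sqr_ge0. Qed.

Lemma wv_energy t : energy (wv t) r = (\int[leb3]_(x in Ball3 r) rayl (density u x) (varP x) (grad2 m x) (m x ^+ 2) t)%:E.
Proof.
have [i ->] := energy_nice r0 (wv_nice t).
have ie : intg leb3 (Ball3 r) (fun x => 2^-1 * density (wv t) x) by exact: intgZ.
congr (_%:E); rewrite -RintegralZl//.
apply: Rint_ae_eq => //; first exact: intg_meas ie.
  exact: intg_meas (intg_rayl Bm m2_ge0 m2_meas iu varP_intg grad2_intg t).
apply: (ae_imp _ (null_axis R)) => x ox _.
by rewrite wv_densityE// mulrA mulVf ?mul1r// pnatr_eq0.
Qed.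

Lemma second_variation_Xv : second_variation u r Xv = \int[leb3]_(x in Ball3 r) (varP x + grad2 m x).
Proof.
rewrite -(second_derivative_rayl Bm m2_ge0 m2_meas iu varP_intg grad2_intg) /second_variation.
by congr (derive1n 2 _ 0); apply/funext => t; rewrite wv_energy.
Qed.

Lemma stable_variation : stable u -> 0 <= \int[leb3]_(x in Ball3 r) (varP x + grad2 m x).
Proof.
move=> st; rewrite -second_variation_Xv; have [cX sX] := Xv_supp.
by apply: st => //; [exact: Xv_smooth|exact: Xv_equiv].
Qed.

Lemma rot5_norm a (y : RCC R) : norm5 (rot5 a y) = norm5 y.
Proof.
rewrite /norm5; congr Num.sqrt; rewrite !sum5E !coord5_rot /Jc /wt /coord5 !(tnth_nth 0) /=.
rewrite !mul0r !mul1r cos0 sin0.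
have e1 := cos2Dsin2 a; have e2 := cos2Dsin2 (2 * a).
move: (cos a) (sin a) (cos (2 * a)) (sin (2 * a)) e1 e2 => c1 s1 c2 s2 e1 e2.
case: y => [[y0 [a1 a2]] [b1 b2]] /=.
transitivity (y0 ^+ 2 + (c1 ^+ 2 + s1 ^+ 2) * (a1 ^+ 2 + a2 ^+ 2) + (c2 ^+ 2 + s2 ^+ 2) * (b1 ^+ 2 + b2 ^+ 2)); first by ring.
by rewrite e1 e2; ring.
Qed.

Lemma rot5_lin a k (y z : RCC R) : rot5 a (y + scale5 k z) = rot5 a y + scale5 k (rot5 a z).
Proof. by rewrite /rot5 /scale5 /=; congr (_, _, _); rewrite mulrDr; congr (_ + _); rewrite mulrCA. Qed.

Lemma rot5_scale a k (y : RCC R) : rot5 a (scale5 k y) = scale5 k (rot5 a y).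
Proof. by rewrite /rot5 /scale5 /=; congr (_, _, _); rewrite mulrCA. Qed.

Lemma wv_equiv t x a : x != 0 -> wv t (rot3 a x) = rot5 a (wv t x).
Proof.
move=> x0.
have E : u (rot3 a x) + scale5 t (Xv (rot3 a x)) = rot5 a (u x + scale5 t (Xv x)).
  by rewrite (u_equiv eo hu)// Xv_equiv// rot5_lin.
by rewrite /wv /normalize5 E rot5_norm rot5_scale.
Qed.

Lemma wv_ess t : ess_supp (Ball3 r) (fun x => u x - wv t x) `<=` Ball3 r.
Proof.
move=> x Hx; apply/(Ball3E x r0); rewrite ltNge; apply/negP => hx.
pose V := ~` [set x : R3 R | nsq x <= M].
have oV : open V by apply: closed_openC; exact: closed_nsq_le.
apply: (Hx V oV); first by rewrite /V/=; apply/negP; rewrite -ltNge; exact: lt_le_trans hx.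
apply: (ae_imp _ (null_axis R)) => y oy Vy _.
have m0 : m y = 0.
  by apply/eqP/negP => /negP /ms[_ h]; exact: Vy.
apply: coord5_inj => i.
have y0 := off_neq0 oy.
have := wv_comp t i y0; rewrite /comp5 /Dv m0 expr0n mulr0 addr0 sqrtr1 invr1 mulr1 (Xv_zero m0).
have -> : coord5 i (0 : RCC R) = 0 by have [-> | -> | -> | [-> | ->]] := ord5_cases i.
by move=> E; rewrite coord5B E mulr0 addr0 subrr.
Qed.

(** The energy of [wv t] exceeds that of [u] by [t ^ 2 / 2] times the integral of [G t], by the
    exact formula for the density; minimality makes this nonnegative, and [t] tends to 0 along
    [harm]. *)
Lemma minimizing_variation : locally_minimizing u -> 0 <= \int[leb3]_(x in Ball3 r) (varP x + grad2 m x).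
Proof.
move=> mu.
pose G t x := varP x / (1 + t ^+ 2 * m x ^+ 2) ^+ 1 + grad2 m x / (1 + t ^+ 2 * m x ^+ 2) ^+ 2.
have iG t : intg leb3 (Ball3 r) (G t).
  apply: intgD => //.
    exact: (@intg_invden _ T3 _ leb3 (Ball3 r) varP (fun x => m x ^+ 2) t 1 Bm m2_ge0 m2_meas varP_intg).
  exact: (@intg_invden _ T3 _ leb3 (Ball3 r) (grad2 m) (fun x => m x ^+ 2) t 2 Bm m2_ge0 m2_meas grad2_intg).
have pos n : 0 <= \int[leb3]_(x in Ball3 r) G (harm R n) x.
  have h0 := harm_gt0 R n; set t := harm R n in h0 *.
  have : (energy u r <= energy (wv t) r)%E.
    apply: mu => //.
    - apply: W12_nice => //; first exact: wv_nice.
      by apply: (ae_imp _ (null_axis R)) => x /off_neq0 x0 _; exact: wv_sphere.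
    - by move=> a; apply: (ae_imp _ (null_axis R)) => x /off_neq0 x0 _; exact: wv_equiv.
    - exact: wv_ess.
  rewrite (energy_nice r0 u_nice).2 wv_energy lee_fin.
  have -> : \int[leb3]_(x in Ball3 r) rayl (density u x) (varP x) (grad2 m x) (m x ^+ 2) t =
     2^-1 * \int[leb3]_(x in Ball3 r) density u x + 2^-1 * t ^+ 2 * \int[leb3]_(x in Ball3 r) G t x.
    rewrite -!RintegralZl//; try exact: iG.
    rewrite -RintegralD//; try exact: intgZ.
    apply: eq_Rintegral => x _; rewrite /rayl /G expr1; ring.
  by rewrite lerDl pmulr_rge0// mulr_gt0 ?exprn_gt0// invr_gt0.
have cv : (fun n => \int[leb3]_(x in Ball3 r) G (harm R n) x) @ \oo --> \int[leb3]_(x in Ball3 r) (varP x + grad2 m x).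
  apply: (@Rint_dct _ T3 _ leb3 _ _ _ (fun x => `|varP x| + `|grad2 m x|)) => //.
  - by move=> n; exact: intg_meas (iG _).
  - by apply: measurable_funD; [exact: intg_meas varP_intg|exact: intg_meas grad2_intg].
  - apply: aeW => x _; rewrite /G.
    pose D n := 1 + harm R n * harm R n * m x ^+ 2.
    have cD : (fun n => (D n)^-1) @ \oo --> (1 : R).
      have hc := @harm_cvg R.
      have h2 : D @ \oo --> (1 + 0 * 0 * m x ^+ 2 : R).
        by apply: cvgD; [exact: cvg_cst|apply: cvgM; [exact: cvgM|exact: cvg_cst]].
      by rewrite !mul0r addr0 in h2; rewrite -[X in _ --> X]invr1; apply: cvgV => //; exact: oner_neq0.
    have : (fun n => varP x * (D n)^-1 + grad2 m x * ((D n)^-1 * (D n)^-1)) @ \oo --> (varP x * 1 + grad2 m x * (1 * 1) : R).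
      by apply: cvgD; apply: cvgM; [exact: cvg_cst|exact: cD|exact: cvg_cst|exact: cvgM].
    rewrite (mulr1 (1 : R)) (mulr1 (varP x)) (mulr1 (grad2 m x)); rewrite [X in X @ _](_ : _ = (fun n => G (harm R n) x))//.
    by apply/funext => n; rewrite /G /D expr1 -expr2 -expr2 -exprVn.
  - by apply: intgD => //; apply: intg_abs => //; [exact: varP_intg|exact: grad2_intg].
  - apply: aeW => x n _; apply: le_trans (ler_normD _ _) _; apply: lerD; rewrite normrM ler_piMr//; exact: invden_le1.
exact: (cvgr_to_ge cv (nearW _ pos)).
Qed.

End Variation.

Section OpenNull.
Variable R : realType.
Local Notation mR := (measurableTypeR R).
Local Notation leb3 := (leb3 R).

Definition box3 (x : R3 R) (e : R) : set (R3 R) :=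
  ((`]x.1.1 - e, x.1.1 + e[%classic : set R) `*` (`]x.1.2 - e, x.1.2 + e[%classic : set R)) `*` (`]x.2 - e, x.2 + e[%classic : set R).

Lemma box_pos (x : R3 R) (e : R) : 0 < e -> (0 < leb3 (box3 x e))%E.
Proof.
move=> e0; pose I (a : R) : set mR := `]a - e, a + e[%classic.
have mI a : measurable (I a) by exact: measurable_itv.
have pI a : (0 < @lebesgue_measure R (I a))%E.
  by rewrite lebesgue_measure_itv/= lte_fin ifT -?EFinD ?lte_fin; lra.
rewrite (_ : leb3 _ = (prodS (@lebesgue_measure R) (@lebesgue_measure R) : set _ -> \bar R) (I x.1.1 `*` I x.1.2) * @lebesgue_measure R (I x.2))%E; last first.
  by apply: (@product_measure1E _ _ _ _ R (prodS (@lebesgue_measure R) (@lebesgue_measure R)) (@lebesgue_measure R)) => //; exact: measurableX.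
rewrite (_ : (prodS _ _ : set _ -> \bar R) _ = @lebesgue_measure R (I x.1.1) * @lebesgue_measure R (I x.1.2))%E; last exact: product_measure1E.
by rewrite !mule_gt0.
Qed.

Lemma meas_box x e : measurable (box3 x e : set (mR * mR * mR)%type).
Proof. by apply: measurableX; [apply: measurableX|]; exact: measurable_itv. Qed.

Lemma open_null_empty (U : set (R3 R)) : open U -> {ae leb3, forall x, ~ U x} -> U = set0.
Proof.
move=> oU [N [mN N0 UN]]; apply/seteqP; split=> // x Ux.
have /nbhs_ballP[e /= e0 He] : nbhs x U by exact: open_nbhs_nbhs.
have sub : box3 x e `<=` N.
  move=> y [[/= h1 h2] h3]; apply: UN => /=; apply; apply: He.
  by rewrite !in_itv/= in h1 h2 h3; split; [split|]; rewrite /ball/= ltr_norml; apply/andP; split; lra.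
have := box_pos x e0; rewrite lt0e => /andP[/negP]; case.
by rewrite -measure_le0 -N0; apply: le_measure; rewrite ?inE//; exact: meas_box.
Qed.
End OpenNull.

(** * The radial cutoff *)

Section NegativeDirection.
Variable R : realType.
Implicit Types (t v : R).

(** With [v = ln |x| ^ 2], [bumpA v] is a radial cutoff supported in [|v| <= 40], 1600 being the
    square of 40. Its Laplacian is [(4 * bumpA2 v + 2 * bumpA1 v) / |x| ^ 2]. This width makes the
    variation slow enough for the Laplacian to be at least [- 2 * bumpA v / |x| ^ 2], which spends 2
    of the available 3. *)
Definition bumpw v : R := 1 - v ^+ 2 / 1600.
Definition bumpA v : R := @E_ R 0 (bumpw v).
Definition bumpA1 v : R := @E_ R 1 (bumpw v) * (- (v / 800)).
Definition bumpA2 v : R := @E_ R 2 (bumpw v) * (v / 800) ^+ 2 - @E_ R 1 (bumpw v) / 800.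

Lemma bumpw_derive v : is_derive v 1 bumpw (- (v / 800)).
Proof.
have D := is_derive_add (@is_derive_cst _ _ _ (1 : R) v 1) (is_derive_mul (is_derive_mul (@is_derive_id _ _ v 1) (@is_derive_id _ _ v 1)) (@is_derive_cst _ _ _ (- 1600^-1 : R) v 1)).
rewrite (_ : bumpw = (fun y => cst 1 y + y * y * cst (- 1600^-1) y)); last by apply/funext => y; rewrite /bumpw /cst; field.
by move: D; congr is_derive; rewrite /cst; field.
Qed.

Lemma bumpA_derive v : is_derive v 1 bumpA (bumpA1 v).
Proof. exact: is_derive_comp1 (bumpw_derive v) (E_derive 0 _). Qed.

Lemma bumpA1_derive v : is_derive v 1 bumpA1 (bumpA2 v).
Proof.
have d := is_derive_comp1 (bumpw_derive v) (E_derive 1 (bumpw v)).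
have := is_derive_mul d (is_derive_mul (@is_derive_id _ _ v 1) (@is_derive_cst _ _ _ (- 800^-1 : R) v 1)).
rewrite (_ : bumpA1 = (fun y => (@E_ R 1 \o bumpw) y * (y * cst (- 800^-1) y))); last by apply/funext => y; rewrite /bumpA1 /cst /=; congr (_ * _); rewrite mulrN.
by congr is_derive; rewrite /bumpA2 /cst /=; move: (E_ 1 (bumpw v)) (E_ 2 (bumpw v)) => a b; field.
Qed.

(* With [p = v / 40] and [w = 1 - p ^ 2 > 0], [w ^ 4 expR w^-1] times this is
   [(1 - w) (1 - 2 w) / 100 - w ^ 2 / 200 - p w ^ 2 / 10 + 2 w ^ 4]. *)
Lemma E2_pos (y : R) : 0 < y -> @E_ R 2 y = ((y^-1) ^+ 4 - 2 * (y^-1) ^+ 3) * expR (- y^-1).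
Proof.
move=> y0; rewrite /E_ /flat y0; congr (_ * _).
rewrite /= derivC subr0 mulr1 derivXn -mulr_natl !hornerE /=; ring.
Qed.

Lemma bump_super v : 0 <= 4 * bumpA2 v + 2 * bumpA1 v + 2 * bumpA v.
Proof.
rewrite /bumpA2 /bumpA1 /bumpA; have [w0|w0] := ltP 0 (bumpw v); last first.
  have n0 n : @E_ R n (bumpw v) = 0 by rewrite /E_ /flat ltNge w0.
  by rewrite !n0 !(mul0r, mulr0, subr0, addr0).
have q2 := E2_pos w0; have q1 : @E_ R 1 (bumpw v) = _ := E1_pos w0; have q0 : @E_ R 0 (bumpw v) = _ := E0_pos w0.
rewrite q2 q1 q0; clear q2 q1 q0.
set w := bumpw v in w0 *; set e := expR _; have e0 : 0 < e by exact: expR_gt0.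
pose p := v / 40; have pE : v = 40 * p by rewrite /p; field.
have wE : w = 1 - p ^+ 2 by rewrite /w /bumpw pE; field.
have p1 : p < 1 by nra.
have wn : w != 0 by rewrite gt_eqF.
pose G := (1 - w) * (1 - 2 * w) / 100 - w ^+ 2 / 200 - p * w ^+ 2 / 10 + 2 * w ^+ 4.
rewrite [leRHS](_ : _ = e * w^-1 ^+ 4 * G).
  have i0 : 0 <= w^-1 by rewrite invr_ge0 ltW.
  apply: mulr_ge0; first by apply: mulr_ge0; [exact: ltW|exact: exprn_ge0].
  have h : p * w ^+ 2 <= w ^+ 2 by rewrite ler_piMl ?sqr_ge0// ltW.
  (* The quartic term is bounded below by its tangent in the variable [w ^+ 2] at [w = 1 / 5]; what
     remains is [3 / 40 * (w - 1 / 5) ^+ 2] plus a positive constant. *)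
  have h1 : 0 <= 2 * (w ^+ 2 - 1 / 25) ^+ 2 by rewrite mulr_ge0 ?sqr_ge0.
  have h2 := sqr_ge0 (w - 1 / 5); rewrite /G; nra.
rewrite /G (_ : (1 - w) * (1 - 2 * w) = p ^+ 2 * (1 - 2 * w)); last by rewrite wE; ring.
rewrite pE -exprVn.
have wi : w^-1 * w = 1 by rewrite mulVf.
move: (w^-1) wi => i wi.
transitivity (e * (i ^+ 4 * (p ^+ 2 * (1 - 2 * w) / 100) * 1 - i ^+ 4 * w ^+ 2 / 200 - p * (i ^+ 4 * w ^+ 2) / 10 + 2 * (i ^+ 4 * w ^+ 4))); last by ring.
rewrite (_ : i ^+ 4 * w ^+ 4 = 1); last by rewrite -exprMn wi expr1n.
rewrite (_ : i ^+ 4 * w ^+ 2 = i ^+ 2); last first.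
  by transitivity (i ^+ 2 * (i * w) ^+ 2); [ring|rewrite wi expr1n mulr1].
rewrite (_ : i ^+ 4 * (p ^+ 2 * (1 - 2 * w) / 100) = (i ^+ 4 - 2 * i ^+ 3 * (i * w)) * p ^+ 2 / 100); last by ring.
by rewrite wi mulr1; field.
Qed.

End NegativeDirection.
Ltac sqpos := repeat first [exact: sqr_ge0 | done | apply: mulr_ge0 | apply: addr_ge0].

(** * Sign of the second variation *)

Section SecondVariationSign.
Variable R : realType.
Local Notation mR := (measurableTypeR R).
Local Notation leb3 := (leb3 R).
Local Notation T3 := (mR * mR * mR)%type.
Implicit Types (x : R3 R) (i : 'I_5) (j : 'I_3) (t : R).
Variables (u : R3 R -> RCC R) (f f1 : 'I_5 -> R -> R) (k : 'I_5).
Hypotheses (P : profile u f f1) (uV : forall x, offaxis x -> density u x = isq x ^+ 2 * Vpot f f1 (T x))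
  (wk : wt R k = 2).

Local Notation oO := (@open_offaxis R).

Definition acut x : R := bumpA (ln (nsq x)).
Definition gcut x : R := bumpA1 (ln (nsq x)) * (nsq x)^-1.
Definition tcut x : R := f k (T x).
Definition vcut n x : R := axcut n x * (acut x * tcut x).
(** The field [e ^ 2 * h * grad h] for [e = axcut n] and [h = acut * tcut]. The square
    [|grad (e h)| ^ 2] is [h ^ 2 * |grad e| ^ 2 - e ^ 2 * h * Delta h] plus the divergence of this
    field, which integrates to 0. *)
Definition Hcut n j x : R := axcut n x * (axcut n x * (acut x ^+ 2 * (tcut x * (f1 k (T x) * Td j x)) + tcut x ^+ 2 * acut x * gcut x * (2 * xc j x))).

Lemma ln_nsq_derive x j : offaxis x -> is_derive x (basis3 R j) (fun x => ln (nsq x)) ((nsq x)^-1 * (2 * xc j x)).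
Proof. by move=> /off_neq0 x0; exact: is_derive_comp1 (is_derive_nsq x j) (is_derive1_ln (nsq_gt0 x0)). Qed.

Lemma smooth_xc j U : open U -> smooth_on U (@xc R j).
Proof.
move=> oU; have [s1 s2 s3] := smooth_coord oU.
case: j => [[|[|[|n]]] hj]; last exact: (False_ind _ (notF hj)).
- exact: s1.
- exact: s2.
- exact: s3.
Qed.

Lemma smooth_invnsq : smooth_on (@offaxis R) (fun x => (nsq x)^-1).
Proof. by apply: (smooth_inv oO (smooth_nsq oO)) => x /off_neq0 /nsq_gt0 h; rewrite gt_eqF. Qed.

Lemma smooth_ln_nsq : smooth_on (@offaxis R) (fun x => ln (nsq x)).
Proof.
apply: (smooth_of_partials oO (G := fun j x => (nsq x)^-1 * (2 * xc j x))).
- by move=> x j ox; exact: ln_nsq_derive.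
- move=> x /off_neq0 x0; apply: (@continuous_comp _ _ _ (@nsq R) (@ln R)); first exact: nsq_cont.
  by apply: continuous_ln; exact: nsq_gt0.
- by move=> j; exact: smoothM oO smooth_invnsq (smoothM oO (smooth_cst 2 oO) (smooth_xc j oO)).
Qed.

Lemma smooth_bumpw : smooth_on (@offaxis R) (fun x => bumpw (ln (nsq x))).
Proof. exact: (smoothB oO (smooth_cst 1 oO) (smoothM oO (smoothX 2 oO smooth_ln_nsq) (smooth_cst _ oO))). Qed.

Lemma smooth_acut : smooth_on (@offaxis R) acut.
Proof. exact: (smooth_E0 oO smooth_bumpw). Qed.

Lemma smooth_gcut : smooth_on (@offaxis R) gcut.
Proof.
exact: (smoothM oO (smoothM oO (smooth_E1 oO smooth_bumpw) (smoothN oO (smoothM oO smooth_ln_nsq (smooth_cst _ oO)))) smooth_invnsq).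
Qed.

Lemma smooth_tcut : smooth_on (@offaxis R) tcut. Proof. exact: (smooth_f_T P k). Qed.

Lemma smooth_tcut1 : smooth_on (@offaxis R) (fun x => f1 k (T x)).
Proof. by apply/smooth_onP => n; have [_] := f_T_Ck P n k. Qed.

Lemma acut_derive x j : offaxis x -> is_derive x (basis3 R j) acut (gcut x * (2 * xc j x)).
Proof. by move=> ox; have := is_derive_comp1 (ln_nsq_derive j ox) (bumpA_derive _); congr is_derive; rewrite /gcut -mulrA. Qed.

Lemma gcut_derive x j : offaxis x ->
  is_derive x (basis3 R j) gcut ((bumpA2 (ln (nsq x)) - bumpA1 (ln (nsq x))) * (nsq x)^-1 ^+ 2 * (2 * xc j x)).
Proof.
move=> ox; have n0 : nsq x != 0 by rewrite gt_eqF// nsq_gt0// off_neq0.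
have := is_derive_mul (is_derive_comp1 (ln_nsq_derive j ox) (bumpA1_derive _))
  (is_derive_comp1 (is_derive_nsq x j) (@is_deriveV R id (nsq x) 1 1 n0 (is_derive_id _ _))).
by congr is_derive; rewrite /= scalE mulr1 -exprVn; ring.
Qed.

Lemma axcut_neq0 n x : axcut n x != 0 -> (n%:R ^+ 2)^-1 <= rho2 x.
Proof.
move=> h; rewrite leNgt; apply/negP => hx; move/negP: h; apply; apply/eqP.
have [n0|n0] := eqVneq (n%:R ^+ 2 : R) 0; first by rewrite /axcut n0 mul0r step0// sub0r oppr_le0.
have n1 : 0 < n%:R ^+ 2 :> R by rewrite lt_def n0 sqr_ge0.
by rewrite /axcut step0// subr_le0 mulrC -ler_pdivlMr// div1r ltW.
Qed.

Lemma acut_neq0 x : x != 0 -> acut x != 0 -> nsq x <= expR 40.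
Proof.
move=> x0 h; have n0 := nsq_gt0 x0; rewrite -(lnK n0) ler_expR.
have : 0 < bumpw (ln (nsq x)).
  by rewrite ltNge; apply/negP => w0; move: h; rewrite /acut /bumpA -/(@E0 R) (E0_neg w0) eqxx.
by rewrite /bumpw; set v := ln _; nra.
Qed.

Lemma vcut_neq0 n x : (0 < n)%N -> axcut n x != 0 -> acut x != 0 -> (n%:R ^+ 2)^-1 <= rho2 x /\ nsq x <= expR 40.
Proof.
move=> n0 e0 a0; have h := axcut_neq0 e0; split=> //; apply: acut_neq0 => //.
by apply: off_neq0; rewrite /offaxis/= gt_eqF// (lt_le_trans _ h)// invr_gt0 exprn_gt0// ltr0n n0.
Qed.

Lemma smooth_vcut n : (0 < n)%N -> smooth_on setT (vcut n).
Proof. by move=> n0; apply: axcut_smooth => //; exact: smoothM oO smooth_acut smooth_tcut. Qed.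

Lemma smooth_Hcut n j : (0 < n)%N -> smooth_on setT (Hcut n j).
Proof.
move=> n0; apply: axcut_smooth => //; apply: smoothM oO (smooth_sub (@subsetT _ _) (@smooth_axcut R n)) _.
apply: smoothD oO (smoothM oO (smoothX 2 oO smooth_acut) (smoothM oO smooth_tcut (smoothM oO smooth_tcut1 (@smooth_Td R j)))) _.
exact: smoothM oO (smoothM oO (smoothM oO (smoothX 2 oO smooth_tcut) smooth_acut) smooth_gcut) (smoothM oO (smooth_cst 2 oO) (smooth_xc j oO)).
Qed.

(** The cutoffs are supported in [nsq x <= expR 40], while the ball of this radius is given by
    [nsq x < expR 80]. *)
Definition rcut : R := expR 40.

Lemma rcut_gt0 : 0 < rcut. Proof. exact: expR_gt0. Qed.
Lemma rcut_sqr : expR 40 < rcut ^+ 2. Proof. by rewrite /rcut -expRM_natl ltr_expR; lra. Qed.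

Lemma Hcut_int n j : (0 < n)%N -> \int[leb3]_(x in Ball3 rcut) partial j (Hcut n j) x = 0.
Proof.
move=> n0; apply: test_int0 => //; first exact: rcut_gt0.
apply: (mk_test (C := [set x | nsq x <= expR 40]) (M := expR 40)) => //.
- exact: smooth_Hcut.
- exact: closed_nsq_le.
- by move=> x /= h; apply/(Ball3E x rcut_gt0); exact: le_lt_trans h rcut_sqr.
move=> x h; have [] // := @vcut_neq0 n x n0.
  by apply: contraNneq h => h; rewrite /Hcut h mul0r.
by apply: contraNneq h => h; rewrite /Hcut h expr0n /= !(mul0r, mulr0, addr0).
Qed.

Lemma T_rot a x : T (rot3 a x) = T x :> R.
Proof. by rewrite /T /expT isq_rot (_ : norm3 (rot3 a x) = norm3 x)// /norm3 -!/(nsq _) nsq_rot. Qed.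

Lemma vcut_rot n a x : vcut n (rot3 a x) = vcut n x.
Proof. by rewrite /vcut /axcut /acut /tcut rho2_rot nsq_rot T_rot. Qed.

Definition hcut j x : R := x.1.1 * (val j == 0%N)%:R + x.1.2 * (val j == 1%N)%:R.

Lemma vcut_partial n j x : offaxis x -> partial j (vcut n) x =
  axcut n x * (acut x * (f1 k (T x) * Td j x) + tcut x * (gcut x * (2 * xc j x))) + acut x * tcut x * (axcut' n x * hcut j x).
Proof.
move=> ox; have [_] := is_derive_mul (is_derive_axcut n x j) (is_derive_mul (acut_derive j ox) (f_T_derive P k j ox)).
by rewrite /partial => ->.
Qed.

Lemma vcut_angular n x : offaxis x -> \sum_j partial j (vcut n) x * ph j x = 0.
Proof.
move=> ox; have [_ _ tp] := coord_identities ox.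
have Xp : \sum_j xc j x * ph j x = 0 by rewrite sum3E /xc /ph /=; ring.
have hp : \sum_j hcut j x * ph j x = 0 by rewrite sum3E /hcut /ph /=; ring.
transitivity (axcut n x * acut x * f1 k (T x) * (\sum_j Td j x * ph j x) + 2 * axcut n x * tcut x * gcut x * (\sum_j xc j x * ph j x)
  + acut x * tcut x * axcut' n x * (\sum_j hcut j x * ph j x)).
  rewrite !mulr_sumr -!big_split; apply: eq_bigr => j _; rewrite vcut_partial//=; ring.
by rewrite tp Xp hp !mulr0 !addr0.
Qed.

Lemma Hcut_partial n j x tdd : offaxis x -> is_derive x (basis3 R j) (Td j) tdd -> let e := axcut n x in let a := acut x in
  let g := gcut x in let X := xc j x in let y := tcut x in let y1 := f1 k (T x) in let td := Td j x in
  partial j (Hcut n j) x = 2 * e * (axcut' n x * hcut j x) * (a ^+ 2 * (y * (y1 * td)) + y ^+ 2 * a * g * (2 * X))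
   + e ^+ 2 * (4 * a * g * X * (y * (y1 * td)) + a ^+ 2 * ((y1 * td) ^+ 2 + y * (y1 * tdd + (4 - Vpot f f1 (T x)) * y * td ^+ 2))
     + 4 * y * y1 * td * a * g * X + 4 * y ^+ 2 * X ^+ 2 * (g ^+ 2 + a * ((bumpA2 (ln (nsq x)) - bumpA1 (ln (nsq x))) * (nsq x)^-1 ^+ 2))
     + 2 * y ^+ 2 * a * g).
Proof.
move=> ox dtd e a g X y y1 td.
have de := is_derive_axcut n x j; have da := acut_derive j ox; have dg := gcut_derive j ox.
have dy := f_T_derive P k j ox; have dy1 := f1_T_derive P k j ox; rewrite wk in dy1.
have dX : is_derive x (basis3 R j) (xc j) 1 by have := is_derive_xc x j j; rewrite eqxx.
have [_] := is_derive_mul de (is_derive_mul de (is_derive_add (is_derive_mul (is_derive_mul da da) (is_derive_mul dy (is_derive_mul dy1 dtd)))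
  (is_derive_mul (is_derive_mul (is_derive_mul (is_derive_mul dy dy) da) dg) (is_derive_mul (@is_derive_cst _ _ _ (2 : R) x (basis3 R j)) dX)))).
rewrite /partial (_ : (fun _ => _) = Hcut n j).
  move=> ->; rewrite -/(hcut j x) -/e -/a -/g -/X -/(tcut x) -/y -/y1 -/td /cst.
  move: (bumpA2 _ - _) (Vpot _ _ _) (hcut j x) => b v h; ring.
by apply/funext => z; rewrite /Hcut /cst /tcut !expr2.
Qed.

Lemma cut_sum (td X h tdd : 'I_3 -> R) (e e' a g y y1 V b N S q r2 : R) :
  \sum_j td j ^+ 2 = q -> \sum_j td j * X j = 0 -> \sum_j X j ^+ 2 = S -> \sum_j h j ^+ 2 = r2 -> \sum_j tdd j = 0 ->
  \sum_j (e * (a * (y1 * td j) + y * (g * (2 * X j))) + a * y * (e' * h j)) ^+ 2 -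
  \sum_j (2 * e * (e' * h j) * (a ^+ 2 * (y * (y1 * td j)) + y ^+ 2 * a * g * (2 * X j))
   + e ^+ 2 * (4 * a * g * X j * (y * (y1 * td j)) + a ^+ 2 * ((y1 * td j) ^+ 2 + y * (y1 * tdd j + (4 - V) * y * td j ^+ 2))
     + 4 * y * y1 * td j * a * g * X j + 4 * y ^+ 2 * X j ^+ 2 * (g ^+ 2 + a * (b * N ^+ 2)) + 2 * y ^+ 2 * a * g)) =
  a ^+ 2 * y ^+ 2 * e' ^+ 2 * r2 - e ^+ 2 * a ^+ 2 * y ^+ 2 * (4 - V) * q - 4 * e ^+ 2 * y ^+ 2 * a * b * N ^+ 2 * S - 6 * e ^+ 2 * y ^+ 2 * a * g.
Proof.
move=> hq h0 hS hr hd.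
transitivity (a ^+ 2 * y ^+ 2 * e' ^+ 2 * (\sum_j h j ^+ 2) - e ^+ 2 * a ^+ 2 * y ^+ 2 * (4 - V) * (\sum_j td j ^+ 2)
  - 4 * e ^+ 2 * y ^+ 2 * a * b * N ^+ 2 * (\sum_j X j ^+ 2) - 6 * e ^+ 2 * y ^+ 2 * a * g - 4 * e ^+ 2 * a * y * y1 * g * (\sum_j td j * X j)
  - e ^+ 2 * a ^+ 2 * y * y1 * \sum_j tdd j); first by rewrite !sum3E; ring.
by rewrite hq h0 hS hr hd !mulr0 !subr0.
Qed.

Lemma Td_xc x : offaxis x -> \sum_j Td j x * xc j x = 0.
Proof.
move=> ox; rewrite sum3E /Td /xc /=; have q2 := isq_sqr ox.
transitivity (inorm x * x.2 * (1 - isq x ^+ 2 * rho2 x)); first by rewrite /rho2; ring.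
by rewrite q2 subrr mulr0.
Qed.

(** The Laplacian of [tcut] is [(4 - V) * tcut / rho ^ 2], and its gradient is orthogonal to the
    radial one of [acut]. Since [varP] contributes [1 - V], the unknown potential cancels and the
    factor [- 3] is left. *)
Lemma cut_identity n x : offaxis x ->
  varP u (vcut n) x + grad2 (vcut n) x - \sum_j partial j (Hcut n j) x =
  acut x ^+ 2 * tcut x ^+ 2 * axcut' n x ^+ 2 * rho2 x - 3 * (axcut n x ^+ 2 * acut x ^+ 2 * tcut x ^+ 2 * isq x ^+ 2)
  - axcut n x ^+ 2 * tcut x ^+ 2 * acut x * (4 * bumpA2 (ln (nsq x)) + 2 * bumpA1 (ln (nsq x))) / nsq x.
Proof.
move=> ox; have [Tdd [dT sT]] := Td_divergence ox.
have [t2 _ _] := coord_identities ox; have tx := Td_xc ox.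
have n0 : nsq x != 0 by rewrite gt_eqF// nsq_gt0// off_neq0.
have X2 : \sum_j xc j x ^+ 2 = nsq x by rewrite sum3E.
have h2 : \sum_j hcut j x ^+ 2 = rho2 x by rewrite sum3E /hcut /rho2 /=; ring.
have K := cut_sum (axcut n x) (axcut' n x) (acut x) (gcut x) (tcut x) (f1 k (T x)) (Vpot f f1 (T x))
  (bumpA2 (ln (nsq x)) - bumpA1 (ln (nsq x))) ((nsq x)^-1) t2 tx X2 h2 sT.
have E1 : grad2 (vcut n) x = \sum_j (axcut n x * (acut x * (f1 k (T x) * Td j x) + tcut x * (gcut x * (2 * xc j x)))
    + acut x * tcut x * (axcut' n x * hcut j x)) ^+ 2 by apply: eq_bigr => j _; rewrite vcut_partial.
have E2 := eq_bigr (op := +%R) (idx := 0) _ (fun j (_ : true) => Hcut_partial n ox (dT j)).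
rewrite -E1 in K; have E := etrans (congr1 (fun b => grad2 (vcut n) x - b) (E2 (index_enum 'I_3))) K.
rewrite -addrA E /varP uV//; clear E E1 E2 K.
rewrite /vcut /gcut; move: (axcut n x) (axcut' n x) (acut x) (tcut x) (bumpA1 _) (bumpA2 _) (Vpot _ _ _) (isq x) => e e' a y A1 A2 V q.
by field.
Qed.

Definition gint x : R := acut x ^+ 2 * tcut x ^+ 2 * isq x ^+ 2.
Definition Kint n x : R := acut x ^+ 2 * tcut x ^+ 2 * grad2 (axcut n) x - axcut n x ^+ 2 * gint x.

Lemma nsq_isq x : offaxis x -> (nsq x)^-1 <= isq x ^+ 2.
Proof. by move=> ox; rewrite isq_sqrE// lef_pV2 ?posrE ?rho2_gt0 ?nsq_gt0 ?off_neq0// rho2_le_nsq. Qed.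

Lemma grad2_axcut n x : grad2 (axcut n) x = axcut' n x ^+ 2 * rho2 x.
Proof.
transitivity (\sum_j axcut' n x ^+ 2 * hcut j x ^+ 2).
  apply: eq_bigr => j _; rewrite -exprMn; congr (_ ^+ 2).
  by have [_] := is_derive_axcut n x j.
by rewrite -mulr_sumr; congr (_ * _); rewrite sum3E /hcut /rho2 /=; ring.
Qed.

(** The Laplacian of the radial cutoff costs at most [2 / |x| ^ 2], hence at most [2 / rho ^ 2], out
    of [3 / rho ^ 2]; the remainder is the negative term of [Kint]. *)
Lemma cut_le n x : offaxis x ->
  varP u (vcut n) x + grad2 (vcut n) x - \sum_j partial j (Hcut n j) x <= Kint n x.
Proof.
move=> ox; rewrite cut_identity// /Kint grad2_axcut /gint.
have h := bump_super (ln (nsq x)); have i0 : 0 <= (nsq x)^-1 by rewrite invr_ge0 nsq_ge0.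
have le := nsq_isq ox.
have a0 : 0 <= acut x by exact: E0_ge0.
have p0 : 0 <= axcut n x ^+ 2 * tcut x ^+ 2 * acut x * (nsq x)^-1 by sqpos.
have := mulr_ge0 p0 h; rewrite -/(acut x).
have p1 : 0 <= axcut n x ^+ 2 * tcut x ^+ 2 * acut x ^+ 2 by sqpos.
have := ler_wpM2l p1 le.
set A1 := bumpA1 _; set A2 := bumpA2 _; move: (axcut n x) (axcut' n x) (tcut x) (acut x) (isq x) (nsq x)^-1 (rho2 x) => e e' y a q N r2 z1 z2.
rewrite -subr_ge0 (_ : _ - _ = 2 * (e ^+ 2 * y ^+ 2 * a ^+ 2 * q ^+ 2 - e ^+ 2 * y ^+ 2 * a ^+ 2 * N) + e ^+ 2 * y ^+ 2 * a * N * (4 * A2 + 2 * A1 + 2 * a)); last by ring.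
by apply: addr_ge0 => //; rewrite mulr_ge0// subr_ge0.
Qed.

(** A component of nonzero weight is part of the potential and inherits its decay [1 / ch ^ 2]. It
    thus vanishes at the axis fast enough to absorb the factor [1 / rho ^ 2] from the gradient of
    the axis cutoff. *)
Lemma tcut_le : exists2 C, 0 <= C & forall x, offaxis x -> tcut x ^+ 2 * isq x ^+ 2 <= C / nsq x.
Proof.
have [C [C0 VC]] := prof_decay P.
exists C => // x ox; have x0 := off_neq0 ox.
have : tcut x ^+ 2 <= C / ch (T x) ^+ 2.
  apply: le_trans (VC _); rewrite /Vpot addrC (bigD1 k)//= wk -addrA ler_wpDr//.
    by apply: addr_ge0; apply: sumr_ge0 => i _; [apply: mulr_ge0|]; exact: sqr_ge0.
  by rewrite ler_peMl ?sqr_ge0//; lra.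
move=> /(ler_wpM2r (sqr_ge0 (isq x))) /le_trans; apply.
rewrite ch_T// exprMn nsqE invfM; have := isq_gt0 ox; move: (isq x) => q q0.
by rewrite le_eqVlt; apply/orP; left; apply/eqP; move: (nsq x)^-1 (gt_eqF q0) => z /negbT k1; field.
Qed.

Lemma gint_ge0 x : 0 <= gint x. Proof. by rewrite /gint; sqpos. Qed.

Lemma acut_le1 x : 0 <= acut x <= 1. Proof. by rewrite /acut /bumpA E0_ge0 E0_le1. Qed.

Lemma acut2_le1 x : acut x ^+ 2 <= 1.
Proof. by have /andP[a0 a1] := acut_le1 x; rewrite expr_le1. Qed.

Lemma gint_bound : exists2 C, 0 <= C & forall x, offaxis x -> gint x <= C / nsq x.
Proof.
have [C C0 h] := tcut_le; exists C => // x ox; apply: le_trans (h x ox).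
by rewrite /gint -mulrA; apply: ler_piMl (acut2_le1 x); sqpos.
Qed.

Lemma smooth_gint : smooth_on (@offaxis R) gint.
Proof. exact: smoothM oO (smoothM oO (smoothX 2 oO smooth_acut) (smoothX 2 oO smooth_tcut)) (smoothX 2 oO (@smooth_isq_off R)). Qed.

Lemma smooth_Kint n : smooth_on (@offaxis R) (Kint n).
Proof.
apply: smoothB oO (smoothM oO (smoothM oO (smoothX 2 oO smooth_acut) (smoothX 2 oO smooth_tcut)) _) (smoothM oO (smoothX 2 oO (smooth_sub (@subsetT _ _) (@smooth_axcut R n))) smooth_gint).
apply: (smooth_sub (@subsetT _ _)).
have s j := smoothX 2 openT (smooth_partial j (@smooth_axcut R n)).
by apply: (smooth_ext openT _ (smoothD openT (smoothD openT (s ord0_3) (s ord1_3)) (s ord2))) => x _; rewrite /grad2 sum3E.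
Qed.

Lemma isq_axis x : ~ offaxis x -> isq x = 0 /\ rho2 x = 0.
Proof. by move=> /negP/negPn/eqP h; rewrite /isq h sqrtr0 invr0. Qed.

Lemma meas_gint : measurable_fun setT (gint : T3 -> R).
Proof.
apply: meas_off; first by move=> x ox; exact: smooth_cont smooth_gint ox.
by move=> x /isq_axis[h _]; rewrite /gint h expr0n mulr0.
Qed.

Lemma meas_Kint n : measurable_fun setT (Kint n : T3 -> R).
Proof.
apply: meas_off; first by move=> x ox; exact: smooth_cont (smooth_Kint n) ox.
by move=> x /isq_axis[h1 h2]; rewrite /Kint grad2_axcut /gint h1 h2 expr0n /= !mulr0 subrr.
Qed.

Lemma Kint_bound : exists2 C, 0 <= C & forall n x, offaxis x -> `|Kint n x| <= C / nsq x.
Proof.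
have [C C0 h] := tcut_le; have [C' C'0 h'] := gint_bound; have [D [D0 hD]] := @axcut'_bound R.
exists (C * D ^+ 2 + C'); first by rewrite addr_ge0 ?mulr_ge0 ?sqr_ge0.
move=> n x ox; apply: le_trans (ler_normB _ _) _; rewrite mulrDl; apply: lerD.
  have r0 := ltW (rho2_gt0 ox); rewrite grad2_axcut ger0_norm; last by sqpos.
  rewrite (_ : _ * _ = acut x ^+ 2 * ((tcut x ^+ 2 * isq x ^+ 2) * (rho2 x * axcut' n x) ^+ 2)).
    apply: (@le_trans _ _ ((tcut x ^+ 2 * isq x ^+ 2) * (rho2 x * axcut' n x) ^+ 2)).
      by apply: ler_piMl (acut2_le1 x); sqpos.
    rewrite [leRHS]mulrAC; apply: ler_pM (h x ox) _; [by sqpos|exact: sqr_ge0|].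
    by rewrite -(real_normK (num_real (rho2 x * _))); apply: lerXn2r; rewrite ?nnegrE// hD.
  have := isq_sqr ox; move: (isq x) (rho2 x) (acut x) (tcut x) (axcut' n x) => q r a y e H.
  by transitivity (a ^+ 2 * y ^+ 2 * e ^+ 2 * r * (q ^+ 2 * r)); [rewrite H; ring|ring].
have g0 := gint_ge0 x; rewrite ger0_norm; last by sqpos.
apply: le_trans (h' x ox).
by rewrite ler_piMl ?gint_ge0// expr_le1 ?axcut_ge0 ?axcut_le1.
Qed.

Lemma Kint_intg n : intg leb3 (Ball3 rcut) (Kint n).
Proof.
have [C C0 h] := Kint_bound.
have mB := @meas_Ball3 R rcut.
have i1 : intg leb3 (Ball3 rcut) (fun x => C / nsq x) by apply: intgZ => //; exact: inv_nsq_intg.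
apply: (@intg_le _ T3 _ leb3 (Ball3 rcut) _ (fun x => C / nsq x)) => //.
  by apply: measurable_funTS; exact: meas_Kint.
move=> x _; have [ox|/isq_axis[h1 h2]] := pselect (offaxis x); first exact: h.
by rewrite /Kint grad2_axcut /gint h1 h2 expr0n /= !mulr0 subrr normr0 divr_ge0 ?nsq_ge0.
Qed.

Lemma gint_intg : intg leb3 (Ball3 rcut) gint.
Proof.
have [C C0 h] := gint_bound.
have mB := @meas_Ball3 R rcut.
have i1 : intg leb3 (Ball3 rcut) (fun x => C / nsq x) by apply: intgZ => //; exact: inv_nsq_intg.
apply: (@intg_le _ T3 _ leb3 (Ball3 rcut) _ (fun x => C / nsq x)) => //.
  by apply: measurable_funTS; exact: meas_gint.
move=> x _; have [ox|/isq_axis[h1 h2]] := pselect (offaxis x); first by rewrite ger0_norm ?gint_ge0// h.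
by rewrite /gint h1 expr0n mulr0 normr0 divr_ge0 ?nsq_ge0.
Qed.

Lemma Kint_cvg x : offaxis x -> Kint ^~ x @ \oo --> - gint x.
Proof.
move=> ox; have c1 := axcut_cvg ox.
have c2 : (fun n => - (axcut n x * axcut n x * gint x)) @ \oo --> - (1 * 1 * gint x).
  by apply: cvgN; apply: cvgM; [exact: cvgM|exact: cvg_cst].
rewrite !mul1r in c2; apply: cvg_trans c2; apply: near_eq_cvg; near=> n.
rewrite /Kint grad2_axcut (_ : axcut' n x = 0); last by near: n; exact: axcut'_cvg.
by rewrite expr0n mul0r mulr0 sub0r expr2.
Unshelve. all: by end_near. Qed.

Definition unit_point t : R3 R := ((ch t)^-1, 0, sh t / ch t).

Lemma unit_pointP t : [/\ nsq (unit_point t) = 1, offaxis (unit_point t) & T (unit_point t) = t].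
Proof.
have c0 := ch_gt0 t; have c1 : ch t != 0 by rewrite gt_eqF.
have n1 : nsq (unit_point t) = 1.
  rewrite /nsq /unit_point /= expr0n addr0 expr_div_n -exprVn.
  transitivity ((1 + sh t ^+ 2) / ch t ^+ 2); first by rewrite -exprVn; ring.
  by rewrite -ch2sh2 divff// expf_neq0.
have r1 : rho2 (unit_point t) = (ch t)^-1 ^+ 2 by rewrite /rho2 /= expr0n addr0.
split=> //; first by rewrite /offaxis/= r1 expf_neq0// invr_eq0.
rewrite /T (_ : expT _ = expR t) ?expRK//.
rewrite /expT /isq r1 sqrtr_sqr ger0_norm ?invr_ge0 ?ltW// invrK /norm3 -/(nsq _) n1 sqrtr1 /= mulrDl mul1r mulfVK//.
by rewrite /ch /sh; field.
Qed.

(** As the axis cutoff is removed, the upper bound [Kint] of the nonnegative second variation tends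
    to minus the integral of [gint], so [gint] vanishes. On the unit sphere [acut] is positive, and
    the points [unit_point t] reach every [t]. *)
Lemma second_variation_vanish :
  (forall n, (0 < n)%N -> intg leb3 (Ball3 rcut) (fun x => varP u (vcut n) x + grad2 (vcut n) x) /\
    0 <= \int[leb3]_(x in Ball3 rcut) (varP u (vcut n) x + grad2 (vcut n) x)) -> forall t, f k t = 0.
Proof.
move=> H; have mB := @meas_Ball3 R rcut.
have pos n : 0 <= \int[leb3]_(x in Ball3 rcut) Kint n.+1 x.
  have [iH H0] := H n.+1 isT; set F := (fun x => _) in iH H0.
  have ih j : intg leb3 (Ball3 rcut) (partial j (Hcut n.+1 j)) by apply: (smooth_intg rcut_gt0 (smooth_partial j (smooth_Hcut j _))).
  have iS : intg leb3 (Ball3 rcut) (fun x => \sum_j partial j (Hcut n.+1 j) x) by exact: intg_sum.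
  have iD : intg leb3 (Ball3 rcut) (fun x => F x - \sum_j partial j (Hcut n.+1 j) x) by exact: intgB.
  have iKD : intg leb3 (Ball3 rcut) (fun x => Kint n.+1 x - (F x - \sum_j partial j (Hcut n.+1 j) x)) by apply: intgB => //; exact: Kint_intg.
  apply: le_trans H0 _; rewrite -subr_ge0.
  have -> : \int[leb3]_(x in Ball3 rcut) F x = \int[leb3]_(x in Ball3 rcut) (F x - \sum_j partial j (Hcut n.+1 j) x).
    rewrite RintegralB// Rint_sum// big1 ?subr0// => j _; exact: Hcut_int.
  rewrite -RintegralB//; last exact: Kint_intg.
  rewrite (@Rint_ae_eq _ T3 _ leb3 (Ball3 rcut) _ (fun x => `|Kint n.+1 x - (F x - \sum_j partial j (Hcut n.+1 j) x)|))//.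
  - by apply: Rintegral_ge0 => x _.
  - exact: intg_meas iKD.
  - exact: intg_meas (intg_abs mB iKD).
  by apply: (ae_imp _ (null_axis R)) => x ox _; rewrite ger0_norm// subr_ge0; exact: cut_le.
have [C C0 bK] := Kint_bound.
have cv : (fun n => \int[leb3]_(x in Ball3 rcut) Kint n.+1 x) @ \oo --> \int[leb3]_(x in Ball3 rcut) (- gint x).
  apply: (@Rint_dct _ T3 _ leb3 _ _ _ (fun x => C / nsq x)) => //.
  - by move=> n; exact: intg_meas (Kint_intg _).
  - exact: intg_meas (intgN mB gint_intg).
  - apply: (ae_imp _ (null_axis R)) => x ox _; have := Kint_cvg ox.
    by rewrite -(cvg_shiftS (Kint ^~ x)).
  - by apply: intgZ => //; exact: inv_nsq_intg.
  - by apply: (ae_imp _ (null_axis R)) => x ox n _; exact: bK.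
have := cvgr_to_ge cv (nearW _ pos).
have -> : \int[leb3]_(x in Ball3 rcut) (- gint x) = - \int[leb3]_(x in Ball3 rcut) gint x.
  by rewrite -[RHS]mulN1r -RintegralZl//; [under [RHS]eq_Rintegral do rewrite mulN1r|exact: gint_intg].
rewrite oppr_ge0 => le0.
have z0 : \int[leb3]_(x in Ball3 rcut) gint x = 0.
  by apply/eqP; rewrite eq_le le0 Rintegral_ge0// => x _; exact: gint_ge0.
have ae0 := @Rint0_ae _ T3 _ leb3 _ _ mB gint_intg (fun x _ => gint_ge0 x) z0.
pose U := [set x : R3 R | [/\ Ball3 rcut x, offaxis x & gint x != 0]].
have oU : open U.
  rewrite openE => x [bx ox gx]; rewrite /interior.
  have n1 : nbhs x (Ball3 rcut) by apply: open_nbhs_nbhs; split=> //; exact: open_Ball3.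
  have n2 : nbhs x (@offaxis R) by apply: open_nbhs_nbhs; split=> //; exact: open_offaxis.
  have n3 : nbhs x [set y | gint y != 0].
    have nn : nbhs (gint x) [set y : R | y != 0] by apply: open_nbhs_nbhs; split=> //; exact: open_neq.
    have c := smooth_cont smooth_gint ox; exact: (c _ nn).
  by near=> y; split; near: y.
have U0 : U = set0.
  apply: open_null_empty => //; apply: (ae_imp _ ae0) => x hx [bx ox /eqP]; apply; exact: hx.
move=> t; have [n1 ox Tt] := unit_pointP t.
have : ~ U (unit_point t) by rewrite U0.
move=> nU; apply/eqP; apply: contraT => ft; exfalso; apply: nU; split=> //.
  apply/(Ball3E _ rcut_gt0); rewrite n1; apply: lt_trans rcut_sqr.
  by rewrite -expR0 ltr_expR.
have a1 : acut (unit_point t) != 0 by rewrite /acut n1 ln1 /bumpA gt_eqF// -/(@E0 R) E0_gt0// /bumpw expr0n mul0r subr0.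
have i1 : isq (unit_point t) != 0 by rewrite gt_eqF// isq_gt0.
by rewrite /gint /tcut Tt; apply: mulf_neq0; [apply: mulf_neq0|]; exact: expf_neq0.
Unshelve. all: by end_near.
Qed.

End SecondVariationSign.
(** A nonzero value would spread to a nonempty open set, which cannot lie inside the null axis. *)
Lemma axis_extend (R : realType) (h : R3 R -> R) : (forall x, x != 0 -> {for x, continuous h}) ->
  (forall x, offaxis x -> h x = 0) -> forall x, x != 0 -> h x = 0.
Proof.
move=> ch h0 x x0; pose U := [set y : R3 R | y != 0 /\ h y != 0].
have oU : open U.
  rewrite openE => y [y0 cy]; rewrite /interior.
  have n1 : nbhs y [set y : R3 R | y != 0] by apply: open_nbhs_nbhs; split=> //; exact: open_off0.
  have nn : nbhs (h y) [set y : R | y != 0] by apply: open_nbhs_nbhs; split=> //; exact: open_neq.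
  have n2 : nbhs y [set y | h y != 0] by have c := ch y y0; exact: (c _ nn).
  by near=> w; split; near: w.
have U0 : U = set0.
  by apply: open_null_empty => //; apply: (ae_imp _ (null_axis R)) => y oy [_ /eqP]; apply; exact: h0.
by apply/eqP; apply: contraT => hx; have : U x by []; rewrite U0.
Unshelve. all: by end_near.
Qed.

Section SecondVariationConclusion.
Variable R : realType.
Variables (u o : R3 R -> RCC R).
Hypotheses (ho : harmonic_S2_S4 o) (eo : equivariant_on (@Sphere2 R) o)
  (hu : forall x, x != 0 -> u x = hom_ext o x).

(** Either hypothesis yields the same integral inequality for the functions [vcut]; it is used for
    each of the two components of weight 2. *)
Lemma vertical_vanish : stable u \/ locally_minimizing u -> forall x, x != 0 -> (u x).2 = 0.
Proof.
move=> st; have P := u_profile ho eo hu.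
have uV x : offaxis x -> density u x = isq x ^+ 2 * Vpot (uf u) (uf1 u) (T x) by move=> ox; rewrite (u_density ho eo hu).
have [p [q [pq1 pqf]]] := exists_normal P.
have f0 k : wt R k = 2 -> forall t, uf u k t = 0.
  move=> wk; apply: (second_variation_vanish P uV wk) => n n0.
  have r0 := rcut_gt0 R; have Mr := rcut_sqr R.
  have c0 : 0 < (n%:R ^+ 2)^-1 :> R by rewrite invr_gt0 exprn_gt0// ltr0n.
  have sm := smooth_vcut k P n0.
  have ms x : vcut (uf u) k n x != 0 -> (n%:R ^+ 2)^-1 <= rho2 x /\ nsq x <= expR 40.
    move=> h; apply: vcut_neq0 => //; first by apply: contraNneq h => h; rewrite /vcut h mul0r.
    by apply: contraNneq h => h; rewrite /vcut h mul0r mulr0.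
  have mr := vcut_rot (uf u) k n.
  have mp x : offaxis x -> \sum_j partial j (vcut (uf u) k n) x * ph j x = 0 by apply: vcut_angular; exact: P.
  split.
    apply: intgD; first exact: meas_Ball3.
      exact: (varP_intg ho eo hu r0 c0 sm ms).
    exact: (grad2_intg r0 sm).
  case: st => [st|mu].
    exact: (stable_variation ho eo hu pq1 pqf r0 c0 Mr sm ms mr mp).
  exact: (minimizing_variation ho eo hu pq1 pqf r0 c0 Mr sm ms mr mp).
have z i : wt R i = 2 -> forall x, x != 0 -> comp5 i u x = 0.
  move=> wi; apply: axis_extend => [x x0|y oy]; first exact: smooth_cont (u_smooth ho hu i) x0.
  rewrite (prof_rep P)// /ev (f0 i wi) mulr0 add0r /Jn.
  case: i wi => [[|[|[|[|[|n]]]]] hi]; rewrite /wt /= => wi; try by move: wi; lra.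
  - by rewrite f0 ?mulr0 ?oppr0 ?mulr0.
  - by rewrite f0 ?mulr0.
  - exact: (False_ind _ (notF hi)).
move=> x x0; have := z ix3 erefl x x0; have := z ix4 erefl x x0.
rewrite /comp5 /coord5 !(tnth_nth 0) /=.
by case: (u x) => [y [a b]] /= -> ->.
Qed.

End SecondVariationConclusion.

(** * Rigidity *)

Section RigidProfile.
Variable R : realType.
Variables (u : R3 R -> RCC R) (f f1 : 'I_5 -> R -> R) (p q : R).
Hypotheses (P : profile u f f1) (z3 : forall t, f ix3 t = 0) (z4 : forall t, f ix4 t = 0)
  (pq1 : p ^+ 2 + q ^+ 2 = 1) (pqf : forall t, p * f ix1 t + q * f ix2 t = 0).
Implicit Types t : R.

(** The profile in the first complex factor is [hprof] times the fixed unit vector [(- q, p)], so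
    that the profile runs in the circle [f_0 ^ 2 + h ^ 2 = 1]. *)
Definition hprof t : R := p * f ix2 t - q * f ix1 t.
Definition hprof1 t : R := p * f1 ix2 t - q * f1 ix1 t.

Lemma deriv_zero (h h1 : R -> R) : (forall t, is_derive t 1 h (h1 t)) -> (forall t, h t = 0) -> forall t, h1 t = 0.
Proof.
move=> d z t; have [_ <-] := d t; have -> : h = cst 0 by apply/funext.
by have [_] := @is_derive_cst _ _ _ (0 : R) t (1 : R).
Qed.

Lemma f_hprof t : f ix1 t = - q * hprof t /\ f ix2 t = p * hprof t.
Proof.
have z := pqf t; rewrite /hprof; move: (f ix1 t) (f ix2 t) z => a b z; split.
  transitivity (a * (p ^+ 2 + q ^+ 2)); first by rewrite pq1 mulr1.
  by apply/eqP; rewrite -subr_eq0; apply/eqP; transitivity (p * (p * a + q * b)); [ring|rewrite z mulr0].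
transitivity (b * (p ^+ 2 + q ^+ 2)); first by rewrite pq1 mulr1.
by apply/eqP; rewrite -subr_eq0; apply/eqP; transitivity (q * (p * a + q * b)); [ring|rewrite z mulr0].
Qed.

Lemma f1_hprof t : f1 ix1 t = - q * hprof1 t /\ f1 ix2 t = p * hprof1 t.
Proof.
have z : p * f1 ix1 t + q * f1 ix2 t = 0.
  apply: (deriv_zero (h := fun t => p * f ix1 t + q * f ix2 t) (h1 := fun t => p * f1 ix1 t + q * f1 ix2 t)) => // s.
  have c a := @is_derive_cst _ _ _ (a : R) s (1 : R).
  have := is_derive_add (is_derive_mul (c p) (prof_d P ix1 s)) (is_derive_mul (c q) (prof_d P ix2 s)).
  by congr is_derive; rewrite /cst; ring.
rewrite /hprof1; move: (f1 ix1 t) (f1 ix2 t) z => a b z; split.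
  transitivity (a * (p ^+ 2 + q ^+ 2)); first by rewrite pq1 mulr1.
  by apply/eqP; rewrite -subr_eq0; apply/eqP; transitivity (p * (p * a + q * b)); [ring|rewrite z mulr0].
transitivity (b * (p ^+ 2 + q ^+ 2)); first by rewrite pq1 mulr1.
by apply/eqP; rewrite -subr_eq0; apply/eqP; transitivity (q * (p * a + q * b)); [ring|rewrite z mulr0].
Qed.

Lemma hprof_d t : is_derive t 1 hprof (hprof1 t).
Proof.
have c a := @is_derive_cst _ _ _ (a : R) t (1 : R).
have := is_derive_add (is_derive_mul (c p) (prof_d P ix2 t)) (is_derive_mul (c (- q)) (prof_d P ix1 t)).
rewrite (_ : (fun _ => _) = hprof); last by apply/funext => s; rewrite /hprof /cst; ring.
by congr is_derive; rewrite /hprof1 /cst; ring.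
Qed.

Lemma f1_34 t : f1 ix3 t = 0 /\ f1 ix4 t = 0.
Proof. by split; [exact: (deriv_zero (prof_d P ix3))|exact: (deriv_zero (prof_d P ix4))]. Qed.

Lemma rigid_relations t : [/\ f ord0 t ^+ 2 + hprof t ^+ 2 = 1, f ord0 t * f1 ord0 t + hprof t * hprof1 t = 0,
  f1 ord0 t ^+ 2 + hprof1 t ^+ 2 = hprof t ^+ 2 & Vpot f f1 t = 2 * hprof t ^+ 2].
Proof.
have [a1 a2] := f_hprof t; have [b1 b2] := f1_hprof t; have [c3 c4] := f1_34 t.
have S := prof_sphere P t; have F := f_f1 P t; have H := hamiltonian P t.
rewrite sum5E a1 a2 z3 z4 in S; rewrite sum5E a1 a2 b1 b2 z3 z4 c3 c4 in F.
have H2 : f1 ord0 t ^+ 2 + hprof1 t ^+ 2 = hprof t ^+ 2.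
  move: H; rewrite !sum5E a1 a2 b1 b2 z3 z4 c3 c4 /wt /=.
  move: (f ord0 t) (f1 ord0 t) (hprof t) (hprof1 t) => x x1 h h1 H.
  transitivity (x1 ^+ 2 + (p ^+ 2 + q ^+ 2) * h1 ^+ 2); first by rewrite pq1 mul1r.
  transitivity ((p ^+ 2 + q ^+ 2) * h ^+ 2); last by rewrite pq1 mul1r.
  by apply/eqP; rewrite -subr_eq0; apply/eqP; move/eqP: H; rewrite -subr_eq0 => /eqP <-; ring.
split=> //.
- rewrite -S; transitivity (f ord0 t ^+ 2 + (p ^+ 2 + q ^+ 2) * hprof t ^+ 2); first by rewrite pq1 mul1r.
  by ring.
- rewrite -F; transitivity (f ord0 t * f1 ord0 t + (p ^+ 2 + q ^+ 2) * (hprof t * hprof1 t)); first by rewrite pq1 mul1r.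
  by ring.
rewrite /Vpot H !sum5E a1 a2 z3 z4 /wt /=.
transitivity (2 * ((p ^+ 2 + q ^+ 2) * hprof t ^+ 2)); first by ring.
by rewrite pq1 mul1r.
Qed.

Lemma f0_le1 t : `|f ord0 t| <= 1.
Proof.
have [S _ _ _] := rigid_relations t; apply: sqr_le_norm => //.
by rewrite expr1n -S lerDl sqr_ge0.
Qed.

Lemma linear_vanish (e a : R -> R) (K t0 : R) : (forall t, is_derive t 1 e (a t * e t)) -> (forall t, `|a t| <= K) ->
  e t0 = 0 -> forall t, e t = 0.
Proof.
move=> d aK z t; apply/eqP; rewrite -sqrf_eq0; apply/eqP.
apply: (@gronwall R (fun t => e t ^+ 2) (fun t => 2 * a t * e t ^+ 2) (2 * K) t0) => // [s|s|s|].
- have := is_derive_mul (d s) (d s); rewrite (_ : (fun _ => _) = (fun t => e t ^+ 2)); last by apply/funext => y; rewrite expr2.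
  by congr is_derive; ring.
- exact: sqr_ge0.
- by rewrite normrM [`|e s ^+ 2|]ger0_norm ?sqr_ge0// normrM normr_nat; apply: ler_wpM2r; [exact: sqr_ge0|apply: ler_wpM2l].
- by rewrite z expr0n.
Qed.

(** The relations give [f_0' ^ 2 = h ^ 4], whose root might change sign with [t]. It does not:
    [f_0' - sg * h ^ 2] solves a linear equation of first order, so it vanishes identically if it
    vanishes at 0. *)
Lemma f0_derivative : exists2 sg : R, sg = 1 \/ sg = - 1 & forall t, f1 ord0 t = sg * hprof t ^+ 2.
Proof.
have D sg : sg ^+ 2 = 1 -> forall t, is_derive t 1 (fun t => f1 ord0 t - sg * hprof t ^+ 2) (2 * sg * f ord0 t * (f1 ord0 t - sg * hprof t ^+ 2)).
  move=> s1 t; have [S F H V] := rigid_relations t.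
  have c a := @is_derive_cst _ _ _ (a : R) t (1 : R).
  have := is_derive_add (prof_ode P ord0 t) (is_derive_mul (c (- sg)) (is_derive_mul (hprof_d t) (hprof_d t))).
  rewrite (_ : (fun _ => _) = (fun t => f1 ord0 t - sg * hprof t ^+ 2)); last by apply/funext => y; rewrite /cst; ring.
  congr is_derive; rewrite V /wt /= /cst; move: (f ord0 t) (f1 ord0 t) (hprof t) (hprof1 t) F => x x1 h h1 F.
  transitivity (2 * sg * x * x1 - 2 * sg ^+ 2 * h ^+ 2 * x - 2 * sg * (x * x1 + h * h1)); last by rewrite F; ring.
  by rewrite s1; ring.
have B sg : sg ^+ 2 = 1 -> forall t, `|2 * sg * f ord0 t| <= 2.
  move=> s1 t; have sn : `|sg| = 1 by apply/eqP; rewrite -sqrp_eq1// real_normK ?num_real// s1.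
  by rewrite !normrM sn mulr1 normr_nat ler_piMr// f0_le1.
have [S F H _] := rigid_relations 0.
have : (f1 ord0 0 - hprof 0 ^+ 2) * (f1 ord0 0 + hprof 0 ^+ 2) = 0.
  move: (f ord0 0) (f1 ord0 0) (hprof 0) (hprof1 0) S F H => x x1 h h1 S F H.
  transitivity (h ^+ 2 * (x1 ^+ 2 + h1 ^+ 2 - h ^+ 2) + x1 ^+ 2 * (1 - h ^+ 2) - (h * h1) ^+ 2); first by ring.
  have -> : h * h1 = - (x * x1) by lra.
  by rewrite H -S; ring.
move=> /eqP; rewrite mulf_eq0 => /orP[/eqP h|/eqP h].
  exists 1; [by left|move=> t; apply/eqP; rewrite -subr_eq0; apply/eqP].
  by apply: (linear_vanish (t0 := 0) (D 1 (expr1n _ 2)) (B 1 (expr1n _ 2))); rewrite mul1r.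
have s1 : (- 1 : R) ^+ 2 = 1 by rewrite sqrrN expr1n.
exists (- 1); [by right|move=> t; apply/eqP; rewrite -subr_eq0; apply/eqP].
by apply: (linear_vanish (t0 := 0) (D (- 1) s1) (B (- 1) s1)); rewrite mulN1r opprK.
Qed.

Lemma hprof_zero t0 : hprof t0 = 0 -> (forall t, hprof t = 0) /\ forall t, f ord0 t = f ord0 0.
Proof.
move=> h0; have [sg s1 hd] := f0_derivative.
have h t : hprof t ^+ 2 = 0.
  apply: (linear_vanish (e := fun t => hprof t ^+ 2) (a := fun t => - 2 * sg * f ord0 t) (K := 2) (t0 := t0)) => // [s|s|].
  - have [_ F _ _] := rigid_relations s.
    have := is_derive_mul (hprof_d s) (hprof_d s); rewrite (_ : (fun _ => _) = (fun t => hprof t ^+ 2)); last by apply/funext => y; rewrite expr2.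
    congr is_derive; rewrite hd in F; move: F; move: (f ord0 s) (hprof s) (hprof1 s) => x h h1 F.
    by transitivity (2 * (x * (sg * h ^+ 2) + h * h1) - 2 * sg * x * h ^+ 2); [ring|rewrite F; ring].
  - have sn : `|sg| = 1 by case: s1 => ->; rewrite ?normrN normr1.
    by rewrite !normrM sn mulr1 normrN normr_nat ler_piMr// f0_le1.
  - by rewrite h0 expr0n.
have h' t : hprof t = 0 by apply/eqP; rewrite -sqrf_eq0; apply/eqP; exact: h.
split=> // t; apply: (@derive0_const R (f ord0)) => s.
have := prof_d P ord0 s; by rewrite hd h mulr0.
Qed.

(** The functions [Y = 1 / h] and [Z = sg * f_0 / h] satisfy the linear system [Y' = Z], [Z' = Y],
    hence are combinations of [ch] and [sh]. The parameters describe the conformal dilations of the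
    sphere along the axis. *)
Lemma hprof_explicit : (forall t, hprof t != 0) -> exists sg Y0 Z0 : R, [/\ sg = 1 \/ sg = - 1, Y0 ^+ 2 - Z0 ^+ 2 = 1,
  forall t, hprof t * (Y0 * ch t + Z0 * sh t) = 1 & forall t, f ord0 t = sg * (Z0 * ch t + Y0 * sh t) * hprof t].
Proof.
move=> hn; have [sg s1 hd] := f0_derivative.
have sg2 : sg ^+ 2 = 1 by case: s1 => ->; rewrite ?sqrrN expr1n.
have h1E t : hprof1 t = - sg * f ord0 t * hprof t.
  have [_ F _ _] := rigid_relations t; rewrite hd in F; apply: (mulfI (hn t)).
  move: F; move: (f ord0 t) (hprof t) (hprof1 t) => x h h1 F.
  by transitivity (x * (sg * h ^+ 2) + h * h1 - x * sg * h ^+ 2); [ring|rewrite F; ring].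
pose Y t := (hprof t)^-1; pose Z t := sg * f ord0 t * (hprof t)^-1.
have dY t : is_derive t 1 Y (Z t).
  have := is_derive_comp1 (hprof_d t) (@is_deriveV R id (hprof t) 1 1 (hn t) (is_derive_id _ _)).
  by congr is_derive; rewrite h1E /Z scalE; move: (hn t); move: (hprof t) (f ord0 t) => h x h0; field.
have dZ t : is_derive t 1 Z (Y t).
  have := is_derive_mul (is_derive_mul (@is_derive_cst _ _ _ sg t (1 : R)) (prof_d P ord0 t)) (dY t).
  congr is_derive; have [S _ _ _] := rigid_relations t; rewrite hd /Z /Y /cst.
  move: (hn t) S; move: (hprof t) (f ord0 t) => h x h0 S.
  transitivity (sg ^+ 2 * (x ^+ 2 + h ^+ 2) * h^-1); last by rewrite sg2 S !mul1r.
  by field.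
pose y t := Y t - (Y 0 * ch t + Z 0 * sh t); pose z t := Z t - (Z 0 * ch t + Y 0 * sh t).
have dch s := @ch_derive R s; have dsh s := @sh_derive R s.
have dy t : is_derive t 1 y (z t).
  have c a := @is_derive_cst _ _ _ (a : R) t (1 : R).
  have := is_derive_add (dY t) (is_derive_add (is_derive_mul (c (- Y 0)) (dch t)) (is_derive_mul (c (- Z 0)) (dsh t))).
  rewrite (_ : (fun _ => _) = y); last by apply/funext => s; rewrite /y /cst; ring.
  by congr is_derive; rewrite /z /cst; ring.
have dz t : is_derive t 1 z (1 * y t).
  have c a := @is_derive_cst _ _ _ (a : R) t (1 : R).
  have := is_derive_add (dZ t) (is_derive_add (is_derive_mul (c (- Z 0)) (dch t)) (is_derive_mul (c (- Y 0)) (dsh t))).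
  rewrite (_ : (fun _ => _) = z); last by apply/funext => s; rewrite /z /cst; ring.
  by congr is_derive; rewrite /y /cst; ring.
have c0 : ch (0 : R) = 1 by rewrite /ch oppr0 expR0; field.
have s0 : sh (0 : R) = 0 by rewrite /sh oppr0 subrr mul0r.
have y0 t : y t = 0.
  apply: (ode_unique (a := fun=> 1) (A := 1) (t0 := 0) dy dz) => [s||]; rewrite ?normr1//.
    by rewrite /y c0 s0; ring.
  by rewrite /z c0 s0; ring.
have z0 t : z t = 0 by exact: deriv_zero dy y0 t.
exists sg, (Y 0), (Z 0); split=> // [|t|t].
- have [S _ _ _] := rigid_relations 0; rewrite /Y /Z; move: (hn 0) S; move: (hprof 0) (f ord0 0) => h x h0 S.
  transitivity ((1 - sg ^+ 2 * x ^+ 2) * h^-1 ^+ 2); first by ring.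
  by rewrite sg2 mul1r (_ : 1 - x ^+ 2 = h ^+ 2); [field|lra].
- have -> : Y 0 * ch t + Z 0 * sh t = Y t by have := y0 t; rewrite /y; lra.
  by rewrite /Y mulfV.
have -> : Z 0 * ch t + Y 0 * sh t = Z t by have := z0 t; rewrite /z; lra.
rewrite /Z; transitivity (sg ^+ 2 * f ord0 t * ((hprof t)^-1 * hprof t)); last by ring.
by rewrite sg2 mulVf// mul1r mulr1.
Qed.

End RigidProfile.
Lemma ord3_cases (j : 'I_3) : [\/ j = ord0_3, j = ord1_3 | j = ord2].
Proof.
case: j => [[|[|[|n]]] hj]; last exact: (False_ind _ (notF hj)).
- by constructor 1; exact: val_inj.
- by constructor 2; exact: val_inj.
- by constructor 3; exact: val_inj.
Qed.

Lemma eprim_alg (F : fieldType) (q n i z Y0 Z0 : F) : q != 0 -> Y0 * n + Z0 * z != 0 -> Y0 ^+ 2 - Z0 ^+ 2 = 1 ->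
  q ^+ 2 * (n ^+ 2 - z ^+ 2) = 1 ->
  2 * q * (Y0 * ((1 + ((Z0 * n + Y0 * z) * q) ^+ 2)^-1 * (q * (Z0 * (z * i) + Y0))) +
    Z0 * (- ((Y0 * n + Z0 * z) * q) ^- 2 * (q * (Y0 * (z * i) + Z0)))) = 2 / (Y0 * n + Z0 * z) ^+ 2.
Proof.
move=> q0 Y1 YZ q2.
(* The denominator in the derivative of the arctangent is the square of the other hyperbolic
   combination, because [Y0 ^+ 2 - Z0 ^+ 2 = 1]. *)
rewrite (_ : 1 + ((Z0 * n + Y0 * z) * q) ^+ 2 = ((Y0 * n + Z0 * z) * q) ^+ 2); last first.
  transitivity ((Y0 ^+ 2 - Z0 ^+ 2) * (q ^+ 2 * (n ^+ 2 - z ^+ 2)) + ((Z0 * n + Y0 * z) * q) ^+ 2); first by rewrite YZ q2 mulr1.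
  by ring.
transitivity (2 * (Y0 ^+ 2 - Z0 ^+ 2) / (Y0 * n + Z0 * z) ^+ 2); last by rewrite YZ mulr1.
by field; rewrite q0 Y1.
Qed.

(** * Variation of the domain along the axis *)

Section DomainVariation.
Variable R : realType.
Implicit Types (x : R3 R) (i : 'I_5) (j : 'I_3) (e : R).
Variables (Y0 Z0 : R).
Hypothesis YZ : Y0 ^+ 2 - Z0 ^+ 2 = 1.
Local Notation oO := (@open_offaxis R).

Definition eta x : R := step (2 - 2 * nsq x).
Definition eta' x : R := step' (2 - 2 * nsq x).
(** Near the origin, where [eta] is 1, this is a vertical translation, which moves the singularity
    along the axis; off the unit ball it is the identity. *)
Definition Phi e x : R3 R := (x.1.1, x.1.2, x.2 - e * eta x).

Lemma smooth_eta U : open U -> smooth_on U eta.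
Proof.
move=> oU; exact: smooth_step oU (smoothB oU (smooth_cst 2 oU) (smoothM oU (smooth_cst 2 oU) (smooth_nsq oU))).
Qed.

Lemma is_derive_eta x j : is_derive x (basis3 R j) eta (- 4 * eta' x * xc j x).
Proof.
have D := is_derive_add (@is_derive_cst _ _ _ (2 : R) x (basis3 R j)) (is_derive_mul (@is_derive_cst _ _ _ (- 2 : R) x (basis3 R j)) (is_derive_nsq x j)).
rewrite (_ : (fun _ => _) = (fun x => 2 - 2 * nsq x)) in D; last by apply/funext => y; rewrite /cst mulNr.
have := is_derive_comp1 D (step_derive _); congr is_derive; rewrite /eta' /cst; ring.
Qed.

Lemma eta_near x : nsq x <= 2^-1 -> eta x = 1. Proof. by move=> h; rewrite /eta step1//; lra. Qed.
Lemma eta_far x : 1 <= nsq x -> eta x = 0. Proof. by move=> h; rewrite /eta step0//; lra. Qed.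
Lemma eta'_near x : nsq x <= 2^-1 -> eta' x = 0. Proof. by move=> h; rewrite /eta' step'1//; lra. Qed.
Lemma eta'_far x : 1 <= nsq x -> eta' x = 0. Proof. by move=> h; rewrite /eta' step'0//; lra. Qed.
Lemma eta01 x : 0 <= eta x <= 1. Proof. by rewrite step_ge0 step_le1. Qed.

Lemma Phi_off e x : offaxis x -> offaxis (Phi e x). Proof. by []. Qed.

Definition dPhi e j k x : R := (k == j)%:R - e * (- 4 * eta' x * xc j x) * (k == ord2)%:R.

Lemma is_derive_Phi e x j : [/\ is_derive x (basis3 R j) (fun x => (Phi e x).1.1) (dPhi e j ord0_3 x),
  is_derive x (basis3 R j) (fun x => (Phi e x).1.2) (dPhi e j ord1_3 x) &
  is_derive x (basis3 R j) (fun x => (Phi e x).2) (dPhi e j ord2 x)].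
Proof.
have [d1 d2 d3] := is_derive_coord x j.
have de := is_derive_add d3 (is_derive_mul (@is_derive_cst _ _ _ (- e : R) x (basis3 R j)) (is_derive_eta x j)).
split.
- by move: d1; congr is_derive; rewrite /dPhi /=; case: j {d2 d3 de} => [[|[|[|n]]] hj]; rewrite ?mulr0 ?subr0//.
- by move: d2; congr is_derive; rewrite /dPhi /=; case: j {d1 d3 de} => [[|[|[|n]]] hj]; rewrite ?mulr0 ?subr0//.
rewrite (_ : (fun _ => _) = (fun x => (Phi e x).2)) in de; last by apply/funext => y; rewrite /Phi /cst /= mulNr.
move: de; congr is_derive; rewrite /dPhi /cst eqxx mulr1.
rewrite (_ : (ord2 == j) = (val j == 2%N)); last by rewrite eq_sym.
by ring.
Qed.

Lemma smooth_Phi e (F : R3 R -> R) : smooth_on (@offaxis R) F -> smooth_on (@offaxis R) (fun x => F (Phi e x)).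
Proof.
move=> sF; have [s1 s2 s3] := smooth_coord oO.
apply: (smooth_map oO oO sF s1 s2 _ (fun x ox => Phi_off e ox)).
exact: smoothB oO s3 (smoothM oO (smooth_cst e oO) (smooth_eta oO)).
Qed.

Lemma partial_Phi e (F : R3 R -> R) x j : smooth_on (@offaxis R) F -> offaxis x ->
  is_derive x (basis3 R j) (fun x => F (Phi e x)) (partial j F (Phi e x) + e * (4 * eta' x * xc j x) * partial ord2 F (Phi e x)).
Proof.
move=> sF ox; apply/is_derive_line.
have [/is_derive_line d1 /is_derive_line d2 /is_derive_line d3] := is_derive_Phi e x j.
have xe : x + 0 *: basis3 R j = x by rewrite scale0r addr0.
have := @is_derive_curve R F (fun h => (Phi e (x + h *: basis3 R j)).1.1) (fun h => (Phi e (x + h *: basis3 R j)).1.2) (fun h => (Phi e (x + h *: basis3 R j)).2) 0 _ _ _ _ d1 d2 d3.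
rewrite xe => /(_ (smooth_c1_near oO sF (Phi_off e ox))).
have -> : ((Phi e x).1.1, (Phi e x).1.2, (Phi e x).2) = Phi e x by [].
congr is_derive; rewrite /dPhi.
have [-> | -> | ->] := ord3_cases j.
- rewrite (_ : (ord1_3 == ord0_3) = false)// (_ : (ord2 == ord0_3) = false)// !eqxx /=.
  by move: (partial _ _ _) (partial _ _ _) (partial _ _ _) => a b c; ring.
- rewrite (_ : (ord0_3 == ord1_3) = false)// (_ : (ord2 == ord1_3) = false)// !eqxx /=.
  by move: (partial _ _ _) (partial _ _ _) (partial _ _ _) => a b c; ring.
rewrite (_ : (ord0_3 == ord2) = false)// (_ : (ord1_3 == ord2) = false)// !eqxx /=.
by move: (partial _ _ _) (partial _ _ _) (partial _ _ _) => a b c; ring.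
Qed.

Definition YT x : R := Y0 * norm3 x + Z0 * x.2.
(* Set to 0 on the axis, where [isq] is 0. *)
Definition edens x : R := 2 * isq x ^+ 2 * (YT x * isq x)^-1 ^+ 2.

Lemma edensE x : offaxis x -> edens x = 2 / YT x ^+ 2.
Proof.
move=> ox; have q0 := isq_gt0 ox; rewrite /edens invfM exprMn mulrACA -mulrA [X in _ * X](_ : _ = YT x ^- 2)//.
by rewrite -exprMn mulfV ?gt_eqF// expr1n mulr1 exprVn.
Qed.
(** A primitive of [edens] in the vertical direction. It takes the place of a change of variables by
    [Phi e]: [edens (Phi e x)] times the Jacobian, minus [edens x], becomes a vertical derivative
    and integrates to 0. *)
Definition eprim x : R := 2 * isq x * (Y0 * atan ((Z0 * norm3 x + Y0 * x.2) * isq x) + Z0 * (YT x * isq x)^-1).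

(** The product of [YT x] with its conjugate [Y0 * |x| - Z0 * x_3] is at least [|x| ^ 2], because
    [Y0 ^+ 2 = 1 + Z0 ^+ 2], and the conjugate is at most a multiple of [|x|]. *)
Lemma YT_bound x : x.2 ^+ 2 <= norm3 x ^+ 2 -> norm3 x ^+ 2 <= 4 * (1 + Z0 ^+ 2) * YT x ^+ 2.
Proof.
rewrite /YT; have Y2 : Y0 ^+ 2 = 1 + Z0 ^+ 2 by move: YZ; lra.
move: (norm3 x) (x.2) => n z zn.
have [->|n0] := eqVneq (n ^+ 2) 0; first by sqpos.
have np : 0 < n ^+ 2 by rewrite lt_def n0 sqr_ge0.
set a := Y0 * n + Z0 * z; pose b := Y0 * n - Z0 * z.
have ab : n ^+ 2 <= a * b.
  rewrite (_ : a * b = n ^+ 2 + Z0 ^+ 2 * (n ^+ 2 - z ^+ 2)); last by transitivity (Y0 ^+ 2 * n ^+ 2 - Z0 ^+ 2 * z ^+ 2); [rewrite /a /b; ring|rewrite Y2; ring].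
  by rewrite lerDl mulr_ge0 ?sqr_ge0// subr_ge0.
have b2 : b ^+ 2 <= 4 * (1 + Z0 ^+ 2) * n ^+ 2.
  have h1 : b ^+ 2 + a ^+ 2 = 2 * (1 + Z0 ^+ 2) * n ^+ 2 + 2 * (Z0 ^+ 2 * z ^+ 2).
    by transitivity (2 * Y0 ^+ 2 * n ^+ 2 + 2 * (Z0 ^+ 2 * z ^+ 2)); [rewrite /a /b; ring|rewrite Y2; ring].
  have h2 : Z0 ^+ 2 * z ^+ 2 <= Z0 ^+ 2 * n ^+ 2 by apply: ler_wpM2l => //; exact: sqr_ge0.
  have := sqr_ge0 a; nra.
rewrite -(ler_pM2r np); apply: (@le_trans _ _ ((a * b) ^+ 2)).
  by rewrite -expr2 lerXn2r ?nnegrE// ltW//; exact: lt_le_trans ab.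
rewrite exprMn mulrC (mulrAC (4 * (1 + Z0 ^+ 2))); apply: ler_wpM2r => //; exact: sqr_ge0.
Qed.

Lemma Ypos x : x != 0 -> YT x != 0.
Proof.
move=> x0; apply/eqP => h; have b : x.2 ^+ 2 <= norm3 x ^+ 2 by rewrite nsqE nsq_rho2 lerDr rho2_ge0.
by have := YT_bound b; rewrite h expr0n /= mulr0 nsqE leNgt nsq_gt0.
Qed.

Lemma smooth_norm3 : smooth_on (@offaxis R) (@norm3 R).
Proof. by apply: (smooth_sqrt oO (smooth_nsq oO)) => y oy; exact/nsq_gt0/off_neq0. Qed.

Lemma smooth_YT : smooth_on (@offaxis R) YT.
Proof.
have [s1 s2 s3] := smooth_coord oO.
exact: smoothD oO (smoothM oO (smooth_cst _ oO) smooth_norm3) (smoothM oO (smooth_cst _ oO) s3).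
Qed.

Lemma smooth_edens : smooth_on (@offaxis R) edens.
Proof.
have := smoothM oO (smooth_cst 2 oO) (smooth_inv oO (smoothX 2 oO smooth_YT) (fun x ox => expf_neq0 2 (Ypos (off_neq0 ox)))).
by apply: (smooth_ext oO) => x ox; rewrite edensE.
Qed.

Lemma eprim_derive x : offaxis x -> is_derive x (basis3 R ord2) eprim (edens x).
Proof.
move=> ox; have x0 := off_neq0 ox.
have dn := is_derive_norm3 ord2 x0; have [_ _ d3] := is_derive_coord x ord2; have dq := is_derive_isq ord2 ox.
have c a := @is_derive_cst _ _ _ (a : R) x (basis3 R ord2).
have dY := is_derive_add (is_derive_mul (c Y0) dn) (is_derive_mul (c Z0) d3).
have dZ := is_derive_add (is_derive_mul (c Z0) dn) (is_derive_mul (c Y0) d3).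
have dZq := is_derive_mul dZ dq; have dYq := is_derive_mul dY dq.
have q0 := isq_gt0 ox; have Y1 := Ypos x0.
have Yq : YT x * isq x != 0 by rewrite mulf_neq0// gt_eqF.
have dV := is_derive_comp1 dYq (@is_deriveV R id (YT x * isq x) 1 1 Yq (is_derive_id _ _)).
have dA := is_derive_comp1 dZq (is_derive1_atan _).
have D := is_derive_mul (is_derive_mul (c 2) dq) (is_derive_add (is_derive_mul (c Y0) dA) (is_derive_mul (c Z0) dV)).
rewrite (_ : (fun _ => _) = eprim) in D; last by apply/funext.
move: D; congr is_derive; rewrite /cst /= scalE edensE// /xc /= !mulr0 !addr0 !mulr1.
have nE : norm3 x ^+ 2 = rho2 x + x.2 ^+ 2 by rewrite nsqE nsq_rho2.
have q2 := isq_sqr ox; have tn := norm3_inorm x0.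
rewrite /YT in Y1 *.
rewrite !mulr0 !add0r !addr0 ; apply: eprim_alg => //; rewrite ?gt_eqF//.
by rewrite -q2; congr (_ * _); rewrite nE addrK.
Qed.

End DomainVariation.

(** * The competitor obtained by moving the singularity *)

Section Competitor.
Variable R : realType.
Local Notation mR := (measurableTypeR R).
Local Notation leb3 := (leb3 R).
Local Notation T3 := (mR * mR * mR)%type.
Implicit Types (x : R3 R) (i : 'I_5) (j : 'I_3) (e : R).
Local Notation oO := (@open_offaxis R).
Variables (u o : R3 R -> RCC R) (Y0 Z0 : R).
Hypotheses (ho : harmonic_S2_S4 o) (eo : equivariant_on (@Sphere2 R) o)
  (hu : forall x, x != 0 -> u x = hom_ext o x) (YZ : Y0 ^+ 2 - Z0 ^+ 2 = 1)
  (uE : forall x, offaxis x -> density u x = edens Y0 Z0 x).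
Let P := u_profile ho eo hu.

(** The value 0 on the axis, a null set, spares a discussion of the singularity at [Phi e x = 0] and
    gives measurability at once. *)
Definition wphi e x : RCC R := if rho2 x == 0 then 0 else u (Phi e x).

Lemma wphi_comp e i x : offaxis x -> comp5 i (wphi e) x = comp5 i u (Phi e x).
Proof. by rewrite /comp5 /wphi => /negbTE ->. Qed.

Lemma wphi_axis e i x : ~ offaxis x -> comp5 i (wphi e) x = 0.
Proof.
move=> /negP/negPn/eqP h; rewrite /comp5 /wphi h eqxx.
by have [-> | -> | -> | [-> | ->]] := ord5_cases i.
Qed.

Lemma smooth_wphi e i : smooth_on (@offaxis R) (comp5 i (wphi e)).
Proof. by apply: (smooth_ext oO _ (smooth_Phi e (smooth_comp_u P i))) => x ox; rewrite wphi_comp. Qed.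

Lemma wphi_meas e i : measurable_fun setT (comp5 i (wphi e) : T3 -> R).
Proof. by apply: meas_off => [x ox|x ax]; [exact: smooth_cont (smooth_wphi e i) ox|exact: wphi_axis]. Qed.

Lemma wphi_sphere e x : offaxis x -> Sphere4 (wphi e x).
Proof. by move=> ox; rewrite /wphi (negbTE ox); apply: (u_sphere ho hu); apply: off_neq0; exact: Phi_off. Qed.

Lemma wphi_le1 e i x : `|comp5 i (wphi e) x| <= 1.
Proof.
have [ox|ax] := pselect (offaxis x); first by apply: coord5_le1; exact: wphi_sphere.
by rewrite wphi_axis// normr0.
Qed.

Lemma wphi_partial e i j x : offaxis x -> partial j (comp5 i (wphi e)) x =
  partial j (comp5 i u) (Phi e x) + e * (4 * eta' x * xc j x) * partial ord2 (comp5 i u) (Phi e x).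
Proof.
move=> ox; rewrite (@near_partial _ _ (fun x => comp5 i u (Phi e x))); last first.
  by apply: (eq_on_near oO) => // y oy; rewrite wphi_comp.
by have [_] := partial_Phi e j (smooth_comp_u P i) ox.
Qed.

Definition vgrad x : R := \sum_i partial ord2 (comp5 i u) x ^+ 2.

Lemma vgrad_le x : offaxis x -> 0 <= vgrad x <= density u x.
Proof.
move=> ox; apply/andP; split; first by apply: sumr_ge0 => i _; exact: sqr_ge0.
rewrite density_off// /vgrad; apply: ler_sum => i _; rewrite sum3E lerDr; apply: addr_ge0; exact: sqr_ge0.
Qed.

Lemma radial_zero i x : offaxis x -> \sum_j xc j x * partial j (comp5 i u) x = 0.
Proof.
move=> ox; have tx := Td_xc ox.
have px : \sum_j ph j x * xc j x = 0 by rewrite sum3E /xc /ph /=; ring.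
transitivity ((\sum_j Td j x * xc j x) * ev (uf1 u) i x + (\sum_j ph j x * xc j x) * (wt R i * evJ (uf u) i x)).
  rewrite !mulr_suml -big_split; apply: eq_bigr => j _; rewrite (u_partial ho eo hu)//=; ring.
by rewrite tx px !mul0r addr0.
Qed.

Lemma density_alg (a : 'I_3 -> R) (b s : R) (X : 'I_3 -> R) : \sum_j (X j * a j) = s * b -> a ord2 = b -> forall c,
  \sum_j (a j + c * X j * b) ^+ 2 = \sum_j a j ^+ 2 + 2 * c * s * b ^+ 2 + c ^+ 2 * (\sum_j X j ^+ 2) * b ^+ 2.
Proof.
move=> h hb c; transitivity (\sum_j a j ^+ 2 + 2 * c * b * (\sum_j (X j * a j)) + c ^+ 2 * (\sum_j X j ^+ 2) * b ^+ 2).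
  by rewrite !sum3E; ring.
by rewrite h; ring.
Qed.

(** As [u] is constant along rays, its gradient at [Phi e x] is orthogonal to [Phi e x], so its
    product with [x] is [e * eta x] times the vertical derivative. Hence the correction is of second
    order in [e]. *)
Lemma wphi_density e x : offaxis x -> density (wphi e) x = edens Y0 Z0 (Phi e x)
  + e ^+ 2 * (8 * eta' x * eta x + 16 * eta' x ^+ 2 * nsq x) * vgrad (Phi e x).
Proof.
move=> ox; have oP : offaxis (Phi e x) := ox.
have X2 : \sum_j xc j x ^+ 2 = nsq x by rewrite sum3E.
rewrite -uE// !density_off// /vgrad mulr_sumr -big_split; apply: eq_bigr => i _ /=.
have h : \sum_j xc j x * partial j (comp5 i u) (Phi e x) = e * eta x * partial ord2 (comp5 i u) (Phi e x).
  have := radial_zero i oP; rewrite !sum3E /xc /Phi /=.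
  move: (partial _ _ _) (partial _ _ _) (partial _ _ _) => a b c h.
  by apply/eqP; rewrite -subr_eq0 -h; apply/eqP; ring.
have := density_alg h erefl (4 * e * eta' x); rewrite X2 => K.
rewrite (eq_bigr (fun j => (partial j (comp5 i u) (Phi e x) + 4 * e * eta' x * xc j x * partial ord2 (comp5 i u) (Phi e x)) ^+ 2)).
  by rewrite K; move: (\sum_j _) (partial _ _ _) => a b; ring.
by move=> j _; rewrite wphi_partial// mulrA [e * _]mulrC; move: (partial _ _ _) (partial _ _ _) => a b; congr (_ ^+ 2); ring.
Qed.

Definition edgeC : R := 8 * (1 + Z0 ^+ 2).

Lemma edens_bound x : offaxis x -> 0 <= edens Y0 Z0 x <= edgeC / nsq x.
Proof.
move=> ox; have x0 := off_neq0 ox; have Y1 := Ypos YZ x0.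
have y2 : 0 < YT Y0 Z0 x ^+ 2 by rewrite lt_def sqrf_eq0 Y1 sqr_ge0.
rewrite edensE// divr_ge0 ?(ltW y2)//= ler_pdivrMr// mulrAC ler_pdivlMr ?nsq_gt0//.
have b : x.2 ^+ 2 <= norm3 x ^+ 2 by rewrite nsqE nsq_rho2 lerDr rho2_ge0.
by have := YT_bound YZ b; rewrite nsqE /edgeC; lra.
Qed.

Lemma edgeC_ge0 : 0 <= edgeC. Proof. by rewrite /edgeC mulr_ge0// addr_ge0// sqr_ge0. Qed.

(** The bound 1/8 keeps [Phi e x] away from the origin outside of the region where [Phi e] is a
    plain translation; inside that region [shift_intg] deals with the moved singularity. *)
Lemma nsq_Phi e x : `|e| <= 1 / 8 -> 2^-1 <= nsq x -> 4^-1 <= nsq (Phi e x).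
Proof.
move=> e8 hx; have /andP[h0 h1] := eta01 x.
have : `|e * eta x * x.2| <= 1 / 8 * `|x.2|.
  rewrite normrM ler_wpM2r// normrM (ger0_norm h0); apply: le_trans e8; by rewrite ler_piMr.
rewrite ler_norml => /andP[_ h].
have h2 : 2 * `|x.2| <= nsq x + 1.
  have xx : x.2 ^+ 2 = `|x.2| ^+ 2 by rewrite real_normK ?num_real.
  rewrite nsq_rho2 xx; have := rho2_ge0 x; have := sqr_ge0 (`|x.2| - 1); move: (`|x.2|) (rho2 x) => b c.
  by rewrite sqrrB1 => h3 h4; lra.
have E : nsq (Phi e x) = nsq x - 2 * (e * eta x * x.2) + (e * eta x) ^+ 2 by rewrite /nsq /Phi /=; ring.
have := sqr_ge0 (e * eta x); rewrite E; lra.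
Qed.

Definition shift3 e x : R3 R := (x.1, x.2 - e).

Lemma inv_nsq_Phi e x : `|e| <= 1 / 8 -> (nsq (Phi e x))^-1 <= (nsq (shift3 e x))^-1 + 4.
Proof.
move=> e8; have i0 : 0 <= (nsq (shift3 e x))^-1 by rewrite invr_ge0 nsq_ge0.
have [h|h] := leP (nsq x) 2^-1.
  by rewrite /Phi eta_near// mulr1 -surjective_pairing -/(shift3 e x); lra.
have := nsq_Phi e8 (ltW h) => h1; have n0 : 0 < nsq (Phi e x) by exact: lt_le_trans h1.
have : (nsq (Phi e x))^-1 <= 4 by rewrite -[leRHS]invrK lef_pV2 ?posrE// invr_gt0.
lra.
Qed.

Lemma shift_intg e : `|e| <= 1 / 8 -> intg leb3 (Ball3 2) (fun x => (nsq (shift3 e x))^-1 + 4).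
Proof.
move=> e8; have mB := @meas_Ball3 R 2; have mB4 := @meas_Ball3 R 4.
apply: intgD => //; last exact: Ball3_intg_cst.
have m : mpres leb3 (shift3 e) by exact: (@vshift_mpres R (fun=> - e) (measurable_cst _)).
have /(intg_mkcond _ _ mB4) i4 := @inv_nsq_intg R 4.
have := intg_sub measurableT mB (@subsetT _ _) (mpres_intg m i4); apply: eq_intg => // x hx.
rewrite /= patchE mem_set//; apply/(Ball3E _ (ltr0Sn R 3)).
have /(Ball3E _ (ltr0Sn R 1)) hx2 := hx.
have : (x.2 - e) ^+ 2 <= 2 * x.2 ^+ 2 + 2 * e ^+ 2 by have := sqr_ge0 (x.2 + e); nra.
have : e ^+ 2 <= 1 by rewrite -(real_normK (num_real e)) expr_le1//; lra.
by move: hx2; rewrite /nsq /shift3 /=; have := sqr_ge0 x.1.1; have := sqr_ge0 x.1.2; nra.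
Qed.

Lemma eta'_bound : exists2 C, 0 <= C & forall x, 0 <= eta' x <= C.
Proof. by have [C [C0 h]] := @step'_bound R; exists C => // x; rewrite step'_ge0 h. Qed.

Lemma eta'_nsq C x : 0 <= eta' x <= C -> 0 <= 8 * eta' x * eta x + 16 * eta' x ^+ 2 * nsq x <= 8 * C + 16 * C ^+ 2.
Proof.
move=> /andP[e0 eC]; have /andP[h0 h1] := eta01 x; have n0 := nsq_ge0 x.
apply/andP; split; first by sqpos.
apply: lerD.
  by rewrite -[leRHS]mulr1; apply: ler_pM => //; [sqpos|rewrite ler_wpM2l].
have [h|h] := leP 1 (nsq x).
  by rewrite eta'_far// expr0n mulr0 mul0r; sqpos.
rewrite -[leRHS]mulr1; apply: ler_pM (ltW h) => //; first by sqpos.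
by rewrite ler_wpM2l// lerXn2r ?nnegrE// (le_trans e0).
Qed.

Lemma wphi_nice e : `|e| <= 1 / 8 -> nice 2 (wphi e).
Proof.
move=> e8; have [C C0 hC] := eta'_bound.
pose K := (8 * C + 16 * C ^+ 2); have K0 : 0 <= K by rewrite /K; sqpos.
pose H x := edgeC * (1 + K) * ((nsq (shift3 e x))^-1 + 4).
apply: (nice_intro_intg (wphi_meas e) (wphi_le1 e) (smooth_wphi e) (H := H)).
- by apply: intgZ; [exact: meas_Ball3|exact: shift_intg].
- have c0 := edgeC_ge0; move=> x; have i0 : 0 <= (nsq (shift3 e x))^-1 by rewrite invr_ge0 nsq_ge0.
  by apply: mulr_ge0; sqpos.
move=> x ox; rewrite wphi_density// /H.
have oP : offaxis (Phi e x) := ox.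
have /andP[d0 d1] := edens_bound oP; have /andP[v0 v1] := vgrad_le oP; rewrite uE// in v1.
have /andP[k0 k1] := eta'_nsq (hC x).
have e2 : e ^+ 2 <= 1 by rewrite -(real_normK (num_real e)) expr_le1//; lra.
apply: (@le_trans _ _ (edens Y0 Z0 (Phi e x) * (1 + K))).
  rewrite [leRHS]mulrDr mulr1 lerD2l [leRHS]mulrC; apply: ler_pM => //; first by apply: mulr_ge0 => //; exact: sqr_ge0.
  by rewrite -[leRHS]mul1r; apply: ler_pM => //; exact: sqr_ge0.
rewrite [leRHS]mulrAC; apply: ler_wpM2r; first by rewrite addr_ge0.
by apply: le_trans d1 _; rewrite ler_wpM2l ?edgeC_ge0//; exact: inv_nsq_Phi.
Qed.

Lemma Phi_far e x : 1 <= nsq x -> Phi e x = x.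
Proof. by move=> h; rewrite /Phi eta_far// mulr0 subr0 -!surjective_pairing. Qed.

(** The factor in brackets is the vertical derivative of the last coordinate of [Phi e], which is
    its Jacobian determinant. *)
Definition dprim e x : R := edens Y0 Z0 (Phi e x) * (1 + 4 * e * eta' x * x.2) - edens Y0 Z0 x.

Lemma dprim_derive e x : offaxis x ->
  is_derive x (basis3 R ord2) (fun x => eprim Y0 Z0 (Phi e x) - eprim Y0 Z0 x) (dprim e x).
Proof.
move=> ox; have oP : offaxis (Phi e x) := ox.
have E y : offaxis y -> is_derive y.2 1 (fun s => eprim Y0 Z0 (y.1.1, y.1.2, s)) (edens Y0 Z0 y).
  move=> oy; have [d pd] := eprim_derive YZ oy; rewrite -pd; exact: (line2 d).
have [_ _ dP] := is_derive_Phi e x ord2; move/is_derive_line : dP => dP.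
have /is_derive_line dE := eprim_derive YZ ox; apply/is_derive_line.
have xe : x + 0 *: basis3 R ord2 = x by rewrite scale0r addr0.
have := E _ oP; rewrite -{1}xe => dF.
have := is_deriveB (is_derive_comp1 dP dF) dE.
rewrite (_ : (_ - _) = (fun h => eprim Y0 Z0 (Phi e (x + h *: basis3 R ord2)) - eprim Y0 Z0 (x + h *: basis3 R ord2))).
  by congr is_derive; rewrite /dprim /dPhi eqxx mulr1 /xc /=; ring.
apply/funext => h; congr (_ - _); rewrite /=; congr (eprim Y0 Z0 _).
have S1 : (x + h *: basis3 R ord2).1.1 = x.1.1 by rewrite /= /GRing.scale/= mulr0 addr0.
have S2 : (x + h *: basis3 R ord2).1.2 = x.1.2 by rewrite /= /GRing.scale/= mulr0 addr0.
by rewrite /Phi S1 S2.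
Qed.

Lemma eta'_cont x : {for x, continuous (@eta' R)}.
Proof.
apply: (@continuous_comp _ _ _ (fun x : R3 R => 2 - 2 * nsq x) (@step' R)); last exact: step'_cont.
by apply: cvgB; [exact: cvg_cst|apply: cvgM; [exact: cvg_cst|exact: nsq_cont]].
Qed.

Lemma dprim_cont e x : offaxis x -> {for x, continuous (dprim e)}.
Proof.
move=> ox; have sE := smooth_edens YZ; apply: cvgB; last exact: smooth_cont sE ox.
apply: cvgM; first exact: smooth_cont (smooth_Phi e sE) ox.
apply: cvgD; first exact: cvg_cst.
have [_ _ s3] := smooth_coord (@openT (R3 R)).
by apply: cvgM; [apply: cvgM; [exact: cvg_cst|exact: eta'_cont]|exact: smooth_cont s3 I].
Qed.

Lemma dprim_meas e : measurable_fun setT (dprim e : T3 -> R).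
Proof.
apply: meas_off => [x ox|x /isq_axis[h _]]; first exact: dprim_cont.
have hP : isq (Phi e x) = 0 by rewrite -h.
by rewrite /dprim /edens hP h expr0n /= !mulr0 !mul0r subrr.
Qed.

Lemma dprim_far e x : ~ Ball3 2 x -> dprim e x = 0.
Proof.
move=> h; have h1 : 1 <= nsq x.
  by rewrite leNgt; apply/negP => h1; apply: h; apply/(Ball3E x (ltr0Sn R 1)); lra.
by rewrite /dprim Phi_far// eta'_far// mulr0 mul0r addr0 mulr1 subrr.
Qed.

Lemma dprim_intg e : `|e| <= 1 / 8 -> intg leb3 setT (dprim e).
Proof.
move=> e8; have mB := @meas_Ball3 R 2; have [C C0 hC] := eta'_bound.
apply: (@intg_extend R (Ball3 2) setT) => //; first by move=> x _; exact: dprim_far.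
have c0 := edgeC_ge0.
pose H x := edgeC * (1 + C) * ((nsq (shift3 e x))^-1 + 4) + edgeC * (nsq x)^-1.
have iH : intg leb3 (Ball3 2) H.
  by apply: intgD => //; apply: intgZ => //; [exact: shift_intg|exact: inv_nsq_intg].
apply: (@intg_le _ T3 _ leb3 (Ball3 2) _ H) => //; first exact: measurable_funTS (dprim_meas e).
move=> x _; have i0 : 0 <= (nsq (shift3 e x))^-1 by rewrite invr_ge0 nsq_ge0.
have n0 : 0 <= (nsq x)^-1 by rewrite invr_ge0 nsq_ge0.
have [ox|/isq_axis[h _]] := pselect (offaxis x); last first.
  have hP : isq (Phi e x) = 0 by rewrite -h.
  rewrite /dprim /edens hP h expr0n /= !mulr0 !mul0r subrr normr0 /H; sqpos; lra.
have oP : offaxis (Phi e x) := ox.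
have /andP[d0 d1] := edens_bound oP; have /andP[d2 d3] := edens_bound ox.
apply: le_trans (ler_normB _ _) _; rewrite /H; apply: lerD; last by rewrite ger0_norm.
have t1 : `|4 * e * eta' x * x.2| <= C.
  have /andP[e0 eC] := hC x.
  have [h|h] := leP 1 (nsq x); first by rewrite eta'_far// mulr0 mul0r normr0.
  have z1 : `|x.2| <= 1.
    rewrite -(expr_le1 (n := 2))// real_normK ?num_real//; apply: le_trans (ltW h); by rewrite nsq_rho2 lerDr rho2_ge0.
  rewrite (_ : 4 * e * eta' x * x.2 = eta' x * (4 * e * x.2)); last by ring.
  rewrite normrM (ger0_norm e0) -[leRHS]mulr1; apply: ler_pM => //; rewrite !normrM normr_nat.
  by rewrite -[leRHS]mul1r; apply: ler_pM => //; lra.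
rewrite normrM (ger0_norm d0) [leRHS]mulrAC; apply: ler_pM => //.
  by apply: le_trans d1 _; rewrite ler_wpM2l//; exact: inv_nsq_Phi.
by apply: le_trans (ler_normD _ _) _; rewrite normr1 lerD2l.
Qed.

Lemma dprim_int e : `|e| <= 1 / 8 -> \int[leb3]_(x in Ball3 2) dprim e x = 0.
Proof.
move=> e8; have mB := @meas_Ball3 R 2.
rewrite Rintegral_mkcond (_ : dprim e \_ (Ball3 2) = dprim e); last first.
  apply/funext => x; rewrite patchE; case: ifPn => // /negP h; rewrite dprim_far// => hx; apply: h; exact: mem_set.
apply: (line_ibp (j := ord2) (F := fun x => eprim Y0 Z0 (Phi e x) - eprim Y0 Z0 x) (M := 1)) => //.
- by move=> x ox; exact: dprim_derive.
- by move=> x ox; exact: dprim_cont.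
- move=> x h; rewrite Phi_far ?subrr// leNgt; apply/negP => h1; apply: h.
  have b (a : R) : a ^+ 2 <= nsq x -> `|a| < 1.
    by move=> ha; rewrite -(expr_lt1 (n := 2))// real_normK ?num_real//; exact: le_lt_trans h1.
  by split; apply: b; rewrite /nsq; have := sqr_ge0 x.1.1; have := sqr_ge0 x.1.2; have := sqr_ge0 x.2; lra.
- exact: dprim_intg.
Qed.

(** The change of the density, freed of the null term [dprim e] and divided by [e]. It is supported
    where [eta'] does not vanish, away from all singularities, hence is bounded uniformly in [e];
    [lint] is its limit. *)
Definition qdom e x : R := - 4 * eta' x * x.2 * edens Y0 Z0 (Phi e x)
  + e * (8 * eta' x * eta x + 16 * eta' x ^+ 2 * nsq x) * vgrad (Phi e x).

Lemma qdom_density e x : offaxis x -> density (wphi e) x - density u x - dprim e x = e * qdom e x.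
Proof. by move=> ox; rewrite wphi_density// uE// /dprim /qdom; ring. Qed.

Lemma u_nice2 : nice 2 u.
Proof. by apply: (u_nice ho eo hu). Qed.

Definition lint x : R := - 4 * eta' x * x.2 * density u x.

Lemma qdom_bound : exists2 C, 0 <= C & forall e x, offaxis x -> `|e| <= 1 / 8 -> `|qdom e x| <= C.
Proof.
have [C C0 hC] := eta'_bound; have c0 := edgeC_ge0.
pose K := 8 * C + 16 * C ^+ 2; have K0 : 0 <= K by rewrite /K; sqpos.
exists (4 * C * (edgeC * 4) + K * (edgeC * 4)); first by sqpos.
move=> e x ox e8; have oP : offaxis (Phi e x) := ox.
have [h|h] := leP (nsq x) 2^-1.
  rewrite /qdom (eta'_near h) expr0n /= !mulr0 !mul0r addr0 mulr0 mul0r addr0 normr0; sqpos.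
have [h1|h1] := leP 1 (nsq x).
  rewrite /qdom (eta'_far h1) expr0n /= !mulr0 !mul0r addr0 mulr0 mul0r addr0 normr0; sqpos.
have nP := nsq_Phi e8 (ltW h); have n0 : 0 < nsq (Phi e x) by exact: lt_le_trans nP.
have i4 : (nsq (Phi e x))^-1 <= 4 by rewrite -[leRHS]invrK lef_pV2 ?posrE// invr_gt0.
have /andP[d0 d1] := edens_bound oP; have /andP[v0 v1] := vgrad_le oP; rewrite uE// in v1.
have d4 : edens Y0 Z0 (Phi e x) <= edgeC * 4 by apply: le_trans d1 _; rewrite ler_wpM2l.
have v4 := le_trans v1 d4; have /andP[k0 k1] := eta'_nsq (hC x); have /andP[e0 eC] := hC x.
have z1 : `|x.2| <= 1.
  rewrite -(expr_le1 (n := 2))// real_normK ?num_real//; apply: le_trans (ltW h1); by rewrite nsq_rho2 lerDr rho2_ge0.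
apply: le_trans (ler_normD _ _) _; apply: lerD.
  rewrite normrM (ger0_norm d0); apply: ler_pM => //.
  rewrite (_ : - 4 * eta' x * x.2 = - (4 * (eta' x * x.2))); last by ring.
  rewrite normrN normrM normr_nat ler_wpM2l// normrM (ger0_norm e0) -[leRHS]mulr1; exact: ler_pM.
rewrite normrM (ger0_norm v0); apply: ler_pM => //; rewrite normrM (ger0_norm k0) -[leRHS]mul1r.
by apply: ler_pM => //; lra.
Qed.

Lemma qdom_cvg (s : R) x : offaxis x -> (fun n => qdom (s * (harm R n / 4)) x) @ \oo --> lint x.
Proof.
move=> ox; have sE := smooth_edens YZ.
have ce : (fun n => s * (harm R n / 4)) @ \oo --> (0 : R).
  have c1 : (fun n => s * (harm R n * 4^-1)) @ \oo --> (s * (0 * 4^-1) : R).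
    by apply: cvgM; [exact: cvg_cst|apply: cvgM; [exact: harm_cvg|exact: cvg_cst]].
  by rewrite mul0r mulr0 in c1.
have cP : (fun n => Phi (s * (harm R n / 4)) x) @ \oo --> x.
  rewrite [X in _ --> X](_ : x = Phi 0 x); last by rewrite /Phi mul0r subr0 -!surjective_pairing.
  have c : {for (0 : R), continuous (fun e : R => Phi e x)}.
    apply: cont_pair; first exact: cvg_cst.
    by apply: cvgB; [exact: cvg_cst|apply: cvgM; [exact: cvg_id|exact: cvg_cst]].
  exact: (cvg_comp _ _ ce c).
have cE : (fun n => edens Y0 Z0 (Phi (s * (harm R n / 4)) x)) @ \oo --> edens Y0 Z0 x.
  exact: (cvg_comp _ _ cP (smooth_cont sE ox)).
have sv : smooth_on (@offaxis R) vgrad.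
  have sp i := smoothX 2 oO (smooth_partial ord2 (smooth_comp_u P i)).
  have := smoothD oO (smoothD oO (smoothD oO (smoothD oO (sp ord0) (sp ix1)) (sp ix2)) (sp ix3)) (sp ix4).
  by apply: (smooth_ext oO) => y _; rewrite /vgrad sum5E.
have cV : (fun n => vgrad (Phi (s * (harm R n / 4)) x)) @ \oo --> vgrad x.
  exact: (cvg_comp _ _ cP (smooth_cont sv ox)).
rewrite /lint uE// -[X in _ --> X]addr0.
rewrite -[X in _ --> (_ + X)](_ : 0 * (8 * eta' x * eta x + 16 * eta' x ^+ 2 * nsq x) * vgrad x = 0); last by rewrite !mul0r.
by apply: cvgD; apply: cvgM => //; [exact: cvg_cst|apply: cvgM => //; exact: cvg_cst].
Qed.

Lemma lint_meas : measurable_fun (Ball3 2 : set T3) lint.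
Proof.
have [iu _] := energy_nice (ltr0Sn R 1) u_nice2.
apply: measurable_funM; last exact: intg_meas iu.
apply: measurable_funTS; apply: measurable_funM.
  apply: measurable_funM => //; apply: (cont_measurable3 openT) => x _; exact: eta'_cont.
have [_ _ s3] := smooth_coord (@openT (R3 R)); exact: smooth_meas s3.
Qed.

Lemma wphi_equiv e b x : offaxis x -> wphi e (rot3 b x) = rot5 b (wphi e x).
Proof.
move=> ox; rewrite /wphi rho2_rot (negbTE ox) -(u_equiv eo hu) ?off_neq0//; congr u.
by rewrite /Phi /eta nsq_rot /rot3.
Qed.

Lemma wphi_ess e : ess_supp (Ball3 2) (fun x => u x - wphi e x) `<=` Ball3 2.
Proof.
move=> x Hx; apply/(Ball3E x (ltr0Sn R 1)); rewrite ltNge; apply/negP => hx.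
pose V := ~` [set x : R3 R | nsq x <= 1].
have oV : open V by apply: closed_openC; exact: closed_nsq_le.
apply: (Hx V oV); first by rewrite /V/=; apply/negP; rewrite -ltNge; lra.
apply: (ae_imp _ (null_axis R)) => y oy /negP; rewrite -ltNge => Vy _.
by rewrite /wphi (negbTE oy) Phi_far ?subrr// ltW.
Qed.

Lemma wphi_minimal (mu : locally_minimizing u) s : s ^+ 2 = 1 -> 0 <= s * \int[leb3]_(x in Ball3 2) lint x.
Proof.
move=> s2; have sn : `|s| = 1 by apply/eqP; rewrite -sqrp_eq1// real_normK ?num_real// s2.
have mB := @meas_Ball3 R 2; have p2 : 0 < 2 :> R by [].
have [iu Eu] := energy_nice p2 u_nice2.
have [C C0 hC] := qdom_bound.
(* As [harm n <= 1 / 2], the division by 4 yields the bound 1/8. The sign [s] lets the singularity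
   move both up and down, so that the first variation vanishes and not merely has a sign. *)
pose a n : R := s * (harm R n / 4).
have aN n : 0 < harm R n / 4 by rewrite divr_gt0// harm_gt0.
have a8 n : `|a n| <= 1 / 8.
  rewrite /a normrM sn mul1r gtr0_norm//.
  have : harm R n <= 2^-1 by rewrite /harm lef_pV2 ?posrE// ?ltr0n// ler_nat.
  lra.
pose q n x := (a n)^-1 * (density (wphi (a n)) x - density u x - dprim (a n) x).
have s0 : s != 0 by rewrite -normr_eq0 sn oner_neq0.
have an0 n : a n != 0 by apply: mulf_neq0 => //; rewrite gt_eqF.
have iw n : intg leb3 (Ball3 2) (density (wphi (a n))) by have [] := energy_nice p2 (wphi_nice (a8 n)).
have id n : intg leb3 (Ball3 2) (dprim (a n)) by exact: intg_sub measurableT mB (@subsetT _ _) (dprim_intg (a8 n)).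
have iq n : intg leb3 (Ball3 2) (q n) by apply: intgZ => //; apply: intgB => //; exact: intgB.
have qE n x : offaxis x -> q n x = qdom (a n) x by move=> ox; rewrite /q qdom_density// mulKf.
have pos n : 0 <= s * \int[leb3]_(x in Ball3 2) q n x.
  have : (energy u 2 <= energy (wphi (a n)) 2)%E.
    apply: mu => //.
    - by apply: W12_nice => //; [exact: wphi_nice|apply: (ae_imp _ (null_axis R)) => x ox _; exact: wphi_sphere].
    - by move=> b; apply: (ae_imp _ (null_axis R)) => x ox _; exact: wphi_equiv.
    - exact: wphi_ess.
  rewrite Eu (energy_nice p2 (wphi_nice (a8 n))).2 lee_fin ler_pM2l ?invr_gt0// => le.
  rewrite /q RintegralZl//; last by apply: intgB => //; exact: intgB.
  rewrite (RintegralB mB (intgB mB (iw n) iu) (id n)).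
  rewrite (dprim_int (a8 n)) subr0 (RintegralB mB (iw n) iu) mulrA.
  have -> : s * (a n)^-1 = (harm R n / 4)^-1.
    by rewrite /a invfM mulrA mulfV ?mul1r.
  by rewrite mulr_ge0 ?subr_ge0// invr_ge0 ltW.
have cv : (fun n => s * \int[leb3]_(x in Ball3 2) q n x) @ \oo --> s * \int[leb3]_(x in Ball3 2) lint x.
  apply: cvgM; first exact: cvg_cst.
  apply: (@Rint_dct _ T3 _ leb3 _ _ _ (fun=> C)) => //.
  - by move=> n; exact: intg_meas (iq n).
  - exact: lint_meas.
  - apply: (ae_imp _ (null_axis R)) => x ox _; rewrite (_ : (fun n => _) = (fun n => qdom (a n) x)).
      exact: qdom_cvg.
    by apply/funext => n; rewrite qE.
  - exact: Ball3_intg_cst.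
  - by apply: (ae_imp _ (null_axis R)) => x ox n _; rewrite qE// hC.
exact: (cvgr_to_ge cv (nearW _ pos)).
Qed.

Lemma lint_zero : locally_minimizing u -> \int[leb3]_(x in Ball3 2) lint x = 0.
Proof.
move=> mu; have h1 := wphi_minimal mu (expr1n _ 2); have s1 : (- 1 : R) ^+ 2 = 1 by rewrite sqrrN expr1n.
by have h2 := wphi_minimal mu s1; move: h1 h2; rewrite mul1r mulN1r oppr_ge0 => h1 h2; apply/eqP; rewrite eq_le h1 h2.
Qed.

Definition flip3 x : R3 R := (x.1, - x.2).

(** Averaging over the reflection in the horizontal plane gives the integrand a sign; with the
    factor [Y0 * Z0] it is nonnegative by [lint_pair]. *)
Definition symint x : R := Y0 * Z0 * (lint x + lint (flip3 x)).

Lemma lint_far x : ~ Ball3 2 x -> lint x = 0.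
Proof.
move=> h; rewrite /lint eta'_far ?mulr0 ?mul0r//.
by rewrite leNgt; apply/negP => h1; apply: h; apply/(Ball3E x (ltr0Sn R 1)); lra.
Qed.

Lemma lint_intg : intg leb3 setT lint.
Proof.
have mB := @meas_Ball3 R 2; have [C C0 hC] := qdom_bound.
apply: (@intg_extend R (Ball3 2) setT) => //; first by move=> x _; exact: lint_far.
apply: (@intg_le _ T3 _ leb3 (Ball3 2) _ (fun=> C)) => //; [exact: lint_meas|exact: Ball3_intg_cst|].
move=> x _; have [ox|ax] := pselect (offaxis x); last first.
  rewrite /lint (_ : density u x = 0) ?mulr0 ?normr0//; apply: big1 => i _; apply: big1 => j _.
  by rewrite /pd; move/negP/negbTE: ax => ->; rewrite expr0n.
have := hC 0 x ox; rewrite normr0 => /(_ _) h; rewrite (_ : lint x = qdom 0 x); first by apply: h; lra.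
by rewrite /lint /qdom uE// !mul0r addr0 (_ : Phi 0 x = x)// /Phi mul0r subr0 -!surjective_pairing.
Qed.

Lemma lint_pair x : offaxis x -> symint x = 32 * (Y0 * Z0) ^+ 2 * (eta' x * norm3 x * x.2 ^+ 2) / (YT Y0 Z0 x * YT Y0 Z0 (flip3 x)) ^+ 2.
Proof.
move=> ox; have of_ : offaxis (flip3 x) := ox.
have nf : nsq (flip3 x) = nsq x by rewrite /nsq /flip3 /= sqrrN.
have nf' : norm3 (flip3 x) = norm3 x by rewrite /norm3 -!/(nsq _) nf.
have e' : eta' (flip3 x) = eta' x by rewrite /eta' nf.
have Y1 := Ypos YZ (off_neq0 ox); have Y2 := Ypos YZ (off_neq0 of_).
rewrite /symint /lint !uE// !edensE// e'; move: Y1 Y2; rewrite /YT nf' /=.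
by move: (norm3 x) (x.2) (eta' x) => n z h Y1 Y2; field; rewrite Y1 Y2.
Qed.

(** The integral of [symint] is 0, so [symint] vanishes almost everywhere; but for [Z0 != 0] it is
    positive wherever [x_3 != 0] and [eta'] is positive, [Y0] being nonzero. *)
Lemma vertical_center : locally_minimizing u -> Z0 = 0.
Proof.
move=> mu; apply/eqP; apply: contraT => z0; exfalso.
have Yn : Y0 != 0.
  by apply/eqP => h; move: YZ; rewrite h expr0n sub0r => hh; have := sqr_ge0 Z0; lra.
have mT := @measurableT _ T3; have iL := lint_intg.
have m : mpres leb3 flip3 by exact: vopp_mpres.
have L0 : \int[leb3]_x lint x = 0.
  rewrite -(lint_zero mu) [RHS]Rintegral_mkcond; congr (Rintegral _ _ _); apply/funext => x; rewrite patchE.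
  by case: ifPn => // /negP h; rewrite lint_far// => hx; apply: h; exact: mem_set.
have iF : intg leb3 setT (fun x => lint (flip3 x)) by exact: mpres_intg m iL.
have iS : intg leb3 setT symint by apply: intgZ => //; exact: intgD.
have S0 : \int[leb3]_x symint x = 0.
  rewrite /symint RintegralZl//; last exact: intgD.
  by rewrite RintegralD// L0 (mpres_Rint m (intg_meas iL)) L0 addr0 mulr0.
have Spos x : 0 <= symint x.
  have [ox|ax] := pselect (offaxis x); last first.
    have d0 y : ~ offaxis y -> density u y = 0.
      by move=> ay; apply: big1 => i _; apply: big1 => j _; rewrite /pd; move/negP/negbTE: ay => ->; rewrite expr0n.
    have ax' : ~ offaxis (flip3 x) := ax.
    by rewrite /symint /lint (d0 _ ax) (d0 _ ax') !mulr0 addr0 mulr0.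
  have [C C0 hC] := eta'_bound; have /andP[e0 _] := hC x; have n0 : 0 <= norm3 x by exact: sqrtr_ge0.
  rewrite lint_pair// mulr_ge0 ?invr_ge0; sqpos.
have ae0 := @Rint0_ae _ T3 _ leb3 _ _ mT iS (fun x _ => Spos x) S0.
pose U := [set x : R3 R | [/\ offaxis x, x.2 != 0 & 0 < 2 - 2 * nsq x < 1]].
have oU : open U.
  rewrite (_ : U = (@offaxis R) `&` ((@snd (R * R)%type R) @^-1` [set y | y != 0] `&` (fun x : R3 R => 2 - 2 * nsq x) @^-1` [set y | 0 < y < 1])); last first.
    by apply/seteqP; split=> x /=; [move=> [? ? ?]; split|move=> [? [? ?]]; split].
  have cn x : {for x, continuous (fun x : R3 R => 2 - 2 * nsq x)}.
    by apply: cvgB; [exact: cvg_cst|apply: cvgM; [exact: cvg_cst|exact: nsq_cont]].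
  apply: openI; first exact: open_offaxis.
  apply: openI; first by apply: open_comp; [move=> x _; exact: cvg_snd|exact: open_neq].
  apply: open_comp; first by move=> x _; exact: cn.
  rewrite (_ : [set y | 0 < y < 1] = `]0, 1[%classic); first exact: itv_open.
  by apply/seteqP; split=> y /=; rewrite in_itv.
have U0 : U = set0.
  apply: open_null_empty => //; apply: (ae_imp _ ae0) => x /(_ I) hx [ox zx /andP[y0 y1]].
  have Y1 := Ypos YZ (off_neq0 ox); have Y2 : YT Y0 Z0 (flip3 x) != 0 by apply: Ypos => //; apply: off_neq0.
  have n0 : 0 < norm3 x by rewrite sqrtr_gt0; apply: nsq_gt0; exact: off_neq0.
  have e0 : 0 < eta' x.
    rewrite /eta' /step'; apply: divr_gt0; last by rewrite exprn_gt0// stepden_gt0.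
    have E1p y : 0 < y -> 0 < E1 y :> R by move=> yp; rewrite E1_pos// mulr_gt0 ?expR_gt0// invr_gt0 exprn_gt0.
    have y2 : 0 < 1 - (2 - 2 * nsq x) by rewrite subr_gt0.
    by apply: addr_gt0; apply: mulr_gt0; rewrite ?E0_gt0 ?E1p.
  move: hx; rewrite lint_pair//; apply/eqP.
  have p1 : eta' x * norm3 x * x.2 ^+ 2 != 0 by apply: mulf_neq0; [apply: mulf_neq0; rewrite gt_eqF|exact: expf_neq0].
  have p2 : 32 * (Y0 * Z0) ^+ 2 != 0 by apply: mulf_neq0 => //; apply: expf_neq0; exact: mulf_neq0.
  by apply: mulf_neq0; [exact: mulf_neq0|rewrite invr_eq0; apply: expf_neq0; exact: mulf_neq0].
(* Here [nsq x = 74 / 100] lies between 1/2 and 1, the range where [eta'] is positive. *)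
have : U (2^-1, 0, 7 / 10).
  split=> /=; [rewrite /offaxis/= /rho2 /= expr0n addr0 expf_neq0//|by rewrite mulf_neq0|rewrite /nsq /= expr0n /=; apply/andP; split; lra].
by rewrite U0.
Qed.

End Competitor.

(** * Minimizers are model maps *)

Section Rigidity.
Variable R : realType.
Implicit Types (x : R3 R) (i : 'I_5) (j : 'I_3).
Variables (u o : R3 R -> RCC R).
Hypotheses (ho : harmonic_S2_S4 o) (eo : equivariant_on (@Sphere2 R) o)
  (hu : forall x, x != 0 -> u x = hom_ext o x) (hn : nonconstant u).

Lemma profile_of_second u' : (forall x, x != 0 -> (u' x : RCC R).2 = 0) -> forall t, uf u' ix3 t = 0 /\ uf u' ix4 t = 0.
Proof.
move=> z t; rewrite /uf /comp5 /coord5 !(tnth_nth 0) /= z ?mer_neq0//.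
Qed.

Lemma minimizing_model : locally_minimizing u ->
  exists a, exists2 sg : R, sg = 1 \/ sg = - 1 & forall x, x != 0 -> forall i, comp5 i u x = lin (eqrow sg a i) x * inorm x.
Proof.
move=> mu; have P := u_profile ho eo hu; set f := uf u in P; set f1 := uf1 u in P.
have v0 := vertical_vanish ho eo hu (or_intror mu).
have z3 t : f ix3 t = 0 by have [] := profile_of_second v0 t.
have z4 t : f ix4 t = 0 by have [] := profile_of_second v0 t.
have [p [q [pq1 pqf]]] := exists_normal P.
have fh t := f_hprof pq1 pqf t.
(* A single zero of [hprof] would make it vanish identically and the first coordinate constant, so
   [u] would be constant. *)
have h0 t : hprof f p q t != 0.
  apply/eqP => ht; have [hz fc] := hprof_zero P z3 z4 pq1 pqf ht.
  apply: hn; exists (f ord0 0, 0, 0) => x x0; apply: coord5_inj => i.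
  pose c i := coord5 i ((f ord0 0, 0, 0) : RCC R).
  suff : comp5 i u x - c i = 0 by move=> /eqP; rewrite subr_eq0 => /eqP.
  apply: (@axis_extend R (fun x => comp5 i u x - c i)) => // y oy.
    by apply: cvgB; [exact: smooth_cont (u_smooth ho hu i) oy|exact: cvg_cst].
  rewrite (prof_rep P)// /ev /c.
  have [a1 a2] := fh (T y); rewrite hz !mulr0 in a1 a2.
  have [-> | -> | -> | [-> | ->]] := ord5_cases i; rewrite /coord5 (tnth_nth 0) /Jn /Cw /Sw /= ?a1 ?a2 ?z3 ?z4 ?fc ?oppr0 ?mulr0 ?mul0r ?mul1r ?addr0 ?subrr//.
have [sg [Y0 [Z0 [s1 YZ hE f0E]]]] := hprof_explicit P z3 z4 pq1 pqf h0.
have hT x : offaxis x -> hprof f p q (T x) = (YT Y0 Z0 x * isq x)^-1.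
  move=> ox; apply: (mulIf (x := YT Y0 Z0 x * isq x)).
    by rewrite mulf_neq0 ?Ypos ?off_neq0// gt_eqF// isq_gt0.
  rewrite mulVf; last by rewrite mulf_neq0 ?Ypos ?off_neq0// gt_eqF// isq_gt0.
  by rewrite -(hE (T x)) ch_T// sh_T// /YT; ring.
have uE x : offaxis x -> density u x = edens Y0 Z0 x.
  move=> ox; rewrite (u_density ho eo hu ox); have [_ _ _ ->] := rigid_relations P z3 z4 pq1 pqf (T x).
  by rewrite hT// /edens mulrCA mulrA.
have Z00 := vertical_center ho eo hu YZ uE mu.
have Y2 : Y0 ^+ 2 = 1 by move: YZ; rewrite Z00 expr0n subr0.
have Yn : Y0 != 0 by apply/eqP => h; move: Y2; rewrite h expr0n => /eqP; rewrite eq_sym oner_eq0.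
have s2 : sg ^+ 2 = 1 by case: s1 => ->; rewrite ?sqrrN expr1n.
(* The unit number of angle [a] is [sg * Y0 * (- q + i p)], the direction of the profile in the
   first factor up to sign. Here [Y0] is 1 or [-1], and the factor [sg] compensates the one in
   [eqrow]. *)
have [a [ca sa]] : exists a, cos a = - (sg * Y0 * q) /\ sin a = sg * Y0 * p.
  apply: ex_angle; transitivity ((sg ^+ 2) * (Y0 ^+ 2) * (p ^+ 2 + q ^+ 2)); first by ring.
  by rewrite s2 Y2 pq1 !mulr1.
exists a, sg => // x x0 i; suff : comp5 i u x - lin (eqrow sg a i) x * inorm x = 0 by move=> /eqP; rewrite subr_eq0 => /eqP.
apply: (@axis_extend R (fun x => comp5 i u x - lin (eqrow sg a i) x * inorm x)) x0 => {x} [y y0|y oy].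
  apply: cvgB; first exact: smooth_cont (u_smooth ho hu i) y0.
  apply: cvgM; last exact: smooth_cont (@smooth_inorm R) y0.
  exact: smooth_cont (smooth_lin _ openT) I.
have y0 := off_neq0 oy; have q0 := isq_gt0 oy; have tn := norm3_inorm y0.
have hy : hprof f p q (T y) * isq y = Y0 * inorm y.
  have n0 : norm3 y != 0 by rewrite gt_eqF// sqrtr_gt0 nsq_gt0.
  have q1 : isq y != 0 by rewrite gt_eqF.
  rewrite hT// /YT Z00 mul0r addr0 inormE; transitivity (Y0 ^+ 2 * (Y0^-1 * (norm3 y)^-1)); last by field; rewrite Yn n0.
  by rewrite Y2; field; rewrite Yn n0 q1.
have [a1 a2] := fh (T y).
rewrite (prof_rep P)// /ev /lin sum3E /eqrow ca sa /xc.
have f0y : f ord0 (T y) = sg * y.2 * inorm y.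
  rewrite f0E sh_T// Z00 mul0r add0r; transitivity (sg * Y0 * y.2 * (hprof f p q (T y) * isq y)); first by ring.
  by rewrite hy; transitivity (sg * Y0 ^+ 2 * y.2 * inorm y); [ring|rewrite Y2 mulr1].
have [-> | -> | -> | [-> | ->]] := ord5_cases i; rewrite /Jn /Cw /Sw /= ?a1 ?a2 ?z3 ?z4 ?f0y.
- by ring.
- rewrite /cosx /sinx; transitivity ((- q * y.1.1 - p * y.1.2) * (hprof f p q (T y) * isq y - sg ^+ 2 * (Y0 * inorm y))); first by ring.
  by rewrite hy s2 mul1r subrr mulr0.
- rewrite /cosx /sinx; transitivity ((p * y.1.1 - q * y.1.2) * (hprof f p q (T y) * isq y - sg ^+ 2 * (Y0 * inorm y))); first by ring.
  by rewrite hy s2 mul1r subrr mulr0.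
- by ring.
- by ring.
Qed.

End Rigidity.
Theorem theorem4p5 (R : realType) (u : R3 R -> RCC R)
    (hu : equivariant_tangent_map u) (hnc : nonconstant u) :
  (~ (forall x : R3 R, x != 0 -> (u x).2 = 0) -> unstable u) /\
  (locally_minimizing u <->
   exists a : R,
     (forall x : R3 R, x != 0 -> u x = rot5 a (hom_ext (@omega_eq1 R) x)) \/
     (forall x : R3 R, x != 0 -> u x = - rot5 a (hom_ext (@omega_eq1 R) x))).
Proof.
have [w [ho eo uo]] := hu; split.
  by move=> h st; apply: h; exact: (vertical_vanish ho eo uo (or_introl st)).
split.
  by move=> /(minimizing_model ho eo uo hnc)[a h]; exists a; exact/model_coords.
move=> [a /model_coords [sg s1 h]].
have sg2 : sg ^+ 2 = 1 by case: s1 => ->; rewrite ?sqrrN expr1n.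
by apply: (eq_minimizing sg2) => x x0 i; exact: h.
Qed.
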